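(* Let $1<p<\infty$ and let $v_0,v_1$, $a$, $\mathscr{W}_{p',1/v_1}$, $\mathfrak{D}_{\mathscr{W}_{p',1/v_1}}$, $J_{\mathscr{W}_{p',1/v_1}}$ and $\mathop{W}\limits^{\circ\circ}{}^1_p$ be as in the context. Let $f\in\mathfrak{D}_{\mathscr{W}_{p',1/v_1}}$. Then $J_{\mathscr{W}_{p',1/v_1}}(f)<\infty$ if and only if $f=\tilde f$ almost everywhere for some $\tilde f\in \mathop{W}\limits^{\circ\circ}{}^1_p$, and in that case $\|f\|_{W^1_p}\approx J_{\mathscr{W}_{p',1/v_1}}(f)$. Consequently $$\mathop{W}\limits^{\circ\circ}{}^1_p=[\mathscr{W}_{p',1/v_1}]'_w=\bigl[[\mathop{W}\limits^{\circ\circ}{}^1_p]'_w\bigr]'_w$$ (as sets, with equivalent norms).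
   Context: Let $1<p<\infty$, $p'=p/(p-1)$. For $1\le r<\infty$ let $\mathscr V_r(0,\infty)$ be the set of functions $v\in L^r_{\rm loc}(0,\infty)$ with $v\ge 0$ and $\|v\|_{L^1(0,\infty)}\neq 0$. Let $v_0,v_1\in\mathscr V_p(0,\infty)$ with $1/v_1\in L^{p'}_{\rm loc}(0,\infty)$, and assume there is $c\in(0,\infty)$ with $\|v_1^{-1}\|_{L^{p'}(0,c)}\|v_0\|_{L^p(0,c)}=\|v_1^{-1}\|_{L^{p'}(c,\infty)}\|v_0\|_{L^p(c,\infty)}=\infty$. Under these assumptions there exist unique strictly increasing absolutely continuous functions $a,b$ on $(0,\infty)$ with $a(t),b(t)\to0$ as $t\to0$, $a(t),b(t)\to\infty$ as $t\to\infty$, $a(t)<t<b(t)$, $\int_{a(t)}^t v_1^{-p'}=\int_t^{b(t)}v_1^{-p'}$ and $\bigl(\int_{a(t)}^{b(t)}v_1^{-p'}\bigr)^{1/p'}\bigl(\int_{a(t)}^{b(t)}v_0^{p}\bigr)^{1/p}=1$ for all $t>0$; $a^{-1}$ denotes the inverse of $a$, and $V_1(t):=\int_{a(t)}^{b(t)}v_1^{-p'}$. For $g\in L^1_{\rm loc}(0,\infty)$ put $\mathbb G(g)=\Bigl(\int_0^\infty v_1^{-p'}(t)\Bigl|\int_t^{a^{-1}(t)}\frac{g(x)}{V_1(x)}\bigl(\int_{a(x)}^t v_1^{-p'}\bigr)dx\Bigr|^{p'}dt\Bigr)^{1/p'}$ and $\mathcal G(g)=\Bigl(\int_0^\infty v_1^{-p'}(t)V_1^{p'}(t)\Bigl|\int_t^{a^{-1}(t)}\frac{g(x)}{V_1(x)}dx\Bigr|^{p'}dt\Bigr)^{1/p'}$,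 and let $\mathscr W_{p',1/v_1}=\{g\in L^1_{\rm loc}(0,\infty):\|g\|_{\mathscr W_{p',1/v_1}}:=\mathbb G(g)+\mathcal G(g)<\infty\}$. The weighted Sobolev space $W^1_p$ consists of $u\in L^1_{\rm loc}(0,\infty)$ with distributional derivative $Du\in L^1_{\rm loc}(0,\infty)$ and $\|u\|_{W^1_p}:=\|v_0u\|_{L^p(0,\infty)}+\|v_1Du\|_{L^p(0,\infty)}<\infty$; $\mathop{W}\limits^{\circ\circ}{}^1_p$ is the subspace of all locally absolutely continuous $f$ on $(0,\infty)$ with $f(0)=0$, $\operatorname{supp} f$ compact in $(0,\infty)$, and $\|f\|_{W^1_p}<\infty$. For a normed space $(X,\|\cdot\|_X)$ of measurable functions on $(0,\infty)$, $\mathfrak D_X:=\{g \text{ measurable}:\int_0^\infty|fg|<\infty\ \forall f\in X\}$, and for $g\in\mathfrak D_X$, $J_X(g):=\sup_{0\neq f\in X}\frac{|\int_0^\infty fg|}{\|f\|_X}$; the weak associate space is $X'_w=\{g:\|g\|_{X'_w}:=J_X(g)<\infty\}$. $A\lesssim B$ means $A\le cB$ with $c$ depending only on $p$; $A\approx B$ means $A\lesssim B\lesssim A$. *)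

(* Defs.v *)
From mathcomp Require Import all_boot all_order all_algebra.
From mathcomp Require Import all_classical all_reals all_analysis.
Import Order.TTheory GRing.Theory Num.Theory.
Set Implicit Arguments. Unset Strict Implicit. Unset Printing Implicit Defensive.

Local Open Scope classical_set_scope.
Local Open Scope ring_scope.

Section Defs.
Context {R : realType}.
Local Notation mu := (@lebesgue_measure R).

Definition Ipos : set R := `]0, +oo[%classic.

Definition dualexp (p : R) : R := p / (p - 1).

Definition Lrnorm (r : R) (A : set R) (g : R -> R) : \bar R :=
  ((\int[mu]_(x in A) (`|g x| `^ r)%:E) `^ r^-1)%E.

Definition locL (r : R) (g : R -> R) : Prop :=
  measurable_fun Ipos g /\
  forall c d : R, 0 < c -> c <= d ->
    (\int[mu]_(x in `[c, d]) (`|g x| `^ r)%:E < +oo)%E.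

Definition weightV (r : R) (v : R -> R) : Prop :=
  locL r v /\ (forall x, Ipos x -> 0 <= v x) /\
  (\int[mu]_(x in Ipos) (v x)%:E != 0)%E.

(* 1/v in L^{r}_loc(0,oo) (in particular v > 0 a.e. so that 1/v is finite
   a.e.) *)
Definition inv_locL (r : R) (v : R -> R) : Prop :=
  {ae mu, forall x, Ipos x -> 0 < v x} /\ locL r (fun x => (v x)^-1).

Definition aeI (f g : R -> R) : Prop := {ae mu, forall x, Ipos x -> f x = g x}.

Definition abs_cont_on (f : R -> R) (al be : R) : Prop :=
  forall eps : R, 0 < eps -> exists2 delta : R, 0 < delta &
    forall (n : nat) (s t : nat -> R),
      (forall k, (k < n)%N -> al <= s k /\ s k <= t k /\ t k <= be) ->
      (forall k, (k.+1 < n)%N -> t k <= s k.+1) ->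
      \sum_(k < n) (t k - s k) < delta ->
      \sum_(k < n) `|f (t k) - f (s k)| < eps.

Definition loc_abs_cont (f : R -> R) : Prop :=
  forall al be : R, 0 < al -> al <= be -> abs_cont_on f al be.

(* A normed space of functions on (0,oo) is given by its carrier predicate X
   and its norm nX. *)
Definition Dspace (X : (R -> R) -> Prop) (g : R -> R) : Prop :=
  measurable_fun Ipos g /\
  forall f, X f -> (\int[mu]_(x in Ipos) (`|f x * g x|)%:E < +oo)%E.

Definition Jfun (X : (R -> R) -> Prop) (nX : (R -> R) -> \bar R)
  (g : R -> R) : \bar R :=
  ereal_sup [set (`| \int[mu]_(x in Ipos) (f x * g x)%:E | *
                  ((fine (nX f))^-1)%:E)%E
            | f in [set f | X f /\ nX f != 0%E]].

(* carrier of the weak associate space X'_w ; its norm is Jfun X nX *)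
Definition wassoc (X : (R -> R) -> Prop) (nX : (R -> R) -> \bar R)
  (g : R -> R) : Prop :=
  Dspace X g /\ (Jfun X nX g < +oo)%E.

Definition same_space (C : R) (X : (R -> R) -> Prop) (nX : (R -> R) -> \bar R)
  (Y : (R -> R) -> Prop) (nY : (R -> R) -> \bar R) : Prop :=
  (forall f, X f -> exists g, Y g /\ aeI f g) /\
  (forall g, Y g -> exists f, X f /\ aeI f g) /\
  (forall f g, X f -> Y g -> aeI f g ->
     (nX f <= C%:E * nY g)%E /\ (nY g <= C%:E * nX f)%E).

Section Concrete.
Variables (p : R) (v0 v1 a b ainv : R -> R).

Local Notation p' := (dualexp p).

Definition w1 (x : R) : R := ((v1 x)^-1) `^ p'.

(* \int_al^be v_1^{-p'} (real, finite for 0 < al <= be) *)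
Definition Wint (al be : R) : R := fine (\int[mu]_(x in `[al, be]) (w1 x)%:E).

Definition V1 (t : R) : R := Wint (a t) (b t).

Definition ab_conditions : Prop :=
  (forall s t, 0 < s -> s < t -> a s < a t) /\
  (forall s t, 0 < s -> s < t -> b s < b t) /\
  loc_abs_cont a /\ loc_abs_cont b /\
  (a x @[x --> 0^'+] --> 0) /\ (b x @[x --> 0^'+] --> 0) /\
  (a x @[x --> +oo] --> +oo) /\ (b x @[x --> +oo] --> +oo) /\
  (forall t, 0 < t -> a t < t /\ t < b t) /\
  (forall t, 0 < t ->
     (\int[mu]_(x in `[a t, t]) (w1 x)%:E = \int[mu]_(x in `[t, b t]) (w1 x)%:E)%E) /\
  (forall t, 0 < t ->
     ((\int[mu]_(x in `[a t, b t]) (w1 x)%:E) `^ p'^-1 *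
      (\int[mu]_(x in `[a t, b t]) (v0 x `^ p)%:E) `^ p^-1 = 1)%E).

Definition ainv_condition : Prop :=
  forall t, 0 < t -> 0 < ainv t /\ a (ainv t) = t.

Definition c_condition (c : R) : Prop :=
  0 < c /\
  (Lrnorm p' `]0%R, c[%classic (fun x => ((v1 x)^-1)%R) * Lrnorm p `]0%R, c[%classic v0 = +oo)%E /\
  (Lrnorm p' `]c, +oo[%classic (fun x => ((v1 x)^-1)%R) * Lrnorm p `]c, +oo[%classic v0 = +oo)%E.

Definition GGb (g : R -> R) : \bar R :=
  ((\int[mu]_(t in Ipos)
     ((w1 t)%:E *
      (`| \int[mu]_(x in `[t, ainv t]) (g x / V1 x * Wint (a x) t)%:E |
         `^ p'))) `^ p'^-1)%E.

Definition GGc (g : R -> R) : \bar R :=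
  ((\int[mu]_(t in Ipos)
     ((w1 t * V1 t `^ p')%:E *
      (`| \int[mu]_(x in `[t, ainv t]) (g x / V1 x)%:E | `^ p'))) `^ p'^-1)%E.

Definition Wnorm (g : R -> R) : \bar R := (GGb g + GGc g)%E.
Definition Wspace (g : R -> R) : Prop := locL 1 g /\ (Wnorm g < +oo)%E.

(* weighted Sobolev norm ||v0 u||_p + ||v1 Du||_p ; for the locally
   absolutely continuous functions considered below, Du is the a.e.
   derivative, written with derive1 *)
Definition W1pnorm (u : R -> R) : \bar R :=
  (Lrnorm p Ipos (fun x => (v0 x * u x)%R) +
   Lrnorm p Ipos (fun x => (v1 x * derive1 u x)%R))%E.

Definition W00 (f : R -> R) : Prop :=
  (exists c d : R, [/\ 0 < c, c <= d & forall x, x < c \/ d < x -> f x = 0]) /\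
  loc_abs_cont f /\ (W1pnorm f < +oo)%E.

End Concrete.
End Defs.

(* Main.v *)
(* Write [w = v_1^(-p')], [u = v_0^p] and [rho(x)] for the [w]-mass of [[a x, x]].

   Integration by parts on [[a x, x]] expresses [f(x)] through averages of [f']
   and of [f w / rho]; Fubini and Hoelder then bound [int f g] by the two
   functionals defining the norm of [g], provided [int |f|^p w rho^(-p)] is
   controlled by the Sobolev norm of [f].  The latter follows by comparing [f] at
   the points [x, a x, a (a x), ...] and using the Schur test between them.

   Conversely the Schur test shows that [g = v_0 gamma] and [g = phi'] have norm
   at most a constant times the [L^p'] norms of [gamma] and [phi / v_1].  If [f]
   pairs absolutely with every [g] of finite norm, testing against derivatives of
   rapidly oscillating [phi] forces [f] to be locally integrable with compact
   support.  If moreover its pairings are bounded by the norm, testing against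
   derivatives of trapezoids shows that the means of [f] over short intervals
   converge to an absolutely continuous function, and the converse Hoelder
   inequality bounds [v_1 f'] and [v_0 f] in [L^p].

   The bidual identity needs only these two inequalities, since the first one
   embeds the space of the [g]'s into the associate space of the Sobolev space. *)

Require Import Defs.
From HB Require Import structures.
From mathcomp Require Import all_boot all_order all_algebra.
From mathcomp Require Import all_classical all_reals all_analysis.
From mathcomp Require Import measurable_realfun ring lra.
Import Order.TTheory GRing.Theory Num.Theory.
Import numFieldNormedType.Exports.
Local Open Scope classical_set_scope.
Local Open Scope ring_scope.
Set Implicit Arguments.
Unset Strict Implicit.
Unset Printing Implicit Defensive.

(** * Densities of absolutely continuous functions *)

Section interval_families.
Context {R : realType}.
Implicit Types (f : R -> R) (al be : R) (l : seq (R * R)).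

(** The constants may depend on [p] alone, so the estimates rest on two consequences of the
    equilibrium conditions that hold with absolute constants. As [[a x, x]] and [[x, b x]] have
    equal [w]-mass [rho x] and [a], [b] increase, [rho] changes by no more than the [w]-mass
    travelled; and the normalisation makes the [u]-mass of [[a x, b x]] equal to [(2 rho x)^(1-p)],
    where [2 rho = V_1]. Kernels containing [a] are handled through bounds on their increments,
    without a formula for the derivative of [a].

    Absolute continuity is given in epsilon-delta form, so densities must be produced before
    anything can be integrated by parts; they come from the Radon-Nikodym theorem.

    Elements of the dual side are merely measurable, and nonzero functions may have norm zero there.
    [Jfun] skips such functions, so it controls all pairings only after a perturbation argument,
    which requires a pair of elements with nonzero pairing. *)

Definition nonoverlap (x y : R * R) := (x.2 <= y.1) || (y.2 <= x.1).

Definition itv_family al be l :=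
  [/\ uniq l, (forall x, x \in l -> [/\ al <= x.1, x.1 < x.2 & x.2 <= be]) &
      (forall x y, x \in l -> y \in l -> x != y -> nonoverlap x y)].

(** Sorting by left endpoint turns a non-overlapping list into the ordered sequences of
    [abs_cont_on]. Unordered lists are used from here on because they can be concatenated freely. *)
Lemma abs_cont_on_family f al be : abs_cont_on f al be ->
  forall e : R, 0 < e -> exists2 d : R, 0 < d & forall l, itv_family al be l ->
    \sum_(x <- l) (x.2 - x.1) < d -> \sum_(x <- l) `|f x.2 - f x.1| < e.
Proof.
move=> fac e e0; have [d d0 H] := fac e e0; exists d => // l [ul lin lno].
pose r := fun x y : R * R => x.1 <= y.1.
pose s := sort r l.
have ps : perm_eq s l by rewrite /s perm_sort.
have us : uniq s by rewrite (perm_uniq ps).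
have rt : total r by move=> x y; exact: le_total.
have ss : sorted r s by exact: sort_sorted.
have rtr : transitive r by move=> x y z; exact: le_trans.
pose x0 := (0, 0) : R * R.
rewrite -(perm_big _ ps)/= -[X in _ -> X < _](perm_big _ ps)/=.
rewrite !(big_nth x0) !big_mkord => lt.
have ms k : (k < size s)%N -> nth x0 s k \in l.
  by move=> ks; rewrite -(perm_mem ps) mem_nth.
apply: (H (size s) (fun k => (nth x0 s k).1) (fun k => (nth x0 s k).2)) => //.
  by move=> k /ms/lin[? /ltW ? ?].
move=> k ks; have ks' := ltnW ks.
have /(lno _ _ (ms _ ks') (ms _ ks))/orP[//|h] : nth x0 s k != nth x0 s k.+1.
  by rewrite nth_uniq// neq_ltn leqnn.
have [_ h2 _] := lin _ (ms _ ks).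
have : r (nth x0 s k) (nth x0 s k.+1).
  by apply: (sorted_leq_nth rtr) => //; move=> x; exact: lexx.
rewrite /r => h3.
by have := le_lt_trans (le_trans h h3) h2; rewrite ltxx.
Qed.

Lemma itv_partition_family f (a b : R) s : itv_partition a b s ->
  exists l, [/\ itv_family a b l, \sum_(x <- l) (x.2 - x.1) = b - a &
    \sum_(x <- l) `|f x.2 - f x.1| = variation a b f s].
Proof.
elim: s a => [a /itv_partition_nil ->|c s ih a abs].
  exists [::]; split; rewrite ?big_nil ?subrr//.
  by rewrite /variation big_nil.
have cbs := itv_partition_cons abs.
have ac : a < c by move: abs => [/= /andP[]].
have cb := itv_partition_le cbs.
have [l [[ul lin lno] llen lvar]] := ih _ cbs.
exists ((a, c) :: l); split.
- split => /=.
  + rewrite ul andbT; apply/negP => /lin[/=].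
    by move=> /le_lt_trans /(_ ac); rewrite ltxx.
  + move=> x; rewrite inE => /predU1P[->/=|/lin[h1 h2 h3]]; split => //.
    exact: le_trans (ltW ac) h1.
  + move=> x y; rewrite !inE => /predU1P[->|xl] /predU1P[->|yl].
    * by rewrite eqxx.
    * by have [h _ _] := lin _ yl; rewrite /nonoverlap/= h.
    * by have [h _ _] := lin _ xl; rewrite /nonoverlap/= h orbT.
    * exact: lno.
- by rewrite big_cons llen/=; ring.
- rewrite big_cons lvar /variation/= [in RHS]big_nat_recl//=.
Qed.

Lemma family_cat al be l1 l2 : itv_family al be l1 -> itv_family al be l2 ->
  (forall x y, x \in l1 -> y \in l2 -> nonoverlap x y) ->
  itv_family al be (l1 ++ l2).
Proof.
move=> [u1 i1 n1] [u2 i2 n2] n12; split.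
- rewrite cat_uniq u1 u2 andbT/=; apply/hasPn => x x2; apply/negP => x1.
  have := n12 _ _ x1 x2; have [_ h _] := i2 _ x2.
  by rewrite /nonoverlap orbb leNgt h.
- by move=> x; rewrite mem_cat => /orP[/i1|/i2].
- move=> x y; rewrite !mem_cat => /orP[x1|x2] /orP[y1|y2] xy.
  + exact: n1.
  + exact: n12.
  + by rewrite /nonoverlap orbC; exact: n12.
  + exact: n2.
Qed.

Lemma itv_familyS al be al' be' l : al' <= al -> be <= be' ->
  itv_family al be l -> itv_family al' be' l.
Proof.
move=> h1 h2 [ul lin lno]; split => // x /lin[h3 h4 h5]; split => //.
  exact: le_trans h3.
exact: le_trans h2.
Qed.

Lemma itv_family_behead al be x l :
  itv_family al be (x :: l) -> itv_family al be l.
Proof.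
move=> [/= /andP[_ ul] lin lno]; split => //.
  by move=> y yl; apply: lin; rewrite inE yl orbT.
by move=> y z yl zl; apply: lno; rewrite inE ?yl ?zl orbT.
Qed.

(** Each interval is cut along a partition that nearly attains its variation; the tolerance is
    halved from one interval to the next, so the errors add up to at most [e]. The total length is
    unchanged, which carries the epsilon-delta condition from [f] to its variation function. *)
Lemma total_variation_family f al be l (e : R) : 0 < e ->
  (forall x, x \in l -> bounded_variation x.1 x.2 f) -> itv_family al be l ->
  exists l', [/\ itv_family al be l',
    (forall y, y \in l' -> exists2 x, x \in l & x.1 <= y.1 /\ y.2 <= x.2),
    \sum_(x <- l') (x.2 - x.1) = \sum_(x <- l) (x.2 - x.1) &
    \sum_(x <- l) fine (total_variation x.1 x.2 f) <=
      \sum_(x <- l') `|f x.2 - f x.1| + e].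
Proof.
move=> + + lfam; have {lfam} := lfam.
elim: l e => [e lfam e0 _|x l ih e lfam e0 bv].
  by exists [::]; split; rewrite ?big_nil ?add0r// ltW.
have [l' [l'fam l'sub l'len l'var]] := ih (e / 2) (itv_family_behead lfam)
  (divr_gt0 e0 (ltr0Sn _ 1)) (fun y yl => bv y (mem_behead (s := x :: l) yl)).
have xl : x \in x :: l by rewrite mem_head.
have [_ lin lno] := lfam.
have [ax xx xb] := lin _ xl.
have tvfin : (total_variation x.1 x.2 f) \is a fin_num.
  by apply/bounded_variationP; [exact: ltW|exact: bv].
have e20 : 0 < e / 2 by rewrite divr_gt0.
have [_ [_ [s ps <-] <-] hs] := ub_ereal_sup_adherent e20 tvfin.
have [l2 [l2fam l2len l2var]] := itv_partition_family f ps.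
exists (l2 ++ l'); split.
- apply: family_cat => //; first exact: itv_familyS l2fam.
  move=> y z yl2 /l'sub[z' z'l [h1 h2]].
  have [_ /(_ _ yl2)[h3 h4 h5] _] := l2fam.
  have z'x : x != z'.
    apply: contraTneq z'l => <-.
    by have [/= /andP[]] := lfam.
  have /orP[h|h] := lno _ _ xl (mem_behead (s := x :: l) z'l) z'x.
    by rewrite /nonoverlap (le_trans h5 (le_trans h h1)).
  by rewrite /nonoverlap (le_trans h2 (le_trans h h3)) orbT.
- move=> y; rewrite mem_cat => /orP[yl2|/l'sub[z zl h]].
    exists x => //; have [_ /(_ _ yl2)[h3 h4 h5] _] := l2fam.
    by split.
  by exists z => //; rewrite inE zl orbT.
- by rewrite big_cat/= l'len l2len big_cons.
- rewrite big_cat/= l2var big_cons.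
  rewrite [X in _ <= _ + X](splitr e) [leRHS]addrACA lerD//.
  rewrite -lee_fin fineK// EFinD -leeBlDr//; exact/ltW.
Qed.

(** With tolerance 1, an interval shorter than [d] has variation at most 1; finitely many steps of
    length [d / 2] exhaust [[al, be]]. *)
Lemma abs_cont_bounded_variation f al be : al <= be -> abs_cont_on f al be ->
  bounded_variation al be f.
Proof.
move=> albe /abs_cont_on_family /(_ _ ltr01)[d d0 H].
have small x y : al <= x -> x <= y -> y <= be -> y - x < d ->
    bounded_variation x y f.
  move=> alx xy ybe xyd; exists 1 => _ [s ps <-].
  have [l [lfam llen <-]] := itv_partition_family f ps.
  by apply/ltW/H; [exact: itv_familyS lfam|rewrite llen].
have d20 : 0 < d / 2 by rewrite divr_gt0.
suff main n : forall x, al <= x -> x <= be -> x - al < d / 2 * n%:R ->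
    bounded_variation al x f.
  have /archi_boundP : 0 <= (be - al) / (d / 2).
    by rewrite divr_ge0// ?subr_ge0// ltW.
  by rewrite ltr_pdivrMr// mulrC => /main; exact.
elim: n => [x alx _|n ih x alx xbe].
  by rewrite mulr0 subr_lt0 ltNge alx.
rewrite -(natr1 n) mulrDr mulr1 => h.
have [xs|xl] := ltP (x - al) d; first exact: small.
have alx' : al <= x - d / 2 by lra.
have x'x : x - d / 2 <= x by lra.
apply/bounded_variationP => //.
rewrite (total_variationD f alx' x'x) fin_numD.
apply/andP; split; apply/bounded_variationP => //.
  by apply: ih => //; lra.
by apply: small => //; lra.
Qed.

End interval_families.

(* The Lebesgue-Stieltjes measure of a nondecreasing absolutely continuous
   function is dominated by Lebesgue measure, so Radon-Nikodym applies. *)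
Section density_of_nondecreasing.
Context {R : realType}.
Local Notation mu := (@lebesgue_measure R).
Variables (v : R -> R) (al be : R).
Hypothesis albe : al < be.
Hypothesis vnd : forall x y, al <= x -> x <= y -> y <= be -> v x <= v y.
Hypothesis vac : forall e : R, 0 < e -> exists2 d : R, 0 < d & forall l,
  itv_family al be l -> \sum_(x <- l) (x.2 - x.1) < d ->
  \sum_(x <- l) (v x.2 - v x.1) < e.

Let clamp x := Num.max al (Num.min x be).
Let T := v be - v al + (be - al).

Let T0 : 0 < T.
Proof. by rewrite /T ltr_wpDl ?subr_gt0// subr_ge0 vnd// ltW. Qed.

(** Distribution function of the measure [dv + dx] on [[al, be]], divided by its mass [T]. Adding
    [dx] makes [T] positive even when [v] is constant; clamping freezes [F] outside [[al, be]]. *)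
Let F x := (v (clamp x) - v al + (clamp x - al)) / T.

Let clamp_ge x : al <= clamp x. Proof. by rewrite /clamp le_max lexx. Qed.
Let clamp_le x : clamp x <= be.
Proof. by rewrite /clamp ge_max (ltW albe)/= ge_min lexx orbT. Qed.
Let clamp_id x : al <= x -> x <= be -> clamp x = x.
Proof. by move=> h1 h2; rewrite /clamp min_l// max_r. Qed.
Local Hint Resolve clamp_ge clamp_le : core.
Let clamp_nd x y : x <= y -> clamp x <= clamp y.
Proof.
move=> xy; rewrite /clamp ge_max le_max lexx/= le_max; apply/orP; right.
by rewrite le_min ge_min xy/= ge_min lexx orbT.
Qed.
Let clamp_lip x y : x <= y -> clamp y - clamp x <= y - x.
Proof.
move=> xy; rewrite /clamp !maxElt !minElt.
by do !case: ifPn; rewrite -?leNgt; lra.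
Qed.

Let F_nd : {homo F : x y / x <= y}.
Proof.
move=> x y xy; rewrite /F ler_pM2r ?invr_gt0// lerD//; last by rewrite lerB ?clamp_nd.
by rewrite lerB// vnd ?clamp_nd.
Qed.

Let F_cont : continuous F.
Proof.
move=> x; apply/(@cvgrPdist_lt _ R^o) => e e0.
have e20 : 0 < e * T / 2 by rewrite divr_gt0// mulr_gt0.
have [d d0 dv] := vac e20.
have main (s t : R) : s <= t -> t - s < Num.min d (e * T / 2) -> F t - F s < e.
  rewrite lt_min => st /andP[h1 h2].
  rewrite /F -mulrBl ltr_pdivrMr//.
  have := clamp_lip st; have := clamp_nd st.
  rewrite le_eqVlt => /predU1P[-> _|lt h]; first by rewrite subrr mulr_gt0.
  have fam : itv_family al be [:: (clamp s, clamp t)].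
    split => // [z|z1 z2]; first by rewrite inE => /eqP ->; split => /=.
    by rewrite !inE => /eqP -> /eqP ->; rewrite eqxx.
  have := dv _ fam; rewrite !big_seq1/= => /(_ (le_lt_trans h h1)) => h3.
  lra.
have m0 : 0 < Num.min d (e * T / 2) by rewrite lt_min d0.
near=> y.
have yx : `|x - y| < Num.min d (e * T / 2).
  near: y; exists (Num.min d (e * T / 2)) => //=.
have [xy|yx'] := leP x y.
  rewrite distrC ger0_norm ?subr_ge0 ?F_nd//; apply: main => //.
  by rewrite -(ger0_norm (x := y - x)) ?subr_ge0// distrC.
rewrite ger0_norm ?subr_ge0 ?F_nd// ?ltW//; apply: main => //; first exact: ltW.
by rewrite -(ger0_norm (x := x - y)) ?subr_ge0// ltW.
Unshelve. all: by end_near. Qed.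

Let F_rc : right_continuous F.
Proof. by move=> x; apply: cvg_at_right_filter; exact: F_cont. Qed.

Let F_Ny : F @ -oo --> (0 : R).
Proof.
apply: (@cvg_trans _ (cst 0 @ -oo)); last exact: cvg_cst.
apply: near_eq_cvg; near=> x.
have -> : F x = 0; last by [].
have xal : x <= al by near: x; exact: nbhs_ninfty_le (num_real _).
rewrite /F (_ : clamp x = al) ?subrr ?add0r ?mul0r//.
by apply/eqP; rewrite eq_le clamp_ge andbT -[leRHS](clamp_id (lexx al) (ltW albe)) clamp_nd.
Unshelve. all: by end_near. Qed.

Let F_y : F @ +oo --> (1 : R).
Proof.
apply: (@cvg_trans _ (cst 1 @ +oo)); last exact: cvg_cst.
apply: near_eq_cvg; near=> x.
have -> : F x = 1; last by [].
have xal : be <= x by near: x; exact: nbhs_pinfty_ge (num_real _).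
rewrite /F (_ : clamp x = be) ?divff ?gt_eqF//.
by apply/eqP; rewrite eq_le clamp_le/= -[leLHS](clamp_id (ltW albe) (lexx be)) clamp_nd.
Unshelve. all: by end_near. Qed.

HB.instance Definition _ := isCumulative.Build R _ R F F_nd F_rc.
HB.instance Definition _ := isCumulativeBounded.Build R 0 1 F F_Ny F_y.

Let Fc : cumulativeBounded (0 : R) (1 : R) := F.
Let nu : probability (measurableTypeR R) R := lebesgue_stieltjes_measure Fc.

Let nu_oc x y : x <= y -> nu `]x, y]%classic = (F y - F x)%:E.
Proof.
move=> xy; rewrite /nu/= /lebesgue_stieltjes_measure /measure_extension.
rewrite measurable_mu_extE/=; last exact: is_ocitv.
by rewrite wlength_itv_bnd.
Qed.

Let F_nu (x y : R) : (al <= x)%R -> (x <= y)%R -> (y <= be)%R ->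
  nu `]x, y]%classic = ((v y - v x + (y - x)) / T)%:E.
Proof.
move=> alx xy ybe; rewrite nu_oc// /F !clamp_id//; first last.
- exact: le_trans xy.
- exact: le_trans ybe.
by rewrite -mulrBl; congr ((_ / _)%:E); ring.
Qed.

Let nu_setT : nu setT = 1%E.
Proof. exact: probability_setT. Qed.


(** The interval []al, be]] already carries the full mass 1. *)
Let nu_outside (N : set (measurableTypeR R)) : measurable N -> N `&` `]al, be] = set0 -> nu N = 0%E.
Proof.
move=> mN N0; apply/eqP; rewrite eq_le measure_ge0 andbT.
have : (nu N + nu `]al, be]%classic)%E = nu (N `|` `]al, be]).
  by rewrite measureU.
rewrite (F_nu (lexx al) (ltW albe) (lexx be)) -/T (divff (lt0r_neq0 T0)) => h.
have : (nu N + 1 <= 1)%E by rewrite h -nu_setT le_measure// inE//; exact: measurableU.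
by rewrite -leeBrDr// -EFinB subrr.
Qed.

(** Endpoints are clamped to [[al, be]] and intervals that collapse are dropped; the rest is an
    interval family. The tolerance [e * T / 2] pays once for [v] and once for [dx], and its factor
    [T] undoes the normalisation of [F]. *)
Let nu_itvs (e : R) : 0 < e -> exists2 d, 0 < d & forall n (I : nat -> set R),
  (forall i, open (I i)) -> (forall i, is_interval (I i)) ->
  (forall i, I i `<=` `](al - 1), (be + 1)[) -> trivIset setT I ->
  (\sum_(0 <= i < n) mu (I i) < d%:E)%E ->
  (\sum_(0 <= i < n) nu (I i) <= e%:E)%E.
Proof.
move=> e0; have e20 : 0 < e * T / 2 by rewrite divr_gt0// mulr_gt0.
have [d d0 dv] := vac e20.
exists (Num.min d (e * T / 2)); first by rewrite lt_min d0.
move=> n I oI iI sI tI.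
pose s i := inf (I i); pose t i := sup (I i).
have Ist i : I i !=set0 -> s i < t i /\ I i = `]s i, t i[%classic.
  move=> I0.
  have bI : has_lbound (I i) by exists (al - 1) => x /sI; rewrite /= in_itv/= => /andP[/ltW].
  have uI : has_ubound (I i) by exists (be + 1) => x /sI; rewrite /= in_itv/= => /andP[_ /ltW].
  have IE : I i = `]s i, t i[%classic.
    have := interval_bounded_interior (iI i) bI uI.
    by rewrite ((interior_id _).1 (oI i)) => ->; rewrite set_itvoo.
  split => //; move: I0; rewrite IE => -[x]/=; rewrite in_itv/= => /andP[].
  exact: lt_trans.
have st i : s i <= t i.
  have [I0|/set0P/Ist[/ltW//]] := eqVneq (I i) set0.
  by rewrite /s /t I0 inf0 sup0.
have muI i : (mu (I i) = (t i - s i)%:E)%E.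
  have [I0|/set0P/Ist[h ->]] := eqVneq (I i) set0.
    by rewrite /s /t I0 measure0 inf0 sup0 subrr.
  by rewrite lebesgue_measure_itv/= lte_fin h.
have nuI i : (nu (I i) <= (F (t i) - F (s i))%:E)%E.
  have [->|/set0P/Ist[h IE]] := eqVneq (I i) set0.
    by rewrite measure0 lee_fin subr_ge0 F_nd.
  rewrite -(nu_oc (ltW h)) le_measure ?inE//=.
    by rewrite IE; exact: measurable_itv.
  by rewrite IE; apply: subset_itvl; rewrite bnd_simp.
under eq_bigr do rewrite muI.
rewrite sumEFin lte_fin lt_min => /andP[h1 h2].
apply: (@le_trans _ _ (\sum_(0 <= i < n) (F (t i) - F (s i))%:E)%E).
  by apply: lee_sum => i _; exact: nuI.
rewrite sumEFin lee_fin.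
pose P i := (clamp (s i), clamp (t i)).
pose r := [seq i <- index_iota 0 n | clamp (s i) < clamp (t i)].
pose l := [seq P i | i <- r].
have clt i : clamp (s i) < clamp (t i) -> s i < t i.
  by rewrite !ltNge; apply: contra => /clamp_nd.
have rno i j : i \in r -> j \in r -> i != j -> nonoverlap (P i) (P j).
  rewrite !mem_filter => /andP[ci _] /andP[cj _] ij.
  have I0 k : clamp (s k) < clamp (t k) -> I k !=set0.
    move=> /clt sk; apply/set0P; apply: contraTneq sk => Ik0.
    by rewrite /s /t Ik0 inf0 sup0 ltxx.
  have [si Ii] := Ist _ (I0 _ ci); have [sj Ij] := Ist _ (I0 _ cj).
  have [tisj|sjti] := leP (t i) (s j).
    by rewrite /nonoverlap/= (clamp_nd tisj).
  have [tjsi|sitj] := leP (t j) (s i).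
    by rewrite /nonoverlap/= (clamp_nd tjsi) orbT.
  have /trivIsetP/(_ i j Logic.I Logic.I ij) := tI.
  rewrite Ii Ij => /seteqP[+ _].
  have : Num.max (s i) (s j) < Num.min (t i) (t j).
    by rewrite lt_min !gt_max si sj sitj sjti.
  move=> m /(_ ((Num.max (s i) (s j) + Num.min (t i) (t j)) / 2))[].
  have := midf_lt m; rewrite lt_min gt_max => -[/andP[h3 h4] /andP[h5 h6]].
  by split; rewrite /= in_itv/=; apply/andP.
have fam : itv_family al be l.
  split.
  - rewrite map_inj_in_uniq ?filter_uniq ?iota_uniq// => i j ir jr Pij.
    apply/eqP; apply: contraT => /(rno _ _ ir jr).
    rewrite -Pij /nonoverlap/= orbb leNgt.
    by move: ir; rewrite mem_filter => /andP[->].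
  - move=> _ /mapP[i ir ->]; split => //=.
    by move: ir; rewrite mem_filter => /andP[].
  - move=> _ _ /mapP[i ir ->] /mapP[j jr ->] Pij; apply: rno => //.
    by apply: contra_neq Pij => ->.
have sumr (f : nat -> R) : (forall i, ~~ (clamp (s i) < clamp (t i)) -> f i = 0) ->
    \sum_(i <- r) f i = \sum_(0 <= i < n) f i.
  move=> f0; rewrite big_filter big_mkcond; apply: eq_bigr => i _.
  by case: ifPn => // /f0.
have ceq i : ~~ (clamp (s i) < clamp (t i)) -> clamp (t i) = clamp (s i).
  by rewrite -leNgt => h; apply/eqP; rewrite eq_le h clamp_nd.
have lenl : \sum_(x <- l) (x.2 - x.1) = \sum_(0 <= i < n) (clamp (t i) - clamp (s i)).
  by rewrite big_map/= sumr// => i /ceq ->; rewrite subrr.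
have lel : \sum_(x <- l) (x.2 - x.1) <= \sum_(0 <= i < n) (t i - s i).
  by rewrite lenl; apply: ler_sum => i _; exact: clamp_lip.
have := dv _ fam (le_lt_trans lel h1).
rewrite big_map/= sumr; last by move=> i /ceq ->; rewrite subrr.
move=> h3.
rewrite (eq_bigr (fun i => T^-1 * ((v (clamp (t i)) - v (clamp (s i))) +
    (clamp (t i) - clamp (s i))))); last first.
  by move=> i _; rewrite /F -mulrBl mulrC; congr (_ * _); ring.
rewrite -mulr_sumr big_split/= -lenl mulrC ler_pdivrMr//.
have := le_lt_trans lel h2; lra.
Qed.

(** A null set lies in an open set of measure below [d], which is a disjoint union of open
    intervals; [nu_itvs] bounds every finite partial sum. *)
Let nu_mu : nu `<< mu.
Proof.
move=> N nullN B mB BN; have muB : mu B = 0%E by exact: nullN.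
apply/eqP; rewrite eq_le measure_ge0 andbT.
have mU : measurable (`](al - 1), (be + 1)[%classic : set (measurableTypeR R)) by exact: measurable_itv.
(* Localising makes every component bounded, so that its infimum and supremum are its endpoints. *)
have -> : nu B = nu (B `&` `](al - 1), (be + 1)[).
  rewrite (measureDI nu mB mU) [X in (X + _)%E](_ : _ = 0%E) ?add0e//.
  apply: nu_outside; first exact: measurableD.
  apply/seteqP; split => // x [[_ +]]/=; rewrite !in_itv/= => h /andP[h1 h2].
  by apply: h; rewrite in_itv/= (lt_trans _ h1) ?(le_lt_trans h2) ?gtrBl ?ltrDl.
apply/lee_addgt0Pr => e e0; rewrite add0e.
have [d d0 H] := nu_itvs e0.
have [U [oU BU Ud]] := outer_measure_open_le B (divr_gt0 d0 (ltr0Sn _ 1)).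
have {}Ud : (mu U < d%:E)%E.
  apply: (le_lt_trans Ud); rewrite [X in (X + _)%E](_ : _ = 0%E); last first.
    by apply/negligible_outer_measure; exists B; split.
  by rewrite add0e lte_fin; lra.
pose V := U `&` `](al - 1), (be + 1)[%classic.
have oV : open V by apply: openI => //; exact: interval_open.
have [I [oiI tI VE]] := OpenSetDisjointItvs.open_disjoint_itv oV.
have mI i : measurable (I i : set (measurableTypeR R)).
  by apply: open_measurable; have [] := oiI i.
have mV : measurable (V : set (measurableTypeR R)).
  exact: open_measurable.
have mUI : measurable (\bigcup_i I i : set (measurableTypeR R)) by rewrite -VE.
apply: (@le_trans _ _ (nu V)).
  rewrite le_measure ?inE//; first exact: measurableI.
  by apply: setSI.
rewrite [X in nu X]VE (measure_semi_bigcup nu mI tI mUI).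
apply: lime_le; first exact: is_cvg_nneseries.
near=> n; apply: H => // [i|i|i|].
- by have [] := oiI i.
- by have [] := oiI i.
- apply: (@subset_trans _ V); last exact: subIsetr.
  by rewrite [X in _ `<=` X]VE; exact: bigcup_sup.
- apply: le_lt_trans Ud; apply: (@le_trans _ _ (mu V)).
    rewrite [X in mu X]VE (measure_semi_bigcup mu mI tI mUI).
    exact: nneseries_lim_ge.
  apply: le_measure; rewrite ?inE//; last exact: subIsetl.
  exact: open_measurable.
Unshelve. all: by end_near. Qed.

Lemma nondecreasing_density : exists q : R -> R,
  mu.-integrable `[al, be] (EFin \o q) /\
  forall x, al <= x -> x <= be -> v x - v al = (\int[mu]_(t in `[al, x]) q t)%R.
Proof.
have [q [q0 qfin qint qE]] := radon_nikodym_sigma_finite nu_mu.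
have mab : measurable (`[al, be]%classic : set (measurableTypeR R)) by exact: measurable_itv.
(* [q] is the density of [(dv + dx) / T]; this solves for the density of [dv]. *)
pose q' x := T * fine (q x) - 1.
have iq : mu.-integrable `[al, be] (EFin \o (fine \o q)).
  apply: (@eq_integrable _ _ _ _ _ mab q); first by move=> x _ /=; rewrite fineK.
  exact: integrableS qint.
have iTq : mu.-integrable `[al, be] (EFin \o (fun x => T * fine (q x))).
  by rewrite (_ : _ \o _ = fun x => T%:E * (EFin \o (fine \o q)) x)%E //; exact: integrableZl.
have i1 : mu.-integrable `[al, be] (EFin \o cst (1 : R)).
  apply: measurable_bounded_integrable => //.
  - suff : (mu `[al, be]%classic < +oo)%E by [].
    by rewrite lebesgue_measure_itv/= lte_fin albe -EFinB ltry.
  - by exists 1; split => // x ? y _ /=; rewrite normr1 ltW.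
exists q'; split.
  by have := integrableB mab iTq i1; apply: eq_integrable.
move=> x alx xbe.
have sx : `[al, x] `<=` `[al, be] by apply: subset_itvl; rewrite bnd_simp.
have mx : measurable `[al, x]%classic by exact: measurable_itv.
rewrite /q' RintegralB//; [|exact: integrableS mab mx sx iTq|exact: integrableS mab mx sx i1].
rewrite RintegralZl//; last exact: integrableS mab mx sx iq.
rewrite Rintegral_cst// mul1r [X in _ = _ - X](_ : _ = x - al); last first.
  transitivity (fine (mu `[al, x]%classic)) => //.
  rewrite lebesgue_measure_itv/= lte_fin; case: ltP => // h.
  by rewrite (_ : x = al) ?subrr//; apply/eqP; rewrite eq_le h.
have -> : (\int[mu]_(t in `[al, x]) fine (q t))%R = fine (nu `]al, x]%classic).
  rewrite qE//; congr fine; rewrite -integral_itv_obnd_cbnd; last first.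
    apply/measurable_EFinP/measurableT_comp => //; apply: measurable_funTS.
    exact: measurable_int qint.
  by apply: eq_integral => y _; rewrite fineK.
rewrite F_nu//= mulrC divfK ?gt_eqF//.
by ring.
Qed.

End density_of_nondecreasing.

Section absolute_continuity.
Context {R : realType}.
Local Notation mu := (@lebesgue_measure R).
Implicit Types (f F : R -> R) (al be : R).

Lemma ae_impl (P Q : R -> Prop) : (forall x, P x -> Q x) ->
  {ae mu, forall x, P x} -> {ae mu, forall x, Q x}.
Proof. by move=> PQ; apply: filterS => //; exact: (ae_filter_ringOfSetsType mu). Qed.

Lemma ae_impl2 (P1 P2 Q : R -> Prop) : (forall x, P1 x -> P2 x -> Q x) ->
  {ae mu, forall x, P1 x} -> {ae mu, forall x, P2 x} -> {ae mu, forall x, Q x}.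
Proof.
move=> PQ; apply: filterS2; first exact: (ae_filter_ringOfSetsType mu).
exact: PQ.
Qed.

Lemma ae_neq (c : R) : {ae mu, forall x, x != c}.
Proof.
exists [set c]; split; [exact: measurable_set1|exact: lebesgue_measure_set1|].
by move=> x /= /negP; rewrite negbK => /eqP.
Qed.

(** Jordan decomposition: [f = v - (v - f)] with [v] the variation function. Both terms are
    nondecreasing and inherit the epsilon-delta condition, so [nondecreasing_density] applies to
    each. *)
Lemma abs_cont_density f al be : al < be -> abs_cont_on f al be ->
  exists q : R -> R, mu.-integrable `[al, be] (EFin \o q) /\
  forall x, al <= x -> x <= be -> f x - f al = (\int[mu]_(t in `[al, x]) q t)%R.
Proof.
move=> albe fac; have bv := abs_cont_bounded_variation (ltW albe) fac.
pose v x := fine (total_variation al x f).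
have bvs x y : al <= x -> x <= y -> y <= be -> bounded_variation x y f.
  move=> alx xy ybe; apply: (bounded_variationl xy ybe).
  exact: bounded_variationr (le_trans xy ybe) bv.
have tvfin x y : al <= x -> x <= y -> y <= be ->
    total_variation x y f \is a fin_num.
  by move=> alx xy ybe; apply/bounded_variationP => //; exact: bvs.
have vB x y : al <= x -> x <= y -> y <= be ->
    v y - v x = fine (total_variation x y f).
  move=> alx xy ybe; rewrite /v (total_variationD f alx xy) fineD ?tvfin//.
    by rewrite addrC addKr.
  exact: le_trans ybe.
have vf x y : al <= x -> x <= y -> y <= be -> `|f y - f x| <= v y - v x.
  move=> alx xy ybe; rewrite vB// -lee_fin fineK ?tvfin//.
  exact: total_variation_ge.
have vac (e : R) : 0 < e -> exists2 d : R, 0 < d & forall l,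
    itv_family al be l -> \sum_(x <- l) (x.2 - x.1) < d ->
    \sum_(x <- l) (v x.2 - v x.1) < e.
  move=> e0; have e20 : 0 < e / 2 by rewrite divr_gt0.
  have [d d0 H] := abs_cont_on_family fac e20; exists d => // l lfam llen.
  have lin (x : R * R) : x \in l -> [/\ al <= x.1, x.1 < x.2 & x.2 <= be].
    by have [_ h _] := lfam; exact: h.
  have [|l' [l'fam _ l'len l'var]] := total_variation_family e20 _ lfam (f := f).
    by move=> x /lin[h1 h2 h3]; apply: bvs => //; exact: ltW.
  have := H _ l'fam; rewrite l'len => /(_ llen) h.
  rewrite big_seq (eq_bigr (fun x : R * R => fine (total_variation x.1 x.2 f))).
    rewrite -big_seq; apply: (le_lt_trans l'var).
    by rewrite [X in _ < X]splitr ltrD2r.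
  by move=> x /lin[h1 h2 h3]; rewrite vB// ltW.
have vnd x y : al <= x -> x <= y -> y <= be -> v x <= v y.
  by move=> h1 h2 h3; rewrite -subr_ge0 (le_trans _ (vf _ _ h1 h2 h3)).
have gac (e : R) : 0 < e -> exists2 d : R, 0 < d & forall l,
    itv_family al be l -> \sum_(x <- l) (x.2 - x.1) < d ->
    \sum_(x <- l) ((v x.2 - f x.2) - (v x.1 - f x.1)) < e.
  move=> e0; have e20 : 0 < e / 2 by rewrite divr_gt0.
  have [d1 d10 H1] := vac _ e20.
  have [d2 d20 H2] := abs_cont_on_family fac e20.
  exists (Num.min d1 d2) => [|l lfam]; first by rewrite lt_min d10.
  rewrite lt_min => /andP[/(H1 _ lfam) h1 /(H2 _ lfam) h2].
  apply: (@le_lt_trans _ _ (\sum_(x <- l) (v x.2 - v x.1) +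
      \sum_(x <- l) `|f x.2 - f x.1|)).
    rewrite -big_split/=; apply: ler_sum => x _.
    by have := ler_norm (- (f x.2 - f x.1)); rewrite normrN; lra.
  lra.
have gnd x y : al <= x -> x <= y -> y <= be -> v x - f x <= v y - f y.
  move=> h1 h2 h3; have := vf _ _ h1 h2 h3.
  by have := ler_norm (f y - f x); lra.
have [q1 [q1i q1E]] := nondecreasing_density albe vnd vac.
have [q2 [q2i q2E]] := nondecreasing_density albe gnd gac.
have mab : measurable (`[al, be]%classic : set (measurableTypeR R)).
  exact: measurable_itv.
exists (fun x => q1 x - q2 x); split.
  by have := integrableB mab q1i q2i; apply: eq_integrable.
move=> x alx xbe.
have sx : `[al, x] `<=` `[al, be] by apply: subset_itvl; rewrite bnd_simp.
have mx : measurable (`[al, x]%classic : set (measurableTypeR R)).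
  exact: measurable_itv.
rewrite RintegralB//.
- by rewrite -q1E// -q2E//; ring.
- exact: integrableS mab mx sx q1i.
- exact: integrableS mab mx sx q2i.
Qed.

Lemma Rintegral_itvD (q : R -> R) al be x y :
  mu.-integrable `[al, be] (EFin \o q) -> al <= x -> x <= y -> y <= be ->
  (\int[mu]_(t in `[al, y]) q t =
   \int[mu]_(t in `[al, x]) q t + \int[mu]_(t in `[x, y]) q t)%R.
Proof.
move=> iq alx xy ybe.
have iS u z : al <= u -> z <= be -> mu.-integrable `[u, z] (EFin \o q).
  move=> h1 h2; apply: integrableS iq => //; try exact: measurable_itv.
  by apply: subset_itv; rewrite bnd_simp.
have := @Rintegral_itvB _ q (BLeft al) (BRight y) x.
rewrite iS//= => /(_ isT); rewrite !bnd_simp alx xy => /(_ isT isT).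
rewrite Rintegral_itv_obnd_cbnd.
  by move=> <-; rewrite addrC subrK.
apply: integrableS (iS x y alx ybe) => //; try exact: measurable_itv.
by apply: subset_itv; rewrite bnd_simp.
Qed.

Lemma integral_ae_derive F (q : R -> R) al be : al < be ->
  mu.-integrable `[al, be] (EFin \o q) ->
  (forall x, al <= x -> x <= be -> F x - F al = (\int[mu]_(t in `[al, x]) q t)%R) ->
  {ae mu, forall x, al < x -> x < be -> is_derive x 1 F (q x)}.
Proof.
move=> albe iq FE.
pose q0 := q \_ `[al, be].
have mab : measurable (`[al, be]%classic : set (measurableTypeR R)).
  exact: measurable_itv.
have iq0 : mu.-integrable setT (EFin \o q0).
  by rewrite /q0 -restrict_EFin; apply/integrable_restrict => //=; rewrite setTI.
have lq0 : locally_integrable [set: R] q0.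
  apply: open_integrable_locally => //; exact: openT.
have iq0' (y : R) : mu.-integrable [set` Interval (BLeft al) (BRight y)] (EFin \o q0).
  by apply: integrableS iq0 => //; exact: measurable_itv.
have := FTC1 iq0' lq0.
apply: filterS; first exact: (ae_filter_ringOfSetsType mu).
move=> x /= + alx xbe.
rewrite lte_fin => /(_ alx)[dG G'x].
have q0x : q0 x = q x.
  by rewrite /q0 patchE mem_set//= in_itv/= (ltW alx) (ltW xbe).
have dF : is_derive x 1 (fun y => \int[mu]_(t in [set` Interval (BLeft al) (BRight y)]) q0 t + F al)%R (q x).
  rewrite -q0x -[X in is_derive _ _ _ X]addr0; apply: is_deriveD.
  apply: DeriveDef; first exact: dG.
  by rewrite -G'x derive1E.
apply: near_eq_is_derive dF.
near=> y.
have aly : al <= y by apply: ltW; near: y; exact: lt_nbhsr.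
have ybe : y <= be by apply: ltW; near: y; exact: lt_nbhsl.
rewrite (_ : (\int[mu]_(t in _) q0 t = \int[mu]_(t in `[al, y]) q t)%R).
  by rewrite -FE// subrK.
apply: eq_Rintegral => z; rewrite inE/= in_itv/= => /andP[alz zy].
by rewrite /q0 patchE mem_set//= in_itv/= alz (le_trans zy).
Unshelve. all: by end_near. Qed.

(** Absolute continuity of the integral of [h], applied to the union of the intervals. *)
Lemma dominated_abs_cont F (h : R -> R) al be :
  mu.-integrable `[al, be] (EFin \o h) ->
  (forall x y, al <= x -> x <= y -> y <= be ->
    `|F y - F x| <= (\int[mu]_(t in `[x, y]) h t)%R) ->
  abs_cont_on F al be.
Proof.
move=> ih dom e e0.
pose h0 := h \_ `[al, be].
have mab : measurable (`[al, be]%classic : set (measurableTypeR R)).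
  exact: measurable_itv.
have ih0 : mu.-integrable setT (EFin \o h0).
  by rewrite /h0 -restrict_EFin; apply/integrable_restrict => //=; rewrite setTI.
have [d [d0 H]] := integral_normr_continuous ih0 e0.
exists d => // n s t st ts std.
have mh0 : measurable_fun setT (EFin \o (fun x => `|h0 x|)).
  by apply/measurable_EFinP; apply: measurableT_comp => //; apply/measurable_EFinP; exact: measurable_int ih0.
(* The union has to end by the last right endpoint, so that the next half-open interval is disjoint
   from it. The condition [0 < n] makes it empty for [n = 0], where [t n.-1] would read [t 0]. *)
suff [A [mA _ muA hA]] : exists A : set (measurableTypeR R), [/\ measurable A,
    (forall x, A x -> (0 < n)%N /\ x <= t n.-1),
    (mu A <= (\sum_(k < n) (t k - s k))%:E)%E &
    ((\sum_(k < n) `|F (t k) - F (s k)|)%:E <= \int[mu]_(x in A) (`|h0 x|)%:E)%E].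
  have Ad : (mu A < d%:E)%E by apply: le_lt_trans muA _; rewrite lte_fin.
  have := H _ mA Ad; apply: le_lt_trans.
  rewrite -lee_fin (le_trans hA)// /Rintegral fineK//.
  apply: integrable_fin_num => //.
  have := integrableS measurableT mA (@subsetT _ _) (integrable_abse ih0).
  exact: eq_integrable.
elim: n st ts {std} => [|n ih1] st ts.
  by exists set0; split => //; rewrite ?big_ord0 ?measure0 ?integral_set0.
have [k kn|k kn|A [mA tA muA hA]] := ih1.
- by apply: st; rewrite ltnS ltnW.
- by apply: ts; rewrite ltnS ltnW.
have [alsn [sntn tnbe]] := st n (ltnSn n).
have mst : measurable (`]s n, t n]%classic : set (measurableTypeR R)) by exact: measurable_itv.
have Ast : [disjoint A & (`]s n, t n]%classic : set (measurableTypeR R))]%classic.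
  apply/disj_setPLR => x Ax /=; apply/negP; rewrite in_itv/= negb_and -leNgt.
  apply/orP; left; have [n0 xt] := tA _ Ax; apply: (le_trans xt).
  by rewrite -[in leRHS](prednK n0) ts// prednK.
exists (A `|` `]s n, t n]%classic); split.
- exact: measurableU.
- move=> x [/tA[n0 xt]|/=]; last by rewrite in_itv/= => /andP[].
  split => //=; apply: (le_trans xt); apply: le_trans sntn.
  by rewrite -[in leRHS](prednK n0) ts// prednK.
- rewrite big_ord_recr/= EFinD; apply: (le_trans (measureU2 _ _ _)) => //.
  apply: leeD => //; suff : (mu `]s n, t n]%classic <= (t n - s n)%:E)%E by [].
  rewrite lebesgue_measure_itv/= lte_fin.
  by case: ifPn => // _; rewrite lee_fin subr_ge0.
- rewrite big_ord_recr/= EFinD ge0_integral_setU//; last exact: measurable_funTS.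
  apply: leeD => //.
  have sub : `[s n, t n] `<=` `[al, be] by apply: subset_itv; rewrite bnd_simp.
  have msn : measurable (`[s n, t n]%classic : set (measurableTypeR R)) by exact: measurable_itv.
  rewrite integral_itv_obnd_cbnd; last exact: measurable_funTS mh0.
  apply: (@le_trans _ _ (\int[mu]_(x in `[s n, t n]) h x)%R%:E).
    by rewrite lee_fin dom.
  rewrite /Rintegral fineK; last first.
    by apply: integrable_fin_num => //; exact: integrableS mab msn sub ih.
  apply: (le_trans (lee_abs _)); apply: (le_trans (le_abse_integral _ _ _)) => //.
    by have := integrableS mab msn sub ih; exact: measurable_int.
  apply: ge0_le_integral => //.
  + apply: measurableT_comp => //.
    by have := integrableS mab msn sub ih; exact: measurable_int.
  + exact: measurable_funTS.
  + by move=> x /sub abx; rewrite /h0 patchE mem_set.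
Qed.

(** Domination gives absolute continuity, hence some density, and differentiation identifies it with
    [q] almost everywhere. This is the tool for products and compositions: their increments are easy
    to dominate, and their derivative is known almost everywhere. *)
Lemma ae_derive_integral F (q h : R -> R) al be : al < be ->
  mu.-integrable `[al, be] (EFin \o h) ->
  (forall x y, al <= x -> x <= y -> y <= be ->
    `|F y - F x| <= (\int[mu]_(t in `[x, y]) h t)%R) ->
  measurable_fun `[al, be] q ->
  {ae mu, forall x, al < x -> x < be -> is_derive x 1 F (q x)} ->
  mu.-integrable `[al, be] (EFin \o q) /\
  forall x, al <= x -> x <= be -> F x - F al = (\int[mu]_(t in `[al, x]) q t)%R.
Proof.
move=> albe ih dom mq aeq.
have [q1 [iq1 q1E]] := abs_cont_density albe (dominated_abs_cont ih dom).
have aeq1 := integral_ae_derive albe iq1 q1E.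
have mab : measurable (`[al, be]%classic : set (measurableTypeR R)).
  exact: measurable_itv.
have qq1 : {ae mu, forall x, al < x -> x < be -> q x = q1 x}.
  apply: (ae_impl2 _ aeq aeq1) => x /= h1 h2 alx xbe.
  have := @derive_val _ _ _ _ _ _ _ (h1 alx xbe).
  by have := @derive_val _ _ _ _ _ _ _ (h2 alx xbe) => -> ->.
have qq1' x y : al <= x -> y <= be -> ae_eq mu `[x, y]%classic (EFin \o q1) (EFin \o q).
  move=> alx ybe.
  have neq : {ae mu, forall z, z != al /\ z != be}.
    by apply: (ae_impl2 _ (ae_neq al) (ae_neq be)).
  apply: (ae_impl2 _ qq1 neq) => z /= h' [zal zbe].
  rewrite in_itv/= => /andP[xz zy]; rewrite h'// lt_neqAle.
    by rewrite eq_sym zal (le_trans alx xz).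
  by rewrite zbe (le_trans zy ybe).
have mq1 := measurable_int _ iq1.
have iq : mu.-integrable `[al, be] (EFin \o q).
  apply/integrableP; split; first exact/measurable_EFinP.
  move/integrableP : iq1 => [_]; apply: le_lt_trans; rewrite le_eqVlt; apply/orP; left; apply/eqP.
  apply: ge0_ae_eq_integral => //.
  - by apply: measurableT_comp => //; exact/measurable_EFinP.
  - exact: measurableT_comp.
  - by have := qq1' al be (lexx _) (lexx _); apply: ae_impl => x /= h' /h' [->].
split => // x alx xbe; rewrite q1E// /Rintegral; congr fine.
have sx : `[al, x] `<=` `[al, be] by apply: subset_itvl; rewrite bnd_simp.
apply: ae_eq_integral.
- exact: measurable_itv.
- by apply: measurable_funS mq1.
- by apply/measurable_EFinP; apply: measurable_funS mq.
- exact: qq1'.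
Qed.


Lemma loc_abs_cont_continuous F x : loc_abs_cont F -> 0 < x -> {for x, continuous F}.
Proof.
move=> Fac x0; apply/(@cvgrPdist_lt _ R^o) => e e0.
have x20 : 0 < x / 2 by rewrite divr_gt0.
have [|d d0 H] := Fac (x / 2) (2 * x) x20 _ e e0; first by lra.
have main (s t : R) : x / 2 <= s -> s <= t -> t <= 2 * x -> t - s < d -> `|F t - F s| < e.
  move=> h1 h2 h3 h4.
  have := H 1%N (fun=> s) (fun=> t); rewrite !big_ord1; apply => //.
near=> y.
have : `|x - y| < Num.min d (x / 2).
  near: y; exists (Num.min d (x / 2)) => //=.
  by rewrite lt_min d0.
rewrite lt_min => /andP[h1 h2].
have [xy|/ltW yx] := leP x y.
  rewrite distrC; apply: main => //.
  - lra.
  - by move: h2; rewrite distrC ger0_norm ?subr_ge0//; lra.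
  - by move: h1; rewrite distrC ger0_norm ?subr_ge0.
apply: main => //.
- by move: h2; rewrite ger0_norm ?subr_ge0//; lra.
- lra.
- by move: h1; rewrite ger0_norm ?subr_ge0.
Unshelve. all: by end_near. Qed.

Lemma measurable_Ipos : measurable (Ipos : set (measurableTypeR R)).
Proof. exact: measurable_itv. Qed.

Lemma continuous_measurable_Ipos F :
  (forall x, 0 < x -> {for x, continuous F}) -> measurable_fun Ipos F.
Proof.
move=> cF; apply: open_continuous_measurable_fun; first exact: interval_open.
by move=> x; rewrite inE /Ipos/= in_itv/= andbT; exact: cF.
Qed.

Lemma ae_Ipos (P : R -> Prop) :
  (forall c d : R, 0 < c -> c < d -> {ae mu, forall x, c < x -> x < d -> P x}) ->
  {ae mu, forall x, 0 < x -> P x}.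
Proof.
move=> H.
have /ae_foralln : forall n, {ae mu, forall x : R, n.+1%:R^-1 < x -> x < n.+2%:R -> P x}.
  move=> n; apply: H => //.
  by rewrite (@le_lt_trans _ _ 1)// ?invf_le1// ?ler1n// ltr1n.
apply: ae_impl => x h x0.
have [n hn] : exists n, (x + x^-1 < n.+1%:R).
  exists (Num.bound (x + x^-1)); apply: (lt_le_trans (archi_boundP _)).
    by rewrite addr_ge0// ?invr_ge0 ltW.
  by rewrite ler_nat.
apply: (h n).
- rewrite invf_plt ?posrE//; apply: le_lt_trans hn.
  by rewrite lerDr ltW.
- apply: (le_lt_trans _ (lt_trans hn _)); last by rewrite ltr_nat.
  by rewrite lerDl invr_ge0 ltW.
Qed.

Lemma is_derive_seq F (x l : R) (u : nat -> R) : is_derive x 1 F l ->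
  (forall n, u n != 0) -> u @ \oo --> (0 : R) ->
  ((u n)^-1 * (F (u n + x) - F x)) @[n --> \oo] --> l.
Proof.
move=> [dF Dl] u0 ucvg.
have : (h^-1 *: ((F \o shift x) (h *: 1) - F x)) @[h --> (0 : R)^'] --> l by rewrite -Dl.
move=> /cvgr_dnbhsP/(_ u (conj u0 ucvg)).
by under eq_cvg do rewrite /= [_ *: 1]mulr1.
Qed.

(** The upper limit of the difference quotients with step [1/(n+1)] is measurable and equals the
    derivative wherever that exists. *)
Lemma measurable_derivative F : (forall x, 0 < x -> {for x, continuous F}) ->
  exists q : R -> R, [/\ measurable_fun setT q, (forall x, x <= 0 -> q x = 0) &
    forall x l : R, 0 < x -> is_derive x 1 F l -> q x = l].
Proof.
move=> cF.
pose g n x := n.+1%:R * (F (n.+1%:R^-1 + x) - F x).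
pose q0 x := limn_esup (fun n => (g n x)%:E).
have mq0 : measurable_fun Ipos q0.
  apply: measurable_fun_limn_esup => n; apply/measurable_EFinP.
  apply: continuous_measurable_Ipos => x x0.
  apply: continuousM; first exact: cst_continuous.
  apply: continuousB; last exact: cF.
  apply: continuous_comp; last by apply: cF; rewrite addr_gt0.
  by apply: continuousD; [exact: cst_continuous|exact: cvg_id].
exists ((fine \o q0) \_ Ipos); split.
- apply/measurable_restrict => //; first exact: measurable_Ipos.
  by rewrite setTI; apply: measurableT_comp.
- by move=> x x0; rewrite patchE memNset// /Ipos/= in_itv/= andbT; apply/negP; rewrite -leNgt.
move=> x l x0 dF; rewrite patchE mem_set; last by rewrite /Ipos/= in_itv/= andbT.
rewrite /q0 /=; suff /cvg_limn_einf_sup[_ ->] : (g n x)%:E @[n --> \oo] --> l%:E by [].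
apply/cvg_EFin; first by near=> n.
have := is_derive_seq (u := fun n => n.+1%:R^-1) dF _ cvg_harmonic.
by under eq_cvg do rewrite /= invrK; apply.
Unshelve. all: by end_near. Qed.

(** Densities obtained on different compact intervals agree only almost everywhere; the function of
    [measurable_derivative] serves for all of them at once. *)
Lemma loc_abs_cont_density F : loc_abs_cont F -> exists q : R -> R,
  [/\ measurable_fun setT q, (forall x, x <= 0 -> q x = 0),
    (forall c d : R, 0 < c -> mu.-integrable `[c, d] (EFin \o q)),
    {ae mu, forall x : R, 0 < x -> is_derive x 1 F (q x)} &
    forall x y : R, 0 < x -> x <= y -> F y - F x = (\int[mu]_(t in `[x, y]) q t)%R].
Proof.
move=> Fac.
have [q [mq q0 qE]] := measurable_derivative (fun x => loc_abs_cont_continuous Fac (x := x)).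
have main (c d : R) : 0 < c -> c < d -> mu.-integrable `[c, d] (EFin \o q) /\
    (F d - F c = (\int[mu]_(t in `[c, d]) q t)%R) /\
    {ae mu, forall x : R, c < x -> x < d -> is_derive x 1 F (q x)}.
  move=> c0 cd.
  have [q1 [iq1 q1E]] := abs_cont_density cd (Fac _ _ c0 (ltW cd)).
  have aeq1 := integral_ae_derive cd iq1 q1E.
  have aeq : {ae mu, forall x : R, c < x -> x < d -> is_derive x 1 F (q x)}.
    apply: ae_impl aeq1 => x /= h cx xd; have h' := h cx xd; rewrite (qE x _ (lt_trans c0 cx) h'); exact: h'.
  have mq1 := measurable_int _ iq1.
  have mabs : measurable_fun `[c, d] (EFin \o (fun x => `|q1 x|)).
    by apply/measurable_EFinP; apply: measurableT_comp => //; exact/measurable_EFinP.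
  have [] := @ae_derive_integral F q (fun x => `|q1 x|) c d cd _ _ _ aeq.
  - by have := integrable_abse iq1; apply: eq_integrable => //; exact: measurable_itv.
  - move=> x y cx xy yd.
    have ixy : mu.-integrable `[x, y] (EFin \o q1).
      apply: integrableS iq1; try exact: measurable_itv.
      by apply: subset_itv; rewrite bnd_simp.
    have -> : F y - F x = (\int[mu]_(t in `[x, y]) q1 t)%R.
      have := Rintegral_itvD iq1 cx xy yd.
      rewrite -q1E ?(le_trans cx xy)// -q1E ?(le_trans xy yd)//; lra.
    by apply: le_normr_Rintegral => //; exact: measurable_itv.
  - exact: measurable_funTS.
  - by move=> iq FE; split => //; split => //; apply: FE => //; exact: ltW.
exists q; split => //.
- move=> c d c0; have [cd|dc] := ltP c d; first exact: (main c d c0 cd).1.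
  move: dc; rewrite le_eqVlt => /predU1P[->|dc].
    rewrite set_itv1; apply: null_set_integrable; first exact: measurable_set1.
    - by apply/measurable_EFinP; exact: measurable_funTS.
    - exact: lebesgue_measure_set1.
  by rewrite set_itv_ge ?bnd_simp -?ltNge//; exact: integrable_set0.
- by apply: ae_Ipos => c d c0 cd; exact: (main c d c0 cd).2.2.
- move=> x y x0; rewrite le_eqVlt => /predU1P[->|xy]; last exact: (main x y x0 xy).2.1.
  by rewrite set_itv1 Rintegral_set1 subrr.
Qed.

End absolute_continuity.

Lemma measurable_itvR {R : realType} (i : interval R) :
  measurable ([set` i] : set (measurableTypeR R)).
Proof. exact: measurable_itv. Qed.

(** * Hölder's inequality and local integrals on the half-line *)

Section integral_tools.
Context {R : realType}.
Local Notation mu := (@lebesgue_measure R).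
Local Open Scope ereal_scope.
Import HBNNSimple.

(* Meant for the integrand of [W1pnorm], where [derive1] is known only almost
   everywhere. *)
Lemma ge0_ae_eq_integral_nm (D : set (measurableTypeR R)) (f g : R -> \bar R) :
  measurable D -> measurable_fun D g ->
  (forall x, D x -> 0 <= f x) -> (forall x, D x -> 0 <= g x) ->
  {ae mu, forall x, D x -> f x = g x} ->
  \int[mu]_(x in D) f x = \int[mu]_(x in D) g x.
Proof.
move=> mD mg f0 g0 fg; apply/eqP; rewrite eq_le; apply/andP; split.
  rewrite [leLHS]ge0_integralE// integral_mkcond.
  apply: ge_ereal_sup => _ /= [h hf <-]; rewrite -integralT_nnsfun.
  apply: ae_ge0_le_integral => //=.
  - by move=> x _; rewrite lee_fin.
  - exact/measurable_EFinP/measurable_funP.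
  - by move=> x _; rewrite patchE; case: ifPn => // xD; apply: g0; exact/set_mem.
  - by apply/measurable_restrict => //; rewrite setTI.
  - apply: ae_impl fg => x fg _; apply: (le_trans (hf x)).
    rewrite !patchE; case: ifPn => // /set_mem xD; by rewrite fg.
case: fg => N [mN N0 subN].
have mDN : measurable (D `\` N) by exact: measurableD.
rewrite (ge0_negligible_integral mN)//.
rewrite (_ : \int[mu]_(x in D `\` N) g x = \int[mu]_(x in D `\` N) f x); last first.
  apply: eq_integral => x; rewrite inE => -[xD xN].
  apply: contrapT => gf; apply: xN; apply: subN => /= /(_ xD) h; exact: gf.
rewrite [leLHS]ge0_integralE; last by move=> x [/f0].
rewrite [leRHS]ge0_integralE//.
apply: ge_ereal_sup => _ /= [h hf <-]; apply: ereal_sup_ubound; exists h => // x.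
apply: (le_trans (hf x)); rewrite !patchE; case: ifPn => [/set_mem[xD _]|_].
  by rewrite mem_set.
by case: ifPn => // /set_mem/f0.
Qed.

Lemma hoelder_on (D : set (measurableTypeR R)) (f g : R -> R) (p q : R) :
  measurable D -> measurable_fun D f -> measurable_fun D g ->
  (0 < p)%R -> (0 < q)%R -> (p^-1 + q^-1 = 1)%R ->
  \int[mu]_(x in D) (`|f x * g x|)%:E <=
  (\int[mu]_(x in D) (`|f x| `^ p)%:E) `^ p^-1 *
  (\int[mu]_(x in D) (`|g x| `^ q)%:E) `^ q^-1.
Proof.
move=> mD mf mg p0 q0 pq.
have mfD : measurable_fun setT (f \_ D : measurableTypeR R -> R).
  by apply/(measurable_restrictT _ mD).
have mgD : measurable_fun setT (g \_ D : measurableTypeR R -> R).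
  by apply/(measurable_restrictT _ mD).
have := hoelder mu mfD mgD p0 q0 pq.
rewrite Lnorm1 unlock /=.
rewrite (_ : \int[mu]_x _ = \int[mu]_(x in D) (`|f x * g x|)%:E); last first.
  rewrite [RHS]integral_mkcond; apply: eq_integral => x _.
  by rewrite !patchE; case: ifPn => //=; rewrite mulr0 normr0.
have E (k : R -> R) (r : R) : (0 < r)%R ->
    \int[mu]_x (`|(k \_ D) x| `^ r)%:E = \int[mu]_(x in D) (`|k x| `^ r)%:E.
  move=> r0; rewrite [RHS]integral_mkcond; apply: eq_integral => x _.
  rewrite !patchE; case: ifPn => // _.
  by rewrite normr0 powR0// gt_eqF.
by rewrite (E f p p0) (E g q q0).
Qed.

End integral_tools.

Section local_integrals.
Context {R : realType}.
Local Notation mu := (@lebesgue_measure R).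
Implicit Types (h g F : R -> R) (x y z c d : R).

(** Measurability is on the whole line, so that kernels in two variables built from [h] are
    measurable on the plane. *)
Definition locint h := measurable_fun setT h /\
  forall c d, 0 < c -> mu.-integrable `[c, d] (EFin \o h).

Definition itvint h x y : R := (\int[mu]_(t in `[x, y]) h t)%R.

(** Based at 1 because the integral down to 0 may diverge. *)
Definition primitive h x := if 1 <= x then itvint h 1 x else - itvint h x 1.

Lemma itvintxx h x : itvint h x x = 0.
Proof. by rewrite /itvint set_itv1 Rintegral_set1. Qed.

Lemma itvint_gt h x y : y < x -> itvint h x y = 0.
Proof. by move=> yx; rewrite /itvint set_itv_ge ?Rintegral_set0// bnd_simp -ltNge. Qed.

Lemma itvint_ge0 h x y : (forall t, 0 <= h t) -> 0 <= itvint h x y.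
Proof. by move=> h0; apply: Rintegral_ge0. Qed.

Lemma itvintE h x y : locint h -> 0 < x ->
  (itvint h x y)%:E = (\int[mu]_(t in `[x, y]) (h t)%:E)%E.
Proof.
move=> [_ ih] x0; rewrite /itvint /Rintegral fineK//.
by apply: integrable_fin_num; [exact: measurable_itv|exact: ih].
Qed.

Lemma itvintD h x y z : locint h -> 0 < x -> x <= y -> y <= z ->
  itvint h x z = itvint h x y + itvint h y z.
Proof. by move=> [_ ih] x0 xy yz; exact: (Rintegral_itvD (ih x z x0)). Qed.

Lemma itvint_le h x y x' y' : locint h -> (forall t, 0 <= h t) -> 0 < x' ->
  x' <= x -> y <= y' -> itvint h x y <= itvint h x' y'.
Proof.
move=> lh h0 x'0 x'x yy'.
have [xy|yx] := leP x y; last by rewrite itvint_gt// itvint_ge0.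
rewrite (itvintD lh x'0 x'x (le_trans xy yy')) (itvintD lh (lt_le_trans x'0 x'x) xy yy').
by rewrite addrCA lerDl addr_ge0// itvint_ge0.
Qed.

Lemma primitiveB h x y : locint h -> 0 < x -> x <= y ->
  primitive h y - primitive h x = itvint h x y.
Proof.
move=> lh x0 xy; rewrite /primitive.
have [ox|xo] := leP 1 x.
  by rewrite (le_trans ox xy) (itvintD lh ltr01 ox xy) addrC addKr.
have [oy|yo] := leP 1 y.
  by rewrite opprK addrC -(itvintD lh x0 (ltW xo) oy).
by rewrite opprK (itvintD lh x0 xy (ltW yo)); ring.
Qed.

Lemma locint_norm h : locint h -> locint (fun x => `|h x|).
Proof.
move=> [mh ih]; split; first exact: measurableT_comp.
move=> c d c0; have := integrable_abse (ih c d c0).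
by apply: eq_integrable => //; exact: measurable_itv.
Qed.

Lemma norm_itvint h x y : locint h -> 0 < x ->
  `|itvint h x y| <= itvint (fun t => `|h t|) x y.
Proof.
move=> [_ ih] x0; apply: le_normr_Rintegral; first exact: measurable_itv.
exact: ih.
Qed.

Lemma dominated_loc_abs_cont F h : locint h ->
  (forall x y, 0 < x -> x <= y -> `|F y - F x| <= itvint h x y) ->
  loc_abs_cont F.
Proof.
move=> [mh ih] dom al be al0 albe; apply: (dominated_abs_cont (ih al be al0)).
by move=> x y alx xy ybe; apply: dom => //; exact: lt_le_trans alx.
Qed.

Lemma primitive_dom h x y : locint h -> 0 < x -> x <= y ->
  `|primitive h y - primitive h x| <= itvint (fun t => `|h t|) x y.
Proof. by move=> lh x0 xy; rewrite primitiveB//; exact: norm_itvint. Qed.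

Lemma primitive_continuous h x : locint h -> 0 < x -> {for x, continuous (primitive h)}.
Proof.
move=> lh; apply: loc_abs_cont_continuous.
apply: (dominated_loc_abs_cont (locint_norm lh)) => y z y0 yz.
exact: primitive_dom.
Qed.

Lemma primitive_ae_derive h : locint h ->
  {ae mu, forall x, 0 < x -> is_derive x 1 (primitive h) (h x)}.
Proof.
move=> lh; apply: ae_Ipos => c d c0 cd; case: (lh) => _ ih.
apply: (integral_ae_derive cd (ih c d c0)) => x cx xd.
by rewrite primitiveB.
Qed.

Lemma measurable_primitive h : locint h -> measurable_fun Ipos (primitive h).
Proof. by move=> lh; apply: continuous_measurable_Ipos => x; exact: primitive_continuous. Qed.

(** The mean value theorem makes [G] Lipschitz on the range of the primitive, so the composition has
    dominated increments. The assumptions on [G] are confined to [[m, M]], which admits powers that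
    are singular at 0. *)
Lemma itvint_comp_primitive h (G g : R -> R) (c m M L al be : R) :
  locint h -> 0 < al -> al < be -> measurable_fun setT g ->
  (forall x, al <= x -> x <= be -> m <= primitive h x + c <= M) ->
  (forall y, m <= y <= M -> is_derive y 1 G (g y)) ->
  (forall y, m <= y <= M -> `|g y| <= L) ->
  mu.-integrable `[al, be] (EFin \o (fun t => g (primitive h t + c) * h t)) /\
  G (primitive h be + c) - G (primitive h al + c) =
  itvint (fun t => g (primitive h t + c) * h t) al be.
Proof.
move=> lh al0 albe mg rng dG gL.
have L0 : 0 <= L.
  by apply: le_trans (normr_ge0 _) (gL _ (rng _ (lexx al) (ltW albe))).
have lnh := locint_norm lh.
have lip u v : m <= u <= M -> m <= v <= M -> `|G v - G u| <= L * `|v - u|.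
  wlog uv : u v / u <= v.
    move=> H; have [uv|/ltW vu] := leP u v; first exact: H.
    by move=> hu hv; rewrite distrC (distrC v); exact: H.
  move=> /andP[mu' uM] /andP[mv vM].
  have inmM x : x \in `[u, v] -> m <= x <= M.
    by rewrite in_itv/= => /andP[h1 h2]; rewrite (le_trans mu' h1) (le_trans h2 vM).
  have [||x /inmM xmM ->] := @MVT_segment _ G g u v uv.
  - by move=> x /subset_itv_oo_cc/inmM; exact: dG.
  - apply: derivable_within_continuous => x /inmM/dG h'.
    exact: ex_derive.
  - by rewrite normrM ler_wpM2r// gL.
have := @ae_derive_integral R (fun t => G (primitive h t + c))
  (fun t => g (primitive h t + c) * h t) (fun t => L * `|h t|) al be albe.
case.
- case: lnh => _ /(_ al be al0) inh.
  have := integrableZl (measurable_itvR _) L inh.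
  by apply: eq_integrable => //; exact: measurable_itv.
- move=> x y alx xy ybe; have x0 := lt_le_trans al0 alx.
  apply: (le_trans (lip _ _ (rng x alx (le_trans xy ybe)) (rng y (le_trans alx xy) ybe))).
  rewrite RintegralZl//; last by case: lnh => _; apply.
  by rewrite ler_wpM2l// [primitive h x + c]addrC opprD addrA addrK; exact: primitive_dom.
- apply: measurable_funM; last by apply: measurable_funTS; case: lh.
  apply: (measurable_comp measurableT) => //.
  apply: measurable_funD => //; apply: measurable_funS (measurable_primitive lh).
    exact: measurable_Ipos.
  by move=> x /=; rewrite /Ipos/= !in_itv/= andbT => /andP[/(lt_le_trans al0)].
- apply: ae_impl (primitive_ae_derive lh) => x /= dP alx xbe.
  have {}dP := dP (lt_trans al0 alx).
  have dPc : is_derive x 1 (fun t => primitive h t + c) (h x).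
    by rewrite -[X in is_derive _ _ _ X]addr0; apply: is_deriveD.
  have dGx : is_derive (primitive h x + c) 1 G (g (primitive h x + c)).
    by apply: dG; apply: rng; exact: ltW.
  exact: (@is_derive1_comp _ G (fun t => primitive h t + c) x).
- by move=> ig /(_ be (ltW albe) (lexx be)).
Qed.

Lemma locintD (f g : R -> R) : locint f -> locint g -> locint (fun t => f t + g t).
Proof.
move=> [mf lf] [mg lg]; split; first exact: measurable_funD.
move=> c d c0; have := integrableD (measurable_itvR `[c, d]) (lf c d c0) (lg c d c0).
by apply: eq_integrable => //; exact: measurable_itvR.
Qed.

Lemma locintZ (k : R) (f : R -> R) : locint f -> locint (fun t => k * f t).
Proof.
move=> [mf lf]; split; first exact: measurable_funM.
move=> c d c0; have := integrableZl (measurable_itvR `[c, d]) k (lf c d c0).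
by apply: eq_integrable => //; exact: measurable_itvR.
Qed.

Lemma itvint_mono (f g : R -> R) x y : locint f -> locint g -> 0 < x ->
  (forall t, x <= t -> t <= y -> f t <= g t) -> itvint f x y <= itvint g x y.
Proof.
move=> lf lg x0 fg; rewrite -lee_fin !itvintE//; apply: le_integral.
- exact: measurable_itvR.
- by case: lf => _; exact.
- by case: lg => _; exact.
- by move=> t; rewrite inE/= in_itv/= => /andP[xt ty]; rewrite lee_fin fg.
Qed.

Lemma itvint_sumD (f g : R -> R) x y : locint f -> locint g -> 0 < x ->
  itvint (fun t => f t + g t) x y = itvint f x y + itvint g x y.
Proof.
move=> lf lg x0.
exact: RintegralD (measurable_itvR `[x, y]) (proj2 lf x y x0) (proj2 lg x y x0).
Qed.

Lemma itvintZ (k : R) (f : R -> R) x y : locint f -> 0 < x ->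
  itvint (fun t => k * f t) x y = k * itvint f x y.
Proof.
move=> lf x0.
exact: RintegralZl (measurable_itvR `[x, y]) (proj2 lf x y x0).
Qed.

Lemma locint_cst (k : R) : locint (fun=> k).
Proof.
split => // c d c0; apply/integrableP; split; first exact/measurable_EFinP.
rewrite integral_cst/=; last exact: measurable_itvR.
rewrite lebesgue_measure_itv/=; case: ifPn => _; last by rewrite mule0.
by rewrite -EFinB -EFinM ltry.
Qed.

End local_integrals.

Lemma le_limn_einf {R : realType} (u v : (\bar R)^nat) :
  (forall n, u n <= v n)%E -> (limn_einf u <= limn_einf v)%E.
Proof.
move=> uv; rewrite !limn_einf_lim; apply: lee_lim; [exact: is_cvg_einfs..|].
apply: nearW => n; apply: le_ereal_inf_tmp => _ /= [k nk <-].
by apply: le_trans (uv k); apply: ereal_inf_lbound; exists k.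
Qed.

Lemma cvg_addr_harmonic {R : realType} (x : R) : x + n.+1%:R^-1 @[n --> \oo] --> x.
Proof.
rewrite -[X in _ --> X]addr0; apply: cvgD; first exact: cvg_cst.
exact: cvg_harmonic.
Qed.

Lemma cvg_comp_harmonic {R : realType} (f : R -> R) (x : R) :
  {for x, continuous f} -> f (x + n.+1%:R^-1) @[n --> \oo] --> f x.
Proof. by move=> cf; apply: continuous_cvg => //; exact: cvg_addr_harmonic. Qed.

(** * Integrals of powers of a primitive *)

Section power_integrals.
Context {R : realType}.
Local Notation mu := (@lebesgue_measure R).
Variable h : R -> R.
Hypothesis lh : locint h.
Hypothesis h0 : forall t, 0 <= h t.

Lemma itvint_primitive (al t : R) : 0 < al -> al <= t ->
  itvint h al t = primitive h t - primitive h al.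
Proof. by move=> al0 alt; rewrite primitiveB. Qed.

Lemma powR_le_base (s y E : R) : 0 < E -> E <= y -> s <= 0 -> y `^ s <= E `^ s.
Proof.
move=> E0 Ey s0; rewrite -[s]opprK !(powRN _ (- s)) lef_pV2 ?posrE ?powR_gt0//.
  by apply: ge0_ler_powR; rewrite ?nnegrE ?oppr_ge0// ltW// (lt_le_trans E0).
exact: lt_le_trans Ey.
Qed.

Lemma measurable_itvint (al be : R) : 0 < al -> measurable_fun `[al, be] (itvint h al).
Proof.
move=> al0; apply: (eq_measurable_fun (fun t => primitive h t - primitive h al)).
  by move=> x; rewrite inE/= in_itv/= => /andP[alx _]; rewrite itvint_primitive.
apply: measurable_funB => //; apply: measurable_funS (measurable_primitive lh).
  exact: measurable_Ipos.
by move=> x /=; rewrite /Ipos/= !in_itv/= andbT => /andP[/(lt_le_trans al0)].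
Qed.

(** Substitution of [itvint h al t + E]; the shift [E > 0] keeps the base of the power away from
    0. *)
Lemma itvint_powR (al be E s : R) : 0 < al -> al <= be -> 0 < E -> s != 0 -> s <= 1 ->
  (\int[mu]_(t in `[al, be]) ((itvint h al t + E) `^ (s - 1) * h t)%:E)%E =
  (((itvint h al be + E) `^ s - E `^ s) / s)%:E.
Proof.
move=> al0; rewrite le_eqVlt => /predU1P[<- E0 s0 s1|albe E0 s0 s1].
  by rewrite set_itv1 integral_set1 itvintxx add0r subrr mul0r.
pose c := E - primitive h al.
have cE t : al <= t -> primitive h t + c = itvint h al t + E.
  by move=> alt; rewrite itvint_primitive// /c; ring.
have [||| ig GE] := @itvint_comp_primitive R h (fun y => y `^ s / s) (fun y => y `^ (s - 1))
  c E (itvint h al be + E) (E `^ (s - 1)) al be lh al0 albe (measurable_powR _).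
- move=> x alx xbe; rewrite cE// lerDr itvint_ge0//= lerD2r.
  by apply: itvint_le.
- move=> y /andP[Ey _]; have y0 := lt_le_trans E0 Ey.
  have := is_derive1_powR s y0 => d.
  have -> : y `^ (s - 1) = s^-1 *: (s * y `^ (s - 1)).
    by rewrite /GRing.scale/= mulrA mulVf// mul1r.
  have -> : (fun y => y `^ s / s) = s^-1 \*: (fun y => y `^ s).
    by apply/funext => z /=; rewrite /GRing.scale/= mulrC.
  exact: is_deriveZ.
- move=> y /andP[Ey _]; rewrite ger0_norm ?powR_ge0//.
  by apply: powR_le_base => //; rewrite subr_le0.
rewrite (_ : (\int[mu]_(t in _) _)%E = (itvint (fun t => (primitive h t + c) `^ (s - 1) * h t) al be)%:E).
  by rewrite -GE cE ?ltW// cE ?lexx// itvintxx add0r mulrBl.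
rewrite /itvint /Rintegral fineK; last first.
  by apply: integrable_fin_num => //; exact: measurable_itvR.
by apply: eq_integral => x; rewrite inE/= in_itv/= => /andP[alx _]; rewrite cE.
Qed.

Lemma itvint_sqrt_le (al be E : R) : 0 < al -> al <= be -> 0 < E ->
  ((\int[mu]_(t in `[al, be]) ((itvint h al t + E) `^ (- 2^-1) * h t)%:E) <=
  (2 * (itvint h al be + E) `^ 2^-1)%:E)%E.
Proof.
move=> al0 albe E0; have := @itvint_powR al be E 2^-1 al0 albe E0.
rewrite (_ : 2^-1 - 1 = - 2^-1 :> R); last by lra.
move=> ->; [|by rewrite invr_eq0|by lra].
rewrite invrK lee_fin mulrC ler_pM2l// gerBl powR_ge0//.
Qed.

Lemma itvint_powRN_le (al be E d : R) : 0 < al -> al <= be -> 0 < E -> 0 < d ->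
  ((\int[mu]_(t in `[al, be]) ((itvint h al t + E) `^ (- (1 + d)) * h t)%:E) <=
  (E `^ (- d) / d)%:E)%E.
Proof.
move=> al0 albe E0 d0; have := @itvint_powR al be E (- d) al0 albe E0.
rewrite oppr_eq0 gt_eqF// (_ : - d - 1 = - (1 + d)); last by ring.
move=> ->//; last by lra.
rewrite lee_fin invrN mulrN -mulNr opprB ler_pM2r ?invr_gt0//.
by rewrite gerBl powR_ge0.
Qed.

(** The limit case [E = 0]: Fatou's lemma along the shifts [E = 1/(n+1)]. *)
Lemma itvint_rsqrt_le (al be : R) : 0 < al -> al <= be ->
  ((\int[mu]_(t in `[al, be]) (itvint h al t `^ (- 2^-1) * h t)%:E) <=
  (2 * itvint h al be `^ 2^-1)%:E)%E.
Proof.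
move=> al0 albe.
pose g n t := ((itvint h al t + n.+1%:R^-1) `^ (- 2^-1) * h t)%:E.
have mI : measurable_fun `[al, be] (itvint h al) by exact: measurable_itvint.
have mh : measurable_fun `[al, be] h by apply: measurable_funTS; case: lh.
have pw (f : R -> R) r : measurable_fun `[al, be] f -> measurable_fun `[al, be] (fun t => f t `^ r).
  by move=> mf; apply: (measurableT_comp (measurable_powR r)).
have mg n : measurable_fun `[al, be] (g n).
  apply/measurable_EFinP/measurable_funM => //; apply: pw.
  exact: measurable_funD.
have g0 n t : `[al, be]%classic t -> (0 <= g n t)%E.
  by move=> _; rewrite lee_fin mulr_ge0// powR_ge0.
have := fatou mu (measurable_itvR `[al, be]) mg g0.
move=> fat; apply: (@le_trans _ _ (\int[mu]_(x in `[al, be]) limn_einf (g^~ x))%E).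
  apply: ge0_le_integral.
  - exact: measurable_itvR.
  - by move=> t _; rewrite lee_fin mulr_ge0// powR_ge0.
  - by apply/measurable_EFinP/measurable_funM => //; exact: pw.
  - apply: (eq_measurable_fun (fun x => - limn_esup (fun n => - g n x))%E).
      by move=> x _; rewrite limn_esupN oppeK.
    apply: measurableT_comp => //; apply: measurable_fun_limn_esup => n.
    exact: measurableT_comp.
  - move=> t /=; rewrite in_itv/= => /andP[alt tbe].
    have It0 : 0 <= itvint h al t by exact: itvint_ge0.
    (* A nonzero power of 0 is 0, also for negative exponents, so the integrand vanishes where the
       inner integral does. *)
    have [I0|In0] := eqVneq (itvint h al t) 0.
      rewrite I0 powR0 ?oppr_eq0 ?invr_eq0// mul0r.
      rewrite -[leLHS](_ : limn_einf (cst 0%E) = 0%E); last first.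
        by have [->] := cvg_limn_einf_sup (@cvg_cst _ (0%:E : \bar R) nat \oo _).
      by apply: le_limn_einf => n; apply: g0; rewrite /= in_itv/= alt tbe.
    have Itp : 0 < itvint h al t by rewrite lt_neqAle eq_sym In0.
    suff /cvg_limn_einf_sup[-> _] : g n t @[n --> \oo] -->
        (itvint h al t `^ (- 2^-1) * h t)%:E by [].
    apply/cvg_EFin; first by apply: nearW.
    apply: cvgM; last exact: cvg_cst.
    have ct : {for itvint h al t, continuous (fun y : R => y `^ (- 2^-1))}.
      apply/differentiable_continuous/derivable1_diffP.
      by apply: derivable_powR; rewrite in_itv/= andbT.
    exact: (cvg_comp_harmonic ct).
apply: (le_trans fat).
have lim2 : (2 * (itvint h al be + n.+1%:R^-1) `^ 2^-1)%:E @[n --> \oo] -->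
    (2 * itvint h al be `^ 2^-1)%:E.
  apply/cvg_EFin; first by apply: nearW.
  apply: cvgM; first exact: cvg_cst.
  have ct : continuous (fun y : R => Num.sqrt y) by exact: sqrt_continuous.
  have I0 : 0 <= itvint h al be by exact: itvint_ge0.
  rewrite powR12_sqrt//; under eq_cvg do rewrite /= powR12_sqrt ?addr_ge0//.
  exact: (cvg_comp_harmonic (ct _)).
have [<- _] := cvg_limn_einf_sup lim2.
apply: le_limn_einf => n.
exact: itvint_sqrt_le.
Qed.

End power_integrals.

(** * The Schur test *)

Section schur.
Context {R : realType}.
Local Notation mu := (@lebesgue_measure R).
Local Open Scope ereal_scope.

(** Hölder in [x] with [P] in [L^p] and [Q g] in [L^q], then Tonelli to integrate [Q^q] in [t]
    first. *)
Lemma schur_test (p q : R) (P Q : measurableTypeR R * measurableTypeR R -> R)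
    (C1 C2 : R) (g : R -> R) :
  (0 < p)%R -> (0 < q)%R -> (p^-1 + q^-1 = 1)%R ->
  (forall z, 0 <= P z)%R -> (forall z, 0 <= Q z)%R ->
  measurable_fun setT P -> measurable_fun setT Q ->
  (0 <= C1)%R -> (0 <= C2)%R ->
  (forall t, \int[mu]_x (P (x, t) `^ p)%:E <= C1%:E) ->
  (forall x, \int[mu]_t (Q (x, t) `^ q)%:E <= C2%:E) ->
  measurable_fun setT g -> (forall x, 0 <= g x)%R ->
  \int[mu]_t ((\int[mu]_x (P (x, t) * Q (x, t) * g x)%:E) `^ q) <=
  (C1 `^ (q / p) * C2)%:E * \int[mu]_x (g x `^ q)%:E.
Proof.
move=> p0 q0 pq P0 Q0 mP mQ C10 C20 HP HQ mg g0.
have mPx t : measurable_fun setT (fun x => P (x, t)).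
  by apply: measurableT_comp => //; exact: measurable_pair2.
have mQx t : measurable_fun setT (fun x => Q (x, t)).
  by apply: measurableT_comp => //; exact: measurable_pair2.
have mQt x : measurable_fun setT (fun t => Q (x, t)).
  by apply: measurableT_comp => //; exact: measurable_pair1.
pose F (z : measurableTypeR R * measurableTypeR R) : \bar R := (Q z `^ q * g z.1 `^ q)%:E.
have F0 z : 0 <= F z by rewrite lee_fin mulr_ge0 ?powR_ge0.
have mF : measurable_fun setT F.
  apply/measurable_EFinP/measurable_funM.
    exact: (measurableT_comp (measurable_powR q)).
  apply: (measurableT_comp (measurable_powR q)).
  by apply: measurableT_comp => //; exact: measurable_fst.
pose F1 (z : measurableTypeR R * measurableTypeR R) : \bar R := (P z * Q z * g z.1)%:E.
have F10 z : 0 <= F1 z by rewrite lee_fin !mulr_ge0.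
have mF1 : measurable_fun setT F1.
  apply/measurable_EFinP/measurable_funM; first exact: measurable_funM.
  by apply: measurableT_comp => //; exact: measurable_fst.
apply: (@le_trans _ _ (\int[mu]_t ((C1 `^ (q / p))%:E * \int[mu]_x F (x, t)))).
  apply: ge0_le_integral => //.
  - by move=> t _; exact: poweR_ge0.
  - apply: (measurableT_comp (measurable_poweR q)).
    exact: (measurable_fun_fubini_tonelli_G F1).
  - apply: emeasurable_funM => //.
    exact: (measurable_fun_fubini_tonelli_G F).
  - move=> t _.
    have := @hoelder_on R setT (fun x => P (x, t)) (fun x => Q (x, t) * g x)%R p q
      measurableT (mPx t) (measurable_funM (mQx t) mg) p0 q0 pq.
    have e1 : \int[mu]_x (`|P (x, t) * (Q (x, t) * g x)|)%:E = \int[mu]_x F1 (x, t).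
      by apply: eq_integral => x _; rewrite ger0_norm ?mulrA// !mulr_ge0.
    have e2 : \int[mu]_x (`|P (x, t)| `^ p)%:E = \int[mu]_x (P (x, t) `^ p)%:E.
      by apply: eq_integral => x _; rewrite ger0_norm.
    have e3 : \int[mu]_x (`|Q (x, t) * g x| `^ q)%:E = \int[mu]_x F (x, t).
      by apply: eq_integral => x _; rewrite ger0_norm ?mulr_ge0// powRM.
    rewrite e1 e2 e3.
    move=> H; apply: (@le_trans _ _ (((\int[mu]_x (P (x, t) `^ p)%:E) `^ p^-1 *
        (\int[mu]_x F (x, t)) `^ q^-1) `^ q)).
      apply: gt0_ler_poweR => //; rewrite ?in_itv/= ?leey ?andbT; first exact: ltW.
        by apply: integral_ge0 => x _; exact: F10.
      by apply: mule_ge0; exact: poweR_ge0.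
    rewrite poweRM ?poweR_ge0// -!poweRrM mulVf ?gt_eqF// poweRe1; last exact: integral_ge0.
    rewrite lee_wpmul2r//; first exact: integral_ge0.
    rewrite mulrC -poweR_EFin; apply: gt0_ler_poweR; rewrite ?in_itv/= ?leey ?andbT//.
    - by rewrite divr_ge0// ltW.
    - by apply: integral_ge0 => x _; rewrite lee_fin powR_ge0.
rewrite ge0_integralZl//; last 3 first.
- exact: (measurable_fun_fubini_tonelli_G F).
- by move=> t _; exact: integral_ge0.
- by rewrite lee_fin powR_ge0.
rewrite EFinM -muleA lee_wpmul2l ?lee_fin ?powR_ge0//.
rewrite -(fubini_tonelli (m1 := mu) (m2 := mu) F mF F0).
rewrite -ge0_integralZl//; last 2 first.
- by apply/measurable_EFinP; exact: (measurableT_comp (measurable_powR q)).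
- by move=> x _; rewrite lee_fin powR_ge0.
apply: ge0_le_integral => //.
- by move=> x _; exact: integral_ge0.
- exact: (measurable_fun_fubini_tonelli_F F).
- apply: emeasurable_funM => //; apply/measurable_EFinP.
  exact: (measurableT_comp (measurable_powR q)).
- move=> x _; rewrite /F /=; under eq_integral do rewrite EFinM.
  rewrite ge0_integralZr//; last 3 first.
  + by apply/measurable_EFinP; exact: (measurableT_comp (measurable_powR q)).
  + by move=> t _; rewrite lee_fin powR_ge0.
  + by rewrite lee_fin powR_ge0.
  by rewrite lee_wpmul2r// lee_fin powR_ge0.
Qed.

End schur.

Section tools.
Context {R : realType}.
Local Notation mu := (@lebesgue_measure R).

(** A simple function below [f] is also below [g]. Measurability never enters, so pointwise bounds
    can be integrated at once. *)
Lemma ge0_le_integral_nm (D : set (measurableTypeR R)) (f g : R -> \bar R) :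
  (forall x, D x -> 0 <= f x)%E -> (forall x, D x -> f x <= g x)%E ->
  (\int[mu]_(x in D) f x <= \int[mu]_(x in D) g x)%E.
Proof.
move=> f0 fg; rewrite ge0_integralE// ge0_integralE; last first.
  by move=> x Dx; exact: le_trans (f0 x Dx) (fg x Dx).
apply: ge_ereal_sup => _ /= [h hf <-]; apply: ereal_sup_ubound; exists h => // x.
apply: (le_trans (hf x)); rewrite !patchE; case: ifPn => // /set_mem Dx.
exact: fg.
Qed.

Lemma powRDp (x r s : R) : 0 < x -> x `^ (r + s) = x `^ r * x `^ s.
Proof. by move=> x0; rewrite powRD// (gt_eqF x0) implybT. Qed.

Lemma powRVp (x r : R) : 0 <= x -> x^-1 `^ r = x `^ (- r).
Proof. by move=> x0; rewrite -powR_inv1// -powRrM mulN1r. Qed.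

Lemma powR_ler (x y r : R) : 0 <= r -> 0 <= x -> x <= y -> x `^ r <= y `^ r.
Proof.
by move=> r0 x0 xy; apply: ge0_ler_powR; rewrite ?nnegrE// (le_trans x0).
Qed.

Lemma powR_half_sq (x : R) : 0 < x -> x `^ 2^-1 * x `^ 2^-1 = x.
Proof. by move=> x0; rewrite -powRDp// (_ : _ + _ = 1) ?powRr1 ?ltW//; lra. Qed.

(** Here [r] and [rX] are the half-lengths at [x] and at [ainv t], [k] is the [w]-mass of [[a x, t]]
    and [I] the [u]-mass of [[t, x]]. Both [r^(p-1) I] and [r^(p-1) (2 rX)^(1-p)] are at most 1,
    which trades the power of [r] for a power of [I + (2 rX)^(1-p)] that can be integrated against
    [u]. *)
Lemma powR_schur_u (p r k I rX : R) : 1 < p -> 0 < r -> 0 <= k -> 0 <= I -> 0 < rX ->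
  r <= 2 * rX -> k <= 2 * rX -> I <= (2 * r) `^ (1 - p) ->
  (r * k) `^ ((p - 1) / 2) <= 2 `^ 2^-1 * ((2 * rX) `^ (1 - p)) `^ (- 2^-1) *
    (I + (2 * rX) `^ (1 - p)) `^ (- 2^-1).
Proof.
move=> p1 r0 k0 I0 rX0 rrX krX Ir.
set E := (_ `^ (1 - p)).
have p10 : 0 <= p - 1 by lra.
have E0 : 0 < E by rewrite powR_gt0; lra.
have EdL : E `^ (- 2^-1) = (2 * rX) `^ ((p - 1) / 2).
  by rewrite -powRrM; congr (_ `^ _); field.
have cancel x : 0 < x -> x `^ (p - 1) * x `^ (1 - p) = 1.
  by move=> x0; rewrite -powRDp// (_ : _ + _ = 0) ?powRr0//; lra.
have h1 : r `^ (p - 1) * I <= 1.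
  rewrite -[leRHS](cancel (2 * r)); last by lra.
  by apply: ler_pM => //; rewrite ?powR_ge0//; apply: powR_ler; lra.
have h2 : r `^ (p - 1) * E <= 1.
  rewrite -[leRHS](cancel (2 * rX)); last by lra.
  by rewrite ler_pM2r//; apply: powR_ler; lra.
have IE0 : 0 < I + E by lra.
have h3 : r `^ (p - 1) <= 2 * (I + E)^-1 by rewrite ler_pdivlMr//; lra.
rewrite EdL powRM ?(ltW r0)// mulrAC ler_pM ?powR_ge0//; last by apply: powR_ler; lra.
rewrite -powRVp ?(ltW IE0)// -powRM ?invr_ge0 ?(ltW IE0)// powRrM.
by apply: powR_ler; rewrite ?powR_ge0 ?invr_ge0//.
Qed.

(** Here [E] is the half-length at [t] and [I] the [w]-mass of [[t, x]]. As [I + E <= 3 r], the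
    decay in [r] becomes a decay in [I + E] that can be integrated against [w]. *)
Lemma powR_schur_tail (p d r k E I : R) : 0 < d -> d = (p - 1) / 2 ->
  0 < r -> 0 <= k -> 0 < E -> 0 <= I -> k <= E -> I + E <= 3 * r ->
  r `^ (- p) * (r * k) `^ d <= 3 `^ (1 + d) * E `^ d * (I + E) `^ (- (1 + d)).
Proof.
move=> d0 dE r0 k0 E0 I0 kE IEr; rewrite powRM ?(ltW r0)// mulrA -powRDp//.
rewrite (_ : - p + d = - (1 + d)); last by rewrite dE; field.
rewrite mulrAC; apply: ler_pM; rewrite ?powR_ge0//; last by apply: powR_ler; lra.
rewrite !powRN ler_pdivlMr ?powR_gt0//; last lra.
rewrite mulrC ler_pdivrMr ?powR_gt0// -powRM ?(ltW r0)//.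
by apply: powR_ler; lra.
Qed.

End tools.

(** * Weighted intervals and Schur bounds *)

(* [w] stands for [v_1^{-p'}] and [u] for [v_0^p]; the field [frame_V] is the
   normalisation of [a] and [b], raised to the power [p]. *)
Record interval_frame {R : realType} (p : R) (w u a b ainv : R -> R) : Prop := IntervalFrame {
  frame_p : 1 < p;
  frame_w : locint w;
  frame_w0 : forall t, 0 <= w t;
  frame_wgt0 : forall x y, 0 < x -> x < y -> 0 < itvint w x y;
  frame_u : locint u;
  frame_u0 : forall t, 0 <= u t;
  frame_a0 : forall x, 0 < x -> 0 < a x;
  frame_ax : forall x, 0 < x -> a x < x;
  frame_xb : forall x, 0 < x -> x < b x;
  frame_a_lt : forall x y, 0 < x -> x < y -> a x < a y;
  frame_b_lt : forall x y, 0 < x -> x < y -> b x < b y;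
  frame_a_cont : forall x, 0 < x -> {for x, continuous a};
  frame_ab : forall x, 0 < x -> itvint w (a x) x = itvint w x (b x);
  frame_V : forall x, 0 < x -> itvint u (a x) (b x) = (2 * itvint w (a x) x) `^ (1 - p);
  frame_ainv0 : forall t, 0 < t -> 0 < ainv t;
  frame_ainvK : forall t, 0 < t -> a (ainv t) = t }.

Section frame_basics.
Context {R : realType} {p : R} {w u a b ainv : R -> R}.
Hypothesis F : interval_frame p w u a b ainv.
Local Notation mu := (@lebesgue_measure R).
Local Notation W := (itvint w).

(* Half of the paper's [V_1 x]. *)
Definition half_length (w a : R -> R) x := itvint w (a x) x.
Local Notation rho := (half_length w a).

Local Notation p0 := (lt_trans ltr01 (frame_p F)).

Lemma frame_a_le x y : 0 < x -> x <= y -> a x <= a y.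
Proof. by move=> x0; rewrite le_eqVlt => /predU1P[->//|/(frame_a_lt F x0)/ltW]. Qed.

Lemma frame_a_leE x y : 0 < x -> 0 < y -> (a x <= a y) = (x <= y).
Proof.
move=> x0 y0; have [xy|yx] := leP x y; first exact: frame_a_le.
by apply/negbTE; rewrite -ltNge; exact: (frame_a_lt F).
Qed.

Lemma frame_ainv_ge x t : 0 < x -> 0 < t -> (x <= ainv t) = (a x <= t).
Proof.
move=> x0 t0; rewrite -{2}(frame_ainvK F t0) frame_a_leE//.
exact: (frame_ainv0 F).
Qed.

Lemma frame_ainv_gt x t : 0 < x -> 0 < t -> (x < ainv t) = (a x < t).
Proof.
move=> x0 t0; rewrite -{2}(frame_ainvK F t0) ltNge -frame_a_leE//; last exact: (frame_ainv0 F).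
by rewrite -ltNge.
Qed.

Lemma frame_aK x : 0 < x -> ainv (a x) = x.
Proof.
move=> x0; have ax0 := frame_a0 F x0; apply/eqP; rewrite eq_le frame_ainv_ge// lexx andbT.
by rewrite -frame_a_leE ?(frame_ainvK F)//; exact: (frame_ainv0 F).
Qed.

Lemma frame_ainv_lt t : 0 < t -> t < ainv t.
Proof. by move=> t0; rewrite frame_ainv_gt//; exact: (frame_ax F). Qed.

Lemma frame_ainv_le s t : 0 < s -> s <= t -> ainv s <= ainv t.
Proof.
move=> s0 st; have t0 := lt_le_trans s0 st.
by rewrite frame_ainv_ge ?(frame_ainvK F)//; exact: (frame_ainv0 F).
Qed.

Lemma half_lengthE x : rho x = W (a x) x. Proof. by []. Qed.

Lemma frame_W0 x y : 0 <= W x y.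
Proof. by apply: itvint_ge0; exact: (frame_w0 F). Qed.

Opaque itvint half_length powR.

Lemma half_length_gt0 x : 0 < x -> 0 < rho x.
Proof. by move=> x0; rewrite half_lengthE; apply: (frame_wgt0 F); [exact: (frame_a0 F)|exact: (frame_ax F)]. Qed.

(** Monotonicity of [a] gives the first bound; monotonicity of [b] with the balance [frame_ab] gives
    the second. Continuity of [rho] and the comparisons between its values come from here. *)
Lemma half_length_lip x y : 0 < x -> x <= y ->
  rho y <= rho x + W x y /\ rho x <= rho y + W x y.
Proof.
move=> x0 xy; have y0 := lt_le_trans x0 xy.
have a0x := frame_a0 F x0; have axx := ltW (frame_ax F x0).
have ayy := ltW (frame_ax F y0).
have xbx := ltW (frame_xb F x0); have yby := ltW (frame_xb F y0).
have axay := frame_a_le x0 xy.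
have bxby : b x <= b y by move: xy; rewrite le_eqVlt => /predU1P[->//|/(frame_b_lt F x0)/ltW].
have e1 : W (a x) x + W x y = W (a x) (a y) + W (a y) y.
  by rewrite -!itvintD//; exact: (frame_w F).
have e2 : W x y + W y (b y) = W x (b x) + W (b x) (b y).
  by rewrite -!itvintD//; try exact: (frame_w F); exact: le_trans xy yby.
rewrite -!(frame_ab F)// in e2.
have := frame_W0 (a x) (a y); have := frame_W0 (b x) (b y).
rewrite !half_lengthE; split; lra.
Qed.

(** The mass equals [rho x + W x y - rho y]. This integrated inequality stands for
    [w(a x) a'(x) <= 2 w(x)]. *)
Lemma frame_W_a x y : 0 < x -> x <= y -> W (a x) (a y) <= 2 * W x y.
Proof.
move=> x0 xy; have y0 := lt_le_trans x0 xy.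
have a0x := frame_a0 F x0; have axx := ltW (frame_ax F x0).
have ayy := ltW (frame_ax F y0).
have axay := frame_a_le x0 xy.
have e1 : W (a x) x + W x y = W (a x) (a y) + W (a y) y.
  by rewrite -!itvintD//; exact: (frame_w F).
have [_] := half_length_lip x0 xy; rewrite !half_lengthE; lra.
Qed.

Lemma frame_W_le x y x' y' : 0 < x' -> x' <= x -> y <= y' -> W x y <= W x' y'.
Proof. by apply: itvint_le; [exact: (frame_w F)|exact: (frame_w0 F)]. Qed.

Lemma half_length_comp t x : 0 < t -> t <= x -> a x <= t ->
  [/\ rho t <= 2 * rho x, W t x <= rho x, W (a x) t <= rho x & W (a x) t <= rho t].
Proof.
move=> t0 tx axt; have x0 := lt_le_trans t0 tx.
have a0x := frame_a0 F x0.
have h : W t x <= rho x by exact: frame_W_le.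
split => //.
- by have [_] := half_length_lip t0 tx; lra.
- exact: frame_W_le.
- by apply: frame_W_le => //; [exact: (frame_a0 F)|exact: frame_a_le].
Qed.

Lemma half_length_continuous x : 0 < x -> {for x, continuous rho}.
Proof.
apply: loc_abs_cont_continuous; apply: (dominated_loc_abs_cont (frame_w F)) => {}x y x0 xy.
have [h1 h2] := half_length_lip x0 xy.
by rewrite ler_norml; apply/andP; split; lra.
Qed.

Lemma half_length_locmin c d : 0 < c -> exists2 m, 0 < m & forall x, c <= x -> x <= d -> m <= rho x.
Proof.
move=> c0; have [cd|dc] := leP c d; last first.
  by exists 1 => // x cx xd; move: dc; rewrite ltNge (le_trans cx xd).
have := @EVT_min R rho c d cd.
have cr : {within `[c, d], continuous rho}.
  apply: continuous_in_subspaceT => x; rewrite inE/= in_itv/= => /andP[cx _].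
  exact: half_length_continuous (lt_le_trans c0 cx).
move=> /(_ cr)[z]; rewrite in_itv/= => /andP[cz zd] H.
exists (rho z); first exact: half_length_gt0 (lt_le_trans c0 cz).
by move=> x cx xd; apply: H; rewrite in_itv/= cx.
Qed.

Lemma frame_U_le x y t : 0 < x -> a x <= y -> t <= b x ->
  itvint u y t <= (2 * rho x) `^ (1 - p).
Proof.
move=> x0 axy tbx; rewrite -(frame_V F x0).
by apply: itvint_le => //; [exact: (frame_u F)|exact: (frame_u0 F)|exact: (frame_a0 F)].
Qed.

(** The value for which [schur_exp p * p' / p = 1/2], the exponent in [kernel_bound]. *)
Definition schur_exp (p : R) := (p - 1) / 2.
Local Notation dl := (schur_exp p).

Lemma schur_exp_gt0 : 0 < dl.
Proof. by rewrite divr_gt0// subr_gt0 (frame_p F). Qed.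

(** The half of the Schur condition that depends on the weight [m]; the other half is
    [kernel_bound]. *)
Definition schur_bound (m : R -> R) C := forall t, 0 < t ->
  (\int[mu]_(x in `[t, ainv t]) (m x * (rho x * W (a x) t) `^ dl)%:E <= C%:E)%E.

(** With [X = ainv t], the normalisation makes [E] the [u]-mass of [[t, b X]]. It bounds the mass of
    [[t, X]], so the power [-1/2] integrates to at most [2 (2 E)^(1/2)]; the powers of [E] cancel
    and 4 remains. *)
Lemma schur_bound_u : schur_bound u 4.
Proof.
move=> t t0; pose X := ainv t.
have X0 : 0 < X by exact: (frame_ainv0 F).
have tX : t < X by exact: frame_ainv_lt.
have aX : a X = t by exact: (frame_ainvK F).
have rX0 := half_length_gt0 X0.
pose E := (2 * rho X) `^ (1 - p).
have rX20 : 0 < 2 * rho X by rewrite mulr_gt0.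
have E0 : 0 < E by rewrite powR_gt0.
have dl0 := schur_exp_gt0.
have pt x : t <= x -> x <= X ->
    (rho x * W (a x) t) `^ dl <= 2 `^ 2^-1 * E `^ (- 2^-1) * (itvint u t x + E) `^ (- 2^-1).
  move=> tx xX; have x0 := lt_le_trans t0 tx.
  have axt : a x <= t by rewrite -frame_ainv_ge.
  have rx0 := half_length_gt0 x0.
  have W0 : 0 <= W (a x) t by exact: frame_W0.
  have I0 : 0 <= itvint u t x by apply: itvint_ge0; exact: (frame_u0 F).
  have WxX : W x X <= rho X by apply: frame_W_le; rewrite ?aX.
  have rxX : rho x <= 2 * rho X by have [_] := half_length_lip x0 xX; lra.
  have WaX : W (a x) t <= 2 * rho X.
    by rewrite -aX (le_trans (frame_W_a x0 xX))// ler_pM2l.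
  have hU := frame_U_le x0 axt (ltW (frame_xb F x0)).
  exact: powR_schur_u (frame_p F) rx0 W0 I0 rX0 rxX WaX hU.
apply: (@le_trans _ _ (\int[mu]_(x in `[t, X]) ((2 `^ 2^-1 * E `^ (- 2^-1))%:E *
    ((itvint u t x + E) `^ (- 2^-1) * u x)%:E))%E).
  apply: ge0_le_integral_nm => x.
    by move=> _; rewrite lee_fin mulr_ge0 ?powR_ge0// (frame_u0 F).
  rewrite /= in_itv/= => /andP[tx xX]; rewrite -EFinM lee_fin [_ * u x]mulrC.
  by rewrite mulrCA ler_wpM2l ?(frame_u0 F)// pt.
rewrite ge0_integralZl//; last 3 first.
- apply/measurable_EFinP/measurable_funM; last first.
    by apply: measurable_funTS; case: (frame_u F).
  apply: (measurableT_comp (measurable_powR _)); apply: measurable_funD => //.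
  exact: measurable_itvint (frame_u F) _ _ t0.
- by move=> x _; rewrite lee_fin mulr_ge0 ?powR_ge0// (frame_u0 F).
- by rewrite lee_fin mulr_ge0 ?powR_ge0.
have := itvint_sqrt_le (frame_u F) (frame_u0 F) t0 (ltW tX) E0.
move=> H; apply: (le_trans (lee_wpmul2l _ H)).
  by rewrite lee_fin mulr_ge0 ?powR_ge0.
rewrite -EFinM lee_fin.
have IE : itvint u t X <= E by apply: frame_U_le; rewrite ?aX// ltW// (frame_xb F).
have I0 : 0 <= itvint u t X by apply: itvint_ge0; exact: (frame_u0 F).
apply: (@le_trans _ _ (2 `^ 2^-1 * E `^ (- 2^-1) * (2 * (2 * E) `^ 2^-1))).
  rewrite ler_wpM2l// ?mulr_ge0 ?powR_ge0// ler_pM2l//; apply: powR_ler; lra.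
rewrite powRM// ?(ltW E0)// powRN.
have E2 : E `^ 2^-1 != 0 by rewrite gt_eqF// powR_gt0.
rewrite [leLHS](_ : _ = 2 * (2 `^ 2^-1 * 2 `^ 2^-1)); first by rewrite powR_half_sq//; lra.
by field.
Qed.

Definition frame_tail x := w x * rho x `^ (- p).

(** On [[t, ainv t]], [rho x] is at least a third of [W t x + rho t], and the resulting power of
    [W t x + rho t] is integrable against [w] since its exponent is below -1. *)
Lemma schur_bound_tail : schur_bound frame_tail (3 `^ (1 + dl) / dl).
Proof.
move=> t t0; pose X := ainv t.
have X0 : 0 < X by exact: (frame_ainv0 F).
have tX : t < X by exact: frame_ainv_lt.
have E0 := half_length_gt0 t0; set E := rho t in E0.
have dl0 := schur_exp_gt0.
have pt (x : R) : t <= x -> x <= X -> frame_tail x * (rho x * W (a x) t) `^ dl <=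
    3 `^ (1 + dl) * E `^ dl * ((W t x + E) `^ (- (1 + dl)) * w x).
  move=> tx xX; have x0 := lt_le_trans t0 tx.
  have axt : a x <= t by rewrite -frame_ainv_ge.
  have rx0 := half_length_gt0 x0.
  have W0 : 0 <= W (a x) t by exact: frame_W0.
  have I0 : 0 <= W t x by exact: frame_W0.
  have [h1 h2 h3 h4] := half_length_comp t0 tx axt.
  have h5 : W t x + E <= 3 * rho x by rewrite /E; lra.
  have H := @powR_schur_tail R p dl (rho x) (W (a x) t) E (W t x) dl0 erefl rx0 W0 E0 I0 h4 h5.
  have aux (f r K A B : R) : 0 <= f -> r * K <= A * B -> f * r * K <= A * (B * f).
    by move=> f0 h; rewrite -mulrA [leRHS]mulrA [leRHS]mulrC ler_wpM2l.
  exact: (aux _ _ _ _ _ (frame_w0 F x) H).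
apply: (@le_trans _ _ (\int[mu]_(x in `[t, X]) ((3 `^ (1 + dl) * E `^ dl)%:E *
    ((W t x + E) `^ (- (1 + dl)) * w x)%:E))%E).
  apply: ge0_le_integral_nm => x.
    by move=> _; rewrite lee_fin !mulr_ge0 ?powR_ge0// (frame_w0 F).
  by rewrite /= in_itv/= => /andP[tx xX]; rewrite -EFinM lee_fin; exact: pt.
rewrite ge0_integralZl//; last 3 first.
- apply/measurable_EFinP/measurable_funM; last first.
    by apply: measurable_funTS; case: (frame_w F).
  apply: (measurableT_comp (measurable_powR _)); apply: measurable_funD => //.
  exact: measurable_itvint (frame_w F) _ _ t0.
- by move=> x _; rewrite lee_fin mulr_ge0 ?powR_ge0// (frame_w0 F).
- by rewrite lee_fin mulr_ge0 ?powR_ge0.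
have := itvint_powRN_le (frame_w F) (frame_w0 F) t0 (ltW tX) E0 dl0.
move=> H; apply: (le_trans (lee_wpmul2l _ H)).
  by rewrite lee_fin mulr_ge0 ?powR_ge0.
rewrite -EFinM lee_fin powRN.
have Ed : E `^ dl != 0 by rewrite gt_eqF// powR_gt0.
rewrite le_eqVlt; apply/orP; left; apply/eqP; field.
by rewrite Ed gt_eqF.
Qed.

(** Substituting the mass [W (a x) t] integrates its power [-1/2] to at most [2 (rho x)^(1/2)],
    which the power of [rho x] cancels. *)
Lemma kernel_bound x : 0 < x ->
  (\int[mu]_(t in `]a x, x]) (w t * (rho x * W (a x) t) `^ (- 2^-1))%:E <= 2%:E)%E.
Proof.
move=> x0; have a0x := frame_a0 F x0; have axx := ltW (frame_ax F x0).
have rx0 := half_length_gt0 x0.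
rewrite integral_itv_obnd_cbnd; last first.
  apply/measurable_EFinP/measurable_funM; first by apply: measurable_funTS; case: (frame_w F).
  apply: (measurableT_comp (measurable_powR _)); apply: measurable_funM => //.
  apply: (measurable_funS _ _ (measurable_itvint (frame_w F) (be := x) a0x)).
    exact: measurable_itvR.
  exact: subset_itv_oc_cc.
apply: (@le_trans _ _ (\int[mu]_(t in `[a x, x]) ((rho x `^ (- 2^-1))%:E *
    (W (a x) t `^ (- 2^-1) * w t)%:E))%E).
  apply: ge0_le_integral_nm => t _.
    by rewrite lee_fin mulr_ge0 ?powR_ge0// (frame_w0 F).
  rewrite -EFinM lee_fin powRM ?(ltW rx0)//; last exact: frame_W0.
  by rewrite mulrC mulrA.
rewrite ge0_integralZl//; last 3 first.
- apply/measurable_EFinP/measurable_funM; last first.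
    by apply: measurable_funTS; case: (frame_w F).
  apply: (measurableT_comp (measurable_powR _)).
  exact: measurable_itvint (frame_w F) _ _ a0x.
- by move=> t _; rewrite lee_fin mulr_ge0 ?powR_ge0// (frame_w0 F).
- by rewrite lee_fin powR_ge0.
have := itvint_rsqrt_le (frame_w F) (frame_w0 F) a0x axx.
move=> H; apply: (le_trans (lee_wpmul2l _ H)).
  by rewrite lee_fin powR_ge0.
rewrite -EFinM lee_fin powRN -half_lengthE.
by rewrite mulrCA mulVf ?mulr1// gt_eqF// powR_gt0.
Qed.

End frame_basics.

Section schur_operators.
Opaque itvint half_length powR.
Context {R : realType} {p : R} {w u a b ainv : R -> R}.
Hypothesis F : interval_frame p w u a b ainv.
Local Notation mu := (@lebesgue_measure R).
Local Notation W := (itvint w).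
Local Notation rho := (half_length w a).
Local Notation dl := (schur_exp p).
Local Notation p' := (dualexp p).
Local Notation mR := (measurableTypeR R).

Lemma frame_p0 : 0 < p. Proof. exact: lt_trans (frame_p F). Qed.
Lemma frame_p10 : 0 < p - 1. Proof. by rewrite subr_gt0 (frame_p F). Qed.
Lemma frame_p'0 : 0 < p'. Proof. by rewrite divr_gt0 ?frame_p0 ?frame_p10. Qed.
Lemma frame_pp' : p^-1 + p'^-1 = 1.
Proof.
rewrite /dualexp; have := frame_p0; have := frame_p10; move=> /lt0r_neq0 h1 /lt0r_neq0 h2.
by field; rewrite h1.
Qed.

Lemma measurable_frame_a : measurable_fun (setT : set mR) (a \_ Ipos : mR -> R).
Proof.
apply/(measurable_restrictT _ measurable_Ipos).
by apply: continuous_measurable_Ipos; exact: (frame_a_cont F).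
Qed.

Let a0 : mR -> R := a \_ Ipos.
Let prim0 : mR -> R := primitive w \_ Ipos.

Let mprim0 : measurable_fun (setT : set mR) prim0.
Proof.
apply/(measurable_restrictT _ measurable_Ipos).
exact: measurable_primitive (frame_w F).
Qed.

Let inI (x : R) : 0 < x -> x \in (Ipos : set R).
Proof. by move=> x0; rewrite inE /Ipos/= in_itv/= x0. Qed.

Let a0E (x : R) : 0 < x -> a0 x = a x.
Proof. by move=> x0; rewrite /a0 patchE inI. Qed.

Let prim0E (x : R) : 0 < x -> prim0 x = primitive w x.
Proof. by move=> x0; rewrite /prim0 patchE inI. Qed.

(** The inequality [a x < t] is strict so that [W (a x) t] is positive on the region and its
    opposite powers in [P] and [Q] cancel. The omitted endpoint does not change the integrals. *)
Definition frame_S (z : mR * mR) := [&& 0 < z.2, z.2 <= z.1 & a0 z.1 < z.2].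

Lemma measurable_frame_S : measurable_fun setT frame_S.
Proof.
apply: measurable_and; first exact: measurable_fun_ltr.
apply: measurable_and; first exact: measurable_fun_ler.
apply: measurable_fun_ltr => //.
by apply: measurableT_comp => //; exact: measurable_frame_a.
Qed.

Lemma frame_SE (x t : R) : frame_S (x, t) = [&& 0 < t, t <= x & a x < t].
Proof.
rewrite /frame_S/=; have [t0/=|//] := ltP 0 t; have [tx/=|//] := leP t x.
by rewrite a0E// (lt_le_trans t0).
Qed.

(** A difference of primitives is measurable on the whole plane, and it is the mass [W (a x) t]
    where that makes sense. *)
Definition frame_W (z : mR * mR) : R := prim0 z.2 - prim0 (a0 z.1).

Lemma measurable_frame_W : measurable_fun setT frame_W.
Proof.
apply: measurable_funB; first by apply: measurableT_comp.
apply: measurableT_comp => //; apply: measurableT_comp => //.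
exact: measurable_frame_a.
Qed.

Lemma frame_WE (x t : R) : 0 < x -> a x <= t -> frame_W (x, t) = W (a x) t.
Proof.
move=> x0 axt; have ax0 := frame_a0 F x0; have t0 := lt_le_trans ax0 axt.
by rewrite /frame_W/= a0E// !prim0E// primitiveB//; exact: (frame_w F).
Qed.

Definition frame_rho (x : mR) : R := frame_W (x, x).

Lemma measurable_frame_rho : measurable_fun setT frame_rho.
Proof.
apply: measurable_funB => //; apply: measurableT_comp => //.
exact: measurable_frame_a.
Qed.

Lemma frame_rhoE (x : R) : 0 < x -> frame_rho x = rho x.
Proof. by move=> x0; rewrite /frame_rho frame_WE// ?ltW ?(frame_ax F)// half_lengthE. Qed.

Let Kern r (z : mR * mR) : R :=
  if frame_S z then (frame_rho z.1 * frame_W z) `^ r else 0.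

Let mKern r : measurable_fun setT (Kern r).
Proof.
apply: measurable_fun_ifT => //; first exact: measurable_frame_S.
apply: (measurableT_comp (measurable_powR r)); apply: measurable_funM.
  by apply: measurableT_comp => //; exact: measurable_frame_rho.
exact: measurable_frame_W.
Qed.

Let Kern0 r z : 0 <= Kern r z.
Proof. by rewrite /Kern; case: ifP => // _; exact: powR_ge0. Qed.

Let KernE r (x t : R) : Kern r (x, t) =
  if [&& 0 < t, t <= x & a x < t] then (rho x * W (a x) t) `^ r else 0.
Proof.
rewrite /Kern frame_SE; case: ifP => // /and3P[t0 tx axt].
have x0 := lt_le_trans t0 tx.
by rewrite frame_rhoE// frame_WE// ltW.
Qed.

Variables (m q : R -> R) (C1 : R).
Hypothesis C10 : 0 <= C1.
Hypothesis mq : measurable_fun setT q.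
Hypothesis q0 : forall x, 0 <= q x.
Hypothesis qm : forall x, 0 < x -> q x `^ p = m x.
Hypothesis Km : schur_bound (p := p) (w := w) (a := a) (ainv := ainv) m C1.

(** The product [P Q] is the kernel [q(x) w(t)^(1/p')] on the region. The opposite powers of
    [rho x * W (a x) t] are inserted so that the integral of [P^p] is controlled by [schur_bound]
    and that of [Q^p'] by [kernel_bound]. *)
Let P (z : mR * mR) : R := q z.1 * Kern (dl / p) z.
Let Q (z : mR * mR) : R := w z.2 `^ p'^-1 * Kern (- (dl / p)) z.

Let P0 z : 0 <= P z. Proof. by rewrite mulr_ge0. Qed.
Let Q0 z : 0 <= Q z. Proof. by rewrite mulr_ge0// powR_ge0. Qed.
Let mP : measurable_fun setT P.
Proof. by apply: measurable_funM => //; exact: measurableT_comp. Qed.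
Let mQ : measurable_fun setT Q.
Proof.
apply: measurable_funM => //; apply: (measurableT_comp (measurable_powR _)).
by apply: measurableT_comp => //; case: (frame_w F).
Qed.

Let P_bound (t : R) : (\int[mu]_x (P (x, t) `^ p)%:E <= C1%:E)%E.
Proof.
have [t0|t0] := ltP 0 t; last first.
  rewrite integral0_eq ?lee_fin// => x _; rewrite /P KernE ltNge t0/= mulr0 powR0//.
  by rewrite gt_eqF// frame_p0.
apply: le_trans (Km t0); rewrite [leRHS]integral_mkcond.
apply: ge0_le_integral_nm => x _; first by rewrite lee_fin powR_ge0.
rewrite patchE; case: ifPn => [|xN].
  rewrite inE/= in_itv/= => /andP[tx xX]; have x0 := lt_le_trans t0 tx.
  rewrite lee_fin /P powRM// qm// KernE t0 tx/= -qm//.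
  rewrite ler_wpM2l ?powR_ge0//; case: ifPn => _; last by rewrite powR0 ?powR_ge0// gt_eqF// frame_p0.
  by rewrite -powRrM divfK// gt_eqF// frame_p0.
rewrite lee_fin /P KernE t0/=; case: ifPn => [/andP[tx axt]|_]; last first.
  by rewrite mulr0 powR0// gt_eqF// frame_p0.
have x0 := lt_le_trans t0 tx.
exfalso; move/negP: xN; apply; rewrite inE/= in_itv/= tx/=.
by rewrite (frame_ainv_ge F)// ltW.
Qed.

Let Q_bound (x : R) : (\int[mu]_t (Q (x, t) `^ p')%:E <= 2%:E)%E.
Proof.
have p'n0 : p' != 0 by rewrite gt_eqF// frame_p'0.
have [x0|x0] := ltP 0 x; last first.
  rewrite integral0_eq ?lee_fin// => t _; rewrite /Q KernE.
  have [t0/=|_] := ltP 0 t; last by rewrite mulr0 powR0.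
  by rewrite leNgt (le_lt_trans x0 t0)/= mulr0 powR0.
apply: le_trans (kernel_bound F x0); rewrite [leRHS]integral_mkcond.
apply: ge0_le_integral_nm => t _; first by rewrite lee_fin powR_ge0.
have a0x := frame_a0 F x0.
rewrite patchE; case: ifPn => [|tN].
  rewrite inE/= in_itv/= => /andP[axt tx]; have t0 := lt_trans a0x axt.
  rewrite lee_fin /Q powRM ?powR_ge0// KernE t0 tx axt/=.
  rewrite -powRrM mulVf// powRr1 ?(frame_w0 F)// ler_wpM2l ?(frame_w0 F)//.
  rewrite -powRrM (_ : - (dl / p) * p' = - 2^-1)//.
  rewrite /schur_exp /dualexp; have := frame_p0; have := frame_p10.
  by move=> /lt0r_neq0 h1 /lt0r_neq0 h2; field; rewrite h1.
rewrite lee_fin /Q KernE; case: ifPn => [/and3P[t0 tx axt]|_]; last first.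
  by rewrite mulr0 powR0.
by exfalso; move/negP: tN; apply; rewrite inE/= in_itv/= tx axt.
Qed.

Let PQE (x t : R) : P (x, t) * Q (x, t) =
  if [&& 0 < t, t <= x & a x < t] then q x * w t `^ p'^-1 else 0.
Proof.
rewrite /P /Q !KernE/=; case: ifPn => [/and3P[t0 tx axt]|_]; last by rewrite !mulr0.
have x0 := lt_le_trans t0 tx; have ax0 := frame_a0 F x0.
have k0 : 0 < rho x * W (a x) t.
  exact: mulr_gt0 (half_length_gt0 F x0) (frame_wgt0 F ax0 axt).
by rewrite powRN mulrACA mulfV ?mulr1// (gt_eqF (powR_gt0 _ k0)).
Qed.

Lemma schur_operator (g : R -> R) : measurable_fun setT g -> (forall x, 0 <= g x) ->
  (\int[mu]_(t in Ipos) ((w t)%:E * (\int[mu]_(x in `[t, ainv t]) (q x * g x)%:E) `^ p') <=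
  (C1 `^ (p' / p) * 2)%:E * \int[mu]_x (g x `^ p')%:E)%E.
Proof.
move=> mg g0.
have := schur_test frame_p0 frame_p'0 frame_pp' P0 Q0 mP mQ C10 (ler0n R 2) P_bound Q_bound mg g0.
apply: le_trans; rewrite integral_mkcond; apply: ge0_le_integral_nm => t _.
  rewrite patchE; case: ifPn => // _; apply: mule_ge0; rewrite ?poweR_ge0//.
  by rewrite lee_fin (frame_w0 F).
rewrite patchE; case: ifPn => [|_]; last exact: poweR_ge0.
rewrite inE /Ipos/= in_itv/= andbT => t0.
have tX := frame_ainv_lt F t0.
have mqg : measurable_fun setT (fun x : mR => q x * g x) by exact: measurable_funM.
have -> : (\int[mu]_(x in `[t, ainv t]) (q x * g x)%:E =
    \int[mu]_(x in `[t, ainv t[) (q x * g x)%:E)%E.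
  rewrite integral_itv_bndo_bndc//.
  by apply/measurable_EFinP; exact: measurable_funTS.
have -> : (\int[mu]_x (P (x, t) * Q (x, t) * g x)%:E =
    (w t `^ p'^-1)%:E * \int[mu]_(x in `[t, ainv t[) (q x * g x)%:E)%E.
  rewrite -ge0_integralZl//; last 3 first.
  - by apply/measurable_EFinP; exact: measurable_funTS.
  - by move=> x _; rewrite lee_fin mulr_ge0.
  - by rewrite lee_fin powR_ge0.
  rewrite [RHS]integral_mkcond; apply: eq_integral => x _.
  rewrite patchE PQE t0/=; have [tx|xt] := leP t x => /=; last first.
    by rewrite mul0r memNset//= in_itv/= leNgt xt.
  rewrite -(frame_ainv_gt F) ?(lt_le_trans t0)//; have [xX|Xx] := ltP x (ainv t).
    by rewrite mem_set/= ?in_itv/= ?tx// -EFinM; congr EFin; rewrite mulrCA -mulrA.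
  by rewrite mul0r memNset//= in_itv/= ltNge Xx andbF.
rewrite poweRM; [|by rewrite lee_fin powR_ge0|]; last first.
  by apply: integral_ge0 => x _; rewrite lee_fin mulr_ge0.
by rewrite poweR_EFin -powRrM mulVf ?powRr1 ?(frame_w0 F)// gt_eqF// frame_p'0.
Qed.

(** The transposed operator: the same factorisation with [P] and [Q], and [p] and [p'],
    exchanged. *)
Lemma schur_operator_dual (g : R -> R) : measurable_fun setT g -> (forall x, 0 <= g x) ->
  (\int[mu]_(x in Ipos) ((m x)%:E * (\int[mu]_(t in `[a x, x]) (w t `^ p'^-1 * g t)%:E) `^ p) <=
  (2 `^ (p / p') * C1)%:E * \int[mu]_x (g x `^ p)%:E)%E.
Proof.
move=> mg g0.
have pp'C : p'^-1 + p^-1 = 1 by rewrite addrC frame_pp'.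
have swap (f : mR * mR -> R) : measurable_fun setT f -> measurable_fun setT (fun z => f (z.2, z.1)).
  by move=> mf; apply: measurableT_comp => //; exact: measurable_swap.
have mP' := swap _ mP; have mQ' := swap _ mQ.
have := schur_test frame_p'0 frame_p0 pp'C (fun z => Q0 (z.2, z.1)) (fun z => P0 (z.2, z.1))
  mQ' mP' (ler0n R 2) C10 Q_bound P_bound mg g0.
apply: le_trans; rewrite integral_mkcond; apply: ge0_le_integral_nm => x _.
  rewrite patchE; case: ifPn => // xI; apply: mule_ge0; rewrite ?poweR_ge0//.
  move: xI; rewrite inE /Ipos/= in_itv/= andbT => x0.
  by rewrite lee_fin -qm// powR_ge0.
rewrite patchE; case: ifPn => [|_]; last exact: poweR_ge0.
rewrite inE /Ipos/= in_itv/= andbT => x0; have ax0 := frame_a0 F x0.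
have mqg : measurable_fun setT (fun t : mR => w t `^ p'^-1 * g t).
  apply: measurable_funM => //; apply: (measurableT_comp (measurable_powR _)).
  by case: (frame_w F).
have -> : (\int[mu]_(t in `[a x, x]) (w t `^ p'^-1 * g t)%:E =
    \int[mu]_(t in `]a x, x]) (w t `^ p'^-1 * g t)%:E)%E.
  rewrite integral_itv_obnd_cbnd//.
  by apply/measurable_EFinP; exact: measurable_funTS.
have -> : (\int[mu]_t (Q (x, t) * P (x, t) * g t)%:E =
    (q x)%:E * \int[mu]_(t in `]a x, x]) (w t `^ p'^-1 * g t)%:E)%E.
  rewrite -ge0_integralZl//; last 3 first.
  - by apply/measurable_EFinP; exact: measurable_funTS.
  - by move=> t _; rewrite lee_fin mulr_ge0// powR_ge0.
  - by rewrite lee_fin q0.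
  rewrite [RHS]integral_mkcond; apply: eq_integral => t _.
  rewrite patchE [Q _ * _]mulrC PQE; case: ifPn => [/and3P[t0 tx axt]|N].
    by rewrite mem_set/= ?in_itv/= ?axt// -EFinM; congr EFin; rewrite -mulrA.
  rewrite mul0r memNset//= in_itv/= => /andP[axt tx]; move/negP: N; apply.
  by rewrite tx axt (lt_trans ax0).
rewrite poweRM; [|by rewrite lee_fin q0|]; last first.
  by apply: integral_ge0 => t _; rewrite lee_fin mulr_ge0// powR_ge0.
by rewrite poweR_EFin qm.
Qed.

End schur_operators.

Section local_integrals_extra.
Opaque itvint half_length powR.
Context {R : realType}.
Local Notation mu := (@lebesgue_measure R).
Local Notation mR := (measurableTypeR R).

Lemma locint_dom (f g : R -> R) : measurable_fun setT f -> locint g ->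
  (forall t, 0 < t -> `|f t| <= g t) -> locint f.
Proof.
move=> mf [mg lg] fg; split => // c d c0; apply: le_integrable (lg c d c0).
- exact: measurable_itvR.
- by apply/measurable_EFinP; exact: measurable_funTS.
- move=> t /=; rewrite in_itv/= => /andP[ct _]; rewrite lee_fin.
  by rewrite (le_trans (fg t (lt_le_trans c0 ct)))// ler_norm.
Qed.

Lemma itvint_hoelder (f g : R -> R) (p q x y : R) : 0 < p -> 0 < q -> p^-1 + q^-1 = 1 ->
  measurable_fun setT f -> measurable_fun setT g ->
  locint (fun t => `|f t| `^ p) -> locint (fun t => `|g t| `^ q) -> 0 < x ->
  (\int[mu]_(t in `[x, y]) (`|f t * g t|)%:E <=
    (itvint (fun t => (`|f t| `^ p)%R) x y `^ p^-1 *
    itvint (fun t => (`|g t| `^ q)%R) x y `^ q^-1)%:E)%E.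
Proof.
move=> p0 q0 pq mf mg lf lg x0.
have mfS : measurable_fun `[x, y] f by exact: measurable_funTS.
have mgS : measurable_fun `[x, y] g by exact: measurable_funTS.
have aux (A B : R) (I J K : \bar R) : A%:E = I -> B%:E = J ->
    (K <= I `^ p^-1 * J `^ q^-1)%E -> (K <= (A `^ p^-1 * B `^ q^-1)%:E)%E.
  by move=> <- <-; rewrite !poweR_EFin -EFinM.
apply: aux (itvintE y lf x0) (itvintE y lg x0) _.
exact: hoelder_on (measurable_itvR `[x, y]) mfS mgS p0 q0 pq.
Qed.

Lemma locint_hoelder (f g : R -> R) (p q : R) : 0 < p -> 0 < q -> p^-1 + q^-1 = 1 ->
  measurable_fun setT f -> measurable_fun setT g ->
  locint (fun t => `|f t| `^ p) -> locint (fun t => `|g t| `^ q) ->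
  locint (fun t => f t * g t).
Proof.
move=> p0 q0 pq mf mg lf lg; split; first exact: measurable_funM.
move=> c d c0; apply/integrableP; split.
  by apply/measurable_EFinP; apply: measurable_funTS; exact: measurable_funM.
have := itvint_hoelder d p0 q0 pq mf mg lf lg c0.
by move=> /le_lt_trans; apply; exact: ltry.
Qed.

Lemma ge0_integral_itvU (f : R -> \bar R) (x y z : R) : x <= y -> y <= z ->
  measurable_fun `[x, z] f -> (forall t, x <= t -> t <= z -> (0 <= f t)%E) ->
  (\int[mu]_(t in `[x, z]) f t = \int[mu]_(t in `[x, y]) f t + \int[mu]_(t in `[y, z]) f t)%E.
Proof.
move=> xy yz mf f0.
have mS u v : x <= u -> v <= z -> measurable_fun `[u, v] f.
  move=> xu vz; apply: measurable_funS mf; first exact: measurable_itvR.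
  by apply: subset_itv; rewrite bnd_simp.
have -> : `[x, z]%classic = (`[x, y] `|` `]y, z])%classic :> set R.
  rewrite (@itv_bndbnd_setU _ _ (BLeft x) (BRight y) (BRight z)) ?bnd_simp//.
rewrite ge0_integral_setU//; try exact: measurable_itvR.
- congr (_ + _)%E; rewrite integral_itv_obnd_cbnd//.
  apply: measurable_funS (mS y z xy (lexx _)); first exact: measurable_itvR.
  exact: subset_itv_oc_cc.
- rewrite -itv_bndbnd_setU ?bnd_simp//.
- move=> t [] /=; rewrite in_itv/= => /andP[h1 h2]; apply: f0 => //.
  + exact: le_trans h2 yz.
  + exact: le_trans xy (ltW h1).
- apply/disj_setPS => t [] /=; rewrite !in_itv/= => /andP[_ ty] /andP[yt _].
  by move: yt; rewrite ltNge ty.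
Qed.

Lemma ge0_integralZl_EFin_in (D : set mR) (f : R -> R) (k : R) : measurable D -> 0 <= k ->
  measurable_fun D f -> (forall t, D t -> 0 <= f t) ->
  (\int[mu]_(t in D) (k%:E * (f t)%:E) = k%:E * \int[mu]_(t in D) (f t)%:E)%E.
Proof.
move=> mD k0 mf f0; rewrite ge0_integralZl//; first exact/measurable_EFinP.
Qed.

Lemma ge0_integralD_EFin_in (D : set mR) (f g : R -> R) : measurable D ->
  measurable_fun D f -> (forall t, D t -> 0 <= f t) ->
  measurable_fun D g -> (forall t, D t -> 0 <= g t) ->
  (\int[mu]_(t in D) (f t + g t)%:E =
   \int[mu]_(t in D) (f t)%:E + \int[mu]_(t in D) (g t)%:E)%E.
Proof.
move=> mD mf f0 mg g0; rewrite -ge0_integralD//; exact/measurable_EFinP.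
Qed.

(** Monotone convergence along [[1/(n+1), n+1]]. *)
Lemma ge0_integral_Ipos_le (f : R -> \bar R) (M : \bar R) : measurable_fun Ipos f ->
  (forall x : R, 0 < x -> (0 <= f x)%E) ->
  (forall x y : R, 0 < x -> x <= y -> (\int[mu]_(t in `[x, y]) f t <= M)%E) ->
  (\int[mu]_(t in Ipos) f t <= M)%E.
Proof.
move=> mf f0 H.
pose E n : set (measurableTypeR R) := `[n.+1%:R^-1, n.+1%:R]%classic.
have inv0 n : 0 < n.+1%:R^-1 :> R by rewrite invr_gt0.
have EI : \bigcup_n E n = Ipos.
  apply/seteqP; split => x /=.
    move=> [n _]; rewrite /E /Ipos/= !in_itv/= andbT => /andP[/(lt_le_trans (inv0 n))].
    by [].
  rewrite /Ipos/= in_itv/= andbT => x0.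
  have xi0 : 0 <= x^-1 by rewrite invr_ge0 ltW.
  exists (maxn (Num.truncn x) (Num.truncn x^-1)) => //; rewrite /E/= in_itv/=; apply/andP; split.
    rewrite invf_ple ?posrE//; apply: (le_trans (ltW (truncnS_gt _))).
    by rewrite ler_nat ltnS leq_maxr.
  apply: (le_trans (ltW (truncnS_gt _))).
  by rewrite ler_nat ltnS leq_maxl.
have ndE : nondecreasing_seq E.
  move=> m n mn; apply/subsetPset; apply: subset_itv; rewrite bnd_simp.
    by rewrite lef_pV2 ?posrE// ler_nat ltnS.
  by rewrite ler_nat ltnS.
have mE n : measurable (E n) by exact: measurable_itvR.
have EP n x : E n x -> 0 < x.
  by rewrite /E/= in_itv/= => /andP[/(lt_le_trans (inv0 n))].
have mfE n : measurable_fun (E n) f.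
  apply: measurable_funS mf; first exact: measurable_Ipos.
  by move=> x /EP x0; rewrite /Ipos/= in_itv/= x0.
have f0E n x : E n x -> (0 <= f x)%E by move=> /EP; exact: f0.
have cvg := ge0_nondecreasing_set_cvg_integral (mu := mu) ndE mE mfE f0E.
rewrite -EI -(cvg_lim _ cvg)//; apply: lime_le.
  by apply/cvg_ex; eexists; exact: cvg.
apply: nearW => n; apply: H => //.
by rewrite (@le_trans _ _ 1)// ?invf_le1// ler1n.
Qed.

End local_integrals_extra.

Section powers.
Context {R : realType}.
Implicit Types x y e p : R.

(** Either [y <= e x] or [x <= y / e]. The coefficient of [x^p] can be made as close to 1 as
    desired, which leaves room for a contraction. *)
Lemma powR_add_eps x y e p : 0 <= x -> 0 <= y -> 0 < e -> 0 <= p ->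
  (x + y) `^ p <= (1 + e) `^ p * x `^ p + (1 + e^-1) `^ p * y `^ p.
Proof.
move=> x0 y0 e0 p0; have e10 : 0 <= 1 + e by lra.
have ei0 : 0 <= e^-1 by rewrite invr_ge0 ltW.
have ei10 : 0 <= 1 + e^-1 by lra.
have [h|h] := leP y (e * x).
  apply: (@le_trans _ _ ((1 + e) `^ p * x `^ p)).
    by rewrite -powRM//; apply: powR_ler => //; lra.
  by rewrite lerDl mulr_ge0// powR_ge0.
apply: (@le_trans _ _ ((1 + e^-1) `^ p * y `^ p)).
  rewrite -powRM//; apply: powR_ler => //; first lra.
  rewrite mulrDl mul1r addrC lerD2l mulrC ler_pdivlMr// mulrC; exact: ltW.
by rewrite lerDr mulr_ge0// powR_ge0.
Qed.

Lemma powR_cancel x p : 0 < x -> x `^ (p - 1) * x `^ (1 - p) = 1.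
Proof. by move=> x0; rewrite -powRDp// (_ : p - 1 + (1 - p) = 0) ?powRr0//; ring. Qed.

Lemma powR_gt1 x p : 1 < x -> 0 < p -> 1 < x `^ p.
Proof.
move=> x1 p0; have := @gt0_ltr_powR R p p0 1 x; rewrite powR1; apply => //; rewrite nnegrE//.
by rewrite (le_trans ler01)// ltW.
Qed.

Lemma powRN_le_scale (k I r s : R) : 0 < I -> 0 < r -> 0 <= k -> 0 <= s -> I <= k * r ->
  r `^ (- s) <= k `^ s * I `^ (- s).
Proof.
move=> I0 r0 k0 s0 Ikr; rewrite !powRN ler_pdivlMr ?powR_gt0// mulrC.
rewrite ler_pdivrMr ?powR_gt0// -powRM ?(ltW r0)//.
by apply: powR_ler; rewrite ?(ltW I0).
Qed.

Lemma powR_npos_le1 x p : 1 <= x -> p <= 0 -> x `^ p <= 1.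
Proof.
move=> x1 p0; apply: (@le_trans _ _ (1 `^ p)); last by rewrite powR1.
exact: powR_le_base.
Qed.

Lemma powR_add2 x y p : 0 <= x -> 0 <= y -> 0 <= p ->
  (x + y) `^ p <= 2 `^ p * (x `^ p + y `^ p).
Proof.
move=> x0 y0 p0; have := powR_add_eps x0 y0 ltr01 p0.
by rewrite invr1 mulrDr.
Qed.

End powers.

(** * The weighted level estimate *)

Section sobolev.
Opaque itvint half_length powR.
Context {R : realType} {p : R} {w u a b ainv : R -> R}.
Hypothesis F : interval_frame p w u a b ainv.
Local Notation mu := (@lebesgue_measure R).
Local Notation W := (itvint w).
Local Notation rho := (half_length w a).
Local Notation p' := (dualexp p).
Local Notation mR := (measurableTypeR R).

(* [r] is the weighted derivative [v1 f'], and [w^(1/p') = 1/v1]. *)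
Record sobolev_fun (p : R) (w u f r : R -> R) (N : R) : Prop := SobolevFun {
  sob_r : measurable_fun setT r;
  sob_rp : locint (fun t => `|r t| `^ p);
  sob_fu : locint (fun t => `|f t| `^ p * u t);
  sob_f : forall x y, 0 < x -> x <= y ->
    f y - f x = itvint (fun t => r t * w t `^ (dualexp p)^-1) x y;
  sob_N : forall x y, 0 < x -> itvint (fun t => `|r t| `^ p + `|f t| `^ p * u t) x y <= N;
  sob_supp : exists c d, [/\ 0 < c, c <= d & forall x, x < c \/ d < x -> f x = 0 /\ r x = 0] }.

Lemma frame_pp1 : p * p'^-1 = p - 1.
Proof.
rewrite /dualexp; have /lt0r_neq0 h1 := frame_p0 F; have /lt0r_neq0 h2 := frame_p10 F.
by field; rewrite ?h1 ?h2.
Qed.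

Lemma frame_wpE : (fun t => `|w t `^ p'^-1| `^ p') = w.
Proof.
apply/funext => t; rewrite ger0_norm ?powR_ge0// -powRrM mulVf ?powRr1 ?(frame_w0 F)//.
by rewrite gt_eqF// (frame_p'0 F).
Qed.

Lemma measurable_frame_wp : measurable_fun setT (fun t => w t `^ p'^-1).
Proof. by apply: (measurableT_comp (measurable_powR _)); case: (frame_w F). Qed.

Lemma locint_wp (r : R -> R) : measurable_fun setT r -> locint (fun t => `|r t| `^ p) ->
  locint (fun t => r t * w t `^ p'^-1).
Proof.
move=> mr lr; apply: (locint_hoelder (frame_p0 F) (frame_p'0 F) (frame_pp' F)) => //.
  exact: measurable_frame_wp.
by rewrite frame_wpE; exact: (frame_w F).
Qed.

Lemma itvint_wp (r : R -> R) x y : measurable_fun setT r -> locint (fun t => `|r t| `^ p) ->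
  0 < x -> itvint (fun t => `|r t * w t `^ p'^-1|) x y `^ p <=
    itvint (fun t => `|r t| `^ p) x y * W x y `^ (p - 1).
Proof.
move=> mr lr x0.
have lw : locint (fun t => `|w t `^ p'^-1| `^ p') by rewrite frame_wpE; exact: (frame_w F).
have := itvint_hoelder y (frame_p0 F) (frame_p'0 F) (frame_pp' F) mr measurable_frame_wp lr lw x0.
rewrite frame_wpE -itvintE//; last exact/locint_norm/locint_wp.
rewrite lee_fin => H.
have I0 : 0 <= itvint (fun t => `|r t| `^ p) x y by apply: itvint_ge0 => t; exact: powR_ge0.
have G0 : 0 <= itvint (fun t => `|r t * w t `^ p'^-1|) x y by exact: itvint_ge0.
have := powR_ler (ltW (frame_p0 F)) G0 H.
rewrite powRM ?powR_ge0// -!powRrM mulVf ?powRr1// ?gt_eqF ?(frame_p0 F)//.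
by rewrite mulrC [p'^-1 * p]mulrC frame_pp1 mulrC.
Qed.

Section one_function.
Variables (f r : R -> R) (N : R).
Hypothesis S : sobolev_fun p w u f r N.
Local Notation rp := (fun t => `|r t| `^ p).
Local Notation fu := (fun t => `|f t| `^ p * u t).
Local Notation h := (fun t => `|r t| `^ p + `|f t| `^ p * u t).

Lemma sob_locint_h : locint h.
Proof. by apply: locintD; [exact: (sob_rp S)|exact: (sob_fu S)]. Qed.

Lemma sob_h0 t : 0 <= h t.
Proof. by rewrite addr_ge0 ?mulr_ge0 ?powR_ge0// (frame_u0 F). Qed.

Lemma sob_h_le x y x' y' : 0 < x' -> x' <= x -> y <= y' -> itvint h x y <= itvint h x' y'.
Proof. by apply: itvint_le; [exact: sob_locint_h|exact: sob_h0]. Qed.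

Lemma sob_N0 : 0 <= N.
Proof. by apply: le_trans (sob_N S 1 ltr01); apply: itvint_ge0; exact: sob_h0. Qed.

Lemma sob_rp_le x y : 0 < x -> itvint rp x y <= itvint h x y.
Proof.
move=> x0; apply: itvint_mono => //; [exact: (sob_rp S)|exact: sob_locint_h|].
by move=> t _ _; rewrite lerDl mulr_ge0 ?powR_ge0// (frame_u0 F).
Qed.

Lemma sob_diff1 x y : 0 < x -> x <= y ->
  `|f y - f x| <= itvint (fun t => `|r t * w t `^ p'^-1|) x y.
Proof.
move=> x0 xy; rewrite (sob_f S)//; apply: norm_itvint => //.
by apply: locint_wp; [exact: (sob_r S)|exact: (sob_rp S)].
Qed.

Lemma sob_diff x y : 0 < x -> x <= y ->
  `|f y - f x| `^ p <= itvint rp x y * W x y `^ (p - 1).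
Proof.
move=> x0 xy; apply: le_trans (itvint_wp y (sob_r S) (sob_rp S) x0).
by apply: powR_ler => //; [exact/ltW/(frame_p0 F)|exact: sob_diff1].
Qed.

Local Notation A x := (`|f x| `^ p * rho x `^ (1 - p)).

Let pow32_le1 : (3 / 2) `^ (1 - p) <= 1.
Proof. by have p10 := frame_p10 F; apply: powR_npos_le1; lra. Qed.

(** By Hölder, [|f y - f (a y)|^p] is at most the energy on [[a y, y]] times [rho y^(p-1)]; the
    growth of [rho] contributes the factor [(3/2)^(1-p) < 1]. *)
Let A_grow (y : R) (e : R) : 0 < y -> 0 < e -> 3 / 2 * rho y <= rho (a y) ->
  A (a y) <= (3 / 2) `^ (1 - p) * (1 + e) `^ p * A y +
             (1 + e^-1) `^ p * itvint h (a y) y.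
Proof.
move=> y0 e0 ry; have ay0 := frame_a0 F y0; have ayy := ltW (frame_ax F y0).
have ry0 := half_length_gt0 F y0.
have p10 := frame_p10 F.
have pos : 0 <= p by exact/ltW/(frame_p0 F).
have df := sob_diff ay0 ayy; rewrite -(@half_lengthE R w a y) in df.
have f_le : `|f (a y)| `^ p <= (1 + e) `^ p * `|f y| `^ p + (1 + e^-1) `^ p * `|f y - f (a y)| `^ p.
  apply: le_trans (powR_add_eps _ _ e0 pos) => //; apply: powR_ler => //.
  by have := ler_normB (f y) (f y - f (a y)); rewrite subKr.
have r32 : rho (a y) `^ (1 - p) <= (3 / 2) `^ (1 - p) * rho y `^ (1 - p).
  rewrite -powRM ?(ltW ry0)//; apply: powR_le_base => //; last by lra.
  by rewrite mulr_gt0//; lra.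
have c32 := pow32_le1.
have e1 : 0 <= (1 + e) `^ p by exact: powR_ge0.
have e2 : 0 <= (1 + e^-1) `^ p by exact: powR_ge0.
have Ih : itvint rp (a y) y <= itvint h (a y) y by exact: sob_rp_le.
have rc : rho y `^ (p - 1) * rho y `^ (1 - p) = 1 by exact: powR_cancel.
apply: (le_trans (ler_pM _ _ f_le r32)); rewrite ?powR_ge0//.
rewrite mulrDl; apply: lerD.
  by rewrite le_eqVlt; apply/orP; left; apply/eqP; ring.
apply: (@le_trans _ _ ((1 + e^-1) `^ p * (itvint rp (a y) y * rho y `^ (p - 1)) * (1 * rho y `^ (1 - p)))).
  apply: ler_pM; rewrite ?mulr_ge0 ?powR_ge0//; first by rewrite ler_wpM2l.
  by rewrite ler_wpM2r ?powR_ge0.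
rewrite mul1r -!mulrA rc mulr1 ler_wpM2l//.
Qed.

(** [|f x|^p] is averaged over [[a x, b x]] against [u], whose mass there is [(2 rho x)^(1-p)]. The
    oscillation of [f] on that interval is controlled by Hölder with its [w]-mass [2 rho x], and the
    powers of [rho x] cancel. *)
Let A_direct (x : R) : 0 < x -> A x <= 2 `^ p * 2 `^ (p - 1) * itvint h (a x) (b x).
Proof.
move=> x0; have ax0 := frame_a0 F x0; have axx := ltW (frame_ax F x0).
have xbx := ltW (frame_xb F x0).
have rx0 := half_length_gt0 F x0; have p10 := frame_p10 F.
have pos : 0 <= p by exact/ltW/(frame_p0 F).
have r20 : 0 < 2 * rho x by rewrite mulr_gt0.
have W2 : W (a x) (b x) = 2 * rho x.
  by rewrite (itvintD (frame_w F) ax0 axx xbx) -(frame_ab F x0) -(@half_lengthE R w a x); ring.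
set e := itvint rp (a x) (b x).
have rp0 t : 0 <= rp t by exact: powR_ge0.
have dt t : a x <= t -> t <= b x -> `|f t - f x| `^ p <= e * (2 * rho x) `^ (p - 1).
  move=> axt tbx; have t0 := lt_le_trans ax0 axt.
  have [xt|/ltW tx] := leP x t.
    apply: (le_trans (sob_diff x0 xt)); apply: ler_pM; rewrite ?powR_ge0 ?itvint_ge0//.
      by apply: itvint_le => //; exact: (sob_rp S).
    apply: powR_ler; rewrite ?(ltW p10) ?(frame_W0 F)// -W2.
    exact: (frame_W_le F).
  rewrite distrC.
  apply: (le_trans (sob_diff t0 tx)); apply: ler_pM; rewrite ?powR_ge0 ?itvint_ge0//.
    by apply: itvint_le => //; exact: (sob_rp S).
  apply: powR_ler; rewrite ?(ltW p10) ?(frame_W0 F)// -W2.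
  exact: (frame_W_le F).
have pt t : a x <= t -> t <= b x ->
    `|f x| `^ p * u t <= 2 `^ p * fu t + 2 `^ p * (e * (2 * rho x) `^ (p - 1)) * u t.
  move=> axt tbx; rewrite mulrA -mulrDl ler_wpM2r ?(frame_u0 F)// -mulrDr.
  apply: (@le_trans _ _ (2 `^ p * (`|f t| `^ p + `|f t - f x| `^ p))); last first.
    by rewrite ler_wpM2l ?powR_ge0// lerD2l dt.
  apply: le_trans (powR_add2 _ _ pos) => //; apply: powR_ler => //.
  by have := ler_normB (f t) (f t - f x); rewrite subKr.
have lu := frame_u F; have lfu := sob_fu S.
have := itvint_mono (locintZ (`|f x| `^ p) lu)
  (locintD (locintZ (2 `^ p) lfu) (locintZ (2 `^ p * (e * (2 * rho x) `^ (p - 1))) lu)) ax0 pt.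
rewrite (itvint_sumD _ (locintZ _ lfu) (locintZ _ lu) ax0) !itvintZ// (frame_V F x0) -(@half_lengthE R w a x).
have rc : (2 * rho x) `^ (p - 1) * (2 * rho x) `^ (1 - p) = 1 by exact: powR_cancel.
have -> : 2 `^ p * (e * (2 * rho x) `^ (p - 1)) * (2 * rho x) `^ (1 - p) = 2 `^ p * e.
  by rewrite -!mulrA rc mulr1.
rewrite -mulrDr [_ + e]addrC => H; rewrite (itvint_sumD _ (sob_rp S) lfu ax0) -/e.
rewrite (_ : rho x `^ (1 - p) = 2 `^ (p - 1) * (2 * rho x) `^ (1 - p)); last first.
  by rewrite powRM ?(ltW rx0)// mulrA powR_cancel// mul1r.
by rewrite mulrCA -mulrA [2 `^ p * _]mulrCA ler_wpM2l ?powR_ge0.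
Qed.

(** Solves [(3/2)^(1-p) (1 + e)^p = (3/2)^((1-p)/2)]: half of the gain from the growth of [rho], on
    the exponent scale, is spent on the factor [(1 + e)^p]. *)
Definition step_eps (p : R) := (3 / 2) `^ ((p - 1) / (2 * p)) - 1.
Definition step_theta (p : R) := (3 / 2) `^ ((1 - p) / 2) : R.
Definition step_const (p : R) := (1 + (step_eps p)^-1) `^ p + 2 `^ p * 2 `^ (p - 1).

Lemma step_eps_gt0 : 0 < step_eps p.
Proof.
have p10 := frame_p10 F; have pos := frame_p0 F.
by rewrite subr_gt0; apply: powR_gt1; rewrite ?divr_gt0 ?mulr_gt0//; lra.
Qed.

Lemma step_thetaE : (3 / 2) `^ (1 - p) * (1 + step_eps p) `^ p = step_theta p.
Proof.
have pos := frame_p0 F; have pn0 : p != 0 by rewrite gt_eqF.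
rewrite (_ : 1 + step_eps p = (3 / 2) `^ ((p - 1) / (2 * p))); last by rewrite /step_eps; ring.
rewrite -powRrM -powRDp; last lra.
by rewrite /step_theta; congr (_ `^ _); field.
Qed.

Lemma step_theta_lt1 : step_theta p < 1.
Proof.
have p10 := frame_p10 F.
rewrite /step_theta -[X in _ `^ X]opprK powRN invf_lt1 ?powR_gt0//.
by apply: powR_gt1; lra.
Qed.

Lemma step_const_gt0 : 0 < step_const p.
Proof. by rewrite ltr_pwDr ?powR_ge0// mulr_gt0// powR_gt0. Qed.

(* If [rho] grows at least by the factor [3/2] from [y] to [a y], the weighted values
   of [f] contract; otherwise they are controlled directly by the energy on
   neighbouring intervals. *)
Lemma sob_level_step y : 0 < y ->
  A (a y) <= step_theta p * A y + step_const p * itvint h (a (a y)) (ainv y).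
Proof.
move=> y0; have ay0 := frame_a0 F y0; have aay0 := frame_a0 F ay0.
have ayy := ltW (frame_ax F y0); have aaay := ltW (frame_ax F ay0).
have X0 := frame_ainv0 F y0; have yX := ltW (frame_ainv_lt F y0).
have I0 : 0 <= itvint h (a (a y)) (ainv y) by apply: itvint_ge0; exact: sob_h0.
have e0 := step_eps_gt0.
have A0 : 0 <= A y by rewrite mulr_ge0 ?powR_ge0.
have [ry|ry] := leP (3 / 2 * rho y) (rho (a y)).
  have := A_grow y0 e0 ry; rewrite step_thetaE => /le_trans; apply.
  rewrite lerD2l; apply: ler_pM; rewrite ?powR_ge0//.
  - by apply: itvint_ge0; exact: sob_h0.
  - by rewrite lerDl mulr_ge0 ?powR_ge0.
  - exact: sob_h_le.
have [h1 h2 _ _] := half_length_comp F y0 yX (eq_ind_r (fun z => z <= y) (lexx y) (frame_ainvK F y0)).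
have WX : W y (ainv y) = rho (ainv y).
  by rewrite half_lengthE (frame_ainvK F y0).
(* Otherwise [[a y, b (a y)]] would contain [[a y, ainv y]], whose [w]-mass [rho y + rho (ainv y)]
   is at least [3/2 * rho y] by [h1]. This is the origin of the threshold 3/2. *)
have bX : b (a y) <= ainv y.
  rewrite leNgt; apply/negP => Xb.
  have := frame_W_le F ay0 (lexx (a y)) (ltW Xb).
  rewrite -(frame_ab F ay0) -(@half_lengthE R w a (a y)).
  rewrite (itvintD (frame_w F) ay0 ayy yX) WX -(@half_lengthE R w a y).
  have ry0 := half_length_gt0 F y0.
  move: ry h1 ry0 {h2 WX I0 A0}; move: (rho y) (rho (a y)) (rho (ainv y)) => *; lra.
apply: le_trans (A_direct ay0) _; rewrite -[leLHS]add0r; apply: lerD.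
  by rewrite mulr_ge0// powR_ge0.
apply: ler_pM; rewrite ?mulr_ge0 ?powR_ge0//.
- by apply: itvint_ge0; exact: sob_h0.
- by rewrite lerDr powR_ge0.
- exact: sob_h_le.
Qed.

Lemma frame_iter_a0 z n : 0 < z -> 0 < iter n a z.
Proof. by move=> z0; elim: n => //= n; exact: (frame_a0 F). Qed.

Lemma frame_iter_a_le z n : 0 < z -> iter n a z <= z.
Proof.
move=> z0; elim: n => //= n; apply: le_trans.
exact/ltW/(frame_ax F)/frame_iter_a0.
Qed.

Lemma sum_itvint_iter z n : 0 < z ->
  \sum_(k < n) itvint h (iter k.+1 a z) (iter k a z) = itvint h (iter n a z) z.
Proof.
move=> z0; elim: n => [|n IH]; first by rewrite big_ord0 itvintxx.
rewrite big_ord_recr/= IH addrC -(itvintD sob_locint_h)//.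
- exact/(frame_a0 F)/frame_iter_a0.
- exact/ltW/(frame_ax F)/frame_iter_a0.
- exact: frame_iter_a_le.
Qed.

(** Each interval consists of three consecutive steps, so the sum splits into three telescoping
    ones. *)
Lemma sum_itvint_iter3 z n : 0 < z ->
  \sum_(k < n) itvint h (iter k.+3 a z) (iter k a z) <= 3 * N.
Proof.
move=> z0.
have bnd y : 0 < y -> \sum_(k < n) itvint h (iter k.+1 a y) (iter k a y) <= N.
  by move=> y0; rewrite sum_itvint_iter//; apply: (sob_N S); exact: frame_iter_a0.
rewrite (_ : 3 * N = N + N + N); last by ring.
have az0 := frame_a0 F z0; have aaz0 := frame_a0 F az0.
have := lerD (lerD (bnd _ z0) (bnd _ az0)) (bnd _ aaz0).
apply: le_trans; rewrite -!big_split/=; apply: ler_sum => k _.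
rewrite -!iterSr /=.
set x := iter k a z; have x0 : 0 < x by exact: frame_iter_a0.
have ax0 := frame_a0 F x0; have aax0 := frame_a0 F ax0.
rewrite (itvintD sob_locint_h (frame_a0 F aax0) (ltW (frame_ax F aax0)) (y := a (a x)) (z := x)); last first.
  exact: le_trans (ltW (frame_ax F ax0)) (ltW (frame_ax F x0)).
rewrite (itvintD sob_locint_h aax0 (ltW (frame_ax F ax0)) (ltW (frame_ax F x0))).
by move: (itvint _ _ _) (itvint _ _ _) (itvint _ _ _) => *; lra.
Qed.

(** The first level vanishes, so summing the one-step inequality bounds the sum [S] by
    [theta S + 3 C N]; this is solved for [S] because [theta < 1]. *)
Lemma sum_sob_level z n : 0 < z -> f (a z) = 0 ->
  \sum_(k < n) A (iter k.+1 a z) <= 3 * step_const p * N / (1 - step_theta p).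
Proof.
move=> z0 faz.
have t1 := step_theta_lt1; have C0 := step_const_gt0.
have t0 : 0 <= step_theta p by exact: powR_ge0.
have A0 x : 0 <= A x by rewrite mulr_ge0 ?powR_ge0.
have t10 : 0 < 1 - step_theta p by rewrite subr_gt0.
rewrite ler_pdivlMr//.
case: n => [|n]; first by rewrite big_ord0 mul0r !mulr_ge0 ?(ltW C0) ?sob_N0.
set Sn := \sum_(_ < _) _.
suff : Sn <= step_theta p * Sn + step_const p * (3 * N).
  move=> H; rewrite mulrBr mulr1 lerBlDr addrC [Sn * _]mulrC.
  by rewrite (_ : 3 * _ * N = step_const p * (3 * N)); last by ring.
have Az : A (iter 1 a z) = 0 by rewrite /= faz normr0 powR0 ?mul0r// gt_eqF// (frame_p0 F).
rewrite {1}/Sn big_ord_recl Az add0r.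
apply: (@le_trans _ _ (\sum_(k < n) (step_theta p * A (iter k.+1 a z) +
    step_const p * itvint h (iter k.+3 a z) (iter k a z)))).
  apply: ler_sum => k _ /=.
  have x0 := frame_iter_a0 k z0.
  have := sob_level_step (frame_a0 F x0); rewrite (frame_aK F x0).
  by [].
rewrite big_split/= -!mulr_sumr; apply: lerD; last first.
  by rewrite ler_wpM2l ?(ltW C0)// sum_itvint_iter3.
by rewrite ler_wpM2l// /Sn big_ord_recr/= lerDl.
Qed.

End one_function.
End sobolev.

Section level_estimate.
Opaque itvint half_length powR.
Context {R : realType} {p : R} {w u a b ainv : R -> R}.
Hypothesis F : interval_frame p w u a b ainv.
Local Notation mu := (@lebesgue_measure R).
Local Notation W := (itvint w).
Local Notation rho := (half_length w a).
Local Notation p' := (dualexp p).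
Local Notation mR := (measurableTypeR R).
Local Notation tail := (@frame_tail R p w a).

Lemma continuous_powR_pos (s x : R) : 0 < x -> {for x, continuous (fun y : R => y `^ s)}.
Proof.
move=> x0; apply/differentiable_continuous/derivable1_diffP.
by apply: derivable_powR; rewrite in_itv/= andbT.
Qed.

Lemma measurable_half_length : measurable_fun Ipos rho.
Proof. apply: continuous_measurable_Ipos => x x0; exact: (half_length_continuous F x0). Qed.

Lemma measurable_frame_tail : measurable_fun Ipos tail.
Proof.
apply: measurable_funM; first by apply: measurable_funTS; case: (frame_w F).
exact: (measurableT_comp (measurable_powR _) measurable_half_length).
Qed.

Lemma frame_tail_ge0 x : 0 <= tail x.
Proof. by rewrite mulr_ge0 ?powR_ge0// (frame_w0 F). Qed.

Lemma measurable_itv_Ipos (f : R -> R) (x y : R) : 0 < x -> measurable_fun Ipos f ->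
  measurable_fun `[x, y] f.
Proof.
move=> x0; apply: measurable_funS; first exact: measurable_Ipos.
by move=> t /=; rewrite /Ipos/= !in_itv/= andbT => /andP[/(lt_le_trans x0)].
Qed.

Lemma continuous_itvint_a (g : R -> R) x : locint g -> 0 < x ->
  {for x, continuous (fun t => itvint g (a t) t)}.
Proof.
move=> lg x0; have ax0 := frame_a0 F x0.
have H : {for x, continuous (fun t => primitive g t - primitive g (a t))}.
  apply: (@continuousB _ R^o); first exact: primitive_continuous.
  by apply: continuous_comp; [exact: (frame_a_cont F)|exact: primitive_continuous].
rewrite /prop_for /continuous_at in H *.
have e y : 0 < y -> primitive g y - primitive g (a y) = itvint g (a y) y.
  by move=> y0; rewrite primitiveB// ?(frame_a0 F)//; exact/ltW/(frame_ax F).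
rewrite -e//; apply: cvg_trans H; apply: near_eq_cvg.
by near=> y; rewrite e//; near: y; exact: lt_nbhsr.
Unshelve. all: by end_near. Qed.

Lemma frame_tailE x : tail x = w x * rho x `^ (- p). Proof. by []. Qed.

Opaque frame_tail.

Section one_function.
Variables (f r : R -> R) (N : R).
Hypothesis S : sobolev_fun p w u f r N.
Local Notation A x := (`|f x| `^ p * rho x `^ (1 - p)).
Local Notation T := (fun t => itvint (fun t => `|r t * w t `^ p'^-1|) (a t) t).

Let lG : locint (fun t => `|r t * w t `^ p'^-1|).
Proof. by apply: locint_norm; exact: locint_wp F _ (sob_r S) (sob_rp S). Qed.

Lemma sob_continuous x : 0 < x -> {for x, continuous f}.
Proof.
apply: loc_abs_cont_continuous; apply: (dominated_loc_abs_cont lG) => y z.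
exact: (sob_diff1 F S).
Qed.

Lemma measurable_sob : measurable_fun Ipos f.
Proof. by apply: continuous_measurable_Ipos; exact: sob_continuous. Qed.

Let mT : measurable_fun Ipos (fun t => T t `^ p).
Proof.
apply: (measurableT_comp (measurable_powR p)).
by apply: continuous_measurable_Ipos => x; exact: continuous_itvint_a.
Qed.

Let T0 t : 0 <= T t. Proof. exact: itvint_ge0. Qed.

Let pos : 0 <= p. Proof. exact/ltW/(frame_p0 F). Qed.

(** For [a y <= t <= y] one has [a t <= a y], hence [|f t| <= |f (a y)| + T t]. The constant term
    integrates against the tail weight to a multiple of [rho (a y)^(1-p)], which gives the level at
    [a y]. *)
Lemma sob_piece y : 0 < y ->
  (\int[mu]_(t in `[a y, y]) (`|f t| `^ p * tail t)%:E <=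
   (2 `^ p * 3 `^ p / (p - 1) * A (a y))%:E +
   (2 `^ p)%:E * \int[mu]_(t in `[a y, y]) (T t `^ p * tail t)%:E)%E.
Proof.
move=> y0; have x0 := frame_a0 F y0; set x := a y in x0 *.
have xy : x < y := frame_ax F y0.
have rx0 := half_length_gt0 F x0.
have p10 := frame_p10 F.
have pt (t : R) : x <= t -> t <= y -> `|f t| `^ p * tail t <=
    2 `^ p * 3 `^ p * `|f x| `^ p * ((W x t + rho x) `^ (- (1 + (p - 1))) * w t) +
    2 `^ p * (T t `^ p * tail t).
  move=> xt ty; have t0 := lt_le_trans x0 xt; have at0 := frame_a0 F t0.
  have atx : a t <= x by exact: (frame_a_le F).
  have ft : `|f t| `^ p <= 2 `^ p * (`|f x| `^ p + T t `^ p).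
    apply: le_trans (powR_add2 _ _ pos) => //; apply: powR_ler => //.
    have h1 := sob_diff1 F S x0 xt.
    have h2 : itvint (fun t => `|r t * w t `^ p'^-1|) x t <= T t by exact: itvint_le.
    by have := ler_normD (f x) (f t - f x); rewrite addrC subrK; move/le_trans; apply; rewrite lerD2l (le_trans h1).
  have tl : tail t <= 3 `^ p * ((W x t + rho x) `^ (- (1 + (p - 1))) * w t).
    rewrite (_ : 1 + (p - 1) = p); last by ring.
    have [h1 h2 _ _] := half_length_comp F x0 xt atx.
    have rt0 := half_length_gt0 F t0; have W0 := frame_W0 F x t.
    have h3 : W x t + rho x <= 3 * rho t by move: (W x t) (rho x) (rho t) h1 h2 => *; lra.
    have I0 : 0 < W x t + rho x by rewrite ltr_wpDl.
    rewrite frame_tailE mulrC mulrA; apply: ler_wpM2r; first exact: (frame_w0 F).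
    exact: powRN_le_scale.
  apply: (le_trans (ler_wpM2r (frame_tail_ge0 t) ft)).
  have aux2 (X Y Z : R) : X * Y * Z <= X * (Y * Z) by rewrite mulrA.
  rewrite mulrDr mulrDl; apply: (lerD _ (aux2 _ _ _)).
  have aux (k2 k3 X Y : R) : k2 * k3 * X * Y = k2 * X * (k3 * Y) by ring.
  rewrite [X in _ <= X]aux; apply: (ler_wpM2l _ tl).
  by apply: mulr_ge0; exact: powR_ge0.
have m1 : measurable_fun `[x, y] (fun t => (W x t + rho x) `^ (- (1 + (p - 1))) * w t).
  apply: measurable_funM; last by apply: measurable_funTS; case: (frame_w F).
  apply: (measurableT_comp (measurable_powR _)); apply: measurable_funD => //.
  exact: measurable_itvint (frame_w F) _ _ x0.
have m2 : measurable_fun `[x, y] (fun t => T t `^ p * tail t).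
  by apply: measurable_funM; apply: measurable_itv_Ipos => //; exact: measurable_frame_tail.
pose k1 t := 2 `^ p * 3 `^ p * `|f x| `^ p * ((W x t + rho x) `^ (- (1 + (p - 1))) * w t).
pose k2 t := 2 `^ p * (T t `^ p * tail t).
have c0 : 0 <= 2 `^ p * 3 `^ p * `|f x| `^ p by rewrite !mulr_ge0 ?powR_ge0.
have g10 t : 0 <= (W x t + rho x) `^ (- (1 + (p - 1))) * w t.
  by rewrite mulr_ge0 ?powR_ge0// (frame_w0 F).
have g20 t : 0 <= T t `^ p * tail t by rewrite mulr_ge0 ?powR_ge0// frame_tail_ge0.
apply: (@le_trans _ _ (\int[mu]_(t in `[x, y]) (k1 t + k2 t)%:E)%E).
  apply: ge0_le_integral_nm => t; first by rewrite lee_fin mulr_ge0 ?powR_ge0// frame_tail_ge0.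
  by rewrite /= in_itv/= => /andP[xt ty]; rewrite lee_fin; exact: pt.
have mk1 : measurable_fun `[x, y] k1 by exact: measurable_funM.
have mk2 : measurable_fun `[x, y] k2 by exact: measurable_funM.
have k10 t : 0 <= k1 t by rewrite mulr_ge0.
have k20 t : 0 <= k2 t by rewrite mulr_ge0 ?powR_ge0.
rewrite (ge0_integralD_EFin_in (measurable_itvR _) mk1 (fun t _ => k10 t) mk2 (fun t _ => k20 t)).
under [X in (X + _)%E]eq_integral do rewrite EFinM.
rewrite (ge0_integralZl_EFin_in (measurable_itvR _) c0 m1 (fun t _ => g10 t)).
under [X in (_ + X <= _)%E]eq_integral do rewrite EFinM.
rewrite (ge0_integralZl_EFin_in (measurable_itvR _) (powR_ge0 2 p) m2 (fun t _ => g20 t)).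
apply: leeD2r.
have := itvint_powRN_le (frame_w F) (frame_w0 F) x0 (ltW xy) rx0 p10.
move=> H; apply: (le_trans (lee_wpmul2l _ H)); first by rewrite lee_fin.
rewrite -EFinM lee_fin opprB le_eqVlt; apply/orP; left; apply/eqP; ring.
Qed.

Lemma sob_pieces z n : 0 < z ->
  (\int[mu]_(t in `[iter n a z, z]) (`|f t| `^ p * tail t)%:E <=
   (2 `^ p * 3 `^ p / (p - 1) * \sum_(k < n) A (iter k.+1 a z))%:E +
   (2 `^ p)%:E * \int[mu]_(t in `[iter n a z, z]) (T t `^ p * tail t)%:E)%E.
Proof.
move=> z0; elim: n => [|n IH].
  rewrite big_ord0 mulr0 set_itv1 integral_set1 add0e.
  by rewrite mule_ge0 ?lee_fin ?powR_ge0// integral_set1.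
have y0 : 0 < iter n a z by exact: (frame_iter_a0 F).
have x0 := frame_a0 F y0; have xy := ltW (frame_ax F y0).
have yz : iter n a z <= z by exact: (frame_iter_a_le F).
have mfm : measurable_fun Ipos (fun t => `|f t| `^ p * tail t).
  apply: measurable_funM; last exact: measurable_frame_tail.
  apply: (measurableT_comp (measurable_powR p)).
  by apply: measurableT_comp => //; exact: measurable_sob.
have mTm : measurable_fun Ipos (fun t => T t `^ p * tail t).
  by apply: measurable_funM => //; exact: measurable_frame_tail.
have fm0 t : 0 <= `|f t| `^ p * tail t by rewrite mulr_ge0 ?powR_ge0// frame_tail_ge0.
have Tm0 t : 0 <= T t `^ p * tail t by rewrite mulr_ge0 ?powR_ge0// frame_tail_ge0.
rewrite iterS (ge0_integral_itvU xy yz); last 2 first.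
- by apply/measurable_EFinP; exact: measurable_itv_Ipos.
- by move=> t _ _; rewrite lee_fin.
rewrite [X in (_ <= _ + _ * X)%E](ge0_integral_itvU xy yz); last 2 first.
- by apply/measurable_EFinP; exact: measurable_itv_Ipos.
- by move=> t _ _; rewrite lee_fin.
apply: (le_trans (leeD (sob_piece y0) IH)).
have aux (k1 k2 s1 s2 : R) (I J : \bar R) : 0 <= k2 -> (0 <= I)%E -> (0 <= J)%E ->
    ((k1 * s1)%:E + k2%:E * I + ((k1 * s2)%:E + k2%:E * J) = (k1 * (s2 + s1))%:E + k2%:E * (I + J))%E.
  by move=> k20 I0 J0; rewrite ge0_muleDr// mulrDr EFinD addeACA [X in (X + _)%E]addeC.
rewrite aux ?powR_ge0//; try by apply: integral_ge0 => t _; rewrite lee_fin.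
by rewrite big_ord_recr/=.
Qed.

(** If the iterates stayed above [c], their infimum [m] would be positive, and an iterate below
    [ainv m] would be followed by one below [m]. *)
Lemma frame_iter_lt z c : 0 < z -> 0 < c -> exists n, iter n a z <= c.
Proof.
move=> z0 c0; apply: contrapT => /forallNP Nc.
have {}Nc n : c < iter n a z by rewrite ltNge; exact/negP.
pose X := [set iter n a z | n in [set: nat]].
have Xi : has_inf X.
  split; first by exists z; exists 0%N.
  by exists c => _ [n _ <-]; exact: ltW.
have cX : c <= inf X by apply: lb_le_inf; [case: Xi|move=> _ [n _ <-]; exact: ltW].
have iX0 : 0 < inf X := lt_le_trans c0 cX.
have e0 : 0 < ainv (inf X) - inf X by rewrite subr_gt0 (frame_ainv_lt F).
have [_ [n _ <-]] := inf_adherent e0 Xi.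
rewrite addrC subrK => H.
have := frame_a_lt F (frame_iter_a0 F n z0) H; rewrite (frame_ainvK F)// ltNge => /negP; apply.
by apply: ge_inf; [case: Xi|exists n.+1].
Qed.

(** The first summand accounts for the values [f (a y)] on the pieces, the second for the increments
    [T]. *)
Definition level_const (p : R) := 2 `^ p * 3 `^ p / (p - 1) * (3 * step_const p / (1 - step_theta p)) +
  2 `^ p * (2 `^ (p / dualexp p) * (3 `^ (1 + schur_exp p) / schur_exp p)).

(** The dual Schur bound for the tail weight, applied to [|r|]. The weight [m0] is its measurable
    extension to the line. *)
Lemma sob_itvint_a : (\int[mu]_(t in Ipos) (T t `^ p * tail t)%:E <=
  (2 `^ (p / p') * (3 `^ (1 + schur_exp p) / schur_exp p) * N)%:E)%E.
Proof.
have pn0 : p != 0 by rewrite gt_eqF// (frame_p0 F).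
pose m0 x := w x * frame_rho (w := w) (a := a) x `^ (- p).
have mm0 : measurable_fun setT m0.
  apply: measurable_funM; first by case: (frame_w F).
  exact: (measurableT_comp (measurable_powR _) (measurable_frame_rho F)).
have m00 x : 0 <= m0 x by rewrite mulr_ge0 ?powR_ge0// (frame_w0 F).
have mq : measurable_fun setT (fun x => m0 x `^ p^-1).
  exact: (measurableT_comp (measurable_powR _)).
have qm x : 0 < x -> (m0 x `^ p^-1) `^ p = tail x.
  by move=> x0; rewrite -powRrM mulVf// powRr1// frame_tailE /m0 (frame_rhoE F).
have d0 := schur_exp_gt0 F.
have C10 : 0 <= 3 `^ (1 + schur_exp p) / schur_exp p by rewrite divr_ge0 ?powR_ge0// ltW.
pose g := (fun t => `|r t|) \_ Ipos.
have mg : measurable_fun setT g.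
  apply/(measurable_restrictT _ measurable_Ipos); apply: measurable_funTS.
  by apply: measurableT_comp => //; exact: (sob_r S).
have g0 x : 0 <= g x by rewrite /g patchE; case: ifP.
have gE (x : R) : 0 < x -> g x = `|r x|.
  by move=> x0; rewrite /g patchE mem_set// /Ipos/= in_itv/= x0.
have := schur_operator_dual F C10 mq (fun x => powR_ge0 _ _) qm (schur_bound_tail F) mg g0.
rewrite (_ : \int[mu]_(x in Ipos) _ = \int[mu]_(t in Ipos) (T t `^ p * tail t)%:E)%E; last first.
  apply: eq_integral => x; rewrite inE /Ipos/= in_itv/= andbT => x0.
  have ax0 := frame_a0 F x0.
  rewrite [RHS]EFinM muleC; congr (_ * _)%E.
  rewrite -poweR_EFin (itvintE _ lG ax0); congr (_ `^ _)%E.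
  apply: eq_integral => t; rewrite inE/= in_itv/= => /andP[axt _].
  by rewrite (gE t (lt_le_trans ax0 axt)) normrM mulrC [`|w t `^ _|]ger0_norm ?powR_ge0.
move=> H; apply: (le_trans H) => {H}; rewrite [leRHS]EFinM lee_wpmul2l//.
  by rewrite lee_fin mulr_ge0 ?powR_ge0.
rewrite (_ : \int[mu]_x _ = \int[mu]_(x in Ipos) (`|r x| `^ p)%:E)%E; last first.
  rewrite [RHS]integral_mkcond; apply: eq_integral => x _; rewrite patchE /g patchE.
  by case: ifPn => // _; rewrite powR0.
apply: ge0_integral_Ipos_le.
- by apply/measurable_EFinP; apply: measurable_funTS; case: (sob_rp S).
- by move=> x _; rewrite lee_fin powR_ge0.
- move=> x y x0 xy; rewrite -itvintE//; last exact: (sob_rp S).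
  by rewrite lee_fin (le_trans (sob_rp_le F S y x0))// (sob_N S).
Qed.

Lemma level_estimate :
  (\int[mu]_(t in Ipos) (`|f t| `^ p * tail t)%:E <= (level_const p * N)%:E)%E.
Proof.
have [c [d [c0 cd fcd]]] := sob_supp S.
have d10 : 0 < d + 1 by have := lt_le_trans c0 cd; lra.
(* Then [a z = d + 1] lies to the right of the support, as [sum_sob_level] requires. *)
pose z := ainv (d + 1); have z0 : 0 < z by exact: (frame_ainv0 F).
have dz : d < z by rewrite (@lt_trans _ _ (d + 1)) ?ltrDl// (frame_ainv_lt F).
have [n nc] := frame_iter_lt z0 c0.
have fm0 t : 0 <= `|f t| `^ p * tail t by rewrite mulr_ge0 ?powR_ge0// frame_tail_ge0.
have Tm0 t : 0 <= T t `^ p * tail t by rewrite mulr_ge0 ?powR_ge0// frame_tail_ge0.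
apply: (@le_trans _ _ (\int[mu]_(t in `[iter n a z, z]) (`|f t| `^ p * tail t)%:E)%E).
  rewrite integral_mkcond [leRHS]integral_mkcond; apply: ge0_le_integral_nm => t _.
    by rewrite patchE; case: ifP => // _; rewrite lee_fin.
  rewrite !patchE; case: ifPn => _; last by case: ifP => // _; rewrite lee_fin.
  case: ifPn => // /negP tN; rewrite (proj1 (fcd _ _)) ?normr0 ?powR0 ?mul0r// ?gt_eqF ?(frame_p0 F)//.
  have [ct|] := ltP t c; [by left|right].
  rewrite ltNge; apply/negP => td; apply: tN; rewrite inE/= in_itv/=.
  by rewrite (le_trans nc)//= (le_trans td)// ltW.
apply: (le_trans (sob_pieces n z0)).
rewrite /level_const mulrDl EFinD; apply: leeD.
  rewrite lee_fin -[X in _ <= X]mulrA ler_wpM2l//.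
    by rewrite !mulr_ge0 ?powR_ge0// invr_ge0 ltW// (frame_p10 F).
  rewrite mulrAC; apply: (sum_sob_level F S _ z0).
  by rewrite (frame_ainvK F)// (proj1 (fcd _ _))//; right; rewrite ltrDl.
rewrite -mulrA EFinM lee_wpmul2l ?lee_fin ?powR_ge0//.
apply: le_trans sob_itvint_a.
rewrite integral_mkcond [leRHS]integral_mkcond; apply: ge0_le_integral_nm => t _.
  by rewrite patchE; case: ifP => // _; rewrite lee_fin.
rewrite !patchE; case: ifPn => [|_]; last by case: ifP => // _; rewrite lee_fin.
rewrite inE/= in_itv/= => /andP[nt _].
by rewrite mem_set// /Ipos/= in_itv/= (lt_le_trans (frame_iter_a0 F n z0) nt).
Qed.

End one_function.
End level_estimate.

(** * Integration by parts and the averaging identity *)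

Section integration_by_parts.
Context {R : realType}.
Local Notation mu := (@lebesgue_measure R).
Local Notation mR := (measurableTypeR R).

Definition has_density (f q : R -> R) := locint q /\
  forall x y : R, 0 < x -> x <= y -> f y - f x = itvint q x y.

Lemma has_density_primitive q : locint q -> has_density (primitive q) q.
Proof. by move=> lq; split => // x y x0 xy; rewrite primitiveB. Qed.

Lemma has_density_dom f q x y : has_density f q -> 0 < x -> x <= y ->
  `|f y - f x| <= itvint (fun t => `|q t|) x y.
Proof. by move=> [lq fq] x0 xy; rewrite fq//; exact: norm_itvint. Qed.

Lemma has_density_bound f q al be x : has_density f q -> 0 < al -> al <= x -> x <= be ->
  `|f x| <= `|f al| + itvint (fun t => `|q t|) al be.
Proof.
move=> fq al0 alx xbe; have := ler_normD (f al) (f x - f al); rewrite addrC subrK.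
move/le_trans; apply; rewrite lerD2l (le_trans (has_density_dom fq al0 alx))//.
by apply: itvint_le => //; case: fq => lq _; exact: locint_norm.
Qed.

Lemma has_density_continuous f q x : has_density f q -> 0 < x -> {for x, continuous f}.
Proof.
move=> fq; apply: loc_abs_cont_continuous.
apply: (dominated_loc_abs_cont (locint_norm (proj1 fq))) => {}x y x0 xy.
exact: has_density_dom fq _ _.
Qed.

Lemma has_density_ae_derive f q : has_density f q ->
  {ae mu, forall x : R, 0 < x -> is_derive x 1 f (q x)}.
Proof.
move=> [lq fq]; apply: ae_Ipos => c d c0 cd.
apply: (integral_ae_derive cd (proj2 lq c d c0)) => x cx xd.
exact: fq.
Qed.

Lemma measurable_has_density f q : has_density f q -> measurable_fun Ipos f.
Proof. by move=> fq; apply: continuous_measurable_Ipos => x; exact: has_density_continuous fq. Qed.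

Lemma itvint_by_parts f g q h al be : has_density f q -> has_density g h ->
  0 < al -> al <= be ->
  mu.-integrable `[al, be] (EFin \o (fun t => q t * g t + f t * h t)) /\
  itvint (fun t => q t * g t + f t * h t) al be = f be * g be - f al * g al.
Proof.
move=> fq gh al0; rewrite le_eqVlt => /predU1P[<-|albe].
  rewrite itvintxx subrr; split => //.
  rewrite set_itv1; apply/integrableP; split; first exact: measurable_fun_set1.
  by rewrite integral_set1.
pose Mf := `|f al| + itvint (fun t => `|q t|) al be.
pose Mg := `|g al| + itvint (fun t => `|h t|) al be.
pose k t := Mf * `|h t| + Mg * `|q t|.
have [[lq _] [lh _]] := (fq, gh).
have lnq := locint_norm lq; have lnh := locint_norm lh.
have lk : locint k by apply: locintD; exact: locintZ.
have [|||ig IE] := @ae_derive_integral R (fun t => f t * g t) (fun t => q t * g t + f t * h t) k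
  al be albe (proj2 lk al be al0).
- move=> x y alx xy ybe; have x0 := lt_le_trans al0 alx.
  change (`|f y * g y - f x * g x| <= itvint k x y).
  rewrite (itvint_sumD _ (locintZ _ lnh) (locintZ _ lnq) x0) !itvintZ//.
  rewrite (_ : f y * g y - f x * g x = f y * (g y - g x) + g x * (f y - f x)); last by ring.
  apply: (le_trans (ler_normD _ _)); rewrite !normrM; apply: lerD; apply: ler_pM => //.
  + by apply: (has_density_bound fq) => //; exact: le_trans xy.
  + exact: has_density_dom gh _ _.
  + by apply: (has_density_bound gh) => //; exact: le_trans ybe.
  + exact: has_density_dom fq _ _.
- apply: measurable_funD; apply: measurable_funM.
  + by apply: measurable_funTS; case: lq.
  + exact: measurable_itv_Ipos (measurable_has_density gh).
  + exact: measurable_itv_Ipos (measurable_has_density fq).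
  + by apply: measurable_funTS; case: lh.
- apply: ae_impl2 (has_density_ae_derive fq) (has_density_ae_derive gh) => x df dg alx xbe.
  have x0 := lt_trans al0 alx.
  have := @is_deriveM _ _ f g x 1 _ _ (df x0) (dg x0).
  by rewrite /GRing.scale/= addrC [g x * _]mulrC.
- by split => //; rewrite (IE be (ltW albe) (lexx be)).
Qed.

Lemma locint_cont (f g : R -> R) : measurable_fun setT f -> locint g ->
  (forall x : R, 0 < x -> {for x, continuous f}) -> locint (fun t => f t * g t).
Proof.
move=> mf lg cf; split; first by apply: measurable_funM => //; case: lg.
move=> c d c0; have [cd|dc] := leP c d; last first.
  by rewrite set_itv_ge ?bnd_simp -?ltNge//; exact: integrable_set0.
have cfw : {within `[c, d], continuous (fun t => `|f t|)}.
  apply: continuous_in_subspaceT => x; rewrite inE/= in_itv/= => /andP[cx _].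
  by apply: continuous_comp; [exact: (cf x (lt_le_trans c0 cx))|exact: norm_continuous].
have [z _ fz] := @EVT_max R _ c d cd cfw.
have := integrableZl (measurable_itvR `[c, d]) (`|f z|) (proj2 (locint_norm lg) c d c0).
apply: le_integrable.
- exact: measurable_itvR.
- apply/measurable_EFinP; apply: measurable_funTS; apply: measurable_funM => //; by case: lg.
- move=> x xcd.
  change ((`|f x * g x|)%:E <= (`| `|f z| * `|g x| |)%:E)%E.
  by rewrite lee_fin !normrM !normr_id ler_wpM2r// fz.
Qed.

Lemma EFin_itvint (f : R -> R) (x y : R) : mu.-integrable `[x, y] (EFin \o f) ->
  (\int[mu]_(t in `[x, y]) (f t)%:E)%E = (itvint f x y)%:E.
Proof.
move=> lf; rewrite /itvint /Rintegral fineK//.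
by apply: integrable_fin_num => //; exact: measurable_itvR.
Qed.

Lemma itvintZ_integrable (k : R) (f : R -> R) (x y : R) : mu.-integrable `[x, y] (EFin \o f) ->
  itvint (fun t => k * f t) x y = k * itvint f x y.
Proof. by move=> lf; exact: RintegralZl (measurable_itvR `[x, y]) lf. Qed.

Lemma eq_itvint (f g : R -> R) (x y : R) : (forall t, x <= t -> t <= y -> f t = g t) ->
  itvint f x y = itvint g x y.
Proof.
move=> fg; apply: eq_Rintegral => t; rewrite inE/= in_itv/= => /andP[xt ty].
exact: fg.
Qed.

Lemma integral_patch_itv (h : R -> R) (c d : R) : locint h -> 0 < c ->
  (\int[mu]_t ((h \_ `[c, d]) t)%:E)%E = (itvint h c d)%:E.
Proof.
move=> lh c0; rewrite -EFin_itvint; last exact: (proj2 lh).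
rewrite [RHS]integral_mkcond; apply: eq_integral => t _.
by rewrite !patchE; case: ifP.
Qed.

End integration_by_parts.

Section averaging.
Context {R : realType} {p : R} {w u a b ainv : R -> R}.
Hypothesis F : interval_frame p w u a b ainv.
Local Notation mu := (@lebesgue_measure R).
Local Notation W := (itvint w).
Local Notation rho := (half_length w a).
Local Notation p' := (dualexp p).
Local Notation mR := (measurableTypeR R).
Local Notation tail := (@frame_tail R p w a).

Opaque itvint half_length powR frame_tail.

(* With [g / V_1] in place of [g], the inner integrals of the functionals
   [GGc] and [GGb]. *)
Definition frame_D (ainv g : R -> R) t := itvint g t (ainv t).
Definition frame_B (w a ainv g : R -> R) t := itvint (fun x => g x * itvint w (a x) t) t (ainv t).

Lemma measurable_ainv : measurable_fun (setT : set mR) (ainv \_ Ipos : mR -> R).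
Proof.
apply: nondecreasing_measurable => // s t st; rewrite !patchE.
case: ifPn => [|_]; rewrite ?inE /Ipos/= ?in_itv/= ?andbT.
  move=> s0; have t0 := lt_le_trans s0 st; rewrite mem_set/= ?in_itv/= ?t0//.
  exact: (frame_ainv_le F).
case: ifPn => //; rewrite ?inE /Ipos/= ?in_itv/= ?andbT => t0.
exact/ltW/(frame_ainv0 F).
Qed.

Lemma measurable_comp_ainv (g : R -> R) : measurable_fun Ipos g ->
  measurable_fun Ipos (fun t => g (ainv t)).
Proof.
move=> mg.
have mg0 : measurable_fun (setT : set mR) (g \_ Ipos : mR -> R).
  exact/(measurable_restrictT _ measurable_Ipos).
have := measurableT_comp mg0 measurable_ainv.
move/(measurable_funS measurableT (@subsetT _ Ipos)); apply: eq_measurable_fun => t.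
rewrite inE /Ipos/= in_itv/= andbT => t0.
have X0 := frame_ainv0 F t0.
have tI : t \in (Ipos : set R) by rewrite inE /Ipos/= in_itv/= t0.
have XI : ainv t \in (Ipos : set R) by rewrite inE /Ipos/= in_itv/= X0.
by rewrite /= patchE [(ainv \_ Ipos) t]patchE tI XI.
Qed.

Section one_weight.
Variable g : R -> R.
Hypothesis lg : locint g.

Let a0 : mR -> R := a \_ Ipos.

Let cprim x : 0 < x -> {for x, continuous (fun x => primitive w (a x))}.
Proof.
move=> x0; have ax0 := frame_a0 F x0.
apply: continuous_comp; first exact: (frame_a_cont F).
exact: primitive_continuous (frame_w F) _.
Qed.

Let mprim : measurable_fun setT ((fun x => primitive w (a x)) \_ Ipos : mR -> R).
Proof.
apply/(measurable_restrictT _ measurable_Ipos).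
by apply: continuous_measurable_Ipos => x; exact: cprim.
Qed.

Let prim := ((fun x => primitive w (a x)) \_ Ipos : R -> R).

Let primE (x : R) : 0 < x -> prim x = primitive w (a x).
Proof. by move=> x0; rewrite /prim patchE mem_set// /Ipos/= in_itv/= x0. Qed.

Lemma locint_Wa t : 0 < t -> locint (fun x => g x * (primitive w t - prim x)).
Proof.
move=> t0.
have := @locint_cont R (fun x => primitive w t - prim x) g.
have -> : (fun x => (primitive w t - prim x) * g x) = (fun x => g x * (primitive w t - prim x)).
  by apply/funext => x; rewrite mulrC.
apply => //; first exact: measurable_funB.
move=> x x0; apply: (@continuousB _ R^o); first exact: cst_continuous.
have := cprim x0; rewrite /prop_for /continuous_at primE// => H.
apply: cvg_trans H; apply: near_eq_cvg.
by near=> y; rewrite primE//; near: y; exact: lt_nbhsr.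
Unshelve. all: by end_near. Qed.

(** The integrand of [frame_B] contains [a x] and is controlled only for [t <= x <= ainv t]; this
    gives a locally integrable function that agrees with it there. *)
Lemma frame_B_kernel t : 0 < t -> exists2 h, locint h &
  forall x, t <= x -> x <= ainv t -> h x = g x * W (a x) t.
Proof.
move=> t0; exists (fun x => g x * (primitive w t - prim x)); first exact: locint_Wa.
move=> x tx xX; have x0 := lt_le_trans t0 tx.
have axt : a x <= t by rewrite -(frame_ainv_ge F).
by rewrite primE// (primitiveB (frame_w F))// (frame_a0 F).
Qed.

Let mprim' : measurable_fun Ipos (fun x => primitive w (a x)).
Proof. by apply: continuous_measurable_Ipos => x; exact: cprim. Qed.

Let lgp : locint (fun x => prim x * g x).
Proof.
have := locint_Wa ltr01 => /(locintZ (-1)) h1.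
have := locintD h1 (locintZ (primitive w 1) lg).
by congr locint; apply/funext => x; ring.
Qed.

(** Splitting the mass into primitives separates [t] from [x], from which the measurability of
    [frame_B] follows. *)
Lemma frame_BE t : 0 < t -> frame_B w a ainv g t =
  primitive w t * itvint g t (ainv t) - itvint (fun x => prim x * g x) t (ainv t).
Proof.
move=> t0; rewrite -(itvintZ _ _ lg)// -[X in _ - X]mul1r -mulNr -(itvintZ _ _ lgp)//.
rewrite -(itvint_sumD _ (locintZ _ lg) (locintZ _ lgp))//.
apply: eq_itvint => x tx xX; have x0 := lt_le_trans t0 tx.
have axt : a x <= t by rewrite -(frame_ainv_ge F).
rewrite -primitiveB// ?(frame_a0 F)//; last exact: (frame_w F).
by rewrite primE//; ring.
Qed.

Lemma measurable_frame_D : measurable_fun Ipos (frame_D ainv g).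
Proof.
have : measurable_fun Ipos (fun t => primitive g (ainv t) - primitive g t).
  by apply: measurable_funB; [apply: measurable_comp_ainv|]; exact: measurable_primitive.
apply: eq_measurable_fun => t; rewrite inE /Ipos/= in_itv/= andbT => t0.
by rewrite primitiveB//; exact/ltW/(frame_ainv_lt F).
Qed.

Lemma measurable_frame_B : measurable_fun Ipos (frame_B w a ainv g).
Proof.
have : measurable_fun Ipos (fun t => primitive w t * frame_D ainv g t -
    (primitive (fun x => prim x * g x) (ainv t) - primitive (fun x => prim x * g x) t)).
  apply: measurable_funB.
    apply: measurable_funM; last exact: measurable_frame_D.
    exact: measurable_primitive (frame_w F).
  by apply: measurable_funB; [apply: measurable_comp_ainv|]; exact: measurable_primitive.
apply: eq_measurable_fun => t; rewrite inE /Ipos/= in_itv/= andbT => t0.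
by rewrite frame_BE// primitiveB//; exact/ltW/(frame_ainv_lt F).
Qed.

Section fubini_swap.
Variables (f r : R -> R) (N : R).
Hypothesis S : sobolev_fun p w u f r N.
Let q t := r t * w t `^ p'^-1.
Let f0 := f \_ Ipos.
Local Notation SS := (frame_S (a := a)).
Local Notation WW := (frame_W (w := w) (a := a)).
Let Fz (z : mR * mR) : R := if SS z then g z.1 * (q z.2 * WW z + f0 z.2 * w z.2) else 0.

Let f0E (x : R) : f0 x = f x.
Proof.
have [c [d [c0 cd fcd]]] := sob_supp S.
rewrite /f0 patchE; case: ifPn => //; rewrite notin_setE /Ipos/= in_itv/= andbT => /negP; rewrite -leNgt => x0.
by rewrite (proj1 (fcd x _))//; left; exact: le_lt_trans c0.
Qed.

Let fq : has_density f q.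
Proof. by split; [exact: locint_wp F _ (sob_r S) (sob_rp S)|exact: sob_f S]. Qed.

Let mf0 : measurable_fun setT f0.
Proof.
by apply/(measurable_restrictT _ measurable_Ipos); exact: measurable_sob F _ _ _ S.
Qed.

Let mF : measurable_fun setT Fz.
Proof.
apply: measurable_fun_ifT => //; first exact: (measurable_frame_S F).
apply: measurable_funM; first by apply: measurableT_comp => //; case: lg.
apply: measurable_funD; apply: measurable_funM.
- by apply: measurableT_comp => //; case: fq => -[].
- exact: (measurable_frame_W F).
- by apply: measurableT_comp.
- by apply: measurableT_comp => //; case: (frame_w F).
Qed.

Let lfw : locint (fun t => `|f0 t| * w t).
Proof.
apply: locint_cont; [exact: measurableT_comp|exact: (frame_w F)|move=> x x0].
rewrite (_ : f0 = f); last by apply/funext.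
by apply: continuous_comp; [exact: has_density_continuous fq _|exact: norm_continuous].
Qed.

Let FzE (x t : R) : Fz (x, t) = if [&& 0 < t, t <= x & a x < t]
  then g x * (q t * W (a x) t + f t * w t) else 0.
Proof.
rewrite /Fz/= frame_SE; case: ifPn => // /and3P[t0 tx axt].
by rewrite (frame_WE F) ?f0E// ?(lt_le_trans t0)// ltW.
Qed.

(** [f] and [r] vanish outside [[c, d]], which confines [t] to [[c, d]] and then [x] to
    [[c, ainv d]]. There [Fz] is dominated by a function of [x] times a function of [t]. *)
Let iF : (mu \x mu)%E.-integrable setT (EFin \o Fz).
Proof.
have [c [d [c0 cd fcd]]] := sob_supp S.
pose K := W (a c) (ainv d).
pose G1 := (fun x => `|g x|) \_ `[c, ainv d].
pose k t := K * `|q t| + `|f0 t| * w t.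
pose G2 := k \_ `[c, d].
have K0 : 0 <= K by exact: (frame_W0 F).
have lq := locint_norm (proj1 fq).
have lk : locint k by apply: locintD => //; exact: locintZ.
have k0 t : 0 <= k t by rewrite addr_ge0 ?mulr_ge0// (frame_w0 F).
have G10 x : 0 <= G1 x by rewrite /G1 patchE; case: ifP.
have G20 x : 0 <= G2 x by rewrite /G2 patchE; case: ifP.
have bound (x t : R) : `|Fz (x, t)| <= G1 x * G2 t.
  rewrite FzE; case: ifPn => [/and3P[t0 tx axt]|_]; last by rewrite normr0 mulr_ge0.
  have x0 := lt_le_trans t0 tx; have d0 := lt_le_trans c0 cd.
  have [ct|tc] := leP c t; last first.
    have [ft rt] := fcd t (or_introl tc).
    by rewrite /q ft rt !mul0r addr0 mulr0 normr0 mulr_ge0.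
  have [td|dt] := leP t d; last first.
    have [ft rt] := fcd t (or_intror dt).
    by rewrite /q ft rt !mul0r addr0 mulr0 normr0 mulr_ge0.
  have xX : x <= ainv d by rewrite (frame_ainv_ge F)// (le_trans (ltW axt)).
  rewrite /G1 /G2 !patchE !mem_set/= ?in_itv/= ?ct ?td ?(le_trans ct)//.
  rewrite normrM ler_wpM2l// (le_trans (ler_normD _ _))// lerD//.
    rewrite normrM mulrC ler_wpM2r// ger0_norm ?(frame_W0 F)//.
    apply: (frame_W_le F); first exact: (frame_a0 F).
      exact: (frame_a_le F) (le_trans ct tx).
    exact: le_trans tx xX.
  by rewrite normrM f0E [`|w t|]ger0_norm// (frame_w0 F).
apply/integrable12ltyP; first exact/measurable_EFinP.
apply: (@le_lt_trans _ _ (\int[mu]_x \int[mu]_t ((G1 x)%:E * (G2 t)%:E))%E).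
  apply: ge0_le_integral_nm => x _; first by apply: integral_ge0 => t _; exact: abse_ge0.
  apply: ge0_le_integral_nm => t _; first exact: abse_ge0.
  by rewrite -EFinM lee_fin; exact: bound.
have mG1 : measurable_fun setT G1.
  apply/(measurable_restrictT _ (measurable_itvR _)); apply: measurable_funTS.
  by apply: measurableT_comp => //; case: lg.
have mG2 : measurable_fun setT G2.
  apply/(measurable_restrictT _ (measurable_itvR _)); apply: measurable_funTS.
  by case: lk.
have -> : (\int[mu]_x \int[mu]_t ((G1 x)%:E * (G2 t)%:E) =
    \int[mu]_x ((itvint k c d)%:E * (G1 x)%:E))%E.
  apply: eq_integral => x _.
  rewrite (ge0_integralZl_EFin_in measurableT (G10 x) mG2 (fun t _ => G20 t)).
  by rewrite integral_patch_itv// muleC.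
rewrite (ge0_integralZl_EFin_in measurableT _ mG1 (fun t _ => G10 t)); last exact: itvint_ge0.
by rewrite (integral_patch_itv _ (locint_norm lg) c0) -EFinM ltry.
Qed.

(* Integrating by parts on [[a x, x]] gives
   [rho(x) f(x) = int_(a x)^x (q(t) W(a x, t) + f(t) w(t)) dt]; then swap the
   order of integration. *)
Lemma averaging_identity :
  (\int[mu]_(x in Ipos) (g x * rho x * f x)%:E =
   \int[mu]_(t in Ipos) (q t * frame_B w a ainv g t + f t * w t * frame_D ainv g t)%:E)%E.
Proof.
have E1 : (\int[mu]_x \int[mu]_t (EFin \o Fz) (x, t) = \int[mu]_(x in Ipos) (g x * rho x * f x)%:E)%E.
  rewrite [RHS]integral_mkcond; apply: eq_integral => x _; rewrite patchE.
  case: ifPn; rewrite ?notin_setE ?inE /Ipos/= in_itv/= andbT; last first.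
    move=> /negP; rewrite -leNgt => x0; apply: integral0_eq => t _; rewrite FzE.
    have [t0|_ //] := ltP 0 t; have [tx|//] := leP t x.
    by move: (lt_le_trans t0 tx); rewrite ltNge x0.
  move=> x0; have ax0 := frame_a0 F x0; have axx := ltW (frame_ax F x0).
  pose gx t := primitive w t - primitive w (a x).
  have gd : has_density gx w.
    split; first exact: (frame_w F).
    by move=> y z y0 yz; rewrite /gx -(primitiveB (frame_w F) y0 yz); ring.
  have [ik IE] := itvint_by_parts fq gd ax0 axx.
  pose k t := q t * gx t + f t * w t.
  transitivity (\int[mu]_(t in `[a x, x]) (g x * k t)%:E)%E; last first.
    rewrite EFin_itvint; last first.
      have := integrableZl (measurable_itvR _) (g x) ik.
      by apply: eq_integrable => //; exact: measurable_itvR.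
    rewrite (itvintZ_integrable _ ik) IE; congr EFin.
    rewrite /gx subrr mulr0 subr0 (primitiveB (frame_w F))// half_lengthE.
    by rewrite [f x * _]mulrC mulrA.
  rewrite -integral_itv_obnd_cbnd; last first.
    apply/measurable_EFinP/measurable_funM => //.
    have := measurable_int _ ik => /measurable_EFinP.
    apply: measurable_funS; first exact: measurable_itvR.
    exact: subset_itv_oc_cc.
  rewrite [RHS]integral_mkcond; apply: eq_integral => t _; rewrite patchE /= FzE.
  case: ifPn => [/and3P[t0 tx axt]|N0].
    rewrite mem_set/= ?in_itv/= ?axt//.
    by rewrite /k /gx primitiveB ?(ltW axt)//; exact: (frame_w F).
  rewrite memNset//= in_itv/= => /andP[axt tx]; move/negP: N0; apply.
  by rewrite (lt_trans ax0 axt) tx axt.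
have E2 : (\int[mu]_t \int[mu]_x (EFin \o Fz) (x, t) =
   \int[mu]_(t in Ipos) (q t * frame_B w a ainv g t + f t * w t * frame_D ainv g t)%:E)%E.
  rewrite [RHS]integral_mkcond; apply: eq_integral => t _; rewrite patchE.
  case: ifPn; rewrite ?notin_setE ?inE /Ipos/= in_itv/= andbT; last first.
    by move=> /negP/negbTE t0; apply: integral0_eq => x _; rewrite FzE t0.
  move=> t0; have tX := frame_ainv_lt F t0.
  have lW := locint_Wa t0.
  pose k x := q t * (g x * (primitive w t - prim x)) + f t * w t * g x.
  have lk : locint k by apply: locintD; exact: locintZ.
  transitivity (\int[mu]_(x in `[t, ainv t]) (k x)%:E)%E; last first.
    rewrite EFin_itvint; last exact: (proj2 lk).
    rewrite (itvint_sumD _ (locintZ _ lW) (locintZ _ lg) t0) !itvintZ//.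
    congr (_ * _ + _)%:E; apply: eq_itvint => x tx xX; have x0 := lt_le_trans t0 tx.
    have axt : a x <= t by rewrite -(frame_ainv_ge F).
    by rewrite primE// primitiveB// ?(frame_a0 F)//; exact: (frame_w F).
  rewrite -integral_itv_bndo_bndc; last first.
    by apply/measurable_EFinP; apply: measurable_funTS; case: lk.
  rewrite [RHS]integral_mkcond; apply: eq_integral => x _; rewrite patchE /= FzE t0/=.
  case: ifPn => [/andP[tx axt]|N0].
    have x0 := lt_le_trans t0 tx.
    rewrite mem_set/= ?in_itv/= ?tx ?(frame_ainv_gt F)//.
    rewrite /k primE// -primitiveB ?(ltW axt) ?(frame_a0 F)//; last exact: (frame_w F).
    by congr EFin; ring.
  rewrite memNset//= in_itv/= => /andP[tx]; rewrite (frame_ainv_gt F) ?(lt_le_trans t0)// => axt.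
  by move/negP: N0; apply; rewrite tx axt.
by rewrite -E1 -E2; exact: Fubini iF.
Qed.

End fubini_swap.
End one_weight.
End averaging.

Section poweR_tools.
Context {R : realType}.
Local Open Scope ereal_scope.

Lemma ge0_poweR_ler (x y : \bar R) (r : R) : (0 <= r)%R -> 0 <= x -> x <= y ->
  x `^ r <= y `^ r.
Proof.
rewrite le_eqVlt => /predU1P[<- _ _|r0 x0 xy]; first by rewrite !poweRe0.
apply: gt0_ler_poweR => //; rewrite ?in_itv/= ?leey ?x0//; first exact: ltW.
by rewrite (le_trans x0).
Qed.

End poweR_tools.

(** * The pairing inequality *)

Section pairing.
Context {R : realType} {p : R} {w u a b ainv : R -> R}.
Hypothesis F : interval_frame p w u a b ainv.
Local Notation mu := (@lebesgue_measure R).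
Local Notation W := (itvint w).
Local Notation rho := (half_length w a).
Local Notation p' := (dualexp p).
Local Notation mR := (measurableTypeR R).
Local Notation tail := (@frame_tail R p w a).

Opaque itvint half_length powR frame_tail frame_B frame_D.

Definition frame_Gb (p : R) (w a ainv g : R -> R) : \bar R :=
  ((\int[mu]_(t in Ipos) (w t * `|frame_B w a ainv g t| `^ dualexp p)%:E) `^ (dualexp p)^-1)%E.

Definition frame_Gc (p : R) (w a ainv g : R -> R) : \bar R :=
  ((\int[mu]_(t in Ipos) (w t * (2 * half_length w a t) `^ dualexp p *
    `|frame_D ainv g t| `^ dualexp p)%:E) `^ (dualexp p)^-1)%E.

Lemma level_const_ge0 : 0 <= level_const p.
Proof.
have h1 := frame_p10 F; have h2 := step_theta_lt1 F; have h3 := step_const_gt0 (p := p).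
have h4 := schur_exp_gt0 F.
have h5 : 0 < 1 - step_theta p by rewrite subr_gt0.
apply: addr_ge0; last first.
  by rewrite mulr_ge0 ?powR_ge0// mulr_ge0 ?powR_ge0// divr_ge0 ?powR_ge0// ltW.
by rewrite mulr_ge0// divr_ge0 ?mulr_ge0 ?powR_ge0// ltW.
Qed.

Lemma sob_energy_r f r N : sobolev_fun p w u f r N ->
  (\int[mu]_(t in Ipos) (`|r t| `^ p)%:E <= N%:E)%E.
Proof.
move=> S; apply: ge0_integral_Ipos_le.
- by apply/measurable_EFinP; apply: measurable_funTS; case: (sob_rp S).
- by move=> x _; rewrite lee_fin powR_ge0.
- move=> x y x0 xy; rewrite -itvintE//; last exact: (sob_rp S).
  by rewrite lee_fin (le_trans (sob_rp_le F S y x0))// (sob_N S).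
Qed.

(** Hölder on each of the two terms of [averaging_identity]. The term with [q] needs only the
    energy; the term with [f] is where [level_estimate] enters. *)
Lemma sob_pairing f r N g : sobolev_fun p w u f r N -> locint g ->
  (`|\int[mu]_(x in Ipos) (g x * rho x * f x)%:E| <=
   (N `^ p^-1)%:E * (frame_Gb p w a ainv g + (level_const p `^ p^-1)%:E * frame_Gc p w a ainv g))%E.
Proof.
move=> S lg; rewrite (averaging_identity F lg S).
pose B := frame_B w a ainv g; pose D := frame_D ainv g.
pose wp t := w t `^ p'^-1; pose wq t := w t `^ p^-1.
have [p0 p'0] := (frame_p0 F, frame_p'0 F).
have pn0 : p != 0 by rewrite gt_eqF.
have p'n0 : p' != 0 by rewrite gt_eqF.
have w0 := frame_w0 F.
have mB : measurable_fun Ipos B by exact: measurable_frame_B F _ lg.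
have mD : measurable_fun Ipos D by exact: measurable_frame_D F _ lg.
have mf : measurable_fun Ipos f by exact: measurable_sob F _ _ _ S.
have mr : measurable_fun Ipos r by apply: measurable_funTS; exact: (sob_r S).
have mwp : measurable_fun Ipos wp by apply: measurable_funTS; exact: measurable_frame_wp F.
have mw : measurable_fun Ipos w by apply: measurable_funTS; case: (frame_w F).
have mwq : measurable_fun Ipos wq by exact: (measurableT_comp (measurable_powR _)).
have mrho : measurable_fun Ipos rho by exact: measurable_half_length F.
have mrV : measurable_fun Ipos (fun t => rho t `^ (-1)).
  exact: (measurableT_comp (measurable_powR _)).
(* [f w D] is split as [(f w^(1/p) / rho) (w^(1/p') rho D)]: the first factor is the quantity in
   [level_estimate], the second the one in [frame_Gc] up to a factor 2. *)
pose f1 t := f t * (wq t * rho t `^ (-1)); pose g1 t := wp t * rho t * D t.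
have mf1 : measurable_fun Ipos f1 by do 2!apply: measurable_funM => //.
have mg1 : measurable_fun Ipos g1 by do 2!apply: measurable_funM => //.
have mwB : measurable_fun Ipos (fun t => wp t * B t) by exact: measurable_funM.
have N0 := sob_N0 F S.
apply: (@le_trans _ _ (\int[mu]_(t in Ipos) (`|r t * (wp t * B t)| + `|f1 t * g1 t|)%:E)%E).
  apply: le_trans (le_abse_integral _ measurable_Ipos _) _.
    apply/measurable_EFinP/measurable_funD; apply: measurable_funM => //.
      exact: measurable_funM.
    exact: measurable_funM.
  apply: ge0_le_integral_nm => t; first by move=> _; exact: abse_ge0.
  rewrite /Ipos/= in_itv/= andbT => t0; rewrite lee_fin -mulrA.
  apply: (le_trans (ler_normD _ _)); rewrite lerD2l le_eqVlt; apply/orP; left; apply/eqP.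
  congr `|_|; have rt0 := half_length_gt0 F t0.
  have wE : w t = wq t * wp t.
    by rewrite /wq /wp -powRD (frame_pp' F) ?powRr1// oner_eq0.
  have rn0 : rho t != 0 by rewrite gt_eqF.
  rewrite /f1 /g1 /D wE powR_inv1 ?(ltW rt0)//.
  by field.
have pw (h : R -> R) : measurable_fun Ipos h -> measurable_fun Ipos (fun t => `|h t|).
  by move=> mh; exact: measurableT_comp.
rewrite (ge0_integralD_EFin_in measurable_Ipos); last 4 first.
- by apply: pw; exact: measurable_funM.
- by [].
- by apply: pw; exact: measurable_funM.
- by [].
rewrite ge0_muleDr; last 2 first.
- exact: poweR_ge0.
- by rewrite mule_ge0 ?poweR_ge0// lee_fin powR_ge0.
apply: leeD.
  apply: (le_trans (hoelder_on measurable_Ipos mr mwB p0 p'0 (frame_pp' F))).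
  apply: lee_pmul; rewrite ?poweR_ge0//.
    rewrite -poweR_EFin; apply: ge0_poweR_ler; rewrite ?invr_ge0 ?(ltW p0)//.
      by apply: integral_ge0 => t _; rewrite lee_fin powR_ge0.
    exact: sob_energy_r S.
  rewrite /frame_Gb (_ : \int[mu]_(x in Ipos) _ = \int[mu]_(t in Ipos) (w t * `|B t| `^ p')%:E)%E//.
  apply: eq_integral => t _; congr EFin.
  by rewrite normrM powRM// ger0_norm ?powR_ge0// -powRrM mulVf// powRr1.
apply: (le_trans (hoelder_on measurable_Ipos mf1 mg1 p0 p'0 (frame_pp' F))).
rewrite muleA; apply: lee_pmul; rewrite ?poweR_ge0//.
  have L0 : 0 <= level_const p * N.
    rewrite -lee_fin; apply: le_trans (level_estimate F S).
    by apply: integral_ge0 => t _; rewrite lee_fin mulr_ge0 ?powR_ge0// (frame_tail_ge0 F).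
  have -> : ((N `^ p^-1)%:E * (level_const p `^ p^-1)%:E = (level_const p * N)%:E `^ p^-1)%E.
    rewrite poweR_EFin -EFinM mulrC -powRM//; exact: level_const_ge0.
  apply: ge0_poweR_ler; rewrite ?invr_ge0 ?(ltW p0)//.
    by apply: integral_ge0 => t _; rewrite lee_fin powR_ge0.
  apply: le_trans (level_estimate F S).
  rewrite le_eqVlt; apply/orP; left; apply/eqP.
  apply: eq_integral => t; rewrite inE /Ipos/= in_itv/= andbT => t0; congr EFin.
  have rt0 := half_length_gt0 F t0.
  rewrite /f1 normrM powRM// frame_tailE [`|wq t * _|]ger0_norm; last by rewrite mulr_ge0 ?powR_ge0.
  rewrite powRM ?powR_ge0// -!powRrM mulVf// powRr1// mulN1r.
  done.
apply: ge0_poweR_ler; rewrite ?invr_ge0 ?(ltW p'0)//.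
  by apply: integral_ge0 => t _; rewrite lee_fin powR_ge0.
apply: ge0_le_integral_nm => t; first by rewrite lee_fin powR_ge0.
rewrite /Ipos/= in_itv/= andbT => t0; rewrite lee_fin.
have rt0 := half_length_gt0 F t0.
rewrite /g1 normrM [(`|_| * _) `^ _]powRM//.
apply: ler_wpM2r; first exact: powR_ge0.
rewrite ger0_norm; last by rewrite mulr_ge0 ?powR_ge0// ltW.
rewrite powRM ?powR_ge0 ?(ltW rt0)// -powRrM mulVf// powRr1// ler_wpM2l//.
by apply: powR_ler; rewrite ?(ltW p'0) ?(ltW rt0)//; lra.
Qed.

End pairing.

(** * Norms of the test functions *)

Section derivative_bounds.
Context {R : realType}.
Local Notation mu := (@lebesgue_measure R).
Local Notation mR := (measurableTypeR R).

(** Both derivatives exist, so they are limits of quotients from the right alone. *)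
Lemma is_derive_le_right (f g : R -> R) (x l m k e : R) :
  is_derive x 1 f l -> is_derive x 1 g m -> 0 < e ->
  (forall y, x <= y -> y <= x + e -> `|f y - f x| <= k * (g y - g x)) -> `|l| <= k * m.
Proof.
move=> df dg e0 H.
pose v n : R := n.+1%:R^-1.
have v0 n : v n != 0 by rewrite invr_eq0 pnatr_eq0.
have vp n : 0 < v n by rewrite invr_gt0.
have cv : v @ \oo --> (0 : R) by exact: cvg_harmonic.
have cf := is_derive_seq df v0 cv.
have cg := is_derive_seq dg v0 cv.
have cnf : `|(v n)^-1 * (f (v n + x) - f x)| @[n --> \oo] --> `|l| by exact: cvg_norm.
have ckg : k * ((v n)^-1 * (g (v n + x) - g x)) @[n --> \oo] --> k * m.
  by apply: cvgM => //; exact: cvg_cst.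
apply: (ler_cvg_to cnf ckg).
have : \forall n \near \oo, `|0 - v n| < e by exact: (@cvgrPdist_lt _ R^o _ _ _ _ _).1 cv e e0.
apply: filterS => n; rewrite sub0r normrN gtr0_norm// => ve.
rewrite normrM ger0_norm ?invr_ge0 ?(ltW (vp n))// mulrCA ler_wpM2l ?invr_ge0 ?(ltW (vp n))//.
by apply: H; rewrite ?lerDr ?(ltW (vp n))// addrC lerD2l ltW.
Qed.

Lemma itvint_cst0 (x y : R) : itvint (fun=> 0) x y = 0.
Proof. by rewrite /itvint /Rintegral integral0. Qed.

Lemma itvint_ae_le (f g : R -> R) (x y : R) : locint f -> locint g -> 0 < x ->
  {ae mu, forall t : R, x < t -> t < y -> f t <= g t} -> itvint f x y <= itvint g x y.
Proof.
move=> lf lg x0 fg.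
have [xy|yx] := leP x y; last by rewrite !itvint_gt.
rewrite -subr_ge0.
have ld : locint (fun t => g t + (-1) * f t) by apply: locintD => //; exact: locintZ.
have -> : itvint g x y - itvint f x y = itvint (fun t => g t + (-1) * f t) x y.
  by rewrite (itvint_sumD _ lg (locintZ _ lf) x0) itvintZ// mulN1r.
rewrite -lee_fin itvintE//.
have -> : (\int[mu]_(t in `[x, y]) (g t + -1 * f t)%:E =
    \int[mu]_(t in `[x, y]) (`|g t + -1 * f t|)%:E)%E.
  apply: ae_eq_integral.
  - exact: measurable_itvR.
  - by apply/measurable_EFinP; apply: measurable_funTS; case: ld.
  - by apply/measurable_EFinP; apply: measurable_funTS; apply: measurableT_comp => //; case: ld.
  - have := ae_impl2 (fun t (h1 : t != x) (h2 : t != y) => conj h1 h2) (ae_neq x) (ae_neq y).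
    move=> /(ae_impl2 _ fg); apply => t h [tx ty]; rewrite /= in_itv/= => /andP[xt ty'].
    rewrite ger0_norm// mulN1r subr_ge0; apply: h.
      by rewrite lt_neqAle eq_sym tx.
    by rewrite lt_neqAle ty.
by apply: integral_ge0 => t _; rewrite lee_fin.
Qed.

Lemma has_density_patch (f q : R -> R) : has_density f q -> has_density (f \_ Ipos) q.
Proof.
move=> [lq fq]; split => // x y x0 xy; have y0 := lt_le_trans x0 xy.
by rewrite !patchE !mem_set ?fq// /Ipos/= in_itv/= ?x0 ?y0.
Qed.

Lemma measurable_has_density_patch (f q : R -> R) : has_density f q ->
  measurable_fun (setT : set mR) (f \_ Ipos : mR -> R).
Proof.
move=> fq; apply/(measurable_restrictT _ measurable_Ipos).
exact: measurable_has_density fq.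
Qed.

(* [k] is only assumed absolutely continuous on [[t, X]], so it is first
   replaced by a primitive of its cut-off density. *)
Lemma itvint_by_parts_le (f q k h m : R -> R) (t X C : R) : measurable_fun setT f ->
  has_density f q -> locint h -> (forall x, 0 <= h x) -> measurable_fun setT m ->
  (forall x : R, 0 < x -> {for x, continuous m}) -> (forall x, 0 <= m x) ->
  0 < t -> t < X ->
  (forall x y, t <= x -> x <= y -> y <= X -> `|k y - k x| <= C * itvint h x y) ->
  (forall x e, t < x -> x < X -> 0 < e -> exists2 d, 0 < d &
    forall y, x <= y -> y <= x + d -> y <= X -> `|k y - k x| <= (m x + e) * itvint h x y) ->
  `|itvint (fun x => q x * k x) t X - (f X * k X - f t * k t)| <=
  itvint (fun x => `|f x| * (m x * h x)) t X.
Proof.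
move=> mf fq lh h0 mm cm m0 t0 tX kC km.
have kac : abs_cont_on k t X.
  apply: (dominated_abs_cont (h := fun x => C * h x)).
    exact: (proj2 (locintZ C lh)).
  move=> x y tx xy yX; change (`|k y - k x| <= itvint (fun x => C * h x) x y).
  by rewrite itvintZ ?kC// (lt_le_trans t0).
have [qk [iqk kE]] := abs_cont_density tX kac.
pose qk0 := qk \_ `[t, X].
have iqk0 : mu.-integrable setT (EFin \o qk0).
  by rewrite /qk0 -restrict_EFin; apply/(integrable_mkcond _ _).1 => //; exact: measurable_itvR.
have lqk0 : locint qk0.
  split; first by apply/measurable_EFinP; exact: measurable_int iqk0.
  by move=> c d _; apply: integrableS iqk0 => //; exact: measurable_itvR.
pose k0 x := k t + (primitive qk0 x - primitive qk0 t).
have k0d : has_density k0 qk0.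
  by split => // x y x0 xy; rewrite -(primitiveB lqk0 x0 xy) /k0; ring.
have k0E x : t <= x -> x <= X -> k0 x = k x.
  move=> tx xX; rewrite /k0 primitiveB//.
  rewrite (eq_itvint (g := qk)); last first.
    move=> y ty yx; rewrite /qk0 patchE mem_set//= in_itv/= ty/=.
    exact: le_trans xX.
  by rewrite /itvint -kE//; ring.
have [ibp IE] := itvint_by_parts fq k0d t0 (ltW tX).
rewrite !k0E ?lexx ?(ltW tX)// in IE.
have lqk : locint (fun x => f x * qk0 x).
  by apply: locint_cont => // x; exact: has_density_continuous fq.
have iqk1 : mu.-integrable `[t, X] (EFin \o (fun x => q x * k0 x)).
  have := integrableB (measurable_itvR _) ibp (proj2 lqk t X t0).
  apply: eq_integrable; first exact: measurable_itvR.
  by move=> x _; rewrite /= -EFinB addrK.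
have -> : itvint (fun x => q x * k x) t X = itvint (fun x => q x * k0 x) t X.
  by apply: eq_itvint => x tx xX; rewrite k0E.
have -> : itvint (fun x => q x * k0 x) t X - (f X * k X - f t * k t) =
    - itvint (fun x => f x * qk0 x) t X.
  have eD : itvint (fun x => q x * k0 x + f x * qk0 x) t X =
      itvint (fun x => q x * k0 x) t X + itvint (fun x => f x * qk0 x) t X.
    exact: RintegralD (measurable_itvR `[t, X]) iqk1 (proj2 lqk t X t0).
  by rewrite -IE eD opprD addrA subrr add0r.
rewrite normrN; apply: le_trans (norm_itvint _ lqk t0) _.
have lmh : locint (fun x => m x * h x) by exact: locint_cont.
apply: itvint_ae_le => //.
- exact: locint_norm.
- apply: locint_cont => //; first exact: measurableT_comp.
  move=> x x0; apply: continuous_comp; first exact: has_density_continuous fq _.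
  exact: norm_continuous.
apply: ae_impl2 (has_density_ae_derive k0d) (primitive_ae_derive lh) => x dk dh tx xX.
have x0 := lt_trans t0 tx.
rewrite normrM ler_wpM2l//.
have main e : 0 < e -> `|qk0 x| <= (m x + e) * h x.
  move=> e0; have [d d0 kd] := km x e tx xX e0.
  have dd0 : 0 < Num.min d (X - x) by rewrite lt_min d0 subr_gt0.
  apply: (is_derive_le_right (dk x0) (dh x0) dd0) => y xy yd.
  have yX : y <= X by rewrite (le_trans yd)// -lerBrDl ge_min lexx orbT.
  rewrite !k0E ?(ltW tx) ?(ltW xX) ?(le_trans (ltW tx))// primitiveB// kd//.
  by rewrite (le_trans yd)// lerD2l ge_min lexx.
apply/ler_addgt0Pr => e e0.
(* The error term is multiplied by [h x], which the division by [h x + 1] absorbs. *)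
have h10 : 0 < h x + 1 by rewrite ltr_wpDl.
apply: (le_trans (main _ (divr_gt0 e0 h10))).
rewrite mulrDl lerD2l mulrAC ler_pdivrMr// ler_wpM2l ?(ltW e0)//.
by rewrite lerDl.
Qed.

End derivative_bounds.

Section norm_bounds.
Context {R : realType} {p : R} {w u a b ainv : R -> R}.
Hypothesis F : interval_frame p w u a b ainv.
Local Notation mu := (@lebesgue_measure R).
Local Notation W := (itvint w).
Local Notation rho := (half_length w a).
Local Notation p' := (dualexp p).
Local Notation mR := (measurableTypeR R).
Local Notation tail := (@frame_tail R p w a).
Local Notation rho0 := (frame_rho (w := w) (a := a)).

Opaque itvint half_length powR frame_tail.

Definition frame_rhoV (w a : R -> R) x := frame_rho (w := w) (a := a) x `^ (-1).
Local Notation rhoV := (frame_rhoV w a).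

(** On the half-line this is [G / V_1], because [V_1 = 2 rho]. *)
Definition frame_scale (w a G : R -> R) x := 2^-1 * frame_rhoV w a x * G x.

Lemma frame_rhoVE x : 0 < x -> rhoV x = (rho x)^-1.
Proof.
by move=> x0; rewrite /frame_rhoV (frame_rhoE F)// powR_inv1// ltW// (half_length_gt0 F).
Qed.

Lemma frame_rhoV_ge0 x : 0 <= rhoV x.
Proof. exact: powR_ge0. Qed.

Lemma measurable_rhoV (k : R) : measurable_fun setT (fun x => k * rhoV x).
Proof.
apply: measurable_funM => //.
exact: (measurableT_comp (measurable_powR _) (measurable_frame_rho F)).
Qed.

Lemma continuous_rhoV (k x : R) : 0 < x -> {for x, continuous (fun x => k * rhoV x)}.
Proof.
move=> x0; have rx0 := half_length_gt0 F x0.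
have H : {for x, continuous (fun x => k * rho x `^ (-1))}.
  apply: (@continuousM _ R^o); first exact: cst_continuous.
  apply: (@continuous_comp _ _ _ rho (fun y => y `^ (-1))).
    exact: (half_length_continuous F x0).
  exact: continuous_powR_pos.
rewrite /prop_for /continuous_at /frame_rhoV (frame_rhoE F x0).
apply: cvg_trans H; apply: near_eq_cvg.
by near=> y; rewrite (frame_rhoE F)//; near: y; exact: lt_nbhsr.
Unshelve. all: by end_near. Qed.

Lemma locint_scale G : locint G -> locint (frame_scale w a G).
Proof.
move=> lG; apply: locint_cont => //; first exact: measurable_rhoV.
by move=> x; exact: continuous_rhoV.
Qed.

Lemma frame_scaleE G x : 0 < x -> frame_scale w a G x = (2 * rho x)^-1 * G x.
Proof. by move=> x0; rewrite /frame_scale frame_rhoVE// invfM. Qed.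

Lemma frame_B_scale G t : 0 < t -> frame_B w a ainv (frame_scale w a G) t =
  itvint (fun x => G x * (W (a x) t / (2 * rho x))) t (ainv t).
Proof.
move=> t0; apply: eq_itvint => x tx xX; rewrite frame_scaleE ?(lt_le_trans t0)//.
have aux (y g W0 : R) : y * g * W0 = g * (W0 * y) by ring.
exact: aux.
Qed.

Lemma frame_D_scale G t : 0 < t -> locint G -> 2 * rho t * frame_D ainv (frame_scale w a G) t =
  itvint (fun x => G x * (rho t / rho x)) t (ainv t).
Proof.
move=> t0 lG; rewrite /frame_D -(itvintZ _ _ (locint_scale lG) t0).
apply: eq_itvint => x tx xX; have x0 := lt_le_trans t0 tx; rewrite frame_scaleE//.
have rx0 := half_length_gt0 F x0; have rn0 : rho x != 0 by rewrite gt_eqF.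
by field.
Qed.

Lemma frame_comp (t x : R) : 0 < t -> t <= x -> x <= ainv t ->
  [/\ 0 < x, a x <= t, rho t <= 2 * rho x, W (a x) t <= rho x & 0 < rho x].
Proof.
move=> t0 tx xX; have x0 := lt_le_trans t0 tx.
have axt : a x <= t by rewrite -(frame_ainv_ge F).
have [h1 _ h2 _] := half_length_comp F t0 tx axt.
by split => //; exact: half_length_gt0 F _ _.
Qed.

Lemma frame_B_le G t : 0 < t -> locint G ->
  `|frame_B w a ainv (frame_scale w a G) t| <= 2 * itvint (fun x => `|G x|) t (ainv t).
Proof.
move=> t0 lG; have lnG := locint_norm lG.
have [h lh hE] := frame_B_kernel F (locint_scale lG) t0.
rewrite /frame_B -(eq_itvint hE); apply: le_trans (norm_itvint _ lh t0) _.
rewrite -(itvintZ _ _ lnG t0); apply: itvint_mono => //.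
- exact: locint_norm.
- exact: locintZ.
move=> x tx xX; have [x0 axt _ Wr rx0] := frame_comp t0 tx xX.
rewrite hE// frame_scaleE// !normrM [`|W _ _|]ger0_norm ?(frame_W0 F)//.
rewrite ger0_norm ?invr_ge0 ?mulr_ge0 ?(ltW rx0)// mulrAC ler_wpM2r//.
rewrite mulrC ler_pdivrMr ?mulr_gt0//.
by move: (W (a x) t) (rho x) Wr rx0 => *; lra.
Qed.

Lemma frame_D_le G t : 0 < t -> locint G ->
  `|2 * rho t * frame_D ainv (frame_scale w a G) t| <= 2 * itvint (fun x => `|G x|) t (ainv t).
Proof.
move=> t0 lG; have lnG := locint_norm lG; have lsG := locint_scale lG.
have rt0 := half_length_gt0 F t0.
rewrite normrM ger0_norm ?mulr_ge0 ?(ltW rt0)//.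
apply: (le_trans (ler_wpM2l _ (norm_itvint _ lsG t0))); first by rewrite mulr_ge0 ?(ltW rt0).
rewrite -(itvintZ _ _ (locint_norm lsG) t0) -(itvintZ _ _ lnG t0).
apply: itvint_mono => //; [exact: locintZ (locint_norm lsG)|exact: locintZ|].
move=> x tx xX; have [x0 axt rtx _ rx0] := frame_comp t0 tx xX.
rewrite frame_scaleE// normrM mulrA ler_wpM2r// ger0_norm ?invr_ge0 ?mulr_ge0 ?(ltW rx0)//.
by rewrite ler_pdivrMr ?mulr_gt0//; move: (rho t) (rho x) rtx rx0 => *; lra.
Qed.

End norm_bounds.

Section kernel_lipschitz.
Context {R : realFieldType}.
Implicit Types A B rx ry rt W : R.

(** Increment from [x] to [y] of the kernel [W (a x) t / (2 rho x)] of [frame_B]: [A] and [B] are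
    the [w]-masses of [[a x, a y]] and [[a y, t]], and [W] that of [[x, y]]. *)
Lemma kernel_lip_B A B rx ry W : 0 < rx -> 0 < ry -> 0 <= W -> 0 <= A -> A <= 2 * W ->
  0 <= B -> B <= ry -> ry <= rx + W -> rx <= ry + W ->
  `|B / (2 * ry) - (A + B) / (2 * rx)| <= 2 * rx^-1 * W.
Proof.
move=> rx0 ry0 W0 A0 AW B0 By l1 l2.
have rxn : rx != 0 by rewrite gt_eqF.
have ryn : ry != 0 by rewrite gt_eqF.
rewrite (_ : _ - _ = - ((A * ry + B * (ry - rx)) / (2 * rx * ry))); last by field; rewrite ?rxn ?ryn.
rewrite normrN normrM [`|(_ * _)^-1|]ger0_norm ?invr_ge0 ?mulr_ge0 ?(ltW rx0) ?(ltW ry0)//.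
rewrite ler_pdivrMr ?mulr_gt0// (_ : 2 * rx^-1 * W * (2 * rx * ry) = 4 * W * ry); last by field.
have h : `|ry - rx| <= W by rewrite ler_norml; apply/andP; split; lra.
apply: (le_trans (ler_normD _ _)); rewrite !normrM (ger0_norm A0) (ger0_norm B0) (gtr0_norm ry0).
apply: (@le_trans _ _ (2 * W * ry + ry * W)); last nra.
by apply: lerD; [exact: (ler_wpM2r (ltW ry0))|exact: ler_pM].
Qed.

(** The corresponding increment for [rho t / rho x], the kernel of [2 rho t * frame_D]. *)
Lemma kernel_lip_D rt rx ry W : 0 < rt -> 0 < rx -> 0 < ry -> 0 <= W -> rt <= 2 * ry ->
  ry <= rx + W -> rx <= ry + W -> `|rt / ry - rt / rx| <= 2 * rx^-1 * W.
Proof.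
move=> rt0 rx0 ry0 W0 rty l1 l2.
have rxn : rx != 0 by rewrite gt_eqF.
have ryn : ry != 0 by rewrite gt_eqF.
rewrite (_ : _ - _ = (rt * (rx - ry)) / (rx * ry)); last by field; rewrite ?rxn ?ryn.
rewrite normrM [`|(_ * _)^-1|]ger0_norm ?invr_ge0 ?mulr_ge0 ?(ltW rx0) ?(ltW ry0)//.
rewrite ler_pdivrMr ?mulr_gt0// (_ : 2 * rx^-1 * W * (rx * ry) = 2 * ry * W); last by field.
have h : `|rx - ry| <= W by rewrite ler_norml; apply/andP; split; lra.
by rewrite normrM (gtr0_norm rt0); apply: ler_pM => //; exact: ltW.
Qed.

End kernel_lipschitz.

Section operator_bounds.
Context {R : realType} {p : R} {w u a b ainv : R -> R}.
Hypothesis F : interval_frame p w u a b ainv.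
Local Notation mu := (@lebesgue_measure R).
Local Notation W := (itvint w).
Local Notation rho := (half_length w a).
Local Notation p' := (dualexp p).
Local Notation mR := (measurableTypeR R).
Local Notation tail := (@frame_tail R p w a).
Local Notation rhoV := (frame_rhoV w a).
Local Notation scale := (frame_scale w a).

Opaque itvint half_length powR frame_tail frame_D frame_B.

Let p'0 : 0 <= p'. Proof. exact/ltW/(frame_p'0 F). Qed.
Let p'n0 : p' != 0. Proof. by rewrite gt_eqF// (frame_p'0 F). Qed.

Lemma continuous_norm_powR (f : R -> R) (x s : R) : 0 < s -> {for x, continuous f} ->
  {for x, continuous (fun y => `|f y| `^ s)}.
Proof.
move=> s0 cf; have cn : {for x, continuous (fun y => `|f y|)}.
  by apply: continuous_comp => //; exact: norm_continuous.
have [fx0|fx0] := eqVneq (f x) 0; last first.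
  apply: (@continuous_comp _ _ _ (fun x => `|f x|) (fun y => y `^ s)) => //.
  by apply: continuous_powR_pos; rewrite normr_gt0.
rewrite /prop_for /continuous_at fx0 normr0 powR0 ?gt_eqF//.
apply/(@cvgrPdist_lt _ R^o) => e e0.
have d0 : 0 < e `^ s^-1 by rewrite powR_gt0.
have /(@cvgrPdist_lt _ R^o)/(_ _ d0) := cf; apply: filterS => y.
rewrite fx0 !sub0r !normrN => fy; rewrite ger0_norm ?powR_ge0//.
rewrite -(powRr1 (ltW e0)) -(mulVf (lt0r_neq0 s0)) powRrM.
by apply: gt0_ltr_powR => //; rewrite nnegrE// powR_ge0.
Qed.

Lemma pow_bound (B I : R -> R) (k M : R) : 0 <= k -> measurable_fun Ipos I ->
  (forall t : R, 0 < t -> 0 <= I t) -> (forall t : R, 0 < t -> `|B t| <= k * I t) ->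
  (\int[mu]_(t in Ipos) (w t * I t `^ p')%:E <= M%:E)%E ->
  ((\int[mu]_(t in Ipos) (w t * `|B t| `^ p')%:E) `^ p'^-1 <= (k * M `^ p'^-1)%:E)%E.
Proof.
move=> k0 mI I0 BI HM.
have wI0 t : Ipos t -> 0 <= w t * I t `^ p' by move=> _; rewrite mulr_ge0 ?powR_ge0// (frame_w0 F).
have mwI : measurable_fun Ipos (fun t => w t * I t `^ p').
  apply: measurable_funM; first by apply: measurable_funTS; case: (frame_w F).
  exact: (measurableT_comp (measurable_powR _)).
have M0 : 0 <= M.
  by rewrite -lee_fin (le_trans _ HM)//; apply: integral_ge0 => t It; rewrite lee_fin wI0.
have -> : (k * M `^ p'^-1)%:E = ((k `^ p' * M)%:E `^ p'^-1)%E.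
  by rewrite poweR_EFin powRM ?powR_ge0// -powRrM mulfV// powRr1.
apply: ge0_poweR_ler; rewrite ?invr_ge0//.
  by apply: integral_ge0 => t _; rewrite lee_fin mulr_ge0 ?powR_ge0// (frame_w0 F).
rewrite EFinM; apply: le_trans (lee_wpmul2l _ HM); last by rewrite lee_fin powR_ge0.
rewrite -(ge0_integralZl_EFin_in measurable_Ipos (powR_ge0 _ _) mwI wI0).
apply: ge0_le_integral_nm => t; first by rewrite lee_fin mulr_ge0 ?powR_ge0// (frame_w0 F).
rewrite /Ipos/= in_itv/= andbT => t0; rewrite -EFinM lee_fin mulrCA ler_wpM2l ?(frame_w0 F)//.
by rewrite -powRM ?I0//; apply: powR_ler => //; exact: BI.
Qed.

Lemma schur_itvint (q m G g : R -> R) (C1 M : R) : 0 <= C1 -> measurable_fun setT q ->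
  (forall x, 0 <= q x) -> (forall x : R, 0 < x -> q x `^ p = m x) ->
  schur_bound (p := p) (w := w) (a := a) (ainv := ainv) m C1 -> locint G ->
  measurable_fun setT g -> (forall x, 0 <= g x) ->
  (forall x : R, 0 < x -> `|G x| <= q x * g x) ->
  (\int[mu]_x (g x `^ p')%:E <= M%:E)%E ->
  (\int[mu]_(t in Ipos) (w t * itvint (fun x => `|G x|) t (ainv t) `^ p')%:E <=
    (C1 `^ (p' / p) * 2 * M)%:E)%E.
Proof.
move=> C10 mq q0 qm Km lG mg g0 Gg HM.
have := schur_operator F C10 mq q0 qm Km mg g0.
move=> H; apply: (@le_trans _ _ ((C1 `^ (p' / p) * 2)%:E * \int[mu]_x (g x `^ p')%:E)%E); last first.
  by rewrite [leRHS]EFinM lee_wpmul2l// lee_fin mulr_ge0 ?powR_ge0.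
apply: le_trans H; apply: ge0_le_integral_nm => t.
  by rewrite lee_fin mulr_ge0 ?powR_ge0// (frame_w0 F).
rewrite /Ipos/= in_itv/= andbT => t0; rewrite EFinM lee_wpmul2l ?lee_fin ?(frame_w0 F)//.
rewrite -poweR_EFin; apply: ge0_poweR_ler => //; first by rewrite lee_fin itvint_ge0.
rewrite itvintE//; last exact: locint_norm.
apply: ge0_le_integral_nm => x; first by rewrite lee_fin.
by rewrite /= in_itv/= => /andP[tx _]; rewrite lee_fin Gg// (lt_le_trans t0).
Qed.

Lemma frame_GcE g : frame_Gc p w a ainv g =
  ((\int[mu]_(t in Ipos) (w t * `|2 * rho t * frame_D ainv g t| `^ p')%:E) `^ p'^-1)%E.
Proof.
apply: (congr1 (fun I : \bar R => (I `^ p'^-1)%E)).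
apply: eq_integral => t; rewrite inE /Ipos/= in_itv/= andbT => t0.
have rt0 := half_length_gt0 F t0; have r20 : 0 <= 2 * rho t by rewrite mulr_ge0// ltW.
have aux (X Y s : R) : 0 <= X -> `|X * Y| `^ s = X `^ s * `|Y| `^ s.
  by move=> X0; rewrite normrM powRM// ger0_norm.
congr EFin; rewrite -mulrA; congr (w t * _); exact: esym (aux _ _ _ r20).
Qed.

Definition low_const (p : R) := 2 * (4 `^ (dualexp p / p) * 2) `^ (dualexp p)^-1.

(** These are the tests [v_0 gamma], as [u^(1/p) = v_0]. Both kernels are bounded, so both
    functionals are dominated by the integral of [|u^(1/p) g|] over [[t, ainv t]], and the Schur
    bound with [m = u] applies. *)
Lemma low_order_bound (g : R -> R) (M : R) : measurable_fun setT g ->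
  locint (fun x => `|g x| `^ p') -> (\int[mu]_x (`|g x| `^ p')%:E <= M%:E)%E ->
  [/\ locint (fun x => u x `^ p^-1 * g x),
  (frame_Gb p w a ainv (scale (fun x : R => (u x `^ p^-1 * g x)%R)) <= (low_const p * M `^ p'^-1)%:E)%E &
  (frame_Gc p w a ainv (scale (fun x : R => (u x `^ p^-1 * g x)%R)) <= (low_const p * M `^ p'^-1)%:E)%E].
Proof.
move=> mg lg HM; have pn0 : p != 0 by rewrite gt_eqF// (frame_p0 F).
have M0 : 0 <= M.
  by rewrite -lee_fin (le_trans _ HM)//; apply: integral_ge0 => t It; rewrite lee_fin powR_ge0.
have mq : measurable_fun setT (fun x => u x `^ p^-1).
  by apply: (measurableT_comp (measurable_powR _)); case: (frame_u F).
have qm x : (u x `^ p^-1) `^ p = u x by rewrite -powRrM mulVf// powRr1// (frame_u0 F).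
have lG : locint (fun x => u x `^ p^-1 * g x).
  apply: (locint_hoelder (frame_p0 F) (frame_p'0 F) (frame_pp' F)) => //.
  rewrite (_ : (fun t => _) = u); first exact: (frame_u F).
  by apply/funext => x; rewrite ger0_norm ?powR_ge0.
have Gg x : 0 < x -> `|u x `^ p^-1 * g x| <= u x `^ p^-1 * `|g x|.
  by rewrite normrM [`|u x `^ _|]ger0_norm ?powR_ge0.
have mng : measurable_fun setT (fun x => `|g x|) by exact: measurableT_comp.
have := schur_itvint (ler0n R 4) mq (fun x => powR_ge0 _ _) (fun x _ => qm x) (schur_bound_u F) lG
  mng (fun x => normr_ge0 _) Gg HM.
pose I t := itvint (fun x => `|u x `^ p^-1 * g x|) t (ainv t).
move=> HI.
have mI : measurable_fun Ipos I by exact: measurable_frame_D F _ (locint_norm lG).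
have I0 (t : R) : 0 < t -> 0 <= I t by move=> _; exact: itvint_ge0.
have cE : low_const p * M `^ p'^-1 = 2 * (4 `^ (p' / p) * 2 * M) `^ p'^-1.
  by rewrite /low_const -mulrA -powRM// mulr_ge0 ?powR_ge0.
split => //.
  rewrite cE; apply: (pow_bound (ler0n R 2) mI I0 _ HI) => t t0.
  exact: (frame_B_le F t0 lG).
rewrite cE frame_GcE; apply: (pow_bound (ler0n R 2) mI I0 _ HI) => t t0.
exact: (frame_D_le F t0 lG).
Qed.

(** The image of [w(t) dt] under [ainv] is at most [2 w(t) dt], by [frame_W_a]. *)
Lemma pushforward_ainv (psi : R -> R) : measurable_fun setT psi ->
  (forall x : R, 0 < x -> {for x, continuous psi}) -> (forall x, 0 <= psi x) ->
  (\int[mu]_(t in Ipos) (w t * psi (ainv t))%:E <= 2%:E * \int[mu]_(t in Ipos) (w t * psi t)%:E)%E.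
Proof.
move=> mpsi cpsi psi0.
pose pa := (fun t => psi (ainv t)) \_ Ipos.
have mpa : measurable_fun setT pa.
  apply/(measurable_restrictT _ measurable_Ipos).
  by apply: measurable_comp_ainv F _ _; exact: measurable_funTS.
have paE (t : R) : 0 < t -> pa t = psi (ainv t).
  by move=> t0; rewrite /pa patchE mem_set// /Ipos/= in_itv/= t0.
have pa0 t : 0 <= pa t by rewrite /pa patchE; case: ifP.
have w0 := frame_w0 F.
have bnd (x y : R) : 0 < x -> x <= y -> exists2 M, 0 <= M & forall z, x <= z -> z <= y -> psi z <= M.
  move=> x0 xy.
  have cw : {within `[x, y], continuous psi}.
    apply: continuous_in_subspaceT => z; rewrite inE/= in_itv/= => /andP[xz _].
    exact: cpsi (lt_le_trans x0 xz).
  have [z _ Hz] := @EVT_max R psi x y xy cw; exists (psi z) => // t xt ty.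
  by apply: Hz; rewrite in_itv/= xt.
pose h t := pa t * w t.
have lh : locint h.
  split; first by apply: measurable_funM => //; case: (frame_w F).
  move=> c d c0; have [cd|dc] := leP c d; last first.
    by rewrite set_itv_ge ?bnd_simp -?ltNge//; exact: integrable_set0.
  have [M M0 HM] := bnd _ _ (frame_ainv0 F c0) (frame_ainv_le F c0 cd).
  apply: le_integrable (integrableZl (measurable_itvR _) M (proj2 (frame_w F) c d c0)).
  - exact: measurable_itvR.
  - apply/measurable_EFinP; apply: measurable_funTS; apply: measurable_funM => //; by case: (frame_w F).
  - move=> t /=; rewrite in_itv/= => /andP[ct td]; have t0 := lt_le_trans c0 ct.
    rewrite lee_fin !ger0_norm ?mulr_ge0// ler_wpM2r// paE// HM//.
      exact: (frame_ainv_le F).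
    exact: (frame_ainv_le F).
have h0 t : 0 <= h t by rewrite mulr_ge0.
(* [K] measures the left-hand integral in terms of the image point [x = ainv t]. Its local growth
   rate is at most [2 psi w]; [itvint_by_parts_le] with [f = 1] turns this rate into an inequality
   of integrals. *)
pose K x := primitive h (a x).
have KE x y : 0 < x -> x <= y -> K y - K x = itvint h (a x) (a y).
  by move=> x0 xy; rewrite /K primitiveB// ?(frame_a0 F)//; exact: (frame_a_le F).
have Kdom (x y M : R) : 0 < x -> x <= y -> 0 <= M -> (forall z, x <= z -> z <= y -> psi z <= M) ->
    `|K y - K x| <= 2 * M * W x y.
  move=> x0 xy M0 HM; rewrite KE// ger0_norm ?itvint_ge0//; have ax0 := frame_a0 F x0.
  have y0 := lt_le_trans x0 xy.
  apply: (@le_trans _ _ (M * W (a x) (a y))); last first.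
    by rewrite [2 * M]mulrC -mulrA ler_wpM2l// (frame_W_a F).
  rewrite -(itvintZ _ _ (frame_w F) ax0); apply: itvint_mono => //.
    exact: locintZ (frame_w F).
  move=> t axt tay; have t0 := lt_le_trans ax0 axt.
  rewrite /h ler_wpM2r// paE// HM//; first by rewrite (frame_ainv_ge F).
  by rewrite -(frame_aK F y0) (frame_ainv_le F).
have main (al be : R) : 0 < al -> al < be -> itvint h (a al) (a be) <= 2 * itvint (fun x => psi x * w x) al be.
  move=> al0 albe.
  have [M M0 HM] := bnd _ _ al0 (ltW albe).
  have c1 : has_density (fun=> 1 : R) (fun=> 0 : R).
    split.
      split => // c d c0; have := @integrable0 _ _ R mu `[c, d]; by apply.
    move=> x y x0 xy; by rewrite subrr itvint_cst0.
  have m2 : measurable_fun setT (fun x => 2 * psi x) by exact: measurable_funM.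
  have cm2 (x : R) : 0 < x -> {for x, continuous (fun x => 2 * psi x)}.
    by move=> x0; apply: (@continuousM _ R^o); [exact: cst_continuous|exact: cpsi].
  have kC (x y : R) : al <= x -> x <= y -> y <= be -> `|K y - K x| <= 2 * M * W x y.
    move=> alx xy ybe; apply: Kdom => //; first exact: lt_le_trans alx.
    by move=> z xz zy; apply: HM; [exact: le_trans xz|exact: le_trans ybe].
  have km (x e : R) : al < x -> x < be -> 0 < e -> exists2 d, 0 < d &
      forall y, x <= y -> y <= x + d -> y <= be -> `|K y - K x| <= (2 * psi x + e) * W x y.
    move=> alx xbe e0; have x0 := lt_trans al0 alx.
    have e20 : 0 < e / 2 by rewrite divr_gt0.
    have /(@cvgrPdist_lt _ R^o)/(_ (e / 2) e20)/nbhs_ballP[d /= d0 Hd] := cpsi x x0.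
    exists (d / 2); first by rewrite divr_gt0.
    move=> y xy yd ybe.
    rewrite (_ : 2 * psi x + e = 2 * (psi x + e / 2)); last by field.
    apply: Kdom => //; first by rewrite addr_ge0// ltW.
    move=> z xz zy; have zd : z <= x + d / 2 := le_trans zy yd.
    have /Hd : ball x d z.
      rewrite /ball/= distrC ger0_norm ?subr_ge0//.
      have d2 : d / 2 < d by rewrite ltr_pdivrMr//; lra.
      by rewrite ltrBlDl (le_lt_trans zd)// ltrD2l.
    by rewrite ltr_distlC => /andP[_ /ltW].
  have := @itvint_by_parts_le R (fun=> 1) (fun=> 0) K w (fun x => 2 * psi x) al be (2 * M)
    (measurable_cst _) c1 (frame_w F) w0 m2 cm2 (fun x => mulr_ge0 (ler0n _ _) (psi0 x)) al0 albe kC km.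
  have -> : itvint (fun x => 0 * K x) al be = 0.
    rewrite (eq_itvint (g := fun=> 0)) => [|x _ _]; last by rewrite mul0r.
    by rewrite -(proj2 c1) ?subrr// ltW.
  rewrite sub0r normrN !mul1r KE ?(ltW albe)// ger0_norm ?itvint_ge0// => /le_trans; apply.
  rewrite -itvintZ//; last by apply: locint_cont => //; exact: (frame_w F).
  by rewrite le_eqVlt; apply/orP; left; apply/eqP; apply: eq_itvint => x _ _; rewrite normr1 mul1r mulrA.
have lpw : locint (fun t => psi t * w t) by apply: locint_cont => //; exact: (frame_w F).
apply: ge0_integral_Ipos_le.
- apply/measurable_EFinP/measurable_funM; first by apply: measurable_funTS; case: (frame_w F).
  by apply: measurable_comp_ainv F _ _; exact: measurable_funTS.
- by move=> x _; rewrite lee_fin mulr_ge0.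
move=> s t s0; rewrite le_eqVlt => /predU1P[<-|st].
  rewrite set_itv1 integral_set1 mule_ge0//; apply: integral_ge0 => x _.
  by rewrite lee_fin mulr_ge0.
have t0 := lt_trans s0 st.
have -> : (\int[mu]_(x in `[s, t]) (w x * psi (ainv x))%:E = (itvint h s t)%:E)%E.
  rewrite itvintE//; apply: eq_integral => x; rewrite inE/= in_itv/= => /andP[sx _].
  by rewrite /h paE ?(lt_le_trans s0)// mulrC.
have Xs : ainv s < ainv t by rewrite (frame_ainv_gt F) ?(frame_ainv0 F)// (frame_ainvK F).
have := main _ _ (frame_ainv0 F s0) Xs; rewrite !(frame_ainvK F)// -lee_fin => /le_trans; apply.
rewrite EFinM lee_wpmul2l// itvintE// ?(frame_ainv0 F)//.
rewrite integral_mkcond [leRHS]integral_mkcond; apply: ge0_le_integral_nm => x _.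
  by rewrite patchE; case: ifP => // _; rewrite lee_fin mulr_ge0.
rewrite !patchE; case: ifPn => [|_]; last by case: ifP => // _; rewrite lee_fin mulr_ge0.
rewrite inE/= in_itv/= => /andP[/(lt_le_trans (frame_ainv0 F s0)) x0 _].
rewrite mem_set; last by rewrite /Ipos/= in_itv/= x0.
by rewrite lee_fin [X in _ <= X]mulrC.
Qed.

Definition tail_const (p : R) := (3 `^ (1 + schur_exp p) / schur_exp p) `^ (dualexp p / p) * 2.
Definition high_const (p : R) :=
  2 * (2 `^ dualexp p * (1 + 2 `^ dualexp p * (2 + tail_const p))) `^ (dualexp p)^-1.

(** The derivative is moved from [f] onto a kernel that varies at the rate [2 w / rho]. What remains
    are the boundary values and an integral of [|f| w / rho]. *)
Lemma frame_by_parts (f q k : R -> R) (t : R) : measurable_fun setT f -> has_density f q -> 0 < t ->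
  (forall x y, t <= x -> x <= y -> y <= ainv t -> `|k y - k x| <= 2 * (rho x)^-1 * W x y) ->
  `|itvint (fun x => q x * k x) t (ainv t)| <= `|f (ainv t) * k (ainv t) - f t * k t| +
  2 * itvint (fun x => `| `|f x| * (1 * rhoV x * w x) |) t (ainv t).
Proof.
move=> mf fq t0 kH; have tX := frame_ainv_lt F t0.
have [m m0 Hm] := half_length_locmin F (ainv t) t0.
have cf (x : R) : 0 < x -> {for x, continuous (fun x => `|f x|)}.
  by move=> x0; apply: continuous_comp; [exact: has_density_continuous fq _|exact: norm_continuous].
have lG : locint (fun x => `|f x| * (1 * rhoV x * w x)).
  apply: locint_cont => //; first exact: measurableT_comp.
  by apply: locint_cont (measurable_rhoV F 1) (frame_w F) _ => x; exact: continuous_rhoV F _ _.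
have kE x : t <= x -> x <= ainv t -> 2 * rhoV x = 2 * (rho x)^-1.
  by move=> tx _; rewrite (frame_rhoVE F)// (lt_le_trans t0).
(* A crude constant on the compact interval suffices for absolute continuity; the sharp rate enters
   through [km]. *)
have kC x y : t <= x -> x <= y -> y <= ainv t -> `|k y - k x| <= 2 * m^-1 * W x y.
  move=> tx xy yX; apply: (le_trans (kH _ _ tx xy yX)).
  rewrite ler_wpM2r ?(frame_W0 F)// ler_pM2l// lef_pV2 ?posrE//.
    by apply: Hm => //; exact: le_trans yX.
  by have := half_length_gt0 F (lt_le_trans t0 tx).
have km (x e : R) : t < x -> x < ainv t -> 0 < e -> exists2 d, 0 < d &
    forall y, x <= y -> y <= x + d -> y <= ainv t -> `|k y - k x| <= (2 * rhoV x + e) * W x y.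
  move=> tx xX e0; exists 1 => // y xy _ yX; apply: (le_trans (kH _ _ (ltW tx) xy yX)).
  by rewrite ler_wpM2r ?(frame_W0 F)// kE ?lerDl ?(ltW e0)// ltW.
have H := @itvint_by_parts_le R f q k w (fun x => 2 * rhoV x) t (ainv t) (2 * m^-1) mf fq
  (frame_w F) (frame_w0 F) (measurable_rhoV F 2) (fun x x0 => continuous_rhoV F (k := 2) x0)
  (fun x => mulr_ge0 (ler0n _ _) (frame_rhoV_ge0 x)) t0 tX kC km.
rewrite -(itvintZ _ _ (locint_norm lG) t0).
have -> : itvint (fun x => 2 * `| `|f x| * (1 * rhoV x * w x) |) t (ainv t) =
    itvint (fun x => `|f x| * (2 * rhoV x * w x)) t (ainv t).
  apply: eq_itvint => x _ _; rewrite ger0_norm; first by ring.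
  by rewrite mulr_ge0// !mulr_ge0 ?frame_rhoV_ge0// (frame_w0 F).
rewrite -lerBlDl (le_trans _ H)//.
exact: lerB_dist.
Qed.

(** After integration by parts both functionals are dominated by [|f t| + |f (ainv t)| + J t], up to
    a factor 2. The first term is the assumption, the second is handled by [pushforward_ainv], the
    third by the Schur bound for the tail weight. *)
Lemma derivative_bound (f q : R -> R) (M : R) : has_density f q ->
  (\int[mu]_(x in Ipos) (`|f x * w x `^ p'^-1| `^ p')%:E <= M%:E)%E ->
  (frame_Gb p w a ainv (scale q) <= (high_const p * M `^ p'^-1)%:E)%E /\
  (frame_Gc p w a ainv (scale q) <= (high_const p * M `^ p'^-1)%:E)%E.
Proof.
move=> fq HM; have lq := proj1 fq.
have p0 := frame_p0 F; have pn0 : p != 0 by rewrite gt_eqF.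
have M0 : 0 <= M.
  by rewrite -lee_fin (le_trans _ HM)//; apply: integral_ge0 => t It; rewrite lee_fin powR_ge0.
pose f0 := f \_ Ipos.
have f0q : has_density f0 q by exact: has_density_patch.
have mf0 : measurable_fun setT f0 by exact: measurable_has_density_patch fq.
have f0E (x : R) : 0 < x -> f0 x = f x.
  by move=> x0; rewrite /f0 patchE mem_set// /Ipos/= in_itv/= x0.
have f00 x : x <= 0 -> f0 x = 0.
  by move=> x0; rewrite /f0 patchE memNset// /Ipos/= in_itv/= andbT; apply/negP; rewrite -leNgt.
have cf0 x : 0 < x -> {for x, continuous f0} by exact: has_density_continuous f0q.
have w0 := frame_w0 F.
have mw : measurable_fun setT w by case: (frame_w F).
have mnf0 : measurable_fun setT (fun x => `|f0 x|) by exact: measurableT_comp.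
have cnf0 (x : R) : 0 < x -> {for x, continuous (fun x => `|f0 x|)}.
  by move=> x0; apply: continuous_comp; [exact: cf0|exact: norm_continuous].
pose psi x := `|f0 x| `^ p'.
have mpsi : measurable_fun setT psi by exact: (measurableT_comp (measurable_powR _)).
have cpsi (x : R) : 0 < x -> {for x, continuous psi}.
  by move=> x0; apply: continuous_norm_powR (frame_p'0 F) _; exact: cf0.
have psi0 x : 0 <= psi x by exact: powR_ge0.
have wpsi (x : R) : 0 < x -> w x * psi x = `|f x * w x `^ p'^-1| `^ p'.
  move=> x0; rewrite normrM [`|w x `^ _|]ger0_norm ?powR_ge0// powRM ?powR_ge0//.
  by rewrite -powRrM mulVf// powRr1// mulrC /psi f0E.
have I1 : (\int[mu]_(t in Ipos) (w t * psi t)%:E <= M%:E)%E.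
  apply: le_trans HM; apply: ge0_le_integral_nm => t; first by rewrite lee_fin mulr_ge0.
  by rewrite /Ipos/= in_itv/= andbT => t0; rewrite wpsi.
have I2 : (\int[mu]_(t in Ipos) (w t * psi (ainv t))%:E <= (2 * M)%:E)%E.
  by apply: (le_trans (pushforward_ainv mpsi cpsi psi0)); rewrite EFinM lee_wpmul2l.
pose G x := `|f0 x| * (1 * rhoV x * w x).
have lrw : locint (fun x => 1 * rhoV x * w x).
  by apply: locint_cont (measurable_rhoV F 1) (frame_w F) _ => x; exact: continuous_rhoV F _ _.
have lG : locint G by exact: locint_cont.
have G0 x : 0 <= G x by rewrite !mulr_ge0// frame_rhoV_ge0.
pose J t := itvint (fun x => `|G x|) t (ainv t).
have I3 : (\int[mu]_(t in Ipos) (w t * J t `^ p')%:E <= (tail_const p * M)%:E)%E.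
  pose q1 x := w x `^ p^-1 * rhoV x.
  have d0 := schur_exp_gt0 F.
  apply: (@schur_itvint q1 tail G (fun x => `|f0 x| * w x `^ p'^-1)).
  - by rewrite divr_ge0 ?powR_ge0// ltW.
  - apply: measurable_funM; first exact: (measurableT_comp (measurable_powR _)).
    by have := measurable_rhoV F 1; apply: eq_measurable_fun => x _; rewrite mul1r.
  - by move=> x; rewrite mulr_ge0 ?powR_ge0.
  - move=> x x0; rewrite /q1 powRM ?powR_ge0// -powRrM mulVf// powRr1//.
    by rewrite /frame_rhoV (frame_rhoE F)// -powRrM mulN1r frame_tailE.
  - exact: schur_bound_tail F.
  - exact: lG.
  - by apply: measurable_funM => //; exact: (measurable_frame_wp F).
  - by move=> x; rewrite mulr_ge0 ?powR_ge0.
  - move=> x x0; rewrite ger0_norm// /G /q1 mul1r.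
    have wE : w x = w x `^ p^-1 * w x `^ p'^-1.
      by rewrite -powRD (frame_pp' F) ?powRr1// oner_eq0.
    rewrite {1}wE le_eqVlt; apply/orP; left; apply/eqP; ring.
  - apply: le_trans HM; rewrite [leRHS]integral_mkcond; apply: ge0_le_integral_nm => x _.
      by rewrite lee_fin powR_ge0.
    rewrite patchE; case: ifPn; rewrite ?notin_setE ?inE /Ipos/= in_itv/= andbT => x0.
      by rewrite lee_fin f0E// normrM [`|w x `^ _|]ger0_norm ?powR_ge0.
    by rewrite f00 ?normr0 ?mul0r ?powR0// leNgt; exact/negP.
have J0 t : 0 <= J t by exact: itvint_ge0.
have mJ : measurable_fun Ipos J by exact: measurable_frame_D F _ (locint_norm lG).
pose I t := `|f0 t| + (`|f0 (ainv t)| + J t).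
have mX : measurable_fun Ipos (fun t => `|f0 (ainv t)|).
  by apply: (measurable_comp_ainv F (g := fun x => `|f0 x|)); exact: measurable_funTS.
have mI : measurable_fun Ipos I.
  by apply: measurable_funD; [exact: measurable_funTS|exact: measurable_funD].
have I0 t : 0 <= I t by rewrite !addr_ge0.
pose K := 2 `^ p' * (1 + 2 `^ p' * (2 + tail_const p)).
have HI : (\int[mu]_(t in Ipos) (w t * I t `^ p')%:E <= (K * M)%:E)%E.
  pose k1 t := w t * psi t; pose k2 t := w t * psi (ainv t); pose k3 t := w t * J t `^ p'.
  have k10 t : 0 <= k1 t by rewrite mulr_ge0.
  have k20 t : 0 <= k2 t by rewrite mulr_ge0.
  have k30 t : 0 <= k3 t by rewrite mulr_ge0 ?powR_ge0.
  have mwI : measurable_fun Ipos w by exact: measurable_funTS.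
  have mk1 : measurable_fun Ipos k1 by apply: measurable_funM => //; exact: measurable_funTS.
  have mk2 : measurable_fun Ipos k2.
    apply: measurable_funM => //; apply: (measurable_comp_ainv F); exact: measurable_funTS.
  have mk3 : measurable_fun Ipos k3.
    by apply: measurable_funM => //; exact: (measurableT_comp (measurable_powR _)).
  have mk23 : measurable_fun Ipos (fun t => 2 `^ p' * (k2 t + k3 t)).
    by apply: measurable_funM => //; exact: measurable_funD.
  have k230 t : Ipos t -> 0 <= 2 `^ p' * (k2 t + k3 t) by move=> _; rewrite mulr_ge0 ?powR_ge0// addr_ge0.
  apply: (@le_trans _ _ (\int[mu]_(t in Ipos) ((2 `^ p')%:E * (k1 t + 2 `^ p' * (k2 t + k3 t))%:E))%E).
    apply: ge0_le_integral_nm => t _; first by rewrite lee_fin mulr_ge0 ?powR_ge0.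
    rewrite -EFinM lee_fin.
    apply: (@le_trans _ _ (w t * (2 `^ p' * (psi t + 2 `^ p' * (psi (ainv t) + J t `^ p'))))).
      rewrite ler_wpM2l//; apply: (le_trans (powR_add2 _ _ p'0)) => //; first by rewrite addr_ge0.
      by rewrite ler_wpM2l ?powR_ge0// lerD2l; exact: powR_add2.
    by rewrite le_eqVlt; apply/orP; left; apply/eqP; rewrite /k1 /k2 /k3; ring.
  rewrite (ge0_integralZl_EFin_in measurable_Ipos (powR_ge0 _ _)); last 2 first.
  - exact: measurable_funD.
  - by move=> t It; rewrite addr_ge0// k230.
  rewrite (ge0_integralD_EFin_in measurable_Ipos mk1 (fun t _ => k10 t) mk23 k230).
  under [X in (_ * (_ + X) <= _)%E]eq_integral do rewrite EFinM.
  rewrite (ge0_integralZl_EFin_in measurable_Ipos (powR_ge0 _ _)); last 2 first.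
  - exact: measurable_funD.
  - by move=> t It; rewrite addr_ge0.
  rewrite (ge0_integralD_EFin_in measurable_Ipos mk2 (fun t _ => k20 t) mk3 (fun t _ => k30 t)).
  have -> : (K * M)%:E = ((2 `^ p')%:E * (M%:E + (2 `^ p')%:E * ((2 * M)%:E + (tail_const p * M)%:E)))%E.
    by rewrite -!(EFinM, EFinD) /K; congr EFin; ring.
  rewrite lee_wpmul2l ?lee_fin ?powR_ge0//; apply: leeD => //.
  by rewrite lee_wpmul2l ?lee_fin ?powR_ge0//; exact: leeD.
have tc0 : 0 <= tail_const p by rewrite mulr_ge0 ?powR_ge0.
have K0 : 0 <= K.
  by rewrite mulr_ge0 ?powR_ge0// addr_ge0// mulr_ge0 ?powR_ge0// addr_ge0.
have cE : high_const p * M `^ p'^-1 = 2 * (K * M) `^ p'^-1.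
  by rewrite /high_const -mulrA -powRM.
have h2 (x : R) : 0 <= x -> x <= 2 * x by move=> x0; lra.
rewrite cE frame_GcE; split; apply: (pow_bound (ler0n R 2) mI (fun t _ => I0 t) _ HI) => t t0.
  rewrite (frame_B_scale F)//; have rt0 := half_length_gt0 F t0.
  apply: (le_trans (frame_by_parts mf0 f0q t0 _)).
    move=> x y tx xy yX; have y0 := lt_le_trans t0 (le_trans tx xy).
    have [x0 axt _ _ rx0] := frame_comp F t0 tx (le_trans xy yX).
    have [_ ayt _ Wy ry0] := frame_comp F t0 (le_trans tx xy) yX.
    have [l1 l2] := half_length_lip F x0 xy.
    have WA := frame_W_a F x0 xy.
    have WE : W (a x) t = W (a x) (a y) + W (a y) t.
      by rewrite (itvintD (frame_w F) (frame_a0 F x0) (frame_a_le F x0 xy) ayt).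
    have W0a := frame_W0 F (a x) (a y); have W0 := frame_W0 F x y; have W0t := frame_W0 F (a y) t.
    rewrite WE; exact: (kernel_lip_B rx0 ry0 W0 W0a WA W0t Wy l1 l2).
  (* The kernel vanishes at [ainv t], because [a (ainv t) = t], and equals 1/2 at [t]. *)
  rewrite (frame_ainvK F)// itvintxx mul0r mulr0 sub0r normrN -half_lengthE normrM.
  have -> : `|rho t / (2 * rho t)| = 2^-1.
    have rn0 : rho t != 0 by rewrite gt_eqF.
    by rewrite invfM mulrCA mulfV// mulr1 ger0_norm.
  rewrite /I !mulrDr; apply: lerD; last by rewrite lerDr mulr_ge0.
  by rewrite mulrC ler_wpM2r//; lra.
rewrite (frame_D_scale F)//; have rt0 := half_length_gt0 F t0.
have tX := ltW (frame_ainv_lt F t0).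
apply: (le_trans (frame_by_parts mf0 f0q t0 _)).
  move=> x y tx xy yX; have y0 := lt_le_trans t0 (le_trans tx xy).
  have [x0 axt _ _ rx0] := frame_comp F t0 tx (le_trans xy yX).
  have [_ ayt rty _ ry0] := frame_comp F t0 (le_trans tx xy) yX.
  have [l1 l2] := half_length_lip F x0 xy.
  exact: (kernel_lip_D rt0 rx0 ry0 (frame_W0 F x y) rty l1 l2).
(* Here both boundary terms stay: the kernel is 1 at [t] and at most 2 at [ainv t]. *)
have [X0 _ rX _ rX0] := frame_comp F t0 tX (lexx _).
rewrite divff ?gt_eqF// mulr1 /I addrA mulrDr; apply: lerD => //.
apply: (le_trans (ler_normB _ _)); rewrite mulrDr [X in _ <= X]addrC; apply: lerD; last exact: h2.
rewrite normrM mulrC ler_wpM2r// ger0_norm ?divr_ge0 ?(ltW rt0) ?(ltW rX0)//.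
by rewrite ler_pdivrMr.
Qed.

End operator_bounds.

(** * Oscillating tests and compact support *)

Section composition.
Context {R : realType}.
Local Notation mu := (@lebesgue_measure R).
Local Notation mR := (measurableTypeR R).

Lemma has_density_comp (G g h : R -> R) (L : R) : locint h -> measurable_fun setT g ->
  (forall y : R, is_derive y 1 G (g y)) -> (forall y, `|g y| <= L) ->
  has_density (fun t => G (primitive h t)) (fun t => g ((primitive h \_ Ipos) t) * h t).
Proof.
move=> lh mg dG gL.
have lnh := locint_norm lh.
have L0 : 0 <= L by apply: le_trans (gL 0).
have mp : measurable_fun (setT : set mR) (primitive h \_ Ipos : mR -> R).
  exact: measurable_has_density_patch (has_density_primitive lh).
split.
  apply: (locint_dom (g := fun t => L * `|h t|)).
  - apply: measurable_funM; last by case: lh.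
    exact: (measurableT_comp mg).
  - exact: locintZ.
  - by move=> t _; rewrite normrM ler_wpM2r.
move=> x y x0; rewrite le_eqVlt => /predU1P[<-|xy]; first by rewrite subrr itvintxx.
pose B := `|primitive h x| + itvint (fun t => `|h t|) x y.
have rng z : x <= z -> z <= y -> - B <= primitive h z + 0 <= B.
  move=> xz zy; rewrite addr0 -ler_norml.
  exact: (has_density_bound (has_density_primitive lh) x0 xz zy).
have [|ig GE] := @itvint_comp_primitive R h G g 0 (- B) B L x y lh x0 xy mg rng.
  by move=> z _; exact: gL.
rewrite !addr0 in GE; rewrite GE; apply: eq_itvint => t xt ty.
by rewrite addr0 patchE mem_set// /Ipos/= in_itv/= (lt_le_trans x0).
Qed.

Lemma has_density_mul (f g q h : R -> R) : has_density f q -> has_density g h ->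
  has_density (fun t => f t * g t)
    (fun t => q t * (g \_ Ipos) t + (f \_ Ipos) t * h t).
Proof.
move=> fq gh.
have f0q := has_density_patch fq; have g0h := has_density_patch gh.
have l1 : locint (fun t => (f \_ Ipos) t * h t).
  apply: locint_cont; [exact: measurable_has_density_patch fq|by case: gh|].
  by move=> x; exact: has_density_continuous f0q.
have l2 : locint (fun t => q t * (g \_ Ipos) t).
  have : locint (fun t => (g \_ Ipos) t * q t).
    apply: locint_cont; [exact: measurable_has_density_patch gh|by case: fq|].
    by move=> x; exact: has_density_continuous g0h.
  by congr locint; apply/funext => t; rewrite mulrC.
split; first exact: locintD.
move=> x y x0 xy; have [_ E] := itvint_by_parts fq gh x0 xy.
rewrite -E; apply: eq_itvint => t xt _.
have tI : t \in (Ipos : set R) by rewrite inE /Ipos/= in_itv/= (lt_le_trans x0 xt).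
by rewrite !patchE tI.
Qed.

End composition.

Section oscillating_tests.
Context {R : realType} {p : R} {w u a b ainv : R -> R}.
Hypothesis F : interval_frame p w u a b ainv.
Local Notation mu := (@lebesgue_measure R).
Local Notation W := (itvint w).
Local Notation p' := (dualexp p).
Local Notation mR := (measurableTypeR R).
Local Notation scale := (frame_scale w a).

Opaque itvint half_length powR frame_tail frame_D frame_B.

(** This is [Wnorm] expressed through the frame, as [WnormE] shows. *)
Definition frame_norm (p : R) (w a ainv g : R -> R) : \bar R :=
  (frame_Gb p w a ainv (frame_scale w a g) + frame_Gc p w a ainv (frame_scale w a g))%E.
Local Notation nrm := (frame_norm p w a ainv).

Let Phi := primitive w.
(** The derivative of the arctangent. Composed with a primitive of [w] it is positive everywhere,
    while its integral against [w] is at most pi whatever the total mass of [w]. *)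
Definition bump (y : R) := (1 + y ^+ 2)^-1.

Lemma bump_den (y : R) : 0 < 1 + y ^+ 2 :> R.
Proof. by rewrite ltr_pwDl// sqr_ge0. Qed.

Lemma bump_gt0 y : 0 < bump y.
Proof. by rewrite invr_gt0 bump_den. Qed.

Lemma bump_le1 y : bump y <= 1.
Proof. by rewrite invf_le1 ?bump_den// lerDl sqr_ge0. Qed.

Lemma is_derive_bump (y : R) : is_derive y 1 bump (- (2 * y) * bump y ^+ 2).
Proof.
have dd : is_derive y 1 (fun y : R => 1 + y ^+ 2) (2 * y).
  have -> : (fun y : R => 1 + y ^+ 2) = cst 1 + (@id R) ^+ 2 by [].
  apply: is_derive_eq; rewrite /GRing.scale/= add0r mulr1 expr1.
  by [].
have := @is_deriveV R (fun y => 1 + y ^+ 2) y (2 * y) 1 (lt0r_neq0 (bump_den y)) dd.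
by rewrite /GRing.scale/= /bump mulrC exprVn mulNr mulrN.
Qed.

Lemma bump_derive_le1 y : `|- (2 * y) * bump y ^+ 2| <= 1.
Proof.
have b0 := bump_gt0 y; have d0 := bump_den y.
rewrite normrM normrN [`|_ ^+ 2|]ger0_norm ?sqr_ge0// expr2 mulrA.
apply: (@le_trans _ _ (1 * bump y)); last by rewrite mul1r bump_le1.
rewrite ler_pM2r// /bump ler_pdivrMr// mul1r normrM ger0_norm//.
have := sqr_ge0 (`|y| - 1); rewrite sqrrB1 real_normK ?num_real// => h.
by move: h; rewrite mulr2n; lra.
Qed.

Lemma measurable_bump : measurable_fun (setT : set mR) (bump : mR -> R).
Proof.
apply: continuous_measurable_fun => y; apply/differentiable_continuous/derivable1_diffP.
by have [] := is_derive_bump y.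
Qed.

Let eta t := bump (Phi t).
Let deta t := - (2 * (Phi \_ Ipos) t) * bump ((Phi \_ Ipos) t) ^+ 2 * w t.

Let etaD : has_density eta deta.
Proof.
apply: (has_density_comp (g := fun y => - (2 * y) * bump y ^+ 2) (L := 1)).
- exact: (frame_w F).
- apply: measurable_funM; first by apply: measurableT_comp => //; exact: measurable_funM.
  by apply: measurable_funX; exact: measurable_bump.
- exact: is_derive_bump.
- exact: bump_derive_le1.
Qed.

Lemma itvint_bump x y : 0 < x -> x <= y ->
  itvint (fun t => bump ((Phi \_ Ipos) t) * w t) x y <= pi.
Proof.
move=> x0 xy.
have [|_ E] := @has_density_comp R atan bump w 1 (frame_w F) measurable_bump.
  by move=> y1; rewrite ger0_norm ?bump_le1// ltW// bump_gt0.
rewrite -E//.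
have := atan_ltpi2 (primitive w y); have := atan_gtNpi2 (primitive w x).
by move: (atan _) (atan _) pi => *; lra.
Qed.

(** As [eta <= 1] and [p' >= 1], the power [|phi|^p'] is at most [eta], whose integral against [w]
    is at most pi; [derivative_bound] concludes. *)
Let test_norm (phi q : R -> R) : has_density phi q ->
  (forall t : R, 0 < t -> `|phi t| <= eta t) -> (nrm q < +oo)%E.
Proof.
move=> phiq phi_eta.
have p'0 := frame_p'0 F.
have p'1 : 1 <= p'.
  rewrite /dualexp ler_pdivlMr ?(frame_p10 F)//; lra.
have H : (\int[mu]_(x in Ipos) (`|phi x * w x `^ p'^-1| `^ p')%:E <= pi%:E)%E.
  apply: (@le_trans _ _ (\int[mu]_(x in Ipos) (bump ((Phi \_ Ipos) x) * w x)%:E)%E).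
    apply: ge0_le_integral_nm => x; first by rewrite lee_fin powR_ge0.
    rewrite /Ipos/= in_itv/= andbT => x0; rewrite lee_fin normrM [`|w x `^ _|]ger0_norm ?powR_ge0//.
    rewrite powRM ?powR_ge0// -powRrM mulVf ?gt_eqF// powRr1 ?(frame_w0 F)//.
    rewrite ler_wpM2r ?(frame_w0 F)// patchE mem_set ?/Ipos/= ?in_itv/= ?x0//.
    apply: (@le_trans _ _ (eta x `^ p')); first by apply: powR_ler; rewrite ?(ltW p'0)// phi_eta.
    apply: (@le_trans _ _ (eta x `^ 1)); last by rewrite powRr1// ltW// bump_gt0.
    by apply: ger_powR => //; rewrite bump_gt0 bump_le1.
  apply: ge0_integral_Ipos_le.
  - apply/measurable_EFinP/measurable_funM; last by apply: measurable_funTS; case: (frame_w F).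
    apply: measurable_funTS; apply: (measurableT_comp measurable_bump).
    exact: measurable_has_density_patch (has_density_primitive (frame_w F)).
  - by move=> x _; rewrite lee_fin mulr_ge0 ?(frame_w0 F)// ltW// bump_gt0.
  - move=> x y x0 xy; rewrite -itvintE ?lee_fin ?itvint_bump//.
    apply: locint_dom (frame_w F) _.
      apply: measurable_funM; last by case: (frame_w F).
      apply: (measurableT_comp measurable_bump).
      exact: measurable_has_density_patch (has_density_primitive (frame_w F)).
    move=> t _; rewrite normrM !ger0_norm ?(frame_w0 F) ?(ltW (bump_gt0 _))//.
    by rewrite -[leRHS]mul1r ler_wpM2r ?(frame_w0 F)// bump_le1.
have [h1 h2] := derivative_bound F phiq H.
by rewrite /frame_norm (le_lt_trans (leeD h1 h2))// -EFinD ltry.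
Qed.

(* The tests are the derivatives of [eta sin T] and [eta cos T], where [T] is a
   primitive of [theta]: their amplitude [eta] does not see [theta], but their
   derivatives do. *)
Lemma oscillating_tests (theta : R -> R) : locint theta -> exists q1 q2 : R -> R,
  [/\ locint q1, locint q2, (nrm q1 < +oo)%E, (nrm q2 < +oo)%E &
   forall t : R, 0 < t -> bump (Phi t) * `|theta t| <= `|q1 t| + `|q2 t|].
Proof.
move=> lt.
have ms : measurable_fun setT (@sin R) by apply: continuous_measurable_fun; exact: continuous_sin.
have mc : measurable_fun setT (@cos R) by apply: continuous_measurable_fun; exact: continuous_cos.
have mns : measurable_fun setT (fun y : R => - sin y) by exact: measurableT_comp.
have dS := has_density_comp lt mc (@is_derive_sin R) (@cos_max R).
have nsin (y : R) : `|- sin y| <= 1 by rewrite normrN sin_max.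
have dC := has_density_comp lt mns (@is_derive_cos R) nsin.
have d1 := has_density_mul etaD dS; have d2 := has_density_mul etaD dC.
exists (fun t => deta t * ((sin \o primitive theta) \_ Ipos) t + (eta \_ Ipos) t * (cos ((primitive theta \_ Ipos) t) * theta t)),
  (fun t => deta t * ((cos \o primitive theta) \_ Ipos) t + (eta \_ Ipos) t * (- sin ((primitive theta \_ Ipos) t) * theta t)).
have e0 t : 0 <= eta t by exact/ltW/bump_gt0.
split.
- by case: d1.
- by case: d2.
- apply: test_norm d1 _ => t t0; rewrite normrM ger0_norm// -[leRHS]mulr1.
  by rewrite ler_wpM2l// sin_max.
- apply: test_norm d2 _ => t t0; rewrite normrM ger0_norm// -[leRHS]mulr1.
  by rewrite ler_wpM2l// cos_max.
move=> t t0; have tI : t \in (Ipos : set R) by rewrite inE /Ipos/= in_itv/= t0.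
rewrite !patchE tI /=; set S := sin _; set C := cos _.
set q1 := (X in _ <= `|X| + _); set q2 := (X in _ <= _ + `|X|).
(* This combination eliminates the derivative of [eta] and leaves [eta theta (cos^2 + sin^2)]. *)
have -> : bump (Phi t) * `|theta t| = `|C * q1 - S * q2|.
  rewrite -[bump _](ger0_norm (e0 t)) -normrM; congr `|_|.
  rewrite (_ : C * q1 - S * q2 = eta t * theta t * (C ^+ 2 + S ^+ 2)); last by rewrite /q1 /q2; ring.
  by rewrite cos2Dsin2 mulr1.
apply: (le_trans (ler_normB _ _)); rewrite !normrM; apply: lerD.
  by rewrite -[leRHS]mul1r ler_wpM2r// cos_max.
by rewrite -[leRHS]mul1r ler_wpM2r// sin_max.
Qed.

End oscillating_tests.

Section compact_support.
Context {R : realType} {p : R} {w u a b ainv : R -> R}.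
Hypothesis F : interval_frame p w u a b ainv.
Local Notation mu := (@lebesgue_measure R).
Local Notation W := (itvint w).
Local Notation p' := (dualexp p).
Local Notation mR := (measurableTypeR R).
Local Notation nrm := (frame_norm p w a ainv).

Opaque itvint half_length powR frame_tail frame_D frame_B.

Let eta t := bump ((primitive w \_ Ipos) t).

Lemma bump_prim_gt0 t : 0 < eta t. Proof. exact: bump_gt0. Qed.

Lemma measurable_bump_prim : measurable_fun setT eta.
Proof.
apply: (measurableT_comp (measurable_bump (R := R))).
exact: measurable_has_density_patch (has_density_primitive (frame_w F)).
Qed.

Variable f : R -> R.
Hypothesis mf : measurable_fun setT f.
Hypothesis fD : forall g, locint g -> (nrm g < +oo)%E ->
  (\int[mu]_(x in Ipos) (`|f x * g x|)%:E < +oo)%E.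

(** No growth condition at 0 or infinity is put on [theta]; this freedom is what forces compact
    support. *)
Lemma weighted_finite (theta : R -> R) : locint theta ->
  (\int[mu]_(x in Ipos) (`|f x| * eta x * `|theta x|)%:E < +oo)%E.
Proof.
move=> /(oscillating_tests F)[q1 [q2 [l1 l2 n1 n2 H]]].
apply: (@le_lt_trans _ _ (\int[mu]_(x in Ipos) (`|f x * q1 x| + `|f x * q2 x|)%:E)%E).
  apply: ge0_le_integral_nm => x; first by rewrite lee_fin !mulr_ge0// ltW// bump_prim_gt0.
  rewrite /Ipos/= in_itv/= andbT => x0; rewrite lee_fin !normrM -mulrDr -mulrA ler_wpM2l//.
  have := H x x0; rewrite /eta patchE mem_set//.
  by rewrite /Ipos/= in_itv/= x0.
have mM g : locint g -> measurable_fun Ipos (fun x => `|f x * g x|).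
  move=> [mg _]; apply: measurable_funTS; apply: measurableT_comp => //.
  exact: measurable_funM.
rewrite (ge0_integralD_EFin_in measurable_Ipos (mM _ l1) (fun _ _ => normr_ge0 _) (mM _ l2) (fun _ _ => normr_ge0 _)).
by rewrite lte_add_pinfty// fD.
Qed.

(** On [[c, d]] the bump is at least [1 / (1 + B^2)], so a constant [theta] is enough. *)
Lemma test_locint : locint f.
Proof.
split => // c d c0; apply/integrableP; split.
  by apply/measurable_EFinP; exact: measurable_funTS.
pose B := `|primitive w c| + itvint (fun t => `|w t|) c d.
have bB t : c <= t -> t <= d -> (1 + B ^+ 2)^-1 <= eta t.
  move=> ct td; have t0 := lt_le_trans c0 ct.
  rewrite /eta patchE mem_set; last by rewrite /Ipos/= in_itv/= t0.
  rewrite lef_pV2 ?posrE ?bump_den// lerD2l -[leLHS]real_normK ?num_real//.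
  apply: lerXn2r; rewrite ?nnegrE// ?addr_ge0 ?itvint_ge0//.
  exact: (has_density_bound (has_density_primitive (frame_w F)) c0 ct td).
have d0 : 0 < 1 + B ^+ 2 := bump_den B.
have wf := weighted_finite (locint_cst (1 + B ^+ 2)).
apply: le_lt_trans wf; rewrite integral_mkcond [leRHS]integral_mkcond.
apply: ge0_le_integral_nm => t _; first by rewrite patchE; case: ifP => // _; exact: abse_ge0.
rewrite !patchE; case: ifPn => [|_]; last first.
  by case: ifP => // _; rewrite lee_fin !mulr_ge0// ltW// bump_prim_gt0.
rewrite inE/= in_itv/= => /andP[ct td]; have t0 := lt_le_trans c0 ct.
rewrite mem_set; last by rewrite /Ipos/= in_itv/= t0.
rewrite lee_fin -mulrA -[leLHS]mulr1 ler_wpM2l// ger0_norm ?(ltW d0)//.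
by rewrite -ler_pdivrMr// mul1r bB.
Qed.

Let k0 t := `|f t| * eta t.

Let mk0 : measurable_fun setT k0.
Proof.
by apply: measurable_funM; [exact: measurableT_comp|exact: measurable_bump_prim].
Qed.

Let k00 t : 0 <= k0 t.
Proof. by rewrite mulr_ge0// ltW// bump_prim_gt0. Qed.

(** Neighbourhoods of the two ends of the half-line, shrinking as [s] grows. *)
Let B (s : R) : set mR := (`]0, s^-1[ `|` `]s, +oo[)%classic.

Let mB s : measurable (B s).
Proof. by apply: measurableU; exact: measurable_itvR. Qed.

Let BE s x : 0 < s -> B s x <-> 0 < x /\ (x < s^-1 \/ s < x).
Proof.
move=> s0; rewrite /B /= !in_itv/= andbT; split.
  by move=> [/andP[x0 xs]|sx]; split; [|left| exact: lt_trans sx|right].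
by move=> [x0 [xs|sx]]; [left; rewrite x0|right].
Qed.

Let BI s : 0 < s -> B s `<=` Ipos.
Proof. by move=> s0 x /(BE _ s0)[x0 _]; rewrite /Ipos/= in_itv/= x0. Qed.

Let BS s s' : 0 < s -> s <= s' -> B s' `<=` B s.
Proof.
move=> s0 ss' x /(BE _ (lt_le_trans s0 ss'))[x0 h]; apply/(BE _ s0); split => //.
case: h => [h|h]; [left|right]; last exact: le_lt_trans h.
by apply: (lt_le_trans h); rewrite lef_pV2 ?posrE// (lt_le_trans s0).
Qed.

Let le_subset (A C : set mR) (h : R -> R) : (forall x, 0 <= h x) -> A `<=` C ->
  (\int[mu]_(x in A) (h x)%:E <= \int[mu]_(x in C) (h x)%:E)%E.
Proof.
move=> h0 AC; rewrite integral_mkcond [leRHS]integral_mkcond.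
apply: ge0_le_integral_nm => x _; rewrite patchE; first by case: ifP => // _; rewrite lee_fin.
rewrite patchE; case: ifPn => [/set_mem/AC xC|_]; first by rewrite mem_set.
by case: ifP => // _; rewrite lee_fin.
Qed.

Let k0_fin : (\int[mu]_(x in Ipos) (k0 x)%:E < +oo)%E.
Proof.
have := weighted_finite (locint_cst 1); congr (_ < _)%E.
by apply: eq_integral => x _; rewrite normr1 mulr1.
Qed.

Let T s := fine (\int[mu]_(x in B s) (k0 x)%:E)%E.

Let TE s : 0 < s -> (T s)%:E = (\int[mu]_(x in B s) (k0 x)%:E)%E.
Proof.
move=> s0; rewrite fineK// ge0_fin_numE; last by apply: integral_ge0 => x _; rewrite lee_fin.
exact: le_lt_trans (le_subset k00 (BI s0)) k0_fin.
Qed.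

Let Tle s s' : 0 < s -> s <= s' -> T s' <= T s.
Proof.
move=> s0 ss'; rewrite -lee_fin !TE//; last exact: lt_le_trans ss'.
by apply: le_subset => //; exact: BS.
Qed.

(** If every [B s] carried at least 1, the integral over each compact interval, hence over the
    half-line, would be at most its own total minus 1. *)
Let tail_small (k : R -> R) : measurable_fun Ipos k -> (forall x, 0 <= k x) ->
  (\int[mu]_(x in Ipos) (k x)%:E < +oo)%E ->
  exists2 s, 1 <= s & (\int[mu]_(x in B s) (k x)%:E < 1)%E.
Proof.
move=> mk kp kfin; apply: contrapT => Hn.
have {}Hn s : 1 <= s -> (1 <= \int[mu]_(x in B s) (k x)%:E)%E.
  by move=> s1; rewrite leNgt; apply/negP => h; apply: Hn; exists s.
have [S SE] : exists S : R, (\int[mu]_(x in Ipos) (k x)%:E = S%:E)%E.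
  exists (fine (\int[mu]_(x in Ipos) (k x)%:E)%E); rewrite fineK// ge0_fin_numE//.
  by apply: integral_ge0 => x _; rewrite lee_fin.
have : (\int[mu]_(x in Ipos) (k x)%:E <= (S - 1)%:E)%E.
  apply: ge0_integral_Ipos_le => //; first exact/measurable_EFinP.
    by move=> x _; rewrite lee_fin.
  move=> x y x0 xy; have y0 := lt_le_trans x0 xy.
  pose s := Num.max 1 (Num.max y x^-1).
  have s1 : 1 <= s by rewrite le_max lexx.
  have s0 : 0 < s := lt_le_trans ltr01 s1.
  have ys : y <= s by rewrite !le_max lexx !orbT.
  have xs : x^-1 <= s by rewrite !le_max lexx !orbT.
  rewrite EFinB leeBrDr//; apply: (@le_trans _ _ (\int[mu]_(t in `[x, y]) (k t)%:E + \int[mu]_(t in B s) (k t)%:E)%E).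
    by rewrite leeD2l// Hn.
  have dis : [disjoint (`[x, y]%classic : set R) & B s].
    apply/disj_setPS => t [/=]; rewrite in_itv/= => /andP[xt ty] /(BE _ s0)[t0 []].
      move=> ts; have : x < s^-1 by exact: le_lt_trans ts.
      by rewrite -[x]invrK ltf_pV2 ?posrE ?invr_gt0// ltNge xs.
    by rewrite ltNge (le_trans ty).
  have sub : (`[x, y]%classic : set R) `|` B s `<=` Ipos.
    move=> t [/=|/(BI s0)//]; rewrite in_itv/= /Ipos/= in_itv/= andbT => /andP[xt _].
    exact: lt_le_trans xt.
  rewrite -ge0_integral_setU//; first by rewrite -SE; exact: le_subset.
  - apply/measurable_EFinP; apply: measurable_funS mk => //; exact: measurable_Ipos.
  - by move=> t _; rewrite lee_fin.
by rewrite SE lee_fin; lra.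
Qed.

(** If the mass [T s] of [k0] on [B s] never vanished, let [theta x = 1 / T (max(1, x, 1/x))]. It is
    locally bounded since [T] decreases, yet [k0 theta] has integral at least [T s / T s = 1] over
    every [B s], contradicting [tail_small]. *)
Lemma test_compact : exists2 s : R, 1 <= s &
  {ae mu, forall x : R, 0 < x -> x < s^-1 \/ s < x -> f x = 0}.
Proof.
have [[s s1 Ts]|Tn] := pselect (exists2 s : R, 1 <= s & T s = 0).
  have s0 : 0 < s := lt_le_trans ltr01 s1.
  exists s => //.
  have : (\int[mu]_(x in B s) `|(k0 x)%:E| = 0)%E.
    transitivity (\int[mu]_(x in B s) (k0 x)%:E)%E; last by rewrite -TE// Ts.
    by apply: eq_integral => x _; rewrite gee0_abs// lee_fin.
  have mkB : measurable_fun (B s) (fun x => (k0 x)%:E).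
    by apply/measurable_EFinP; exact: measurable_funTS.
  move/(ae_eq_integral_abs mu (mB s) mkB); apply: ae_impl => x h x0 xs.
  have /h[/eqP] : B s x by apply/(BE _ s0).
  by rewrite mulf_eq0 normr_eq0 (gt_eqF (bump_prim_gt0 x)) orbF => /eqP.
have Tp s : 1 <= s -> 0 < T s.
  move=> s1; have s0 : 0 < s := lt_le_trans ltr01 s1.
  rewrite lt_neqAle eq_sym; apply/andP; split.
    by apply/eqP => h; apply: Tn; exists s.
  by rewrite -lee_fin TE//; apply: integral_ge0 => x _; rewrite lee_fin.
pose sg (x : R) := Num.max 1 (Num.max x (x `^ (-1))).
(* The extra maximum makes [y |-> T (max(1, y))] monotone on the whole line, hence measurable. *)
pose theta x := T (Num.max 1 (sg x)) `^ (-1).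
have mT : measurable_fun (setT : set mR) (fun y : mR => T (Num.max 1 y)).
  apply: nonincreasing_measurable => // s s' ss'.
  apply: Tle; first by rewrite lt_max ltr01.
  by rewrite ge_max !le_max lexx ss' orbT.
have msg : measurable_fun (setT : set mR) (sg : mR -> R).
  by apply: measurable_maxr => //; apply: measurable_maxr => //; exact: measurable_powR.
have mth : measurable_fun setT theta.
  exact: (measurableT_comp (measurable_powR _) (measurableT_comp mT msg)).
have sg1 x : 1 <= sg x by rewrite le_max lexx.
have thE x : theta x = (T (sg x))^-1.
  by rewrite /theta max_r// powR_inv1// ltW// Tp.
have th0 x : 0 <= theta x by rewrite thE invr_ge0 ltW// Tp.
have lth : locint theta.
  split => // c d c0; pose s0 := Num.max 1 (Num.max d c^-1).
  have s01 : 1 <= s0 by rewrite le_max lexx.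
  apply: le_integrable (proj2 (locint_cst (T s0)^-1) c d c0).
  - exact: measurable_itvR.
  - by apply/measurable_EFinP; exact: measurable_funTS.
  move=> t /=; rewrite in_itv/= => /andP[ct td]; have t0 := lt_le_trans c0 ct.
  rewrite lee_fin !ger0_norm ?th0 ?invr_ge0 ?(ltW (Tp _ _))// thE lef_pV2 ?posrE ?Tp//.
  apply: Tle; first exact: lt_le_trans (sg1 t).
  rewrite /sg /s0 !ge_max !le_max lexx td orbT/= powR_inv1 ?(ltW t0)//.
  by rewrite lef_pV2 ?posrE// ct !orbT.
have := weighted_finite lth.
have -> : (\int[mu]_(x in Ipos) (`|f x| * eta x * `|theta x|)%:E = \int[mu]_(x in Ipos) (k0 x * theta x)%:E)%E.
  by apply: eq_integral => x _; rewrite [`|theta x|]ger0_norm.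
move=> fin; have mkt : measurable_fun Ipos (fun x => k0 x * theta x).
  by apply: measurable_funTS; exact: measurable_funM.
have [s s1] := tail_small mkt (fun x => mulr_ge0 (k00 x) (th0 x)) fin.
have s0 : 0 < s := lt_le_trans ltr01 s1.
rewrite ltNge => /negP; case.
apply: (@le_trans _ _ (\int[mu]_(x in B s) ((T s)^-1%:E * (k0 x)%:E))%E).
  rewrite (ge0_integralZl_EFin_in (mB s)); last 3 first.
  - by rewrite invr_ge0 ltW// Tp.
  - exact: measurable_funTS.
  - by [].
  by rewrite -TE// -EFinM mulVf// gt_eqF// Tp.
apply: ge0_le_integral_nm => x.
  by move=> _; rewrite -EFinM lee_fin mulr_ge0// invr_ge0 ltW// Tp.
move=> /(BE _ s0)[x0 h]; rewrite -EFinM lee_fin mulrC ler_wpM2l// thE lef_pV2 ?posrE ?Tp//.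
apply: Tle => //; rewrite /sg !le_max powR_inv1 ?(ltW x0)//.
case: h => [xs|sx]; last by rewrite (ltW sx) orbT.
have : s <= x^-1 by rewrite -[s]invrK lef_pV2 ?posrE ?invr_gt0// ltW.
by move=> ->; rewrite !orbT.
Qed.

End compact_support.

(** * Recovering a Sobolev function from its pairings *)

Section clamped_sums.
Context {R : realType}.
Local Notation mu := (@lebesgue_measure R).
Local Notation mR := (measurableTypeR R).

(** Its density is the indicator of [[s, t]], and its difference quotient with step [h] is the
    trapezoid used as a test function. *)
Definition clamp (s t x : R) := Num.min (Num.max x s) t.

Variant clamp_spec (s t x : R) : R -> Prop :=
  | ClampL of x <= s : clamp_spec s t x s
  | ClampM of s <= x & x <= t : clamp_spec s t x x
  | ClampR of t <= x : clamp_spec s t x t.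

Lemma clampP s t x : s <= t -> clamp_spec s t x (clamp s t x).
Proof.
move=> st; rewrite /clamp; have [xs|sx] := leP x s; first by rewrite min_l//; exact: ClampL.
by have [xt|tx] := leP x t; [apply: ClampM => //; exact: ltW|apply: ClampR; exact: ltW].
Qed.

Lemma clamp_shift s t h x : clamp (s - h) (t - h) x + h = clamp s t (x + h).
Proof. by rewrite /clamp addr_minl addr_maxl !subrK. Qed.

(** The intervals follow one another, so at most one clamp moves at a time. The induction needs the
    sharper bound by the increment of [Num.min _ (t n)]. *)
Lemma clamp_sum_lip n (s t : nat -> R) (x y : R) : x <= y ->
  (forall k, (k < n)%N -> s k <= t k) -> (forall k, (k.+1 < n)%N -> t k <= s k.+1) ->
  \sum_(k < n) (clamp (s k) (t k) y - clamp (s k) (t k) x) <= y - x.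
Proof.
move=> xy; case: n => [|n] st ts; first by rewrite big_ord0 subr_ge0.
suff H : \sum_(k < n.+1) (clamp (s k) (t k) y - clamp (s k) (t k) x) <=
    Num.min y (t n) - Num.min x (t n).
  by apply: (le_trans H); case: (leP y (t n)); case: (leP x (t n)) => *; lra.
elim: n st ts => [|n ih] st ts.
  rewrite big_ord_recr big_ord0/= add0r.
  have := st 0%N isT; case: (leP y (t 0%N)); case: (leP x (t 0%N)) => ? ? h;
  by case: (clampP y h); case: (clampP x h) => *; lra.
rewrite big_ord_recr/=; have {}ih := ih (fun k kn => st k (ltnW kn)) (fun k kn => ts k (ltnW kn)).
apply: (le_trans (lerD ih (lexx _))).
have h := st n.+1 (ltnSn _); have tns := ts n (ltnSn _).
have E z : Num.min z (t n.+1) = Num.min z (s n.+1) + (clamp (s n.+1) (t n.+1) z - s n.+1).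
  by case: (leP z (t n.+1)); case: (leP z (s n.+1)); case: (clampP z h) => *; lra.
have M : Num.min y (t n) - Num.min x (t n) <= Num.min y (s n.+1) - Num.min x (s n.+1).
  by case: (leP y (t n)); case: (leP x (t n)); case: (leP y (s n.+1)); case: (leP x (s n.+1)) => *; lra.
by rewrite !E; move: M => *; lra.
Qed.

Lemma clamp_step s t h x : s <= t -> 0 <= h ->
  0 <= clamp s t (x + h) - clamp s t x <= h * \1_(`[s - h, t]%classic : set mR) x.
Proof.
move=> st h0; rewrite indicE; case: (boolP (x \in _)).
  by move=> _; rewrite mulr1; case: (clampP x st); case: (clampP (x + h) st) => *; apply/andP; split; lra.
rewrite notin_setE/= in_itv/= => /negP; rewrite negb_and -!ltNge mulr0 => /orP[] ?;
by case: (clampP x st); case: (clampP (x + h) st) => *; apply/andP; split; lra.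
Qed.

Lemma itvint_indic (g : R -> R) (x0 y0 s t : R) : locint g -> 0 < x0 ->
  locint (fun x => g x * \1_(`[s, t]) x) /\
  itvint (fun x => g x * \1_(`[s, t]) x) x0 y0 = itvint g (Num.max x0 s) (Num.min y0 t).
Proof.
move=> lg x00; have lgi : locint (fun x => g x * \1_(`[s, t]) x).
  apply: (locint_dom _ (locint_norm lg)) => [|x _].
    by apply: measurable_funM; [case: lg|exact: measurable_indic (measurable_itvR _)].
  by rewrite normrM ler_piMr// indicE; case: (_ \in _); rewrite ?normr1 ?normr0.
split=> //; apply: EFin_inj; rewrite itvintE// itvintE//; last by rewrite lt_max x00.
rewrite integral_mkcond [RHS]integral_mkcond; apply: eq_integral => x _; rewrite !patchE indicE.
have -> : (x \in `[Num.max x0 s, Num.min y0 t]%classic) =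
    (x \in `[x0, y0]%classic) && (x \in `[s, t]%classic).
  apply/idP/andP => [|[]]; rewrite ?inE/= !in_itv/= ge_max le_min.
    by move=> /andP[/andP[-> ->] /andP[-> ->]].
  by move=> /andP[-> ->] /andP[-> ->].
by case: (x \in `[x0, y0]%classic) => //; case: (x \in _) => /=; rewrite ?mulr1 ?mulr0.
Qed.

Lemma locint1 : locint (fun=> (1 : R)).
Proof. exact: locint_cst. Qed.

Lemma itvint1 (x y : R) : x <= y -> itvint (fun=> (1 : R)) x y = y - x.
Proof.
move=> xy; rewrite /itvint Rintegral_cst; last exact: measurable_itvR.
rewrite mul1r [X in fine X](lebesgue_measure_itv `[x, y])/= lte_fin; move: xy; rewrite le_eqVlt.
by move=> /predU1P[->|->]//; rewrite ltxx subrr.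
Qed.

Lemma has_density_clamp (s t : R) : s <= t -> has_density (clamp s t) (fun x => 1 * \1_(`[s, t]) x).
Proof.
move=> st.
split; first by case: (itvint_indic 1 s t locint1 ltr01).
move=> x y x0 xy; have [_ ->] := itvint_indic y s t locint1 x0.
have [h|h] := leP (Num.max x s) (Num.min y t); last rewrite itvint_gt//.
  rewrite itvint1//; move: h; case: (leP x s); case: (leP y t); case: (clampP x st); case: (clampP y st) => *; lra.
move: h; case: (leP x s); case: (leP y t); case: (clampP x st); case: (clampP y st) => *; lra.
Qed.

End clamped_sums.

Section limit_representative.
Context {R : realType} {p : R} {w u a b ainv : R -> R}.
Hypothesis F : interval_frame p w u a b ainv.
Local Notation mu := (@lebesgue_measure R).
Local Notation W := (itvint w).
Local Notation p' := (dualexp p).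
Local Notation mR := (measurableTypeR R).
Local Notation nrm := (frame_norm p w a ainv).

Opaque itvint half_length powR frame_tail frame_D frame_B.

Variables (f : R -> R) (c d K : R).
Hypotheses (lf : locint f) (c0 : 0 < c) (cd : c <= d) (K0 : 0 <= K).
Hypothesis f0 : forall x : R, x < c \/ d < x -> f x = 0.
Hypothesis fK : forall g, locint g -> (nrm g < +oo)%E ->
  (`|\int[mu]_(x in Ipos) (f x * g x)%:E| <= K%:E * nrm g)%E.

Lemma integral_Ipos_itvint (g : R -> R) (x y : R) : locint g -> 0 < x ->
  (forall t, t < x \/ y < t -> g t = 0) ->
  (\int[mu]_(t in Ipos) (g t)%:E)%E = (itvint g x y)%:E.
Proof.
move=> lg x0 g0; rewrite -(integral_patch_itv _ lg x0) integral_mkcond.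
apply: eq_integral => t _; rewrite !patchE.
case: (boolP (t \in `[x, y]%classic)) => [|/negP].
  rewrite inE/= in_itv/= => /andP[xt _]; rewrite mem_set//.
  by rewrite /Ipos/= in_itv/= (lt_le_trans x0).
rewrite inE/= in_itv/= => /negP; rewrite negb_and -!ltNge => /orP h.
by rewrite g0//; case: ifP.
Qed.

Lemma high_test (phi q : R -> R) (M x y : R) : has_density phi q ->
  (\int[mu]_(t in Ipos) (`|phi t * w t `^ p'^-1| `^ p')%:E <= M%:E)%E ->
  locint (fun t => f t * q t) -> 0 < x -> x <= c -> d <= y ->
  `|itvint (fun t => f t * q t) x y| <= K * (2 * high_const p) * M `^ p'^-1.
Proof.
move=> phq HM lfq x0 xc dy; have [h1 h2] := derivative_bound F phq HM.
have nq : (nrm q <= (2 * high_const p * M `^ p'^-1)%:E)%E.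
  apply: (le_trans (leeD h1 h2)); rewrite -EFinD lee_fin.
  by rewrite (_ : _ + _ = 2 * high_const p * M `^ p'^-1)//; ring.
have := fK (proj1 phq) (le_lt_trans nq (ltry _)).
rewrite (integral_Ipos_itvint lfq x0 (y := y)); last first.
  move=> t [tx|ty]; rewrite f0 ?mul0r//; [left; exact: lt_le_trans xc|right; exact: le_lt_trans ty].
rewrite -lee_fin => /le_trans; apply; rewrite -mulrA EFinM.
by apply: lee_wpmul2l => //; rewrite lee_fin.
Qed.

Lemma low_test (g : R -> R) (M x y : R) : measurable_fun setT g ->
  locint (fun t => `|g t| `^ p') -> (\int[mu]_t (`|g t| `^ p')%:E <= M%:E)%E ->
  locint (fun t => f t * (u t `^ p^-1 * g t)) -> 0 < x -> x <= c -> d <= y ->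
  `|itvint (fun t => f t * (u t `^ p^-1 * g t)) x y| <= K * (2 * low_const p) * M `^ p'^-1.
Proof.
move=> mg lg HM lfq x0 xc dy; have [lq h1 h2] := low_order_bound F mg lg HM.
have nq : (nrm (fun t => (u t `^ p^-1 * g t)%R) <= (2 * low_const p * M `^ p'^-1)%:E)%E.
  apply: (le_trans (leeD h1 h2)); rewrite -EFinD lee_fin.
  by rewrite (_ : _ + _ = 2 * low_const p * M `^ p'^-1)//; ring.
have := fK lq (le_lt_trans nq (ltry _)).
rewrite (integral_Ipos_itvint lfq x0 (y := y)); last first.
  move=> t [tx|ty]; rewrite f0 ?mul0r//; [left; exact: lt_le_trans xc|right; exact: le_lt_trans ty].
rewrite -lee_fin => /le_trans; apply; rewrite -mulrA EFinM.
by apply: lee_wpmul2l => //; rewrite lee_fin.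
Qed.

Let K1 := K * (2 * high_const p).

Definition left_mean (f : R -> R) (h x : R) := h^-1 * itvint f (x - h) x.

(** For [h <= t - s], the trapezoid that rises on [[s - h, s]] and falls on [[t - h, t]]. Pairing
    [f] with its derivative gives the difference of the left means at [s] and at [t]. *)
Let tramp (s t h x : R) := h^-1 * (clamp s t (x + h) - clamp s t x).

Lemma has_densityD (f1 q1 f2 q2 : R -> R) : has_density f1 q1 -> has_density f2 q2 ->
  has_density (fun x => f1 x + f2 x) (fun x => q1 x + q2 x).
Proof.
move=> [l1 h1] [l2 h2]; split; first exact: locintD.
move=> x y x0 xy; rewrite itvint_sumD// -h1// -h2//; ring.
Qed.

Lemma has_densityZ (k : R) (f1 q1 : R -> R) : has_density f1 q1 ->
  has_density (fun x => k * f1 x) (fun x => k * q1 x).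
Proof.
move=> [l1 h1]; split; first exact: locintZ.
by move=> x y x0 xy; rewrite itvintZ// -h1// mulrBr.
Qed.

Lemma has_density_ext (f1 f2 q1 q2 : R -> R) : has_density f1 q1 -> f1 =1 f2 -> q1 =1 q2 ->
  has_density f2 q2.
Proof. by move=> h1 /funext <- /funext <-. Qed.

Let has_density_tramp (s t h : R) : 0 < h -> h < s -> s <= t -> exists q : R -> R,
  [/\ has_density (tramp s t h) q, locint (fun x => f x * q x) &
   forall x y : R, 0 < x -> x <= s - h -> t <= y ->
    itvint (fun x => f x * q x) x y = left_mean f h s - left_mean f h t].
Proof.
move=> h0 hs st; have sth : s - h <= t - h by lra.
pose q1 (x : R) : R := 1 * \1_(`[s - h, t - h]%classic : set mR) x.
pose q2 (x : R) : R := 1 * \1_(`[s, t]%classic : set mR) x.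
exists (fun x => h^-1 * (q1 x + (-1) * q2 x)).
have sh0 : 0 < s - h by lra.
have [l1 e1] := itvint_indic (t - h) (s - h) (t - h) lf sh0.
have [l2 e2] := itvint_indic t s t lf (lt_trans h0 hs).
have D : has_density (tramp s t h) (fun x => h^-1 * (q1 x + (-1) * q2 x)).
  apply: has_densityZ.
  have d1 := has_density_clamp sth; have d2 := has_densityZ (-1) (has_density_clamp st).
  have [lD h3] := has_densityD d1 d2.
  split => // x y x0 xy; rewrite -h3// -!clamp_shift; ring.
have E x : f x * (h^-1 * (q1 x + (-1) * q2 x)) =
    h^-1 * (f x * \1_(`[s - h, t - h]%classic : set mR) x + (-1) * (f x * \1_(`[s, t]%classic : set mR) x)).
  by rewrite /q1 /q2; ring.
have lfq : locint (fun x => f x * (h^-1 * (q1 x + (-1) * q2 x))).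
  under eq_fun do rewrite E; apply: locintZ; apply: locintD => //; exact: locintZ.
split => // x y x0 xs ty.
under eq_fun do rewrite E.
have s0 : 0 < s by lra.
rewrite itvintZ//; last by apply: locintD => //; exact: locintZ.
rewrite itvint_sumD//; last exact: locintZ.
rewrite itvintZ//.
have [_ ->] := itvint_indic y (s - h) (t - h) lf x0.
have [_ ->] := itvint_indic y s t lf x0.
have [i1 i2 i3] : [/\ x <= s, t - h <= y & s - h <= s] by split; lra.
rewrite !max_r// !min_r//.
rewrite /left_mean -mulrBr; congr (_ * _).
rewrite -!primitiveB//; try lra.
Qed.

Section family.
Variables (h al be : R) (sg s t : nat -> R).
Hypotheses (h0 : 0 < h) (al0 : 0 < al) (alc : al <= c) (dbe : d <= be).
Hypothesis sg1 : forall k, `|sg k| <= 1.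

Let phi n x := \sum_(k < n) sg k * tramp (s k) (t k) h x.
Let G n x := \sum_(k < n) w x * \1_(`[s k - h, t k]%classic : set mR) x.

Let phi_density n : (forall k, (k < n)%N -> [/\ al + h <= s k, s k <= t k & t k <= be]) ->
  exists q : R -> R, [/\ has_density (phi n) q, locint (fun x => f x * q x) &
    itvint (fun x => f x * q x) al be =
    \sum_(k < n) sg k * (left_mean f h (s k) - left_mean f h (t k))].
Proof.
elim: n => [|n ih] H.
  exists (fun=> 0); rewrite big_ord0.
  have l0 := locint_cst (0 : R).
  have E : (fun x => f x * 0) = (fun=> 0 : R) by apply/funext => x; rewrite mulr0.
  rewrite E itvint_cst0; split => //; split => // x y _ _.
  by rewrite /phi !big_ord0 subrr itvint_cst0.
have [q [D l e]] := ih (fun k kn => H k (ltnW kn)).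
have [sn st tb] := H n (ltnSn _).
have hs : h < s n by apply: lt_le_trans sn; rewrite ltrDr.
have [q1 [D1 l1 e1]] := has_density_tramp h0 hs st.
exists (fun x => q x + sg n * q1 x).
have E x : f x * (q x + sg n * q1 x) = f x * q x + sg n * (f x * q1 x) by ring.
rewrite (funext E).
split.
- apply: (has_density_ext (has_densityD D (has_densityZ (sg n) D1))) => // x.
  by rewrite /phi big_ord_recr.
- by apply: locintD => //; exact: locintZ.
- rewrite itvint_sumD//; last exact: locintZ.
  by rewrite itvintZ// e e1//; [rewrite big_ord_recr|lra].
Qed.

Let G_itvint n : (forall k, (k < n)%N -> [/\ al + h <= s k, s k <= t k & t k <= be]) ->
  locint (G n) /\ itvint (G n) al be = \sum_(k < n) W (s k - h) (t k).
Proof.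
elim: n => [|n ih] H.
  rewrite big_ord0 /G; under eq_fun do rewrite big_ord0.
  rewrite itvint_cst0; split=> //.
  exact: (locint_cst 0).
have [lG eG] := ih (fun k kn => H k (ltnW kn)).
have [sn st tb] := H n (ltnSn _).
have [l1 e1] := itvint_indic be (s n - h) (t n) (frame_w F) al0.
rewrite /G; under eq_fun do rewrite big_ord_recr/=.
split; first exact: locintD.
rewrite itvint_sumD// eG e1 big_ord_recr/= max_r ?min_r//; lra.
Qed.

(* The test function is the sum of the ramps [sg k * tramp (s k) (t k) h]: it has
   modulus at most 1 and lives on the union of the intervals [[s k - h, t k]]. *)
Lemma family_means n : (forall k, (k < n)%N -> [/\ al + h <= s k, s k <= t k & t k <= be]) ->
  (forall k, (k.+1 < n)%N -> t k <= s k.+1) ->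
  `|\sum_(k < n) sg k * (left_mean f h (s k) - left_mean f h (t k))| <=
  K1 * (\sum_(k < n) W (s k - h) (t k)) `^ p'^-1.
Proof.
move=> H ord; have [q [D l <-]] := phi_density H; have [lG eG] := G_itvint H.
apply: (high_test D) => //.
have hV0 : 0 <= h^-1 by rewrite invr_ge0 ltW.
have tr (k : nat) (x : R) : (k < n)%N ->
    0 <= tramp (s k) (t k) h x <= \1_(`[s k - h, t k]%classic : set mR) x.
  move=> kn; have [_ st _] := H k kn; have /andP[h1 h2] := clamp_step x st (ltW h0).
  rewrite mulr_ge0//=; apply: (le_trans (ler_wpM2l hV0 h2)).
  by rewrite mulrA mulVf ?mul1r// gt_eqF.
have ph (x : R) : `|phi n x| <= \sum_(k < n) tramp (s k) (t k) h x.
  apply: (le_trans (ler_norm_sum _ _ _)); apply: ler_sum => k _.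
  have /andP[h1 _] := tr k x (ltn_ord k).
  by rewrite normrM [`|tramp _ _ _ _|]ger0_norm// ler_piMl.
have ph1 (x : R) : `|phi n x| <= 1.
  apply: (le_trans (ph x)); rewrite -mulr_sumr -(mulVf (lt0r_neq0 h0)).
  apply: ler_wpM2l => //.
  have xh : x <= x + h by rewrite lerDl ltW.
  have := clamp_sum_lip xh (fun k kn => (let: And3 _ h _ := H k kn in h)) ord.
  by rewrite [x + h]addrC addrK.
have G0 x : 0 <= G n x.
  by apply: sumr_ge0 => k _; rewrite mulr_ge0 ?(frame_w0 F)// indicE.
have p'1 : 1 <= p' by rewrite /dualexp ler_pdivlMr ?(frame_p10 F)//; lra.
have pt (x : R) : `|phi n x * w x `^ p'^-1| `^ p' <= G n x.
  rewrite normrM [`|w x `^ _|]ger0_norm ?powR_ge0//.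
  rewrite powRM ?powR_ge0// -powRrM mulVf ?gt_eqF ?(frame_p'0 F)// powRr1 ?(frame_w0 F)//.
  rewrite /G -mulr_sumr mulrC ler_wpM2l ?(frame_w0 F)//.
  apply: (@le_trans _ _ (`|phi n x|)).
    have [->|nz] := eqVneq (`|phi n x|) 0; first by rewrite powR0// gt_eqF// (frame_p'0 F).
    rewrite -[leRHS]powRr1//; apply: ger_powR => //; rewrite ph1 andbT lt_neqAle eq_sym nz; exact: normr_ge0.
  apply: (le_trans (ph x)); apply: ler_sum => k _.
  by have /andP[] := tr k x (ltn_ord k).
rewrite -eG -(integral_Ipos_itvint lG al0) => [|x xo].
  by apply: ge0_le_integral_nm => x _; rewrite lee_fin ?powR_ge0//; exact: pt.
rewrite /G big1// => k _; rewrite indicE memNset ?mulr0//=.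
have [h1 h2 h3] := H k (ltn_ord k).
by rewrite in_itv/= => /andP[h4 h5]; case: xo => ?; lra.
Qed.

End family.

End limit_representative.

(** * The limit of the means *)

Section means_limit.
Context {R : realType}.
Local Notation mu := (@lebesgue_measure R).
Local Notation mR := (measurableTypeR R).

Lemma ae_exists (P : R -> Prop) (z x : R) : {ae mu, forall y : R, P y} -> z < x ->
  exists y, [/\ z < y, y < x & P y].
Proof.
move=> [N [mN N0 NP]] zx; apply: contrapT => H.
have sub : (`]z, x[%classic : set R) `<=` N.
  move=> y /=; rewrite in_itv/= => /andP[zy yx]; apply: NP => /= Py; apply: H.
  by exists y.
have : (mu `]z, x[%classic <= mu N)%E.
  by apply: le_measure => //; rewrite inE//; exact: measurable_itvR.
rewrite N0 lebesgue_measure_itv/= lte_fin zx -EFinB lee_fin leNgt subr_gt0.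
by rewrite zx.
Qed.

Lemma powR_small (k s e : R) : 0 <= k -> 0 < s -> 0 < e ->
  exists2 m : R, 0 < m & forall y : R, 0 <= y -> y <= m -> k * y `^ s < e.
Proof.
move=> k0 s0 e0; have k1 : 0 < k + 1 by lra.
exists ((e / (k + 1)) `^ s^-1); first by rewrite powR_gt0// divr_gt0.
move=> y y0 ym; apply: (@le_lt_trans _ _ (k * (e / (k + 1)))).
  apply: ler_wpM2l => //; have := powR_ler (ltW s0) y0 ym.
  by rewrite -powRrM mulVf ?gt_eqF// powRr1// divr_ge0// ltW.
by rewrite mulrA ltr_pdivrMr// mulrC ltr_pM2l//; lra.
Qed.

Lemma cvg_sum_ord (n : nat) (f : nat -> nat -> R) (l : nat -> R) :
  (forall k, (k < n)%N -> f k m @[m --> \oo] --> l k) ->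
  \sum_(k < n) f k m @[m --> \oo] --> \sum_(k < n) l k.
Proof.
elim: n => [|n ih] H.
  by rewrite big_ord0; under eq_fun do rewrite big_ord0; exact: cvg_cst.
rewrite big_ord_recr/=; under eq_fun do rewrite big_ord_recr/=.
by apply: cvgD; [apply: ih => k kn; exact: H (ltnW kn)|exact: H (ltnSn _)].
Qed.

Variables (f w : R -> R) (c d k r : R).
Hypotheses (lf : locint f) (lw : locint w) (w0 : forall x, 0 <= w x).
Hypotheses (c0 : 0 < c) (cd : c <= d) (k0 : 0 <= k) (r0 : 0 < r).
Hypothesis f0 : forall x : R, x < c \/ d < x -> f x = 0.
Hypothesis family : forall (h al be : R) (sg s t : nat -> R) (n : nat),
  0 < h -> 0 < al -> al <= c -> d <= be -> (forall i, `|sg i| <= 1) ->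
  (forall i, (i < n)%N -> [/\ al + h <= s i, s i <= t i & t i <= be]) ->
  (forall i, (i.+1 < n)%N -> t i <= s i.+1) ->
  `|\sum_(i < n) sg i * (left_mean f h (s i) - left_mean f h (t i))| <=
  k * (\sum_(i < n) itvint w (s i - h) (t i)) `^ r.

Let v n : R := n.+1%:R^-1.
Let v_gt0 n : 0 < v n. Proof. by rewrite invr_gt0. Qed.
Let v_cvg : v @ \oo --> (0 : R). Proof. exact: cvg_harmonic. Qed.
Let v_small (e : R) : 0 < e -> \forall n \near \oo, v n < e.
Proof.
move=> e0; have : \forall n \near \oo, `|0 - v n| < e by exact: (@cvgrPdist_lt _ R^o _ _ _ _ _).1 v_cvg e e0.
by apply: filterS => n; rewrite sub0r normrN gtr0_norm.
Qed.

Let means_pair (h x y : R) : 0 < h -> h < x -> x <= y ->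
  `|left_mean f h x - left_mean f h y| <= k * itvint w (x - h) y `^ r.
Proof.
move=> h0 hx xy.
have := @family h (Num.min c (x - h)) (Num.max d y) (fun=> 1) (fun=> x) (fun=> y) 1%N h0.
rewrite !big_ord_recr !big_ord0/= !add0r mul1r; apply.
- by rewrite lt_min c0 subr_gt0.
- by rewrite ge_min lexx.
- by rewrite le_max lexx.
- by move=> _; rewrite normr1.
- move=> _ _; split => //; last by rewrite le_max lexx orbT.
  by rewrite -lerBrDr ge_min lexx orbT.
- by [].
Qed.

Let means_ae : {ae mu, forall x : R, 0 < x -> left_mean f (v n) x @[n --> \oo] --> f x}.
Proof.
apply: ae_impl (primitive_ae_derive lf) => x H x0.
have vn n : - v n != 0 by rewrite oppr_eq0 gt_eqF.
have cv : (fun n => - v n) @ \oo --> (0 : R) by rewrite -oppr0; exact: cvgN.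
have := is_derive_seq (H x0) vn cv; apply: cvg_trans; apply: near_eq_cvg.
have := v_small x0; apply: filterS => n vx.
rewrite /left_mean -primitiveB ?subr_gt0//; last by rewrite gerBl ltW.
by rewrite invrN mulNr -mulrN opprB addrC addrC [- v n + x]addrC.
Qed.

Let itvint_small (x e : R) : 0 < x -> 0 < e -> exists z : R,
  [/\ 0 < z, z < x & k * itvint w z x `^ r < e].
Proof.
move=> x0 e0; have [m m0 Hm] := powR_small k0 r0 e0.
have /(@cvgrPdist_lt _ R^o)/(_ m m0)/nbhs_ballP[d1 /= d0 Hd] := primitive_continuous lw x0.
pose z := Num.max (x / 2) (x - d1 / 2).
have zx : z < x by rewrite gt_max; apply/andP; split; lra.
have z0 : 0 < z by rewrite lt_max; apply/orP; left; lra.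
have zd : x - d1 < z by rewrite lt_max; apply/orP; right; lra.
exists z; split=> //; apply: Hm; first exact: itvint_ge0.
have /Hd : ball x d1 z by rewrite /ball/= gtr0_norm ?subr_gt0//; lra.
rewrite (primitiveB lw z0 (ltW zx)); move/ltW; apply: le_trans; exact: ler_norm.
Qed.

Definition means_limit (f : R -> R) (x : R) : R :=
  lim (left_mean f (n.+1%:R^-1 : R) x @[n --> \oo]).

(** Convergence holds at every point: for large [n] the means at [x] are close, by [means_pair], to
    those at a nearby [y < x] where Lebesgue differentiation applies, so they form a Cauchy
    sequence. *)
Let means_cvg (x : R) : 0 < x -> left_mean f (v n) x @[n --> \oo] --> means_limit f x.
Proof.
move=> x0; suff : cvg (left_mean f (v n) x @[n --> \oo]) by [].
apply/(@cauchy_cvgP R^o); apply: cauchy_exP => e e0.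
have e20 : 0 < e / 2 by rewrite divr_gt0.
have [z [z0 zx Hz]] := itvint_small x0 e20.
have [y [zy yx Hy]] := ae_exists means_ae zx.
have y0 := lt_trans z0 zy; exists (f y).
have H1 : \forall n \near \oo, `|f y - left_mean f (v n) y| < e / 2.
  by have /(@cvgrPdist_lt _ R^o)/(_ _ e20) := Hy y0.
have yz0 : 0 < y - z by rewrite subr_gt0.
have H2 := v_small yz0.
change (\forall n \near \oo, `|f y - left_mean f (v n) x| < e).
near=> n.
have a1 : `|f y - left_mean f (v n) y| < e / 2 by near: n.
have vyz : v n < y - z by near: n.
have vy : v n < y by lra.
have := means_pair (v_gt0 n) vy (ltW yx).
have zv : z <= y - v n by lra.
have := @itvint_le R w (y - v n) x z x lw w0 z0 zv (lexx _).
move=> h1 /le_trans/(_ (ler_wpM2l k0 (powR_ler (ltW r0) (itvint_ge0 _ _ w0) h1))) h2.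
have := ler_distD (left_mean f (v n) y) (f y) (left_mean f (v n) x).
by rewrite -/(v n) => h3; move: h1 h2 h3 a1 Hz => *; lra.
Unshelve. all: by end_near. Qed.

Lemma means_limit_ae : {ae mu, forall x : R, 0 < x -> means_limit f x = f x}.
Proof. by apply: ae_impl means_ae => x H x0; apply/cvg_lim => //; exact: H. Qed.

Lemma means_limit0 x : x < c \/ d < x -> means_limit f x = 0.
Proof.
move=> H; apply/cvg_lim => //; apply: cvg_near_cst.
have [dx|xd] := ltP d x.
  have xd0 : 0 < x - d by rewrite subr_gt0.
  apply: filterS (v_small xd0) => n vx.
  rewrite /left_mean (@eq_itvint _ _ (fun=> 0)) ?itvint_cst0 ?mulr0// => t t1 _.
  by apply: f0; right; rewrite -/(v n) in t1; lra.
have xc : x < c by case: H => // dx; lra.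
apply: nearW => n; rewrite /left_mean (@eq_itvint _ _ (fun=> 0)) ?itvint_cst0 ?mulr0// => t _ t1.
by apply: f0; left; lra.
Qed.

(** A short family of intervals has small [w]-mass, which the family bound turns into a small sum of
    increments of the means; the estimate then passes to the limit in the width of the means. *)
Lemma means_limit_loc_abs_cont : loc_abs_cont (means_limit f).
Proof.
move=> al be al0 albe e e0.
have e20 : 0 < e / 2 by rewrite divr_gt0.
have [m m0 Hm] := powR_small k0 r0 e20.
have m20 : 0 < m / 2 by rewrite divr_gt0.
have := dominated_loc_abs_cont (locint_norm lw) (fun x y x0 xy => primitive_dom lw x0 xy).
move=> /(_ al be al0 albe _ m20)[dl dl0 Hdl]; exists dl => // n s t st ord sml.
have {Hdl sml} := Hdl n s t st ord sml; set S := \sum_(i < n) _ => Sm.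
(* With these signs the family bound controls the sum of the absolute increments. *)
pose g := means_limit f; pose sg i := Num.sg (g (s i) - g (t i)).
have sp i : (i < n)%N -> 0 < s i by move=> /st[h _]; exact: lt_le_trans h.
have tp i : (i < n)%N -> 0 < t i by move=> h; have [_ [h1 _]] := st i h; exact: lt_le_trans (sp i h) h1.
have -> : \sum_(i < n) `|g (t i) - g (s i)| = \sum_(i < n) sg i * (g (s i) - g (t i)).
  by apply: eq_bigr => i _; rewrite -normrEsg distrC.
suff : \sum_(i < n) sg i * (g (s i) - g (t i)) <= e / 2 by move=> ?; lra.
have C1 : \sum_(i < n) sg i * (left_mean f (v N) (s i) - left_mean f (v N) (t i)) @[N --> \oo] -->
    \sum_(i < n) sg i * (g (s i) - g (t i)).
  apply: (@cvg_sum_ord n (fun i N => sg i * (left_mean f (v N) (s i) - left_mean f (v N) (t i)))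
    (fun i => sg i * (g (s i) - g (t i)))) => i ni; apply: cvgM; first exact: cvg_cst.
  by apply: cvgB; apply: means_cvg; [exact: sp|exact: tp].
have C2 : \sum_(i < n) (primitive w (t i) - primitive w (s i - v N)) @[N --> \oo] -->
    \sum_(i < n) (primitive w (t i) - primitive w (s i)).
  apply: (@cvg_sum_ord n (fun i N => primitive w (t i) - primitive w (s i - v N))
    (fun i => primitive w (t i) - primitive w (s i))) => i ni; apply: cvgB; first exact: cvg_cst.
  have cs : s i - v N @[N --> \oo] --> s i - 0 by apply: cvgB => //; exact: cvg_cst.
  by rewrite subr0 in cs; exact: cvg_comp cs (primitive_continuous lw (sp i ni)).
have S2 : \sum_(i < n) (primitive w (t i) - primitive w (s i)) <= S.
  by apply: ler_sum => i _; exact: ler_norm.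
have H2 : \forall N \near \oo, \sum_(i < n) (primitive w (t i) - primitive w (s i - v N)) < m.
  by apply: (cvgr_lt _ C2); apply: le_lt_trans S2 _; lra.
have al20 : 0 < al / 2 by rewrite divr_gt0.
have H3 := v_small al20.
apply: (cvgr_to_le C1); near=> N.
have a1 : \sum_(i < n) (primitive w (t i) - primitive w (s i - v N)) < m by near: N.
have a2 : v N < al / 2 by near: N.
have st' i : (i < n)%N -> [/\ Num.min c (al / 2) + v N <= s i, s i <= t i & t i <= Num.max be d].
  move=> ni; have [h1 [h2 h3]] := st i ni; split => //; last by rewrite le_max h3.
  by have : Num.min c (al / 2) <= al / 2; [rewrite ge_min lexx orbT|move=> h4; lra].
have sg1 i : `|sg i| <= 1 by rewrite normr_sg; case: (_ != 0).
have := @family (v N) (Num.min c (al / 2)) (Num.max be d) sg s t n (v_gt0 N) _ _ _ sg1 st' ord.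
rewrite lt_min c0 al20 ge_min lexx le_max lexx orbT => /(_ isT isT isT) H.
apply: (le_trans (ler_norm _)); apply: (le_trans H); apply/ltW; apply: Hm.
  by apply: sumr_ge0 => i _; exact: itvint_ge0.
apply: le_trans (ltW a1); apply: ler_sum => i _; have [h1 h2 h3] := st' i (ltn_ord i).
rewrite primitiveB//; last by have := v_gt0 N; move: h2 => *; lra.
have h4 : 0 < Num.min c (al / 2) by rewrite lt_min c0.
by lra.
Unshelve. all: by end_near. Qed.

End means_limit.

(** * Energy bounds by the converse Hölder inequality *)

Section bounded_tests.
Context {R : realType}.
Local Notation mu := (@lebesgue_measure R).
Local Notation mR := (measurableTypeR R).

Lemma itvint_dominated_cvg (g C : R -> R) (phi : nat -> R -> R) (M x y : R) :
  locint g -> 0 < x -> measurable_fun setT C -> (forall n, measurable_fun setT (phi n)) ->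
  (forall n t, 0 < t -> `|phi n t| <= M) ->
  {ae mu, forall t : R, 0 < t -> phi n t @[n --> \oo] --> C t} ->
  itvint (fun t => phi n t * g t) x y @[n --> \oo] --> itvint (fun t => C t * g t) x y.
Proof.
move=> lg x0 mC mphi phiM phiC; have [mg ig] := lg.
pose D : set mR := `[x, y]%classic.
have Dp t : D t -> 0 < t by rewrite /D/= in_itv/= => /andP[xt _]; exact: lt_le_trans xt.
have mD : measurable D by exact: measurable_itvR.
have mf n : measurable_fun D (fun t => (phi n t * g t)%:E).
  by apply/measurable_EFinP; apply: measurable_funTS; exact: (measurable_funM (mphi n) mg).
have mC' : measurable_fun D (fun t => (C t * g t)%:E).
  by apply/measurable_EFinP; apply: measurable_funTS; exact: measurable_funM.
have cv : {ae mu, forall t, D t -> (phi n t * g t)%:E @[n --> \oo] --> (C t * g t)%:E}.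
  apply: ae_impl phiC => t H /Dp t0; apply: cvg_EFin; first exact: nearW.
  by apply: cvgM; [exact: H|exact: cvg_cst].
have ig' : mu.-integrable D (fun t => (M * `|g t|)%:E).
  by case: (locintZ M (locint_norm lg)) => _; apply.
have dom : {ae mu, forall t n, D t -> (`|(phi n t * g t)%:E| <= (M * `|g t|)%:E)%E}.
  apply: aeW => t n /Dp t0; rewrite -[(`|_|)%E]/((`|phi n t * g t|)%:E) lee_fin normrM.
  by rewrite ler_wpM2r// phiM.
have [ic _ cvI] := dominated_convergence mD mf mC' cv ig' dom.
have E n : (\int[mu]_(t in D) (phi n t * g t)%:E)%E = (itvint (fun t => phi n t * g t) x y)%:E.
  apply: EFin_itvint; apply: (le_integrable mD (mf n) _ ig') => t /Dp t0.
  change ((`|phi n t * g t|)%:E <= (`|M * `|g t| |)%:E)%E; rewrite lee_fin !normrM normr_id.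
  by rewrite ler_wpM2r// (le_trans (phiM n t t0))// ler_norm.
have E' : (\int[mu]_(t in D) (C t * g t)%:E)%E = (itvint (fun t => C t * g t) x y)%:E.
  exact: EFin_itvint.
move: cvI; rewrite E' => /fine_cvgP[_]; apply: cvg_trans; apply: near_eq_cvg.
by apply: nearW => n; rewrite /= E.
Qed.

Lemma lipschitz_density (G : R -> R) (L : R) :
  (forall x y, 0 < x -> x <= y -> `|G y - G x| <= L * (y - x)) -> exists q, has_density G q.
Proof.
move=> GL; have lL := locintZ L (@locint1 R).
have [|q [mq _ iq _ qE]] := @loc_abs_cont_density R G.
  apply: (dominated_loc_abs_cont lL) => x y x0 xy.
  by rewrite itvintZ ?itvint1//; [exact: GL|exact: locint1].
by exists q; split.
Qed.

Variables (C : R -> R) (Mc al be : R).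
Hypotheses (mC : measurable_fun setT C) (CM : forall t, `|C t| <= Mc) (al0 : 0 < al).
Hypothesis C0 : forall t, t < al \/ be < t -> C t = 0.

Lemma locint_bounded : locint C.
Proof.
apply: (locint_dom mC (locintZ Mc (@locint1 R))) => t _.
by rewrite mulr1.
Qed.

Let v n : R := n.+1%:R^-1.
Let v_gt0 n : 0 < v n. Proof. by rewrite invr_gt0. Qed.

(** Turns a bounded measurable function into one with a density, keeping the bound and converging
    almost everywhere. Averaging forward spreads the support only to the left. *)
Definition forward_mean (C : R -> R) n : R -> R :=
  (fun x : R => n.+1%:R * (primitive C (x + n.+1%:R^-1) - primitive C x)) \_ Ipos.

Lemma forward_meanE n x : 0 < x ->
  forward_mean C n x = n.+1%:R * itvint C x (x + n.+1%:R^-1).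
Proof.
move=> x0; rewrite /forward_mean patchE mem_set; last by rewrite /Ipos/= in_itv/= x0.
by rewrite primitiveB ?lerDl//; exact: locint_bounded.
Qed.

Let itvint_bounded x y : 0 < x -> x <= y -> `|itvint C x y| <= Mc * (y - x).
Proof.
move=> x0 xy; apply: (le_trans (norm_itvint _ locint_bounded x0)).
rewrite -itvint1// -(itvintZ _ _ (@locint1 R) x0).
apply: itvint_mono => //; [exact: locint_norm locint_bounded|exact: locintZ (@locint1 R)|].
by move=> t _ _; rewrite mulr1.
Qed.

Lemma forward_mean_bound n x : 0 < x -> `|forward_mean C n x| <= Mc.
Proof.
move=> x0; rewrite forward_meanE// normrM ger0_norm//.
have := itvint_bounded x0 (y := x + v n); rewrite lerDl (ltW (v_gt0 n)) => /(_ isT).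
rewrite [x + _]addrC addrK => h; rewrite -ler_pdivlMl//.
by rewrite [leRHS]mulrC.
Qed.

Lemma forward_mean_density n : exists q, has_density (forward_mean C n) q.
Proof.
have [|q hq] := @lipschitz_density (fun x : R => n.+1%:R * (primitive C (x + n.+1%:R^-1) - primitive C x))
   (n.+1%:R * (Mc + Mc)).
  move=> x y x0 xy.
  have xv : 0 < x + v n by rewrite addr_gt0.
  have xyv : x + v n <= y + v n by rewrite lerD2r.
  have h1 := itvint_bounded x0 xy; have h2 := itvint_bounded xv xyv.
  rewrite -mulrBr normrM ger0_norm// -mulrA ler_wpM2l//.
  rewrite (_ : _ - _ = itvint C (x + v n) (y + v n) - itvint C x y).
    apply: (le_trans (ler_normB _ _)); move: h1 h2; rewrite (_ : y + v n - (x + v n) = y - x); last by ring.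
    by move=> *; lra.
  by rewrite -!(primitiveB locint_bounded)// /v; ring.
by exists q; exact: has_density_patch.
Qed.

Lemma forward_mean_cvg : {ae mu, forall x : R, 0 < x -> forward_mean C n x @[n --> \oo] --> C x}.
Proof.
apply: ae_impl (primitive_ae_derive locint_bounded) => x H x0.
have vn n : v n != 0 by rewrite gt_eqF.
have := is_derive_seq (H x0) vn (@cvg_harmonic R); apply: cvg_trans; apply: near_eq_cvg.
apply: nearW => n; rewrite /forward_mean patchE mem_set; last by rewrite /Ipos/= in_itv/= x0.
by rewrite /v invrK [n.+1%:R^-1 + x]addrC.
Qed.

Lemma forward_mean0 n x : n.+1%:R^-1 <= al / 2 -> x < al / 2 \/ be < x -> forward_mean C n x = 0.
Proof.
move=> nal H; have [x0|xn] := ltP 0 x; last first.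
  by rewrite /forward_mean patchE memNset// /Ipos/= in_itv/= andbT; apply/negP; rewrite -leNgt.
rewrite forward_meanE// (@eq_itvint _ _ (fun=> 0)) ?itvint_cst0 ?mulr0// => t t1 t2.
apply: C0; move: (n.+1%:R^-1) nal t2 => e nal t2.
by case: H => H; [left|right]; lra.
Qed.

End bounded_tests.

Section converse_hoelder.
Context {R : realType}.
Local Notation mu := (@lebesgue_measure R).
Local Notation mR := (measurableTypeR R).

(* Apply the hypothesis to [sgn r |r|^(p-1)], truncated to the sets where [r] is
   bounded and [om] is bounded below. *)
Lemma converse_hoelder (p K x y : R) (r om : R -> R) : 1 < p -> 0 <= K -> 0 < x -> (forall t, 0 <= om t) ->
  measurable_fun setT r -> measurable_fun setT om ->
  {ae mu, forall t : R, x <= t -> t <= y -> 0 < om t} ->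
  (forall (ga : R -> R) (m : R), measurable_fun setT ga ->
    (forall t : R, t < x \/ y < t -> ga t = 0) ->
    (forall t : R, `|ga t| <= m) -> (forall t : R, `|ga t| <= m * om t) ->
    `|itvint (fun t => r t * ga t) x y| <=
    K * itvint (fun t => `|ga t| `^ dualexp p) x y `^ (dualexp p)^-1) ->
  (\int[mu]_(t in `[x, y]) (`|r t| `^ p)%:E <= (K `^ p)%:E)%E.
Proof.
move=> p1 K0 x0 om0 mr mom ompos H.
have p0 : 0 < p by lra.
have p10 : 0 < p - 1 by lra.
have p'p : (p - 1) * dualexp p = p by rewrite /dualexp mulrCA mulfV ?mulr1// gt_eqF.
have pV : p^-1 + (dualexp p)^-1 = 1.
  by rewrite /dualexp invf_div -{1}[p^-1]mul1r -mulrDl addrC subrK mulfV// gt_eqF.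
pose D : set mR := `[x, y]%classic.
have mD : measurable D by exact: measurable_itvR.
pose E n : set mR := [set t : R | [/\ x <= t, t <= y, `|r t| <= n%:R & 1 <= n%:R * om t]].
have mnr : measurable_fun setT (fun t => `|r t|) by exact: measurableT_comp.
have mE n : measurable (E n).
  have -> : E n = D `&` [set t | `|r t| <= n%:R] `&` [set t | 1 <= n%:R * om t].
    apply/seteqP; split => t /=; rewrite /E /D /= in_itv/=; first by move=> [-> -> ? ?]; split.
    by move=> [[/andP[? ?] ?] ?]; split.
  apply: measurableI; first apply: measurableI => //.
    have := mnr measurableT _ (measurable_itvR `]-oo, n%:R]); rewrite setTI; congr measurable.
  have mno : measurable_fun setT (fun t => n%:R * om t) by exact: measurable_funM.
  have := mno measurableT _ (measurable_itvR `[1, +oo[); rewrite setTI; congr measurable.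
  by apply/seteqP; split => t /=; rewrite in_itv/= andbT.
have En n t : t \in E n -> [/\ x <= t, t <= y, `|r t| <= n%:R & 1 <= n%:R * om t].
  by rewrite inE.
pose G n (t : R) : R := `|r t| `^ p * \1_(E n) t.
have mrp : measurable_fun setT (fun t => `|r t| `^ p).
  exact: (measurableT_comp (measurable_powR _)).
have mG n : measurable_fun setT (G n).
  by apply: measurable_funM => //; exact: measurable_indic (mE n).
have G0 n t : 0 <= G n t by rewrite /G mulr_ge0 ?powR_ge0// indicE.
have Gb n t : `|G n t| <= n%:R `^ p.
  rewrite ger0_norm// /G indicE; case: (boolP (t \in E n)) => [/En[_ _ h _]|_].
    by rewrite mulr1; apply: powR_ler => //; exact: ltW.
  by rewrite mulr0 powR_ge0.
have key n : itvint (G n) x y <= K `^ p.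
  pose ga (t : R) := Num.sg (r t) * `|r t| `^ (p - 1) * \1_(E n) t.
  have mga : measurable_fun setT ga.
    apply: measurable_funM; last exact: measurable_indic (mE n).
    apply: measurable_funM; last exact: (measurableT_comp (measurable_powR _)).
    have sgE z : Num.sg z = \1_(`]0, +oo[%classic : set mR) z - \1_(`]-oo, 0[%classic : set mR) z :> R.
      rewrite !indicE.
      have -> : (z \in `]0, +oo[%classic) = (0 < z) by apply/idP/idP; rewrite inE/= in_itv/= andbT.
      have -> : (z \in `]-oo, 0[%classic) = (z < 0) by apply/idP/idP; rewrite inE/= in_itv/=.
      by case: sgrP => h; rewrite /= ?ltxx ?h ?(lt_gtF h) ?subrr ?subr0 ?sub0r.
    under eq_fun do rewrite sgE.
    by apply: measurable_funB; apply: (measurableT_comp (measurable_indic (measurable_itvR _)) mr).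
  have gan t : `|ga t| = `|r t| `^ (p - 1) * \1_(E n) t.
    rewrite /ga !normrM (ger0_norm (powR_ge0 _ _)) [`|\1_ _ _|]ger0_norm ?indicE//.
    rewrite normr_sg; have [->|_] := eqVneq (r t) 0; last by rewrite mul1r.
    by rewrite normr0 powR0 ?mul0r// gt_eqF.
  have ga1 t : `|ga t| <= n%:R `^ (p - 1).
    rewrite gan indicE; case: (boolP (t \in E n)) => [/En[_ _ h _]|_].
      by rewrite mulr1; apply: powR_ler => //; exact: ltW.
    by rewrite mulr0 powR_ge0.
  (* Large enough to dominate [|ga|] and, because [1 <= n * om] on [E n], also [|ga| / om]. *)
  pose m := n%:R `^ (p - 1) * (1 + n%:R).
  have h := @H ga m mga.
  have rga t : r t * ga t = G n t.
    rewrite /ga /G !mulrA; congr (_ * _); rewrite [r t * _]mulrC -normrEsg.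
    have [->|nz] := eqVneq (`|r t|) 0; first by rewrite mul0r powR0// gt_eqF.
    have n0 : 0 < `|r t| by rewrite lt_neqAle eq_sym nz normr_ge0.
    by rewrite -{1}[`|r t|]powRr1// -powRDp// addrC subrK.
  have gap t : `|ga t| `^ dualexp p = G n t.
    rewrite gan /G indicE; case: (t \in E n).
      by rewrite !mulr1 -powRrM p'p.
    by rewrite !mulr0 powR0// gt_eqF// /dualexp divr_gt0.
  have {h} := h _ _ _.
  rewrite (funext rga) (funext gap) => h.
  have S0 : 0 <= itvint (G n) x y by exact: itvint_ge0.
  move: (itvint (G n) x y) S0 h => S S0 h.
  have {h} hS : S <= K * S `^ (dualexp p)^-1.
    rewrite -[leLHS]ger0_norm//; apply: h => t.
    - move=> tD; rewrite /ga indicE memNset ?mulr0// => -[h1 h2 _ _].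
      by case: tD; rewrite ltNge ?h1 ?h2.
    - apply: (le_trans (ga1 t)); rewrite /m -[leLHS]mulr1 ler_wpM2l ?powR_ge0//.
      by rewrite lerDl.
    - rewrite gan indicE; case: (boolP (t \in E n)) => [/En[_ _ h1 h2]|nE].
        rewrite mulr1 /m -mulrA; apply: (@le_trans _ _ (n%:R `^ (p - 1) * 1)).
          by rewrite mulr1; apply: powR_ler => //; exact: ltW.
        rewrite ler_wpM2l ?powR_ge0// mulrDl mul1r.
        by have := om0 t; lra.
      by rewrite mulr0 !mulr_ge0 ?powR_ge0// addr_ge0.
  have [->|Sn] := eqVneq S 0; first exact: powR_ge0.
  have Sp : 0 < S by rewrite lt_neqAle eq_sym Sn.
  have : S `^ p^-1 <= K.
    rewrite -(ler_pM2r (powR_gt0 (dualexp p)^-1 Sp)) -powRDp// pV powRr1//.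
  move=> /(powR_ler (ltW p0) (powR_ge0 _ _)); rewrite -powRrM mulVf ?gt_eqF// powRr1//.
have Gnd t : nondecreasing_seq (fun n => (G n t)%:E).
  move=> n m nm; rewrite lee_fin /G ler_wpM2l ?powR_ge0// !indicE ler_nat.
  case: (boolP (t \in E n)) => // /En[h1 h2 h3 h4].
  rewrite (_ : t \in E m)// inE; split => //; first by rewrite (le_trans h3)// ler_nat.
  by rewrite (le_trans h4)// ler_wpM2r// ler_nat.
have mGE n : measurable_fun D (fun t => (G n t)%:E).
  by apply/measurable_EFinP; exact: measurable_funTS (mG n).
have GE0 n t : D t -> (0 <= (G n t)%:E)%E by rewrite lee_fin.
have cvI := cvg_monotone_convergence mD mGE GE0 (fun t _ => Gnd t).
have -> : (\int[mu]_(t in `[x, y]) (`|r t| `^ p)%:E =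
    \int[mu]_(t in D) (limn (fun n => (G n t)%:E)))%E.
  apply: ge0_ae_eq_integral_nm => //.
  - apply: (@emeasurable_fun_cvg _ _ _ _ (fun n (t : mR) => (G n t)%:E) _ mGE) => t _.
    exact: ereal_nondecreasing_is_cvgn.
  - move=> t Dt; apply: lime_ge; first exact: ereal_nondecreasing_is_cvgn.
    by apply: nearW => n; exact: GE0.
  - apply: ae_impl ompos => t H1; rewrite /D/= in_itv/= => /andP[xt ty].
    have ot := H1 xt ty; apply/esym/cvg_lim => //; apply: cvg_near_cst.
    have := nbhs_infty_ger (Num.max `|r t| (om t)^-1); apply: filterS => n.
    rewrite ge_max => /andP[h1 h2]; rewrite /G indicE (_ : t \in E n) ?mulr1//.
    by rewrite inE; split => //; rewrite -ler_pdivrMr// mul1r.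
move: (cvI mu) => /cvg_lim <- //; apply: lime_le.
  apply: ereal_nondecreasing_is_cvgn => n m nm; apply: ge0_le_integral => //.
  - by move=> t Dt; exact: GE0.
  - by move=> t Dt; exact: Gnd.
apply: nearW => n; rewrite EFin_itvint ?lee_fin//.
have : locint (G n).
  by apply: (locint_dom (mG n) (locintZ (n%:R `^ p) (@locint1 R))) => t _; rewrite mulr1.
by case=> _; apply.
Qed.
End converse_hoelder.

Section sobolev_representative.
Context {R : realType} {p : R} {w u a b ainv : R -> R}.
Hypothesis F : interval_frame p w u a b ainv.
Local Notation mu := (@lebesgue_measure R).
Local Notation W := (itvint w).
Local Notation p' := (dualexp p).
Local Notation mR := (measurableTypeR R).
Local Notation nrm := (frame_norm p w a ainv).

Opaque itvint half_length powR frame_tail frame_D frame_B.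

Let p'0 : 0 < p'. Proof. exact: frame_p'0 F. Qed.
Let pV0 : 0 < p'^-1. Proof. by rewrite invr_gt0. Qed.
Let p'n0 : p' != 0. Proof. by rewrite gt_eqF. Qed.

Lemma locint_powR_bounded (g C : R -> R) (M s : R) : locint g -> (forall t, 0 <= g t) ->
  measurable_fun setT C -> (forall t, `|C t| <= M) -> 0 <= s ->
  locint (fun t => `|C t| `^ s * g t).
Proof.
move=> lg g0 mC CM s0; apply: (locint_dom _ (locintZ (M `^ s) lg)) => [|t _].
  apply: measurable_funM; last by case: lg.
  by apply: (measurableT_comp (measurable_powR _)); exact: measurableT_comp.
rewrite ger0_norm ?mulr_ge0 ?powR_ge0// ler_wpM2r//.
by apply: powR_ler.
Qed.

Lemma itvint_supp (g : R -> R) (x y x0 y0 : R) : locint g -> 0 < x -> x <= x0 -> y0 <= y ->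
  (forall t, t < x0 \/ y0 < t -> g t = 0) -> itvint g x y = itvint g x0 y0.
Proof.
move=> lg x0' xx yy g0; apply: EFin_inj.
rewrite -!(integral_Ipos_itvint lg)//; first exact: lt_le_trans xx.
by move=> t H; apply: g0; case: H => H; [left|right]; [exact: lt_le_trans xx|exact: le_lt_trans H].
Qed.

Section density.
Variables (f qf : R -> R) (c d K : R).
Hypotheses (fq : has_density f qf) (mf : measurable_fun setT f) (c0 : 0 < c) (cd : c <= d) (K0 : 0 <= K).
Hypothesis f0 : forall x : R, x < c \/ d < x -> f x = 0.
Hypothesis fK : forall g, locint g -> (nrm g < +oo)%E ->
  (`|\int[mu]_(x in Ipos) (f x * g x)%:E| <= K%:E * nrm g)%E.

Let lf : locint f.
Proof.
have := locint_cont mf (@locint1 R) (fun x => @has_density_continuous _ _ _ x fq).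
by congr locint; apply/funext => x; rewrite mulr1.
Qed.

(** Integration by parts turns the pairing of [qf] with [phi] into that of [f] with the derivative
    of [phi], which [high_test] bounds; the boundary terms vanish with [f]. *)
Let density_step (phi q : R -> R) (x y M : R) : has_density phi q -> measurable_fun setT phi ->
  0 < x -> x < c -> d < y -> (forall t, `|phi t| <= M) -> (forall t, t < x \/ y < t -> phi t = 0) ->
  `|itvint (fun t => phi t * qf t) x y| <=
  K * (2 * high_const p) * itvint (fun t => `|phi t| `^ p' * w t) x y `^ p'^-1.
Proof.
move=> pq mphi x0 xc dy phM ph0.
have l1 : locint (fun t => phi t * qf t).
  by apply: locint_cont => //; [case: fq|move=> t; exact: has_density_continuous pq].
have l2 : locint (fun t => f t * q t).
  by apply: locint_cont => //; [case: pq|move=> t; exact: has_density_continuous fq].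
have lp := locint_powR_bounded (frame_w F) (frame_w0 F) mphi phM (ltW p'0).
have xy : x <= y by exact: (ltW (lt_trans xc (le_lt_trans cd dy))).
have [_] := itvint_by_parts fq pq x0 xy.
rewrite f0; last by right.
rewrite (f0 (x := x)); last by left.
rewrite !mul0r subrr.
rewrite (@eq_itvint _ _ (fun t => phi t * qf t + f t * q t)); last by move=> t _ _; rewrite [qf t * _]mulrC.
rewrite itvint_sumD// => /eqP; rewrite addr_eq0 => /eqP ->; rewrite normrN.
apply: (high_test F K0 f0 fK pq _ l2 x0 (ltW xc) (ltW dy)).
rewrite -(integral_Ipos_itvint lp x0) => [|t H]; last by rewrite ph0// normr0 powR0// mul0r.
apply: ge0_le_integral_nm => t _; rewrite lee_fin ?powR_ge0//.
rewrite normrM [`|w t `^ _|]ger0_norm ?powR_ge0//.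
by rewrite powRM ?powR_ge0// -powRrM mulVf// powRr1 ?(frame_w0 F).
Qed.

(** Passage to bounded measurable tests: both sides are limits along the forward means, by dominated
    convergence. *)
Lemma density_test (C : R -> R) (M x0 y0 : R) : 0 < x0 -> measurable_fun setT C ->
  (forall t, `|C t| <= M) -> (forall t, t < x0 \/ y0 < t -> C t = 0) ->
  `|itvint (fun t => C t * qf t) x0 y0| <=
  K * (2 * high_const p) * itvint (fun t => `|C t| `^ p' * w t) x0 y0 `^ p'^-1.
Proof.
(* The left end stays below [x0 / 2] because forward means spread the support of [C] to the left;
   [x < c] and [d < y] make [f] vanish at both ends. *)
move=> x00 mC CM C0; pose x := Num.min c x0 / 2; pose y := Num.max d y0 + 1.
have mi0 : 0 < Num.min c x0 by rewrite lt_min c0.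
have x'0 : 0 < x by rewrite divr_gt0.
have [xc xx] : x < c /\ x <= x0 / 2.
  have h1 : Num.min c x0 <= c by rewrite ge_min lexx.
  have h2 : Num.min c x0 <= x0 by rewrite ge_min lexx orbT.
  by rewrite /x; split; lra.
have [dy yy] : d < y /\ y0 < y.
  have h1 : d <= Num.max d y0 by rewrite le_max lexx.
  have h2 : y0 <= Num.max d y0 by rewrite le_max lexx orbT.
  by rewrite /y; split; lra.
have M0 : 0 <= M := le_trans (normr_ge0 _) (CM 0).
have lw := frame_w F; have w0 := frame_w0 F.
pose ph n := forward_mean C n.
have phD n : exists q, has_density (ph n) q := forward_mean_density mC CM n.
have mph n : measurable_fun setT (ph n).
  have [q hq] := phD n; have -> : ph n = ph n \_ Ipos.
    by apply/funext => t; rewrite /ph /forward_mean !patchE; case: ifP.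
  exact: measurable_has_density_patch hq.
have phM n t : `|ph n t| <= M.
  have [t0|tn] := ltP 0 t; first exact: forward_mean_bound.
  rewrite /ph /forward_mean patchE memNset ?normr0//.
  by rewrite /Ipos/= in_itv/= andbT; apply/negP; rewrite -leNgt.
have phC := forward_mean_cvg mC CM.
have cv1 := itvint_dominated_cvg (x := x) (y := y) (proj1 fq) x'0 mC mph (fun n t _ => phM n t) phC.
have mCp (C' : R -> R) : measurable_fun setT C' -> measurable_fun setT (fun t => `|C' t| `^ p').
  by move=> mC'; apply: (measurableT_comp (measurable_powR _)); exact: measurableT_comp.
have cv2 : itvint (fun t => `|ph n t| `^ p' * w t) x y @[n --> \oo] -->
    itvint (fun t => `|C t| `^ p' * w t) x y.
  apply: (@itvint_dominated_cvg _ w (fun t => `|C t| `^ p') (fun n t => `|ph n t| `^ p') (M `^ p') x y) => //.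
  - exact: mCp.
  - by move=> n; exact: mCp.
  - by move=> n t _; rewrite ger0_norm ?powR_ge0//; apply: powR_ler => //; exact: ltW.
  - apply: ae_impl phC => t H t0.
    exact: cvg_comp (H t0) (@continuous_norm_powR R id (C t) p' p'0 (fun x => cvg_id _)).
have I0 (C' : R -> R) : 0 <= itvint (fun t => `|C' t| `^ p' * w t) x y.
  by apply: itvint_ge0 => t; rewrite mulr_ge0 ?powR_ge0.
have cv3 := cvg_comp _ _ cv2 (@continuous_norm_powR R id _ p'^-1 pV0 (fun x => cvg_id _)).
have cv4 : K * (2 * high_const p) * `|itvint (fun t => `|ph n t| `^ p' * w t) x y| `^ p'^-1 @[n --> \oo] -->
    K * (2 * high_const p) * `|itvint (fun t => `|C t| `^ p' * w t) x y| `^ p'^-1.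
  by apply: cvgM; [exact: cvg_cst|exact: cv3].
have := ler_cvg_to (cvg_norm cv1) cv4.
have lCq : locint (fun t => C t * qf t).
  apply: (locint_dom _ (locintZ M (locint_norm (proj1 fq)))) => [|t _].
    by apply: measurable_funM => //; case: fq => -[].
  by rewrite normrM ler_wpM2r.
have lCw := locint_powR_bounded lw w0 mC CM (ltW p'0).
have xx0 : x <= x0 by lra.
rewrite (itvint_supp lCq x'0 xx0 (ltW yy)); last by move=> t H; rewrite C0// mul0r.
rewrite (itvint_supp lCw x'0 xx0 (ltW yy)); last by move=> t H; rewrite C0// normr0 powR0// mul0r.
rewrite [`|itvint (fun t => `|C t| `^ p' * w t) x0 y0|]ger0_norm; last first.
  by apply: itvint_ge0 => t; rewrite mulr_ge0 ?powR_ge0.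
apply; have x02 : 0 < x0 / 2 by rewrite divr_gt0.
have : \forall n \near \oo, `|0 - n.+1%:R^-1| < x0 / 2.
  exact: (@cvgrPdist_lt _ R^o _ _ _ _ _).1 (@cvg_harmonic R) (x0 / 2) x02.
apply: filterS => n; rewrite sub0r normrN gtr0_norm ?invr_gt0// => nx.
have [q hq] := phD n; rewrite [`|itvint (fun t => `|ph n t| `^ p' * w t) x y|]ger0_norm//.
apply: (density_step hq (mph n) x'0 xc dy (phM n)) => t H.
have H' : t < x0 / 2 \/ y0 < t.
  by case: H => H; [left; exact: lt_le_trans H xx|right; exact: lt_trans yy H].
have := @forward_mean0 R C M x0 y0 mC CM; rewrite /ph; apply => //; exact: ltW.
Qed.

(** The converse Hölder inequality for [qf / w^(1/p')]. The truncation [|ga| <= m w^(1/p')] is what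
    keeps the test [C = ga / w^(1/p')] bounded. *)
Lemma density_energy (x y : R) : {ae mu, forall t : R, 0 < t -> 0 < w t} -> 0 < x ->
  (\int[mu]_(t in `[x, y]) (`|qf t * (w t `^ p'^-1)^-1| `^ p)%:E <= ((K * (2 * high_const p)) `^ p)%:E)%E.
Proof.
move=> wae x0; have w0 := frame_w0 F; have [[mqf _] _] := fq.
have mwp := measurable_frame_wp F.
have mwV : measurable_fun setT (fun t => (w t `^ p'^-1)^-1).
  have -> : (fun t => (w t `^ p'^-1)^-1) = (fun t => (w t `^ p'^-1) `^ (-1)).
    by apply/funext => t; rewrite powR_inv1// powR_ge0.
  exact: (measurableT_comp (measurable_powR _)).
apply: (@converse_hoelder R p _ x y (fun t => qf t * (w t `^ p'^-1)^-1) (fun t => w t `^ p'^-1)).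
- by have := frame_p10 F; lra.
- by rewrite !mulr_ge0 ?powR_ge0// /high_const mulr_ge0 ?powR_ge0.
- by [].
- by move=> t; exact: powR_ge0.
- exact: measurable_funM.
- exact: mwp.
- by apply: ae_impl wae => t H xt _; rewrite powR_gt0// H// (lt_le_trans x0).
move=> ga m mga ga0 gam gamo.
pose C t := ga t * (w t `^ p'^-1)^-1.
have mC : measurable_fun setT C by exact: measurable_funM.
have m0 : 0 <= m := le_trans (normr_ge0 _) (gam 0).
have CM t : `|C t| <= m.
  rewrite /C normrM normfV [`|w t `^ _|]ger0_norm ?powR_ge0//.
  have := powR_ge0 (w t) p'^-1; rewrite le_eqVlt => /predU1P[<-|wp0]; first by rewrite invr0 mulr0.
  by rewrite ler_pdivrMr.
have C0 t : t < x \/ y < t -> C t = 0 by move=> H; rewrite /C ga0// mul0r.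
have := density_test x0 mC CM C0.
rewrite (_ : itvint _ x y = itvint (fun t => qf t * (w t `^ p'^-1)^-1 * ga t) x y); last first.
  by apply: eq_itvint => t _ _; rewrite /C; ring.
rewrite (_ : itvint (fun t => `|C t| `^ p' * w t) x y = itvint (fun t => `|ga t| `^ p') x y)//.
apply: eq_itvint => t _ _; rewrite /C normrM normfV [`|w t `^ _|]ger0_norm ?powR_ge0//.
have [w00|wn] := eqVneq (w t) 0.
  have := gamo t; rewrite w00 powR0 ?invr_eq0// mulr0 normr_le0 => /eqP ->.
  by rewrite normr0 mulr0 powR0.
have wpn : w t `^ p'^-1 != 0 by rewrite gt_eqF// powR_gt0// lt_neqAle eq_sym wn w0.
rewrite powRM ?invr_ge0 ?powR_ge0// -mulrA -[RHS]mulr1; congr (_ * _).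
have wE : (w t `^ p'^-1) `^ p' = w t by rewrite -powRrM mulVf// powRr1.
transitivity ((w t `^ p'^-1)^-1 `^ p' * (w t `^ p'^-1) `^ p'); first by rewrite wE.
rewrite -powRM ?invr_ge0 ?powR_ge0//.
by rewrite mulVf// powR1.
Qed.

(** No derivative is involved, so every bounded [ga] supported in [[x, y]] is admissible and
    [om = 1] serves. *)
Lemma low_energy (x y : R) : 0 < x ->
  (\int[mu]_(t in `[x, y]) (`|f t * u t `^ p^-1| `^ p)%:E <= ((K * (2 * low_const p)) `^ p)%:E)%E.
Proof.
move=> x0; have mu' : measurable_fun setT (fun t => u t `^ p^-1).
  by apply: (measurableT_comp (measurable_powR _)); case: (frame_u F).
apply: (@converse_hoelder R p _ x y (fun t => f t * u t `^ p^-1) (fun=> 1)).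
- by have := frame_p10 F; lra.
- by rewrite !mulr_ge0 ?powR_ge0// /low_const mulr_ge0 ?powR_ge0.
- by [].
- by [].
- exact: measurable_funM.
- exact: measurable_cst.
- by apply: aeW.
move=> ga m mga ga0 gam _.
pose x1 := Num.min c x; pose y1 := Num.max d y.
have x10 : 0 < x1 by rewrite lt_min c0.
have lp : locint (fun t => `|ga t| `^ p').
  have := locint_powR_bounded (@locint1 R) (fun=> ler01) mga gam (ltW p'0).
  by congr locint; apply/funext => t; rewrite mulr1.
have HM : (\int[mu]_t (`|ga t| `^ p')%:E <= (itvint (fun t => (`|ga t| `^ p')%R) x y)%:E)%E.
  rewrite -(integral_patch_itv _ lp x0); apply: ge0_le_integral_nm => t _; first by rewrite lee_fin powR_ge0.
  rewrite patchE; case: ifPn => //; rewrite notin_setE/= in_itv/= => /negP; rewrite negb_and -!ltNge => /orP H.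
  by rewrite ga0// normr0 powR0.
have [lq _ _] := low_order_bound F mga lp HM.
have lfq : locint (fun t => f t * (u t `^ p^-1 * ga t)).
  by apply: locint_cont => // t; exact: has_density_continuous fq.
have x1c : x1 <= c by rewrite ge_min lexx.
have x1x : x1 <= x by rewrite ge_min lexx orbT.
have dy1 : d <= y1 by rewrite le_max lexx.
have yy1 : y <= y1 by rewrite le_max lexx orbT.
have := low_test F K0 f0 fK mga lp HM lfq x10 x1c dy1.
rewrite (itvint_supp lfq x10 x1x yy1); last by move=> t H; rewrite ga0// !mulr0.
by rewrite (@eq_itvint _ _ (fun t => f t * u t `^ p^-1 * ga t))// => t _ _; rewrite mulrA.
Qed.

End density.

End sobolev_representative.

Section representative.
Context {R : realType} {p : R} {w u a b ainv : R -> R}.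
Hypothesis F : interval_frame p w u a b ainv.
Local Notation mu := (@lebesgue_measure R).
Local Notation p' := (dualexp p).
Local Notation mR := (measurableTypeR R).
Local Notation nrm := (frame_norm p w a ainv).

Opaque itvint half_length powR frame_tail frame_D frame_B.

Lemma pairing_ae (f f' g : R -> R) : measurable_fun setT f -> measurable_fun setT f' ->
  measurable_fun setT g -> {ae mu, forall x : R, 0 < x -> f x = f' x} ->
  (\int[mu]_(x in Ipos) (f x * g x)%:E = \int[mu]_(x in Ipos) (f' x * g x)%:E)%E.
Proof.
move=> mf mf' mg ff'; apply: ae_eq_integral => //.
- exact: measurable_Ipos.
- by apply/measurable_EFinP; apply: measurable_funTS; exact: measurable_funM.
- by apply/measurable_EFinP; apply: measurable_funTS; exact: measurable_funM.
- by apply: ae_impl ff' => x H; rewrite /Ipos/= in_itv/= andbT => /H ->.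
Qed.

Lemma sobolev_representative (f : R -> R) (K : R) : {ae mu, forall t : R, 0 < t -> 0 < w t} ->
  measurable_fun setT f -> 0 <= K ->
  (forall g, locint g -> (nrm g < +oo)%E -> (\int[mu]_(x in Ipos) (`|f x * g x|)%:E < +oo)%E) ->
  (forall g, locint g -> (nrm g < +oo)%E ->
    (`|\int[mu]_(x in Ipos) (f x * g x)%:E| <= K%:E * nrm g)%E) ->
  exists ft qf : R -> R, [/\ has_density ft qf,
    exists c d, [/\ 0 < c, c <= d & forall x, x < c \/ d < x -> ft x = 0],
    {ae mu, forall x : R, 0 < x -> f x = ft x},
    forall x y : R, 0 < x -> (\int[mu]_(t in `[x, y]) (`|qf t * (w t `^ p'^-1)^-1| `^ p)%:E <=
      ((K * (2 * high_const p)) `^ p)%:E)%E &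
    forall x y : R, 0 < x -> (\int[mu]_(t in `[x, y]) (`|ft t * u t `^ p^-1| `^ p)%:E <=
      ((K * (2 * low_const p)) `^ p)%:E)%E].
Proof.
move=> wae mf K0 fD fK; have lf := test_locint F mf fD.
have [s s1 fs] := test_compact F mf fD.
have s0 : 0 < s := lt_le_trans ltr01 s1.
pose c := s^-1; have c0 : 0 < c by rewrite invr_gt0.
have cs : c <= s by rewrite (le_trans _ s1)// invf_le1.
(* [f] vanishes outside [[c, s]] only almost everywhere; the cut-off makes this hold at every point
   before means are taken. *)
pose f1 := f \_ `[c, s].
have mf1 : measurable_fun setT f1.
  by apply/(measurable_restrictT _ (measurable_itvR `[c, s])); exact: measurable_funTS.
have f1E : {ae mu, forall x : R, 0 < x -> f x = f1 x}.
  apply: ae_impl fs => x H x0; rewrite /f1 patchE; case: ifPn => //.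
  rewrite notin_setE/= in_itv/= => /negP; rewrite negb_and -!ltNge => /orP h.
  exact: H.
have f10 x : x < c \/ s < x -> f1 x = 0.
  move=> h; rewrite /f1 patchE memNset//= in_itv/= => /andP[h1 h2].
  by case: h; rewrite ltNge ?h1 ?h2.
have lf1 : locint f1.
  apply: (locint_dom mf1 (locint_norm lf)) => t _.
  by rewrite /f1 patchE; case: ifP => // _; rewrite normr0.
have f1K g : locint g -> (nrm g < +oo)%E ->
    (`|\int[mu]_(x in Ipos) (f1 x * g x)%:E| <= K%:E * nrm g)%E.
  by move=> lg ng; rewrite -(pairing_ae mf mf1 (proj1 lg) f1E); exact: fK.
have lw := frame_w F; have w0 := frame_w0 F.
have K1 : 0 <= K * (2 * high_const p).
  by rewrite !mulr_ge0 ?powR_ge0.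
have r0 : 0 < p'^-1 by rewrite invr_gt0 (frame_p'0 F).
have fam : forall (h al be : R) (sg s0 t : nat -> R) (n : nat),
  0 < h -> 0 < al -> al <= c -> s <= be -> (forall i, `|sg i| <= 1) ->
  (forall i, (i < n)%N -> [/\ al + h <= s0 i, s0 i <= t i & t i <= be]) ->
  (forall i, (i.+1 < n)%N -> t i <= s0 i.+1) ->
  `|\sum_(i < n) sg i * (left_mean f1 h (s0 i) - left_mean f1 h (t i))| <=
  K * (2 * high_const p) * (\sum_(i < n) itvint w (s0 i - h) (t i)) `^ p'^-1.
  move=> h al be sg s2 t n h0 al0 alc sbe sg1 H ord.
  exact: (family_means F lf1 K0 f10 f1K h0 al0 alc sbe sg1 H ord).
pose ft := means_limit f1.
have ac := means_limit_loc_abs_cont lf1 lw w0 c0 K1 r0 fam.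
have ae1 := means_limit_ae lf1.
have ft0 : forall x, x < c \/ s < x -> ft x = 0 by exact: means_limit0 f10.
have [qf [mq _ iq _ qE]] := loc_abs_cont_density ac.
have fq : has_density ft qf by split.
have mft : measurable_fun setT ft.
  have -> : ft = ft \_ Ipos.
    apply/funext => x; rewrite patchE; case: ifPn => //; rewrite notin_setE /Ipos/= in_itv/= andbT => /negP.
    by rewrite -leNgt => x0; apply: ft0; left; exact: le_lt_trans c0.
  exact: measurable_has_density_patch fq.
have fft : {ae mu, forall x : R, 0 < x -> f x = ft x}.
  by apply: ae_impl2 f1E ae1 => x h1 h2 x0; rewrite h1// /ft h2.
have ftK g : locint g -> (nrm g < +oo)%E ->
    (`|\int[mu]_(x in Ipos) (ft x * g x)%:E| <= K%:E * nrm g)%E.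
  by move=> lg ng; rewrite -(pairing_ae mf mft (proj1 lg) fft); exact: fK.
exists ft, qf; split => //.
- by exists c, s.
- by move=> x y x0; exact: (density_energy F fq mft c0 cs K0 ft0 ftK y wae x0).
- by move=> x y x0; exact: (low_energy F fq mft c0 K0 ft0 ftK y x0).
Qed.

End representative.

(** * Weak associate spaces *)

Section weights.
Context {R : realType}.
Local Notation mu := (@lebesgue_measure R).
Local Notation mR := (measurableTypeR R).

Lemma IposE (x : R) : Ipos x = (0 < x) :> Prop.
Proof. by rewrite /Ipos/= in_itv/= andbT. Qed.

Lemma patch_Ipos (g : R -> R) (x : R) : 0 < x -> (g \_ Ipos) x = g x.
Proof. by move=> x0; rewrite patchE mem_set// IposE. Qed.

Lemma measurable_patch_Ipos (g : R -> R) : measurable_fun Ipos g ->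
  measurable_fun setT (g \_ Ipos).
Proof. by move=> mg; apply/(measurable_restrictT _ measurable_Ipos). Qed.

Lemma eq_integral_itv (f g : R -> \bar R) (x y : R) : 0 < x ->
  (forall t, 0 < t -> f t = g t) ->
  (\int[mu]_(t in `[x, y]) f t = \int[mu]_(t in `[x, y]) g t)%E.
Proof.
move=> x0 fg; apply: eq_integral => t; rewrite inE/= in_itv/= => /andP[xt _].
by apply: fg; exact: lt_le_trans xt.
Qed.

Lemma locint_patch (g : R -> R) : measurable_fun Ipos g ->
  (forall c d : R, 0 < c -> c <= d -> (\int[mu]_(x in `[c, d]) (`|g x|)%:E < +oo)%E) ->
  locint (g \_ Ipos).
Proof.
move=> mg ig; have mp := measurable_patch_Ipos mg; split => // c d c0.
have [cd|dc] := leP c d; last first.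
  by rewrite set_itv_ge ?bnd_simp -?ltNge//; exact: integrable_set0.
apply/integrableP; split; first by apply/measurable_EFinP; exact: measurable_funTS.
have := ig c d c0 cd; congr (_ < _)%E; apply: eq_integral_itv => // t t0.
by rewrite /= patch_Ipos.
Qed.

Lemma locL_locint (r : R) (v : R -> R) : locL r v -> (forall x, Ipos x -> 0 <= v x) ->
  locint ((fun x => v x `^ r) \_ Ipos).
Proof.
move=> [mv iv] v0; apply: locint_patch.
  exact: (measurableT_comp (measurable_powR _) mv).
move=> c d c0 cd; have := iv c d c0 cd; congr (_ < _)%E; apply: eq_integral_itv => // t t0.
by rewrite !ger0_norm ?powR_ge0 ?v0 ?IposE.
Qed.

Lemma itvint_ae_gt0 (h : R -> R) (x y : R) : locint h -> (forall t, 0 <= h t) ->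
  {ae mu, forall t : R, 0 < t -> 0 < h t} -> 0 < x -> x < y -> 0 < itvint h x y.
Proof.
move=> lh h0 hae x0 xy; rewrite lt_neqAle itvint_ge0// andbT eq_sym; apply/eqP => I0.
have : (\int[mu]_(t in `[x, y]) `|(h t)%:E| = 0)%E.
  transitivity ((itvint h x y)%:E); last by rewrite I0.
  by rewrite itvintE//; apply: eq_integral => t _; rewrite gee0_abs// lee_fin.
have mhE : measurable_fun `[x, y] (fun t => (h t)%:E).
  by apply/measurable_EFinP; apply: measurable_funTS; case: lh.
move/(ae_eq_integral_abs mu (measurable_itvR `[x, y]) mhE) => H.
have : {ae mu, forall t : R, 0 < t -> ~ (x <= t /\ t <= y)}.
  apply: ae_impl2 H hae => t H1 H2 t0 [xt ty]; have := H2 t0.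
  have tI : `[x, y]%classic t by rewrite /= in_itv/= xt.
  by have := H1 tI; rewrite /cst => -[->]; rewrite ltxx.
move=> /ae_exists/(_ xy)[t [xt ty]]; apply; first exact: lt_trans xt.
by rewrite !ltW.
Qed.

Variables (p : R) (v0 v1 a b ainv : R -> R).
Hypotheses (p1 : 1 < p) (V0 : weightV p v0) (V1' : weightV p v1) (V1V : inv_locL (dualexp p) v1).
Hypotheses (AB : ab_conditions p v0 v1 a b) (AI : ainv_condition a ainv).
Local Notation p' := (dualexp p).

(** Zero off the half-line, where nothing is known about [v1]. *)
Definition dual_weight (p : R) (v1 : R -> R) : R -> R := w1 p v1 \_ Ipos.
Definition low_weight (p : R) (v0 : R -> R) : R -> R := (fun x => v0 x `^ p) \_ Ipos.
Local Notation w := (dual_weight p v1).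
Local Notation u := (low_weight p v0).

Let p'0 : 0 < p'. Proof. by rewrite /dualexp divr_gt0 ?subr_gt0// (lt_trans ltr01). Qed.

Let v1V0 x : Ipos x -> 0 <= (v1 x)^-1.
Proof. by case: V1' => _ [h _] /h; rewrite invr_ge0. Qed.

Lemma dual_weight_ge0 t : 0 <= w t.
Proof. by rewrite /dual_weight patchE; case: ifP => // _; exact: powR_ge0. Qed.

Lemma low_weight_ge0 t : 0 <= u t.
Proof. by rewrite /low_weight patchE; case: ifP => // _; exact: powR_ge0. Qed.

Lemma dual_weight_gt0 : {ae mu, forall t : R, 0 < t -> 0 < w t}.
Proof.
case: V1V => h _; apply: ae_impl h => t h t0; rewrite /dual_weight patch_Ipos//.
by rewrite powR_gt0// invr_gt0 h// IposE.
Qed.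

Lemma locint_dual_weight : locint w.
Proof. by case: V1V => _ h; exact: locL_locint. Qed.

Lemma locint_low_weight : locint u.
Proof. by case: V0 => h [h2 _]; exact: locL_locint. Qed.

Lemma integral_w1 (x y : R) : 0 < x ->
  (\int[mu]_(t in `[x, y]) (w1 p v1 t)%:E)%E = (itvint w x y)%:E.
Proof.
move=> x0; rewrite itvintE//; last exact: locint_dual_weight.
by apply: eq_integral_itv => // t t0; rewrite /dual_weight patch_Ipos.
Qed.

Lemma integral_v0 (x y : R) : 0 < x ->
  (\int[mu]_(t in `[x, y]) (v0 t `^ p)%:E)%E = (itvint u x y)%:E.
Proof.
move=> x0; rewrite itvintE//; last exact: locint_low_weight.
by apply: eq_integral_itv => // t t0; rewrite /low_weight patch_Ipos.
Qed.

Lemma frame_of_weights : interval_frame p w u a b ainv.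
Proof.
case: AB => a_lt [b_lt [aac [bac [a0 [b0 [ay [by_ [axb [abE VE]]]]]]]]].
(* If [a x <= 0], then near 0 the increasing function [a] would stay below the negative value
   [a (x / 2)], against its limit 0. *)
have apos x : 0 < x -> 0 < a x.
  move=> x0; rewrite ltNge; apply/negP => ax.
  have x20 : 0 < x / 2 by rewrite divr_gt0.
  have h : a (x / 2) < 0 by apply: lt_le_trans ax; apply: a_lt => //; lra.
  have e0 : 0 < - a (x / 2) by rewrite oppr_gt0.
  have /(@cvgrPdist_lt _ R^o)/(_ _ e0) := a0.
  move=> [d /= d0 /(_ (Num.min (d / 2) (x / 4)))]; rewrite /ball/=.
  have d20 : 0 < d / 2 by rewrite divr_gt0.
  have x40 : 0 < x / 4 by rewrite divr_gt0.
  have m0 : 0 < Num.min (d / 2) (x / 4) by rewrite lt_min d20.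
  have md : Num.min (d / 2) (x / 4) <= d / 2 by rewrite ge_min lexx.
  have mx : Num.min (d / 2) (x / 4) <= x / 4 by rewrite ge_min lexx orbT.
  rewrite sub0r normrN ger0_norm ?(ltW m0)// sub0r normrN => /(_ _ m0)H.
  have m2 : a (Num.min (d / 2) (x / 4)) < a (x / 2) by apply: a_lt => //; lra.
  have := H _; rewrite ltr0_norm; last exact: lt_trans h.
  by rewrite ltrN2 => H1; have := lt_trans m2 (H1 ltac:(lra)); rewrite ltxx.
split => //.
- exact: locint_dual_weight.
- exact: dual_weight_ge0.
- by move=> x y x0 xy; apply: itvint_ae_gt0 => //; [exact: locint_dual_weight|exact: dual_weight_ge0|exact: dual_weight_gt0].
- exact: locint_low_weight.
- exact: low_weight_ge0.
- by move=> x /axb[].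
- by move=> x /axb[].
- by move=> x; exact: loc_abs_cont_continuous.
- move=> x x0; have := abE x x0; rewrite !integral_w1 ?apos//.
  by move=> [].
- move=> x x0; have := VE x x0; have ax0 := apos x x0; rewrite integral_w1// integral_v0//.
  have [ax xb] := axb x x0.
  have := abE x x0; rewrite !integral_w1// => -[E].
  rewrite (itvintD locint_dual_weight ax0 (ltW ax) (ltW xb)) -E.
  have rp : 0 < itvint w (a x) x.
    by apply: itvint_ae_gt0 => //; [exact: locint_dual_weight|exact: dual_weight_ge0|exact: dual_weight_gt0].
  have U0 : 0 <= itvint u (a x) (b x) by apply: itvint_ge0; exact: low_weight_ge0.
  rewrite !poweR_EFin -EFinM => -[].
  move: (itvint u (a x) (b x)) U0 (itvint w (a x) x) rp => U U0 rr rp.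
  rewrite (_ : rr + rr = 2 * rr); last by ring.
  have r20 : 0 < 2 * rr by rewrite mulr_gt0.
  move: (2 * rr) r20 => V V0' H.
  have pn : p != 0 by rewrite gt_eqF// (lt_trans ltr01).
  (* The normalisation raised to the power [p], where [p / p' = p - 1]. *)
  have VU : V `^ (p - 1) * U = 1.
    have := congr1 (fun z => z `^ p) H; rewrite powR1 powRM ?powR_ge0// -!powRrM mulVf// powRr1//.
    by rewrite [p'^-1 * p](_ : _ = p - 1)// /dualexp invf_div; field.
  have := powR_cancel p V0'; move: VU.
  move: (V `^ (p - 1)) (V `^ (1 - p)) => A B AU AB1.
  by rewrite -[LHS]mul1r -AB1 mulrAC AU mul1r.
- by move=> t /AI[].
- by move=> t /AI[].
Qed.

End weights.

(** * Translation of the two norms *)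

Section norm_translation.
Context {R : realType}.
Local Notation mu := (@lebesgue_measure R).
Local Notation mR := (measurableTypeR R).
Variables (p : R) (v0 v1 a b ainv : R -> R).
Hypotheses (p1 : 1 < p) (V0 : weightV p v0) (V1' : weightV p v1) (V1V : inv_locL (dualexp p) v1).
Hypotheses (AB : ab_conditions p v0 v1 a b) (AI : ainv_condition a ainv).
Local Notation p' := (dualexp p).
Local Notation w := (dual_weight p v1).
Local Notation u := (low_weight p v0).
Local Notation nrm := (frame_norm p w a ainv).
Local Notation rho := (half_length w a).

Let F := frame_of_weights p1 V0 V1' V1V AB AI.

Opaque itvint half_length powR frame_tail.

Lemma WintE (x y : R) : 0 < x -> Wint p v1 x y = itvint w x y.
Proof. by move=> x0; rewrite /Wint (integral_w1 V1' V1V)//. Qed.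

Lemma V1E (t : R) : 0 < t -> V1 p v1 a b t = 2 * rho t.
Proof.
move=> t0; have a0 := frame_a0 F t0; rewrite /V1 WintE//.
rewrite (itvintD (frame_w F) a0 (ltW (frame_ax F t0)) (ltW (frame_xb F t0))) -(frame_ab F t0).
by rewrite half_lengthE; ring.
Qed.

Lemma integral_itv_B (g G : R -> R) (t : R) : locint G -> (forall x, 0 < x -> g x = G x) -> 0 < t ->
  (\int[mu]_(x in `[t, ainv t]) (g x / V1 p v1 a b x * Wint p v1 (a x) t)%:E)%E =
  (frame_B w a ainv (frame_scale w a G) t)%:E.
Proof.
move=> lG gG t0; have [h lh hE] := frame_B_kernel F (locint_scale F lG) t0.
have E : frame_B w a ainv (frame_scale w a G) t = itvint h t (ainv t).
  by rewrite /frame_B; apply: eq_itvint => x tx xX; rewrite hE.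
rewrite E itvintE//; apply: eq_integral => x; rewrite inE/= in_itv/= => /andP[tx xX].
have x0 := lt_le_trans t0 tx; congr EFin.
by rewrite hE// (frame_scaleE F)// gG// V1E// WintE ?(frame_a0 F)//; ring.
Qed.

Lemma integral_itv_D (g G : R -> R) (t : R) : locint G -> (forall x, 0 < x -> g x = G x) -> 0 < t ->
  (\int[mu]_(x in `[t, ainv t]) (g x / V1 p v1 a b x)%:E)%E =
  (frame_D ainv (frame_scale w a G) t)%:E.
Proof.
move=> lG gG t0; rewrite /frame_D itvintE//; last exact: (locint_scale F lG).
apply: eq_integral => x; rewrite inE/= in_itv/= => /andP[tx xX].
have x0 := lt_le_trans t0 tx; congr EFin.
by rewrite (frame_scaleE F)// gG// V1E//; ring.
Qed.

Lemma WnormE (g G : R -> R) : locint G -> (forall x, 0 < x -> g x = G x) ->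
  Wnorm p v1 a b ainv g = nrm G.
Proof.
move=> lG gG; rewrite /Wnorm /frame_norm /GGb /GGc /frame_Gb /frame_Gc; congr (_ + _)%E.
- congr (_ `^ _)%E; apply: eq_integral => t; rewrite inE IposE => t0.
  rewrite (integral_itv_B lG gG t0) -[(`|_|)%E]/((`|frame_B w a ainv (frame_scale w a G) t|)%:E).
  by rewrite poweR_EFin -EFinM /dual_weight patch_Ipos.
- congr (_ `^ _)%E; apply: eq_integral => t; rewrite inE IposE => t0.
  rewrite (integral_itv_D lG gG t0) -[(`|_|)%E]/((`|frame_D ainv (frame_scale w a G) t|)%:E).
  by rewrite poweR_EFin -EFinM V1E// /dual_weight patch_Ipos.
Qed.

Lemma locL1_patch (g : R -> R) : locL 1 g -> locint (g \_ Ipos).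
Proof.
move=> [mg ig]; apply: locint_patch => // c d c0 cd; have := ig c d c0 cd.
by congr (_ < _)%E; apply: eq_integral_itv => // t _; rewrite powRr1.
Qed.

Lemma Wspace_patch (g : R -> R) : Wspace p v1 a b ainv g ->
  [/\ locint (g \_ Ipos), nrm (g \_ Ipos) = Wnorm p v1 a b ainv g & (nrm (g \_ Ipos) < +oo)%E].
Proof.
move=> [lg ng]; have lG := locL1_patch lg.
have E : nrm (g \_ Ipos) = Wnorm p v1 a b ainv g.
  by rewrite (@WnormE g (g \_ Ipos))// => x x0; rewrite patch_Ipos.
by rewrite E.
Qed.

Lemma Wspace_locint (g G : R -> R) : locint G -> (forall x, 0 < x -> g x = G x) ->
  (nrm G < +oo)%E -> Wspace p v1 a b ainv g /\ Wnorm p v1 a b ainv g = nrm G.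
Proof.
move=> lG gG nG; have E : Wnorm p v1 a b ainv g = nrm G by exact: WnormE.
split=> //; split; last by rewrite E.
have [mG iG] := lG; split.
  have : measurable_fun Ipos G by exact: measurable_funTS.
  by apply: eq_measurable_fun => x; rewrite inE IposE => /gG.
move=> c d c0 _; have /integrableP[_] := iG c d c0; congr (_ < _)%E.
by apply: eq_integral_itv => // t t0; rewrite powRr1// gG.
Qed.

Let perturb_pow (I I0 m : R -> R) (k : R) : measurable_fun Ipos I -> measurable_fun Ipos I0 ->
  measurable_fun Ipos m -> (forall t, 0 <= m t) ->
  ((\int[mu]_(t in Ipos) (m t * `|I t| `^ p')%:E) `^ p'^-1 = 0)%E ->
  (\int[mu]_(t in Ipos) (m t * `|k * I t + I0 t| `^ p')%:E =
   \int[mu]_(t in Ipos) (m t * `|I0 t| `^ p')%:E)%E.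
Proof.
move=> mI mI0 mm m0 /poweR_eq0_eq0 H.
have mp (J : R -> R) : measurable_fun Ipos J -> measurable_fun Ipos (fun t => (m t * `|J t| `^ p')%:E).
  move=> mJ; apply/measurable_EFinP; apply: measurable_funM => //.
  by apply: (measurableT_comp (measurable_powR _)); exact: measurableT_comp.
have I0' (J : R -> R) t : (0 <= (m t * `|J t| `^ p')%:E)%E by rewrite lee_fin mulr_ge0// powR_ge0.
have {}H : (\int[mu]_(t in Ipos) `|(m t * `|I t| `^ p')%:E| = 0)%E.
  rewrite -[RHS]H; first by apply: eq_integral => t _; rewrite gee0_abs.
  by apply: integral_ge0.
have aeI := (ae_eq_integral_abs mu measurable_Ipos (mp _ mI)).1 H.
apply: ge0_ae_eq_integral_nm.
- exact: measurable_Ipos.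
- exact: mp.
- by move=> t _; rewrite lee_fin mulr_ge0// powR_ge0.
- by move=> t _; exact: I0'.
apply: ae_impl aeI => t h /h [] /eqP; rewrite mulf_eq0 => /orP[/eqP ->|]; first by rewrite !mul0r.
by rewrite powR_eq0 normr_eq0 => /andP[/eqP -> _]; rewrite mulr0 add0r.
Qed.

(** [frame_B] and [frame_D] are linear in [G]. If the norm of [G] is 0, their weighted powers vanish
    almost everywhere, so adding [k G] changes the integrands only on a null set. *)
Lemma frame_norm_perturb (G G0 : R -> R) (k : R) : locint G -> locint G0 -> nrm G = 0%E ->
  nrm (fun x => k * G x + G0 x) = nrm G0.
Proof.
move=> lG lG0.
have ls := locint_scale F lG; have ls0 := locint_scale F lG0.
have sE : frame_scale w a (fun x => k * G x + G0 x) =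
    (fun x => k * frame_scale w a G x + frame_scale w a G0 x).
  by apply/funext => x; rewrite /frame_scale; ring.
have DE t : 0 < t -> frame_D ainv (frame_scale w a (fun x => k * G x + G0 x)) t =
    k * frame_D ainv (frame_scale w a G) t + frame_D ainv (frame_scale w a G0) t.
  by move=> t0; rewrite /frame_D sE (itvint_sumD _ (locintZ k ls) ls0 t0) itvintZ.
have BE t : 0 < t -> frame_B w a ainv (frame_scale w a (fun x => k * G x + G0 x)) t =
    k * frame_B w a ainv (frame_scale w a G) t + frame_B w a ainv (frame_scale w a G0) t.
  move=> t0; have [h lh hE] := frame_B_kernel F ls t0; have [h0 lh0 h0E] := frame_B_kernel F ls0 t0.
  have e1 : frame_B w a ainv (frame_scale w a G) t = itvint h t (ainv t).
    by rewrite /frame_B; apply: eq_itvint => x tx xX; rewrite hE.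
  have e2 : frame_B w a ainv (frame_scale w a G0) t = itvint h0 t (ainv t).
    by rewrite /frame_B; apply: eq_itvint => x tx xX; rewrite h0E.
  rewrite e1 e2 -(itvintZ k _ lh t0) -(itvint_sumD _ (locintZ k lh) lh0 t0) /frame_B sE.
  by apply: eq_itvint => x tx xX; rewrite hE// h0E//; ring.
have mw : measurable_fun Ipos w by apply: measurable_funTS; case: (frame_w F).
have mwr : measurable_fun Ipos (fun t => w t * (2 * rho t) `^ p').
  apply: measurable_funM => //; apply: (measurableT_comp (measurable_powR _)).
  by apply: measurable_funM => //; exact: measurable_half_length F.
have gb0 : (0 <= frame_Gb p w a ainv (frame_scale w a G))%E by exact: poweR_ge0.
have gc0 : (0 <= frame_Gc p w a ainv (frame_scale w a G))%E by exact: poweR_ge0.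
move=> /eqP; rewrite (padde_eq0 gb0 gc0) => /andP[/eqP nb /eqP nc].
have EB : frame_Gb p w a ainv (frame_scale w a (fun x => k * G x + G0 x)) =
    frame_Gb p w a ainv (frame_scale w a G0).
  apply: (congr1 (fun I : \bar R => (I `^ p'^-1)%E)).
  transitivity (\int[mu]_(t in Ipos) (w t * `|k * frame_B w a ainv (frame_scale w a G) t +
    frame_B w a ainv (frame_scale w a G0) t| `^ p')%:E)%E.
    by apply: eq_integral => t; rewrite inE IposE => t0; rewrite BE.
  exact: (perturb_pow k (measurable_frame_B F ls) (measurable_frame_B F ls0) mw (frame_w0 F) nb).
have EC : frame_Gc p w a ainv (frame_scale w a (fun x => k * G x + G0 x)) =
    frame_Gc p w a ainv (frame_scale w a G0).
  apply: (congr1 (fun I : \bar R => (I `^ p'^-1)%E)).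
  transitivity (\int[mu]_(t in Ipos) (w t * (2 * rho t) `^ p' * `|k * frame_D ainv (frame_scale w a G) t +
    frame_D ainv (frame_scale w a G0) t| `^ p')%:E)%E.
    by apply: eq_integral => t; rewrite inE IposE => t0; rewrite DE.
  have wr0 t : 0 <= w t * (2 * rho t) `^ p' by exact: (mulr_ge0 (frame_w0 F t) (powR_ge0 _ _)).
  exact: (perturb_pow k (measurable_frame_D F ls) (measurable_frame_D F ls0) mwr wr0 nc).
by rewrite /frame_norm EB EC.
Qed.

End norm_translation.

Section local_bounds.
Context {R : realType}.
Local Notation mu := (@lebesgue_measure R).
Local Notation mR := (measurableTypeR R).

Lemma le_integral_itv_Ipos (h : R -> R) (x y : R) : 0 < x -> (forall t, 0 <= h t) ->
  (\int[mu]_(t in `[x, y]) (h t)%:E <= \int[mu]_(t in Ipos) (h t)%:E)%E.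
Proof.
move=> x0 h0; rewrite integral_mkcond [leRHS]integral_mkcond.
apply: ge0_le_integral_nm => t _; rewrite patchE; first by case: ifP => // _; rewrite lee_fin.
rewrite patchE; case: ifPn => [|_]; last by case: ifP => // _; rewrite lee_fin.
rewrite inE/= in_itv/= => /andP[xt _]; rewrite mem_set// IposE; exact: lt_le_trans xt.
Qed.

Lemma locint_of_bound (h : R -> R) (M : R) : measurable_fun setT h -> (forall t, 0 <= h t) ->
  (forall x y : R, 0 < x -> (\int[mu]_(t in `[x, y]) (h t)%:E <= M%:E)%E) ->
  locint h /\ forall x y : R, 0 < x -> itvint h x y <= M.
Proof.
move=> mh h0 hM; have lh : locint h.
  split => // x y x0; apply/integrableP; split; first by apply/measurable_EFinP; exact: measurable_funTS.
  rewrite (le_lt_trans _ (ltry M))//; apply: le_trans (hM x y x0).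
  by apply: ge0_le_integral_nm => t _; rewrite gee0_abs// lee_fin.
by split => // x y x0; rewrite -lee_fin itvintE//; exact: hM.
Qed.

End local_bounds.

Section weight_roots.
Context {R : realType}.
Variables (p : R) (v0 v1 : R -> R).
Hypotheses (p1 : 1 < p) (V0 : weightV p v0) (V1' : weightV p v1).
Local Notation p' := (dualexp p).
Local Notation w := (dual_weight p v1).
Local Notation u := (low_weight p v0).

Let pn0 : p != 0. Proof. by rewrite gt_eqF// (lt_trans ltr01). Qed.
Let p'n0 : p' != 0. Proof. by rewrite /dualexp mulf_neq0// invr_eq0 subr_eq0 gt_eqF. Qed.

Lemma dual_weight_root (x : R) : 0 < x -> (w x `^ p'^-1)^-1 = v1 x.
Proof.
move=> x0; case: V1' => _ [h _]; rewrite /dual_weight patch_Ipos// /w1 -powRrM mulfV//.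
by rewrite powRr1 ?invrK// invr_ge0 h// IposE.
Qed.

Lemma low_weight_root (x : R) : 0 < x -> u x `^ p^-1 = v0 x.
Proof.
move=> x0; case: V0 => _ [h _]; rewrite /low_weight patch_Ipos// -powRrM mulfV//.
by rewrite powRr1// h// IposE.
Qed.

End weight_roots.

Section sobolev_translation.
Context {R : realType} {p : R} {w u a b ainv : R -> R}.
Hypothesis F : interval_frame p w u a b ainv.
Local Notation mu := (@lebesgue_measure R).
Local Notation mR := (measurableTypeR R).
Variables (v0 v1 : R -> R).
Hypothesis wae : {ae mu, forall t : R, 0 < t -> 0 < w t}.
Hypothesis w_root : forall x : R, 0 < x -> (w x `^ (dualexp p)^-1)^-1 = v1 x.
Hypothesis u_root : forall x : R, 0 < x -> u x `^ p^-1 = v0 x.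
Local Notation p' := (dualexp p).
Local Notation X := (W00 p v0 v1).
Local Notation nX := (W1pnorm p v0 v1).

Let p0 : 0 < p := frame_p0 F.
Let pn0 : p != 0. Proof. by rewrite gt_eqF// (frame_p0 F). Qed.
Let pV0 : 0 <= p^-1. Proof. by rewrite invr_ge0 ltW// (frame_p0 F). Qed.
Let p'n0 : p' != 0. Proof. by rewrite gt_eqF// (frame_p'0 F). Qed.

Opaque itvint half_length powR frame_tail frame_D frame_B.

Lemma measurable_wpV : measurable_fun setT (fun t => (w t `^ p'^-1)^-1).
Proof.
have -> : (fun t => (w t `^ p'^-1)^-1) = (fun t => (w t `^ p'^-1) `^ (-1)).
  by apply/funext => t; rewrite powR_inv1// powR_ge0.
exact: (measurableT_comp (measurable_powR _) (measurable_frame_wp F)).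
Qed.

Lemma measurable_up : measurable_fun setT (fun t => u t `^ p^-1).
Proof. by apply: (measurableT_comp (measurable_powR _)); case: (frame_u F). Qed.

Definition low_part (f : R -> R) : \bar R := (\int[mu]_(x in Ipos) (`|f x * u x `^ p^-1| `^ p)%:E)%E.
Definition high_part (q : R -> R) : \bar R :=
  (\int[mu]_(x in Ipos) (`|q x * (w x `^ p'^-1)^-1| `^ p)%:E)%E.

Lemma low_part_ge0 f : (0 <= low_part f)%E.
Proof. by apply: integral_ge0 => t _; rewrite lee_fin powR_ge0. Qed.

Lemma high_part_ge0 f : (0 <= high_part f)%E.
Proof. by apply: integral_ge0 => t _; rewrite lee_fin powR_ge0. Qed.

Let measurable_high (q : R -> R) : measurable_fun setT q ->
  measurable_fun setT (fun x => `|q x * (w x `^ p'^-1)^-1| `^ p).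
Proof.
move=> mq; apply: (measurableT_comp (measurable_powR _)); apply: measurableT_comp => //.
by apply: measurable_funM => //; exact: measurable_wpV.
Qed.

Lemma W1pnormE (f q : R -> R) : has_density f q ->
  nX f = (low_part f `^ p^-1 + high_part q `^ p^-1)%E.
Proof.
move=> fq.
have E1 : Lrnorm p Ipos (fun x => v0 x * f x) = (low_part f `^ p^-1)%E.
  apply: (congr1 (fun I : \bar R => (I `^ p^-1)%E)); apply: eq_integral => t; rewrite inE IposE => t0.
  by rewrite u_root// [v0 t * _]mulrC.
suff E2 : Lrnorm p Ipos (fun x => v1 x * derive1 f x) = (high_part q `^ p^-1)%E.
  by rewrite /W1pnorm E1 E2.
apply: (congr1 (fun I : \bar R => (I `^ p^-1)%E)); apply: ge0_ae_eq_integral_nm.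
- exact: measurable_Ipos.
- apply/measurable_EFinP; apply: measurable_funTS; apply: measurable_high.
  by case: fq => -[].
- by move=> t _; rewrite lee_fin powR_ge0.
- by move=> t _; rewrite lee_fin powR_ge0.
- apply: ae_impl (has_density_ae_derive fq) => t H; rewrite IposE => t0.
  have [_ dE] := H t0; rewrite w_root// derive1E dE.
  by rewrite [v1 t * _]mulrC.
Qed.

Lemma W1pnorm_ge0 f : (0 <= nX f)%E.
Proof. by rewrite /W1pnorm /Lrnorm adde_ge0// poweR_ge0. Qed.

Lemma W1pnorm_le (f q : R -> R) (K1 K2 : R) : has_density f q -> measurable_fun Ipos f ->
  0 <= K1 -> 0 <= K2 ->
  (forall x y : R, 0 < x -> (\int[mu]_(t in `[x, y]) (`|q t * (w t `^ p'^-1)^-1| `^ p)%:E <= (K1 `^ p)%:E)%E) ->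
  (forall x y : R, 0 < x -> (\int[mu]_(t in `[x, y]) (`|f t * u t `^ p^-1| `^ p)%:E <= (K2 `^ p)%:E)%E) ->
  (nX f <= (K1 + K2)%:E)%E.
Proof.
move=> fq mf K10 K20 H1 H2; rewrite (W1pnormE fq) EFinD addeC.
have root (I : \bar R) (K : R) : (0 <= I)%E -> 0 <= K -> (I <= (K `^ p)%:E)%E -> (I `^ p^-1 <= K%:E)%E.
  move=> I0 K0 /(ge0_poweR_ler pV0 I0) h; apply: (le_trans h).
  by rewrite poweR_EFin -powRrM mulfV// powRr1.
have h1 : (high_part q <= (K1 `^ p)%:E)%E.
  apply: ge0_integral_Ipos_le.
  - apply/measurable_EFinP; apply: measurable_funTS; apply: measurable_high.
    by case: fq => -[].
  - by move=> x _; rewrite lee_fin powR_ge0.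
  - by move=> x y x0 _; exact: H1.
have h2 : (low_part f <= (K2 `^ p)%:E)%E.
  apply: ge0_integral_Ipos_le.
  - apply/measurable_EFinP; apply: (measurableT_comp (measurable_powR _)).
    apply: measurableT_comp => //; apply: measurable_funM => //.
    by apply: measurable_funTS; exact: measurable_up.
  - by move=> x _; rewrite lee_fin powR_ge0.
  - by move=> x y x0 _; exact: H2.
by apply: leeD; apply: root => //; [exact: low_part_ge0|exact: high_part_ge0].
Qed.

Lemma W00_density f : X f -> exists q, has_density f q.
Proof.
move=> [_ [fac _]]; have [q [mq _ iq _ qE]] := loc_abs_cont_density fac.
by exists q; split.
Qed.

Lemma measurable_W00 f : X f -> measurable_fun setT f.
Proof.
move=> Xf; have [q fq] := W00_density Xf; case: Xf => -[c [d [c0 cd f0]]] _.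
have -> : f = f \_ Ipos.
  apply/funext => x; rewrite patchE; case: ifPn => //; rewrite notin_setE IposE => /negP.
  by rewrite -leNgt => x0; apply: f0; left; exact: le_lt_trans c0.
exact: measurable_has_density_patch fq.
Qed.

Lemma density_ae0 (f q : R -> R) (c d : R) : has_density f q -> 0 < c ->
  (forall x, x < c \/ d < x -> f x = 0) ->
  {ae mu, forall x : R, 0 < x -> x < c \/ d < x -> q x = 0}.
Proof.
move=> fq c0 f0; apply: ae_impl (has_density_ae_derive fq) => x H x0 xcd.
have df := H x0; apply/eqP; rewrite -normr_le0 -[leRHS](mul0r 1).
have di : is_derive x 1 (@id R) 1 by exact: is_derive_id.
case: xcd => [xc|dx].
  have e0 : 0 < (c - x) / 2 by rewrite divr_gt0// subr_gt0.
  apply: (is_derive_le_right df di e0) => y xy yx.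
  by rewrite !f0 ?subrr ?normr0 ?mul0r//; left; lra.
apply: (is_derive_le_right df di ltr01) => y xy yx.
by rewrite !f0 ?subrr ?normr0 ?mul0r//; right; lra.
Qed.

Lemma fin_num_W1pnorm f : X f -> nX f = (fine (nX f))%:E.
Proof.
by move=> [_ [_ h]]; rewrite fineK// ge0_fin_numE// W1pnorm_ge0.
Qed.

(** The candidate is [r = q / w^(1/p')] restricted to [[c, d]]: [sob_supp] asks for zeros at every
    point, while [q] vanishes outside [[c, d]] only almost everywhere. The factor 2 adds the two
    energies. *)
Lemma sobolev_of_parts (f q : R -> R) (c d M : R) : has_density f q -> measurable_fun setT f ->
  0 < c -> c <= d -> (forall x, x < c \/ d < x -> f x = 0) ->
  (\int[mu]_(x in Ipos) (`|f x * u x `^ p^-1| `^ p)%:E <= M%:E)%E ->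
  (\int[mu]_(x in Ipos) (`|q x * (w x `^ p'^-1)^-1| `^ p)%:E <= M%:E)%E ->
  exists r, sobolev_fun p w u f r (2 * M).
Proof.
move=> fq mf c0 cd f0 hl hh; have mq : measurable_fun setT q by case: fq => -[].
pose r0 t := q t * (w t `^ p'^-1)^-1.
have mr0 : measurable_fun setT r0 by apply: measurable_funM => //; exact: measurable_wpV.
pose r := r0 \_ `[c, d].
have mr : measurable_fun setT r.
  by apply/(measurable_restrictT _ (measurable_itvR `[c, d])); exact: measurable_funTS.
have up1 t : u t = (u t `^ p^-1) `^ p by rewrite -powRrM mulVf// powRr1// (frame_u0 F).
have lowE t : `|f t| `^ p * u t = `|f t * u t `^ p^-1| `^ p.
  by rewrite normrM powRM// [`|u t `^ _|]ger0_norm ?powR_ge0// -up1.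
have rr0 t : `|r t| `^ p <= `|r0 t| `^ p.
  by rewrite /r patchE; case: ifP => // _; rewrite normr0 powR0// powR_ge0.
have [| | | lr rM] := @locint_of_bound R (fun t => `|r t| `^ p) M.
- by apply: (measurableT_comp (measurable_powR _)); exact: measurableT_comp.
- by move=> t; exact: powR_ge0.
- move=> x y x0; apply: le_trans (le_integral_itv_Ipos y x0 (fun t => powR_ge0 _ _)) _.
  by apply: le_trans hh; apply: ge0_le_integral_nm => t _; rewrite lee_fin ?powR_ge0//; exact: rr0.
have [| | | lu uM] := @locint_of_bound R (fun t => `|f t| `^ p * u t) M.
- apply: measurable_funM; last by case: (frame_u F).
  by apply: (measurableT_comp (measurable_powR _)); exact: measurableT_comp.
- by move=> t; rewrite mulr_ge0 ?powR_ge0 ?(frame_u0 F).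
- move=> x y x0; under eq_integral do rewrite lowE.
  by apply: le_trans (le_integral_itv_Ipos y x0 (fun t => powR_ge0 _ _)) _; exact: hl.
exists r; split => //.
- move=> x y x0 xy; rewrite (proj2 fq)//.
  have lrw := locint_wp F mr lr.
  have E : {ae mu, forall t : R, 0 < t -> q t = r t * w t `^ p'^-1}.
    apply: ae_impl2 (density_ae0 fq c0 f0) wae => t h1 h2 t0.
    rewrite /r patchE; case: ifPn => [_|].
      by rewrite /r0 mulrVK// unitfE gt_eqF// powR_gt0// h2.
    rewrite notin_setE/= in_itv/= => /negP; rewrite negb_and -!ltNge => /orP h.
    by rewrite h1// mul0r.
  have lq := proj1 fq; apply/eqP; rewrite eq_le; apply/andP; split.
    by apply: itvint_ae_le => //; apply: ae_impl E => t h xt _; rewrite -h// (lt_trans x0).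
  by apply: itvint_ae_le => //; apply: ae_impl E => t h xt _; rewrite -h// (lt_trans x0).
- by move=> x y x0; rewrite itvint_sumD// mulr2n mulrDl mul1r lerD// ?rM ?uM.
- exists c, d; split => // x h; split; first exact: f0.
  rewrite /r patchE memNset//= in_itv/= => /andP[h1 h2].
  by case: h; rewrite ltNge ?h1 ?h2.
Qed.

Lemma sobolev_of_W00 f : X f -> exists r, sobolev_fun p w u f r (2 * fine (nX f) `^ p).
Proof.
move=> Xf; have [q fq] := W00_density Xf; have mf := measurable_W00 Xf.
have fE := fin_num_W1pnorm Xf; have nE := W1pnormE fq.
have [[c [d [c0 cd f0]]] _] := Xf.
have n0 : 0 <= fine (nX f) by rewrite fine_ge0// W1pnorm_ge0.
move: (fine (nX f)) fE n0 => n fE n0.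
have lp0 := low_part_ge0 f; have hp0 := high_part_ge0 q.
have part (I J : \bar R) : (0 <= I)%E -> (0 <= J)%E -> (I `^ p^-1 + J `^ p^-1 = n%:E)%E -> (I <= (n `^ p)%:E)%E.
  move=> I0 J0 IJ; have : (I `^ p^-1 <= n%:E)%E by rewrite -IJ leeDl// poweR_ge0.
  move=> /(ge0_poweR_ler (ltW p0) (poweR_ge0 _ _)); rewrite poweR_EFin -poweRrM// mulVf//.
  by rewrite poweRe1.
have hl : (low_part f <= (n `^ p)%:E)%E by apply: (part _ _ lp0 hp0); rewrite -nE.
have hh : (high_part q <= (n `^ p)%:E)%E by apply: (part _ _ hp0 lp0); rewrite addeC -nE.
exact: (sobolev_of_parts fq mf c0 cd f0 hl hh).
Qed.

End sobolev_translation.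

(** * Abstract weak duality *)

Section weak_duality.
Context {R : realType}.
Local Notation mu := (@lebesgue_measure R).
Local Notation mR := (measurableTypeR R).
Implicit Types (f g h : R -> R) (X : (R -> R) -> Prop) (nX : (R -> R) -> \bar R).

Lemma pairingC f g : (\int[mu]_(x in Ipos) (f x * g x)%:E = \int[mu]_(x in Ipos) (g x * f x)%:E)%E.
Proof. by apply: eq_integral => x _; rewrite mulrC. Qed.

Lemma abs_pairingC f g :
  (\int[mu]_(x in Ipos) (`|f x * g x|)%:E = \int[mu]_(x in Ipos) (`|g x * f x|)%:E)%E.
Proof. by apply: eq_integral => x _; rewrite mulrC. Qed.

Lemma pairing_integrable f g : measurable_fun Ipos f -> measurable_fun Ipos g ->
  (\int[mu]_(x in Ipos) (`|f x * g x|)%:E < +oo)%E ->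
  mu.-integrable Ipos (EFin \o (fun x => f x * g x)).
Proof.
move=> mf mg fin; apply/integrableP; split => //.
by apply/measurable_EFinP; exact: measurable_funM.
Qed.

Lemma pairing_fin f g : measurable_fun Ipos f -> measurable_fun Ipos g ->
  (\int[mu]_(x in Ipos) (`|f x * g x|)%:E < +oo)%E ->
  exists I : R, (\int[mu]_(x in Ipos) (f x * g x)%:E = I%:E)%E.
Proof.
move=> mf mg fin; exists (fine (\int[mu]_(x in Ipos) (f x * g x)%:E)%E); rewrite fineK//.
by apply: integrable_fin_num; [exact: measurable_Ipos|exact: pairing_integrable].
Qed.

Lemma pairing_linear f f0 h (k : R) : measurable_fun Ipos f -> measurable_fun Ipos f0 ->
  measurable_fun Ipos h ->
  (\int[mu]_(x in Ipos) (`|f x * h x|)%:E < +oo)%E ->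
  (\int[mu]_(x in Ipos) (`|f0 x * h x|)%:E < +oo)%E ->
  (\int[mu]_(x in Ipos) ((k * f x + f0 x) * h x)%:E =
   k%:E * \int[mu]_(x in Ipos) (f x * h x)%:E + \int[mu]_(x in Ipos) (f0 x * h x)%:E)%E.
Proof.
move=> mf mf0 mh i i0; have mI : measurable (Ipos : set mR) := measurable_Ipos.
have I1 := pairing_integrable mf mh i; have I0 := pairing_integrable mf0 mh i0.
have I2 := integrableZl mI k I1.
rewrite -(integralZl mI I1) -(integralD mI I2 I0); apply: eq_integral => x _.
by rewrite /= mulrDl -mulrA.
Qed.

Lemma pairing_linear_fin f f0 h (k : R) : measurable_fun Ipos f -> measurable_fun Ipos f0 ->
  measurable_fun Ipos h ->
  (\int[mu]_(x in Ipos) (`|f x * h x|)%:E < +oo)%E ->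
  (\int[mu]_(x in Ipos) (`|f0 x * h x|)%:E < +oo)%E ->
  (\int[mu]_(x in Ipos) (`|(k * f x + f0 x) * h x|)%:E < +oo)%E.
Proof.
move=> mf mf0 mh i i0; have mI : measurable (Ipos : set mR) := measurable_Ipos.
have I1 := pairing_integrable mf mh i; have I0 := pairing_integrable mf0 mh i0.
have /integrableP[_] := integrableD mI (integrableZl mI k I1) I0; congr (_ < _)%E.
by apply: eq_integral => x _; rewrite /= mulrDl -mulrA.
Qed.

Lemma Jfun_ub X nX f g : X f -> nX f != 0%E ->
  (`|\int[mu]_(x in Ipos) (f x * g x)%:E| * ((fine (nX f))^-1)%:E <= Jfun X nX g)%E.
Proof. by move=> Xf nf; apply: ereal_sup_ubound; exists f. Qed.

Lemma Jfun_le X nX g (M : R) : 0 <= M -> (forall f, X f -> (0 <= nX f < +oo)%E) ->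
  (forall f, X f -> nX f != 0%E ->
    (`|\int[mu]_(x in Ipos) (f x * g x)%:E| <= M%:E * nX f)%E) -> (Jfun X nX g <= M%:E)%E.
Proof.
move=> M0 nX0 H; apply: ge_ereal_sup => _ [f [Xf nf] <-].
have := H f Xf nf; have /andP[] := nX0 f Xf; case: (nX f) nf => [n nn n0 _|//|//].
have np : 0 < n by rewrite lt_neqAle eq_sym -lee_fin n0 andbT; apply: contraNneq nn => ->.
by move=> h; rewrite /= lee_pdivrMr.
Qed.

(** The properties of a norm on which the duality argument rests, together with [null_stable] for
    its null vectors. *)
Definition normlike X nX := forall f, X f -> measurable_fun Ipos f /\ (0 <= nX f < +oo)%E.

(* [f0] witnesses that null vectors of [nX] do not affect the norm: [nX (k f + f0) = nX f0 <> 0]. *)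
Definition null_stable X nX f0 := [/\ X f0, nX f0 != 0%E &
  forall f, X f -> nX f = 0%E -> forall k : R,
    X (fun x => k * f x + f0 x) /\ nX (fun x => k * f x + f0 x) = nX f0].

Lemma normlike_gt0 X nX f : normlike X nX -> X f -> nX f != 0%E ->
  exists2 n : R, 0 < n & nX f = n%:E.
Proof.
move=> NX Xf nf; have [_ /andP[]] := NX f Xf; case: (nX f) nf => [n nn n0 _|//|//].
by exists n => //; rewrite lt_neqAle eq_sym -lee_fin n0 andbT; apply: contraNneq nn => ->.
Qed.

Lemma Jfun_ge0 X nX f0 g : normlike X nX -> null_stable X nX f0 -> (0 <= Jfun X nX g)%E.
Proof.
move=> NX [Xf0 n0 _]; apply: le_trans (Jfun_ub g Xf0 n0).
have [n np ->] := normlike_gt0 NX Xf0 n0.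
by rewrite mule_ge0 ?abse_ge0// lee_fin invr_ge0 ltW.
Qed.

(* [Jfun] only tests [f] with [nX f <> 0]; a null vector [f] is reached by testing
   [k f + f0] for large [k]. *)
Lemma pairing_le_Jfun X nX f0 f h : normlike X nX -> null_stable X nX f0 ->
  Dspace X h -> (Jfun X nX h < +oo)%E -> X f ->
  (`|\int[mu]_(x in Ipos) (f x * h x)%:E| <= Jfun X nX h * nX f)%E.
Proof.
move=> NX NS [mh Dh] Jfin Xf; have J0 := Jfun_ge0 h NX NS.
have [f_nz|f_nz] := eqVneq (nX f) 0%E; last first.
  have := Jfun_ub h Xf f_nz; have [n np ->] := normlike_gt0 NX Xf f_nz.
  by rewrite /= lee_pdivrMr.
rewrite f_nz mule0; have [Xf0 f0nz pert] := NS.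
have [mf _] := NX f Xf; have [mf0 _] := NX f0 Xf0.
have df := Dh f Xf; have df0 := Dh f0 Xf0.
have [I IE] := pairing_fin mf mh df; have [I0 I0E] := pairing_fin mf0 mh df0.
have [n np nE] := normlike_gt0 NX Xf0 f0nz.
have [J JE] : exists J : R, Jfun X nX h = J%:E.
  by exists (fine (Jfun X nX h)); rewrite fineK// ge0_fin_numE.
have H (k : R) : `|k * I + I0| <= J * n.
  have [Xk nk] := pert f Xf f_nz k.
  have nzk : nX (fun x => k * f x + f0 x) != 0%E by rewrite nk.
  have := Jfun_ub h Xk nzk; rewrite nk.
  rewrite (pairing_linear k mf mf0 mh df df0) IE I0E nE JE /=.
  by rewrite lee_pdivrMr.
suff I_0 : I = 0 by rewrite IE I_0 /= normr0.
apply/eqP/negPn/negP => In.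
have I_gt0 : 0 < `|I| by rewrite normr_gt0.
have := H ((J * n + `|I0| + 1) / I); rewrite divfK// leNgt => /negP; apply.
have := ler_norm (J * n + `|I0| + 1 + I0); apply: lt_le_trans.
have := ler_norm (- I0); rewrite normrN => h1; lra.
Qed.

Lemma aeI_pairing f g h : measurable_fun Ipos f -> measurable_fun Ipos g -> measurable_fun Ipos h ->
  aeI f g -> (\int[mu]_(x in Ipos) (h x * f x)%:E = \int[mu]_(x in Ipos) (h x * g x)%:E)%E.
Proof.
move=> mf mg mh fg; apply: ae_eq_integral => //.
- exact: measurable_Ipos.
- by apply/measurable_EFinP; exact: measurable_funM.
- by apply/measurable_EFinP; exact: measurable_funM.
- by apply: ae_impl fg => x H /H ->.
Qed.

Lemma aeI_Jfun X nX f g : normlike X nX -> measurable_fun Ipos f -> measurable_fun Ipos g ->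
  aeI f g -> Jfun X nX f = Jfun X nX g.
Proof.
move=> NX mf mg fg; rewrite /Jfun; congr ereal_sup; apply/seteqP; split => _ [h [Xh nh] <-];
  exists h => //; have [mh _] := NX h Xh; first by rewrite (aeI_pairing mf mg mh fg).
by rewrite (aeI_pairing mf mg mh fg).
Qed.

Lemma wassoc_norm X nX f0 : normlike X nX -> null_stable X nX f0 ->
  normlike (wassoc X nX) (Jfun X nX).
Proof. by move=> NX NS g [[mg _] Jg]; split=> //; rewrite Jg (Jfun_ge0 g NX NS). Qed.

(* In the associate space a null vector annihilates [X], so adding it changes no pairing. *)
Lemma wassoc_null_stable X nX f0 g0 : normlike X nX -> null_stable X nX f0 ->
  wassoc X nX g0 -> (\int[mu]_(x in Ipos) (f0 x * g0 x)%:E != 0)%E ->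
  null_stable (wassoc X nX) (Jfun X nX) g0.
Proof.
move=> NX NS X'g0 nz; have [Xf0 f0nz _] := NS; have [[mg0 Dg0] Jg0] := X'g0.
split => //.
  apply/eqP => J0; have := pairing_le_Jfun NX NS (conj mg0 Dg0) Jg0 Xf0; rewrite J0 mul0e.
  by move=> h; move: nz; rewrite -abse_eq0 eq_le abse_ge0 h.
move=> g [[mg Dg] Jg] Jg_0 k.
have mk : measurable_fun Ipos (fun x => k * g x + g0 x).
  by apply: measurable_funD => //; exact: measurable_funM.
have lin f : X f -> (\int[mu]_(x in Ipos) (f x * (k * g x + g0 x))%:E =
    \int[mu]_(x in Ipos) (f x * g0 x)%:E)%E.
  move=> Xf; have [mf _] := NX f Xf; rewrite pairingC.
  rewrite pairing_linear//; [|by rewrite abs_pairingC Dg|by rewrite abs_pairingC Dg0].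
  have : (\int[mu]_(x in Ipos) (g x * f x)%:E = 0)%E.
    apply/eqP; rewrite -abse_eq0 eq_le abse_ge0 andbT pairingC.
    by have := pairing_le_Jfun NX NS (conj mg Dg) Jg Xf; rewrite Jg_0 mul0e.
  by move=> ->; rewrite mule0 add0e pairingC.
have JE : Jfun X nX (fun x => k * g x + g0 x) = Jfun X nX g0.
  by rewrite /Jfun; congr ereal_sup; apply/seteqP; split => _ [f [Xf nf] <-];
    exists f => //; rewrite lin.
split => //; split; last by rewrite JE.
split => // f Xf; have [mf _] := NX f Xf; rewrite abs_pairingC.
by apply: pairing_linear_fin => //; rewrite abs_pairingC ?Dg ?Dg0.
Qed.

End weak_duality.

(** * Pairings of the Sobolev space *)

Section frame_duality.
Context {R : realType} {p : R} {w u a b ainv : R -> R}.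
Hypothesis F : interval_frame p w u a b ainv.
Local Notation mu := (@lebesgue_measure R).
Local Notation mR := (measurableTypeR R).
Variables (v0 v1 : R -> R).
Hypothesis wae : {ae mu, forall t : R, 0 < t -> 0 < w t}.
Hypothesis w_root : forall x : R, 0 < x -> (w x `^ (dualexp p)^-1)^-1 = v1 x.
Hypothesis u_root : forall x : R, 0 < x -> u x `^ p^-1 = v0 x.
Local Notation p' := (dualexp p).
Local Notation X := (W00 p v0 v1).
Local Notation nX := (W1pnorm p v0 v1).
Local Notation nrm := (frame_norm p w a ainv).
Local Notation rho := (half_length w a).

Let p0 : 0 < p := frame_p0 F.
Let pn0 : p != 0. Proof. by rewrite gt_eqF// (frame_p0 F). Qed.

Opaque itvint half_length powR frame_tail frame_D frame_B.

(** One factor 2 comes from [f G = 2 (G / (2 rho)) rho f], the other from [(2 n^p)^(1/p) <= 2 n]. *)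
Definition pairing_const (p : R) := 4 * (1 + level_const p `^ p^-1).

Lemma pairing_const_gt0 : 0 < pairing_const p.
Proof. by rewrite mulr_gt0// ltr_pwDl// powR_ge0. Qed.

Lemma W00_locint_pairing f G : X f -> locint G -> exists c d, [/\ 0 < c,
  locint (fun x => f x * G x) & forall x, x < c \/ d < x -> f x = 0].
Proof.
move=> Xf lG; have [q fq] := W00_density Xf; have mf := measurable_W00 Xf.
have [[c [d [c0 cd f0]]] _] := Xf; exists c, d; split => //.
by apply: locint_cont => // x; exact: has_density_continuous fq.
Qed.

Lemma W00_pairing_fin f G : X f -> locint G ->
  (\int[mu]_(x in Ipos) (`|f x * G x|)%:E < +oo)%E.
Proof.
move=> Xf lG; have [c [d [c0 lfG f0]]] := W00_locint_pairing Xf lG.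
rewrite (integral_Ipos_itvint (y := d) (locint_norm lfG) c0) ?ltry// => x h.
by rewrite f0// mul0r normr0.
Qed.

Lemma W00_pairing f G : X f -> locint G ->
  (`|\int[mu]_(x in Ipos) (f x * G x)%:E| <= (pairing_const p)%:E * nX f * nrm G)%E.
Proof.
move=> Xf lG; have [c [d [c0 lfG f0]]] := W00_locint_pairing Xf lG.
have [r S] := sobolev_of_W00 F wae w_root u_root Xf.
rewrite (fin_num_W1pnorm Xf).
have n0 : 0 <= fine (nX f) by rewrite fine_ge0// W1pnorm_ge0.
move: (fine (nX f)) S n0 => n S n0.
have := sob_pairing F S (locint_scale F lG).
have fG0 x : x < c \/ d < x -> f x * G x = 0 by move=> h; rewrite f0// mul0r.
have -> : (\int[mu]_(x in Ipos) (frame_scale w a G x * rho x * f x)%:E =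
    \int[mu]_(x in Ipos) (2^-1 * (f x * G x))%:E)%E.
  apply: eq_integral => x; rewrite inE IposE => x0; congr EFin.
  rewrite (frame_scaleE F)//; have rn0 : rho x != 0 by rewrite gt_eqF// (half_length_gt0 F).
  move: (rho x) (f x) (G x) rn0 => r1 f1 G1 rn0; field; exact: rn0.
rewrite (integral_Ipos_itvint (y := d) (locintZ 2^-1 lfG) c0); last by move=> x h; rewrite fG0// mulr0.
rewrite (integral_Ipos_itvint (y := d) lfG c0)// (itvintZ 2^-1 d lfG c0).
have gb0 : (0 <= frame_Gb p w a ainv (frame_scale w a G))%E by exact: poweR_ge0.
have gc0 : (0 <= frame_Gc p w a ainv (frame_scale w a G))%E by exact: poweR_ge0.
rewrite /frame_norm; move: (frame_Gb _ _ _ _ _) (frame_Gc _ _ _ _ _) gb0 gc0 => A B A0 B0.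
have L0 : 0 <= level_const p `^ p^-1 by exact: powR_ge0.
rewrite /pairing_const; move: (level_const p `^ p^-1) L0 => L L0 H.
have Nn : (2 * n `^ p) `^ p^-1 <= 2 * n.
  rewrite powRM ?powR_ge0// -powRrM mulfV// powRr1// ler_wpM2r//.
  rewrite -[leRHS]powRr1//; apply: ler_powR; first by rewrite ler1n.
  by rewrite invf_le1// ltW// (frame_p F).
have AB : (A + L%:E * B <= (1 + L)%:E * (A + B))%E.
  rewrite ge0_muleDr//; apply: leeD.
    by rewrite -[leLHS]mul1e; apply: lee_wpmul2r => //; rewrite lee_fin; lra.
  by apply: lee_wpmul2r => //; rewrite lee_fin; lra.
have {}H : ((`|2^-1 * itvint (fun t => f t * G t) c d|)%:E <= (2 * n)%:E * ((1 + L)%:E * (A + B)))%E.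
  have a1 : (0 <= ((2 * n `^ p) `^ p^-1)%:E)%E by rewrite lee_fin powR_ge0.
  have a2 : (0 <= A + L%:E * B)%E by rewrite adde_ge0// mule_ge0.
  have a3 : (((2 * n `^ p) `^ p^-1)%:E <= (2 * n)%:E)%E by rewrite lee_fin.
  exact: (le_trans H (lee_pmul a1 a2 a3 AB)).
rewrite -[(`|_|)%E]/((`|itvint (fun t => f t * G t) c d|)%:E).
move: (itvint _ _ _) H => I H.
have -> : ((4 * (1 + L))%:E * n%:E * (A + B) = 2%:E * ((2 * n)%:E * ((1 + L)%:E * (A + B))))%E.
  rewrite !muleA -!EFinM; congr (_%:E * _)%E; ring.
have -> : (`|I|)%:E = (2%:E * (`|2^-1 * I|)%:E)%E.
  by rewrite -EFinM normrM ger0_norm ?invr_ge0// mulrA mulfV ?mul1r.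
by apply: lee_wpmul2l => //; rewrite lee_fin.
Qed.

(** Zero energy makes [f] constant on the half-line, and compact support makes the constant 0. *)
Lemma W1pnorm0 f : X f -> nX f = 0%E -> forall x, f x = 0.
Proof.
move=> Xf nf; have [r S] := sobolev_of_W00 F wae w_root u_root Xf.
move: S; rewrite nf /= powR0// mulr0 => S.
have [c [d [c0 cd f0]]] := sob_supp S.
have H x y : 0 < x -> x <= y -> f y = f x.
  move=> x0 xy; have h1 := sob_rp_le F S y x0; have h2 := sob_N S y x0.
  have h3 := itvint_wp F y (sob_r S) (sob_rp S) x0.
  have h4 : itvint (fun t => `|r t| `^ p) x y = 0.
    by apply/eqP; rewrite eq_le (le_trans h1 h2) itvint_ge0// => t; exact: powR_ge0.
  move: h3; rewrite h4 mul0r => h3.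
  have I0 : 0 <= itvint (fun t => `|r t * w t `^ p'^-1|) x y by exact: itvint_ge0.
  have : itvint (fun t => `|r t * w t `^ p'^-1|) x y `^ p == 0.
    by rewrite eq_le h3 powR_ge0.
  rewrite powR_eq0 => /andP[/eqP h5 _].
  have := norm_itvint y (locint_wp F (sob_r S) (sob_rp S)) x0.
  by rewrite h5 -(sob_f S)// normr_le0 subr_eq0 => /eqP.
move=> x; have [x0|xn] := ltP 0 x; last by apply: (f0 x _).1; left; exact: le_lt_trans c0.
have y1 : x <= Num.max x (d + 1) by rewrite le_max lexx.
rewrite -(H x _ x0 y1); apply: (f0 _ _).1; right; rewrite lt_max; apply/orP; right; lra.
Qed.

Let P := primitive w.
Let al := a 1.
Let be := b 1.
Let c := al / 2.
Let d := be + 1.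

Let al0 : 0 < al. Proof. by apply: (frame_a0 F); exact: ltr01. Qed.
Let albe : al < be.
Proof. by apply: (@lt_trans _ _ 1); [apply: (frame_ax F)|apply: (frame_xb F)]; exact: ltr01. Qed.
Let c0 : 0 < c. Proof. by rewrite divr_gt0. Qed.
Let c_al : c < al. Proof. by rewrite /c ltr_pdivrMr// ltr_pMr// ltr1n. Qed.
Let be_d : be < d. Proof. by rewrite /d; lra. Qed.
Let cd : c <= d. Proof. exact/ltW/(lt_trans c_al)/(lt_trans albe). Qed.

(** A tent in the variable [P]. Its increments are at most those of [P], so its derivative is at
    most [w] almost everywhere, and [v_1] times the derivative has [p]-th power at most [w], which
    is integrable on [[c, d]]. *)
Let tent := (fun x => Num.max 0 (Num.min (P x - P c) (P d - P x))) \_ Ipos.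

Let P_le x y : 0 < x -> x <= y -> P x <= P y.
Proof.
move=> x0 xy; rewrite -subr_ge0 /P (primitiveB (frame_w F))// itvint_ge0//; exact: frame_w0 F.
Qed.

Let tent_dom x y : 0 < x -> x <= y -> `|tent y - tent x| <= P y - P x.
Proof.
move=> x0 xy; have y0 := lt_le_trans x0 xy; rewrite /tent !patch_Ipos//.
have := P_le x0 xy; move: (P x) (P y) (P c) (P d) => Px Py Pc Pd h; rewrite ler_norml.
case: (leP (Py - Pc) (Pd - Py)); case: (leP (Px - Pc) (Pd - Px)) => h1 h2;
  rewrite /Num.max; case: ifPn; case: ifPn; rewrite -?leNgt => h3 h4; apply/andP; split; lra.
Qed.

Let tent0 x : x < c \/ d < x -> tent x = 0.
Proof.
have [x0 h|xn _] := ltP 0 x; last first.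
  by rewrite /tent patchE memNset// IposE; apply/negP; rewrite -leNgt.
rewrite /tent patch_Ipos//; apply/max_idPl; rewrite ge_min !subr_le0; apply/orP.
by case: h => h; [left; apply: P_le => //; exact: ltW|right; apply: P_le (ltW h); exact: lt_le_trans cd].
Qed.

Let tent_ge0 x : 0 <= tent x.
Proof. by rewrite /tent patchE; case: ifP => // _; rewrite le_max lexx. Qed.

Let tent_le x : tent x <= P d - P c.
Proof.
have h := P_le c0 cd; rewrite /tent patchE; case: ifP => [|_]; last by rewrite subr_ge0.
rewrite inE IposE => x0; rewrite ge_max subr_ge0 h/= ge_min.
have [xd|dx] := leP x d; first by rewrite lerD2r P_le.
by apply/orP; right; have := P_le (lt_le_trans c0 cd) (ltW dx); lra.
Qed.

Let tent_ac : loc_abs_cont tent.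
Proof.
apply: (dominated_loc_abs_cont (frame_w F)) => x y x0 xy.
by rewrite -(primitiveB (frame_w F))//; exact: tent_dom.
Qed.

Let patch_fin (h : R -> R) : locint h -> (forall t, 0 <= h t) ->
  (\int[mu]_(t in Ipos) ((h \_ `[c, d]) t)%:E < +oo)%E.
Proof.
move=> lh h0; apply: (@le_lt_trans _ _ (\int[mu]_t ((h \_ `[c, d]) t)%:E)%E); last first.
  by rewrite (integral_patch_itv d lh c0) ltry.
rewrite integral_mkcond; apply: ge0_le_integral_nm => t _; rewrite patchE.
  by case: ifP => // _; rewrite patchE; case: ifP => // _; rewrite lee_fin.
by case: ifP => // _; rewrite patchE; case: ifP => // _; rewrite lee_fin.
Qed.

Let W00_tent : X tent.
Proof.
split; [by exists c, d; split|split; first exact: tent_ac].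
have [q [mq _ iq dq qE]] := loc_abs_cont_density tent_ac.
have fq : has_density tent q by split.
have lw := frame_w F; have w0 := frame_w0 F.
rewrite (W1pnormE F w_root u_root fq) lte_add_pinfty// poweR_lty//.
  have lMu := locintZ ((P d - P c) `^ p) (frame_u F).
  have pos t : 0 <= (P d - P c) `^ p * u t by rewrite mulr_ge0 ?powR_ge0 ?(frame_u0 F).
  apply: le_lt_trans (patch_fin lMu pos).
  apply: ge0_le_integral_nm => t _; first by rewrite lee_fin powR_ge0.
  rewrite lee_fin patchE; case: ifPn => [_|]; last first.
    rewrite notin_setE/= in_itv/= => /negP; rewrite negb_and -!ltNge => /orP h.
    by rewrite tent0// mul0r normr0 powR0.
  rewrite normrM powRM// [`|u t `^ _|]ger0_norm ?powR_ge0// -powRrM mulVf// powRr1 ?(frame_u0 F)//.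
  by rewrite ler_wpM2r ?(frame_u0 F)// ger0_norm//; apply: powR_ler => //; exact: ltW.
apply: le_lt_trans (patch_fin lw w0).
have mhi : measurable_fun setT (fun t => `|q t * (w t `^ p'^-1)^-1| `^ p).
  apply: (measurableT_comp (measurable_powR _)); apply: measurableT_comp => //.
  by apply: measurable_funM => //; exact: (measurable_wpV F).
have mpw : measurable_fun setT (w \_ `[c, d]).
  by apply/(measurable_restrictT _ (measurable_itvR `[c, d])); apply: measurable_funTS; case: lw.
apply: ae_ge0_le_integral.
- exact: measurable_Ipos.
- by move=> t _; rewrite lee_fin powR_ge0.
- by apply/measurable_EFinP; exact: measurable_funTS.
- by move=> t _; rewrite lee_fin patchE; case: ifP.
- by apply/measurable_EFinP; exact: measurable_funTS.
have qw : {ae mu, forall t : R, 0 < t -> `|q t| <= w t}.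
  apply: ae_impl2 dq (primitive_ae_derive lw) => t h1 h2 t0.
  rewrite -[w t]mul1r; apply: (is_derive_le_right (h1 t0) (h2 t0) ltr01) => y ty _.
  by rewrite mul1r; exact: tent_dom.
apply: ae_impl2 (density_ae0 fq c0 tent0) qw => t h1 h2; rewrite IposE => t0.
rewrite lee_fin patchE; case: ifPn => [_|]; last first.
  rewrite notin_setE/= in_itv/= => /negP; rewrite negb_and -!ltNge => /orP h.
  by rewrite h1// mul0r normr0 powR0.
have qt := h2 t0; have [wt0|wn] := eqVneq (w t) 0.
  by move: qt; rewrite wt0 normr_le0 => /eqP ->; rewrite mul0r normr0 powR0.
have wt : 0 < w t by rewrite lt_neqAle eq_sym wn w0.
rewrite normrM normfV [`|w t `^ _|]ger0_norm ?powR_ge0//.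
have wE : (w t * (w t `^ p'^-1)^-1) `^ p = w t.
  rewrite -powRN -{1}[w t]powRr1// -powRDp// -powRrM (_ : _ * p = 1) ?powRr1//.
  by rewrite mulrBl mul1r mulrC (frame_pp1 F) opprB addrC subrK.
rewrite -[leRHS]wE; apply: powR_ler; [exact: ltW|by rewrite mulr_ge0 ?invr_ge0 ?powR_ge0|].
by rewrite ler_wpM2r// invr_ge0 powR_ge0.
Qed.

(** A witness that neither norm is identically zero, on which the perturbation of null vectors
    relies. [G0] is [u] on [[a 1, b 1]], written as [u^(1/p) u^((p-1)/p)] to suit [low_order_bound].
    The [u]-mass of that interval is positive by the normalisation, and the tent is bounded below on
    it. *)
Lemma nondegenerate_pair : exists f0 G0, [/\ X f0, locint G0, (nrm G0 < +oo)%E &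
  (\int[mu]_(x in Ipos) (f0 x * G0 x)%:E != 0)%E].
Proof.
have lu := frame_u F; have u0 := frame_u0 F.
pose ga := (fun t => u t `^ ((p - 1) / p)) \_ `[al, be].
have mga : measurable_fun setT ga.
  apply/(measurable_restrictT _ (measurable_itvR `[al, be])); apply: measurable_funTS.
  by apply: (measurableT_comp (measurable_powR _)); case: lu.
have e1 : (p - 1) / p * p' = 1.
  by rewrite /dualexp; have := frame_p10 F => /lt0r_neq0 h; field; rewrite pn0 h.
have gap t : `|ga t| `^ p' = (u \_ `[al, be]) t.
  rewrite /ga !patchE; case: ifP => _; last by rewrite normr0 powR0// gt_eqF// (frame_p'0 F).
  by rewrite ger0_norm ?powR_ge0// -powRrM e1 powRr1.
have lga : locint (fun t => `|ga t| `^ p').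
  rewrite (funext gap); apply: (locint_dom _ lu) => [|t _].
    by apply/(measurable_restrictT _ (measurable_itvR `[al, be])); apply: measurable_funTS; case: lu.
  by rewrite patchE; case: ifP => _; rewrite ?normr0// ger0_norm.
have HM : (\int[mu]_t (`|ga t| `^ p')%:E <= (itvint u al be)%:E)%E.
  rewrite -(integral_patch_itv be lu al0); apply: ge0_le_integral_nm => t _; rewrite lee_fin ?powR_ge0//.
  by rewrite gap.
have [lG h1 h2] := low_order_bound F mga lga HM.
pose G0 t := u t `^ p^-1 * ga t.
exists tent, G0; split; [exact: W00_tent|exact: lG| |].
  by rewrite /frame_norm (le_lt_trans (leeD h1 h2))// -EFinD ltry.
have [c' [d' [c'0 lfG _]]] := W00_locint_pairing W00_tent lG.
rewrite (@integral_Ipos_itvint R (fun t => tent t * G0 t) al be lfG al0); last first.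
  move=> t h; rewrite /G0 /ga patchE memNset ?mulr0//= in_itv/= => /andP[h3 h4].
  by case: h; rewrite ltNge ?h3 ?h4.
pose m := Num.min (P al - P c) (P d - P be).
have be0 : 0 < be := lt_trans al0 albe.
have m0 : 0 < m.
  rewrite lt_min /P (primitiveB (frame_w F) c0 (ltW c_al)) (primitiveB (frame_w F) be0 (ltW be_d)).
  by rewrite (frame_wgt0 F c0 c_al) (frame_wgt0 F be0 be_d).
have Upos : 0 < itvint u al be.
  rewrite (frame_V F ltr01) powR_gt0// mulr_gt0//.
  exact: (frame_wgt0 F (frame_a0 F ltr01) (frame_ax F ltr01)).
rewrite gt_eqF// lte_fin; apply: (@lt_le_trans _ _ (m * itvint u al be)); first exact: mulr_gt0.
rewrite -(itvintZ m be lu al0); apply: itvint_mono => //; first exact: locintZ.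
move=> t at_ tb; have t0 := lt_le_trans al0 at_.
have GE : G0 t = u t.
  rewrite /G0 /ga patchE mem_set ?/= ?in_itv/= ?at_ ?tb//.
  have [->|un] := eqVneq (u t) 0; first by rewrite powR0 ?mul0r// invr_eq0.
  have ut : 0 < u t by rewrite lt_neqAle eq_sym un u0.
  rewrite -powRDp// (_ : _ + _ = 1) ?powRr1//.
  by rewrite mulrBl mulfV// mul1r addrC subrK.
rewrite GE ler_wpM2r// /tent patch_Ipos// le_max; apply/orP; right.
have h3 := P_le al0 at_; have h4 := P_le t0 tb.
by rewrite /m le_min !ge_min; apply/andP; split; apply/orP; [left|right]; lra.
Qed.

End frame_duality.

(** * The associate spaces and the bidual *)

Section associate_spaces.
Context {R : realType} {p : R} {w u a b ainv : R -> R}.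
Hypothesis F : interval_frame p w u a b ainv.
Local Notation mu := (@lebesgue_measure R).
Local Notation mR := (measurableTypeR R).
Variables (v0 v1 : R -> R).
Hypothesis wae : {ae mu, forall t : R, 0 < t -> 0 < w t}.
Hypothesis w_root : forall x : R, 0 < x -> (w x `^ (dualexp p)^-1)^-1 = v1 x.
Hypothesis u_root : forall x : R, 0 < x -> u x `^ p^-1 = v0 x.
Local Notation p' := (dualexp p).
Local Notation X := (W00 p v0 v1).
Local Notation nX := (W1pnorm p v0 v1).
Local Notation nrm := (frame_norm p w a ainv).
Variables (Wsp : (R -> R) -> Prop) (nW : (R -> R) -> \bar R).
Hypothesis Wm : forall g, Wsp g -> measurable_fun Ipos g.
Hypothesis W_patch : forall g, Wsp g ->
  [/\ locint (g \_ Ipos), nrm (g \_ Ipos) = nW g & (nrm (g \_ Ipos) < +oo)%E].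
Hypothesis W_intro : forall g G, locint G -> (forall x, 0 < x -> g x = G x) ->
  (nrm G < +oo)%E -> Wsp g /\ nW g = nrm G.
Hypothesis W_perturb : forall G G0 (k : R), locint G -> locint G0 -> nrm G = 0%E ->
  nrm (fun x => k * G x + G0 x) = nrm G0.

Lemma frame_norm_ge0 g : (0 <= nrm g)%E.
Proof. by rewrite /frame_norm adde_ge0// poweR_ge0. Qed.

Opaque itvint half_length powR frame_tail frame_D frame_B frame_norm.

Local Notation CA := (pairing_const p).
(** The bounds for [v_1 f'] and [v_0 f], each doubled because the norm of a test is the sum of two
    functionals. *)
Definition recovery_const (p : R) := 2 * high_const p + 2 * low_const p.
Local Notation CB := (recovery_const p).

Let CA0 : 0 <= CA. Proof. exact/ltW/pairing_const_gt0. Qed.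

Lemma recovery_const_ge0 : 0 <= CB.
Proof. by rewrite addr_ge0// mulr_ge0// /high_const /low_const mulr_ge0 ?powR_ge0. Qed.

Let NW : normlike Wsp nW.
Proof. by move=> g Wg; split; [exact: Wm|have [_ <- ->] := W_patch Wg; rewrite frame_norm_ge0]. Qed.

Let NX : normlike X nX.
Proof.
move=> f Xf; split; first by apply: measurable_funTS; exact: measurable_W00 Xf.
by rewrite W1pnorm_ge0; case: Xf => _ [_ ->].
Qed.

Let eq_pairing (f g : R -> R) : (\int[mu]_(x in Ipos) (f x * (g \_ Ipos) x)%:E =
  \int[mu]_(x in Ipos) (f x * g x)%:E)%E.
Proof. by apply: eq_integral => x; rewrite inE IposE => x0; rewrite patch_Ipos. Qed.

Let eq_abs_pairing (f g : R -> R) : (\int[mu]_(x in Ipos) (`|f x * (g \_ Ipos) x|)%:E =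
  \int[mu]_(x in Ipos) (`|f x * g x|)%:E)%E.
Proof. by apply: eq_integral => x; rewrite inE IposE => x0; rewrite patch_Ipos. Qed.

Let pairingXW f g : X f -> Wsp g ->
  (`|\int[mu]_(x in Ipos) (f x * g x)%:E| <= CA%:E * nX f * nW g)%E.
Proof.
move=> Xf Wg; have [lG <- _] := W_patch Wg; rewrite -eq_pairing.
exact: (W00_pairing F wae w_root u_root Xf lG).
Qed.

Let pairingXW_fin f g : X f -> Wsp g -> (\int[mu]_(x in Ipos) (`|f x * g x|)%:E < +oo)%E.
Proof.
move=> Xf Wg; have [lG _ _] := W_patch Wg; rewrite -eq_abs_pairing.
exact: (W00_pairing_fin Xf lG).
Qed.

Lemma W00_Dspace f : X f -> Dspace Wsp f.
Proof.
move=> Xf; have [mf _] := NX Xf; split => // g Wg.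
by rewrite abs_pairingC; exact: pairingXW_fin.
Qed.

Lemma Jfun_W00_le f : X f -> (Jfun Wsp nW f <= CA%:E * nX f)%E.
Proof.
move=> Xf; rewrite (fin_num_W1pnorm Xf) -EFinM; apply: Jfun_le.
- by rewrite mulr_ge0// fine_ge0// W1pnorm_ge0.
- by move=> g Wg; have [] := NW Wg.
- move=> g Wg _; rewrite pairingC EFinM -(fin_num_W1pnorm Xf); exact: pairingXW.
Qed.

Let Wassoc g : Wsp g -> wassoc X nX g /\ (Jfun X nX g <= CA%:E * nW g)%E.
Proof.
move=> Wg; have [mg /andP[g0 gfin]] := NW Wg.
have gE : nW g = (fine (nW g))%:E by rewrite fineK// ge0_fin_numE.
have JE : (Jfun X nX g <= CA%:E * nW g)%E.
  rewrite gE -EFinM; apply: Jfun_le.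
  - by rewrite mulr_ge0// fine_ge0.
  - by move=> f Xf; have [] := NX Xf.
  - move=> f Xf _; rewrite EFinM -gE muleAC; exact: pairingXW.
split=> //; split; last by rewrite (le_lt_trans JE)// gE -EFinM ltry.
by split => // f Xf; exact: pairingXW_fin.
Qed.

(** A null vector of [X] is the zero function. In [Wsp] it need not be, and [W_perturb] takes
    over. *)
Let null_stables : exists f0 G0, [/\ null_stable X nX f0, null_stable Wsp nW G0 &
  (\int[mu]_(x in Ipos) (f0 x * G0 x)%:E != 0)%E].
Proof.
have [f0 [G0 [Xf0 lG0 nG0 nz]]] := nondegenerate_pair F w_root u_root.
have [WG0 nWG0] := W_intro lG0 (fun x _ => erefl) nG0.
have H := pairingXW Xf0 WG0.
exists f0, G0; split; [| |exact: nz].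
- split; first exact: Xf0.
    apply/eqP => f00; move: nz; rewrite -abse_eq0 eq_le abse_ge0 andbT => /negP; apply.
    by move: H; rewrite f00 mule0 mul0e.
  move=> f Xf nf k; have fE := W1pnorm0 F wae w_root u_root Xf nf.
  have -> : (fun x => k * f x + f0 x) = f0 by apply/funext => x; rewrite fE mulr0 add0r.
  by split.
- split; first exact: WG0.
    apply/eqP => f00; move: nz; rewrite -abse_eq0 eq_le abse_ge0 andbT => /negP; apply.
    by move: H; rewrite f00 mule0.
  move=> g Wg ng k; have [lg gE _] := W_patch Wg.
  have nk := W_perturb k lg lG0 (etrans gE ng).
  have [|||W1 ->] := @W_intro (fun x => k * g x + G0 x) (fun x => k * (g \_ Ipos) x + G0 x).
  - exact: (locintD (locintZ k lg) lG0).
  - by move=> x x0; rewrite patch_Ipos.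
  - by rewrite nk; exact: nG0.
  by split; [exact: W1|exact: (etrans nk (esym nWG0))].
Qed.

Lemma Dspace_representative f : Dspace Wsp f -> (Jfun Wsp nW f < +oo)%E ->
  exists ft, [/\ X ft, aeI f ft & (nX ft <= CB%:E * Jfun Wsp nW f)%E].
Proof.
move=> Df Jf; have [f0 [G0 [_ NSW _]]] := null_stables; have [mf Df'] := Df.
have J0 := Jfun_ge0 f NW NSW.
have JE : Jfun Wsp nW f = (fine (Jfun Wsp nW f))%:E by rewrite fineK// ge0_fin_numE.
pose K := fine (Jfun Wsp nW f); have K0 : 0 <= K by rewrite fine_ge0.
have mf1 := measurable_patch_Ipos mf.
have [||ft [q [fq supp fft H1 H2]]] := sobolev_representative F wae mf1 K0.
- move=> G lG nG; have [WG _] := W_intro lG (fun x _ => erefl) nG.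
  by rewrite abs_pairingC eq_abs_pairing; exact: Df'.
- move=> G lG nG; have [WG <-] := W_intro lG (fun x _ => erefl) nG.
  rewrite pairingC eq_pairing /K -JE; exact: pairing_le_Jfun NW NSW Df Jf WG.
have nft : (nX ft <= (CB * K)%:E)%E.
  have h0 : 0 <= high_const p by rewrite /high_const mulr_ge0 ?powR_ge0.
  have l0 : 0 <= low_const p by rewrite /low_const mulr_ge0 ?powR_ge0.
  have -> : CB * K = K * (2 * high_const p) + K * (2 * low_const p) by rewrite /recovery_const; ring.
  apply: (W1pnorm_le F w_root u_root fq (measurable_has_density fq)) => //; by rewrite !mulr_ge0 ?powR_ge0.
exists ft; split.
- split => //; split; last by rewrite (le_lt_trans nft)// ltry.
  apply: (dominated_loc_abs_cont (locint_norm (proj1 fq))) => x y x0 xy.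
  exact: has_density_dom fq _ _.
- by apply: ae_impl fft => x h; rewrite IposE => x0; rewrite -h// patch_Ipos.
- by rewrite JE -EFinM.
Qed.

(** By continuity, agreement almost everywhere is agreement on the half-line. This identifies the
    representative found by recovery with any other one in [X]. *)
Lemma W00_aeI f g : X f -> X g -> aeI f g -> f = g.
Proof.
move=> Xf Xg fg; apply/funext => x; have [x0|xn] := ltP 0 x; last first.
  have [[c [d [c0 _ f0]]] _] := Xf; have [[c' [d' [c'0 _ g0]]] _] := Xg.
  by rewrite f0 ?g0//; left; exact: le_lt_trans xn _.
have cf : {for x, continuous f} by apply: loc_abs_cont_continuous => //; case: Xf => _ [].
have cg : {for x, continuous g} by apply: loc_abs_cont_continuous => //; case: Xg => _ [].
have ch : {for x, continuous (fun y => f y - g y)} by exact: (@continuousB _ R^o).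
apply/eqP; rewrite -subr_eq0; apply/negPn/negP => nz.
have e0 : 0 < `|f x - g x| by rewrite normr_gt0.
have /(@cvgrPdist_lt _ R^o)/(_ _ e0)/nbhs_ballP[d /= d0 Hd] := ch.
have xd : x < x + d by rewrite ltrDl.
have [y [xy yd]] := ae_exists fg xd; rewrite IposE => /(_ (lt_trans x0 xy)) E.
have bxy : ball x d y by rewrite /ball/= ltr0_norm ?subr_lt0// opprB ltrBlDl.
by have := Hd y bxy; rewrite /= E subrr subr0 ltxx.
Qed.

Lemma same_spaceW (C : R) : CA <= C -> CB <= C ->
  [/\ (forall f, Dspace Wsp f -> ((Jfun Wsp nW f < +oo)%E <-> exists ft, X ft /\ aeI f ft)),
   (forall f ft, Dspace Wsp f -> X ft -> aeI f ft ->
     (nX ft <= C%:E * Jfun Wsp nW f)%E /\ (Jfun Wsp nW f <= C%:E * nX ft)%E) &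
   same_space C X nX (wassoc Wsp nW) (Jfun Wsp nW)].
Proof.
move=> CAC CBC; have [f0 [G0 [_ NSW _]]] := null_stables.
have mX f : X f -> measurable_fun Ipos f by move=> /NX[].
have Jae f ft : Dspace Wsp f -> X ft -> aeI f ft -> Jfun Wsp nW f = Jfun Wsp nW ft.
  by move=> [mf _] Xft fft; exact: aeI_Jfun NW mf (mX _ Xft) fft.
have Jfin ft : X ft -> (Jfun Wsp nW ft < +oo)%E.
  move=> Xft; apply: (le_lt_trans (Jfun_W00_le Xft)).
  by rewrite (fin_num_W1pnorm Xft) -EFinM ltry.
have norms f ft : Dspace Wsp f -> X ft -> aeI f ft ->
    (nX ft <= C%:E * Jfun Wsp nW f)%E /\ (Jfun Wsp nW f <= C%:E * nX ft)%E.
  move=> Df Xft fft; have JE := Jae f ft Df Xft fft; split.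
    have Jf : (Jfun Wsp nW f < +oo)%E by rewrite JE Jfin.
    have [ft2 [Xft2 fft2 n2]] := Dspace_representative Df Jf.
    have -> : ft = ft2.
      by apply: W00_aeI => //; apply: ae_impl2 fft fft2 => x h1 h2 Ix; rewrite -h1// h2.
    apply: (le_trans n2); apply: lee_wpmul2r; first exact: Jfun_ge0 NW NSW.
    by rewrite lee_fin.
  rewrite JE; apply: (le_trans (Jfun_W00_le Xft)); apply: lee_wpmul2r; first exact: W1pnorm_ge0.
  by rewrite lee_fin.
split; [|exact: norms|].
- move=> f Df; split=> [Jf|[ft [Xft fft]]].
    by have [ft [Xft fft _]] := Dspace_representative Df Jf; exists ft.
  by rewrite (Jae f ft)// Jfin.
- split; [|split].
  + move=> f Xf; exists f; split; last by apply: aeW.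
    by split; [exact: W00_Dspace|exact: Jfin].
  + move=> g [Dg Jg]; have [ft [Xft gft _]] := Dspace_representative Dg Jg.
    by exists ft; split=> //; apply: ae_impl gft => x h Ix; rewrite h.
  + move=> f g Xf [Dg Jg] fg; apply: norms => //.
    by apply: ae_impl fg => x h Ix; rewrite h.
Qed.

(** Passing from [X] to its bidual costs the constant 1, which is why [1 <= C] is assumed. In the
    other direction the embedding of [Wsp] costs [CA] and the recovery of the representative
    [CB]. *)
Lemma same_space_bidual (C : R) : 1 <= C -> CA * CB <= C ->
  same_space C X nX (wassoc (wassoc X nX) (Jfun X nX)) (Jfun (wassoc X nX) (Jfun X nX)).
Proof.
move=> C1 CABC; have [f0 [G0 [NSX NSW nz]]] := null_stables.
have mX f : X f -> measurable_fun Ipos f by move=> /NX[].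
have NX' := wassoc_norm NX NSX.
have WG0 : Wsp G0 by case: NSW.
have NSX' := wassoc_null_stable NX NSX (proj1 (Wassoc WG0)) nz.
have DX f : X f -> Dspace (wassoc X nX) f.
  move=> Xf; split; first exact: mX.
  by move=> g [[mg Dg] _]; rewrite abs_pairingC; exact: Dg.
have JX f : X f -> (Jfun (wassoc X nX) (Jfun X nX) f <= nX f)%E.
  move=> Xf; rewrite (fin_num_W1pnorm Xf); apply: Jfun_le.
  - by rewrite fine_ge0// W1pnorm_ge0.
  - by move=> g /NX'[].
  - move=> g [Dg Jg] _; rewrite -(fin_num_W1pnorm Xf) pairingC muleC.
    exact: pairing_le_Jfun NX NSX Dg Jg Xf.
have back h : wassoc (wassoc X nX) (Jfun X nX) h -> Dspace Wsp h /\
    (Jfun Wsp nW h <= CA%:E * Jfun (wassoc X nX) (Jfun X nX) h)%E.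
  move=> [[mh Dh] Jh]; split.
    by split => // g Wg; apply: Dh; have [] := Wassoc Wg.
  have J0 := Jfun_ge0 h NX' NSX'.
  have JE : Jfun (wassoc X nX) (Jfun X nX) h = (fine (Jfun (wassoc X nX) (Jfun X nX) h))%:E.
    by rewrite fineK// ge0_fin_numE.
  rewrite JE -EFinM; apply: Jfun_le.
  - by rewrite mulr_ge0// fine_ge0.
  - by move=> g /NW[].
  - move=> g Wg _; have [X'g Jg] := Wassoc Wg.
    apply: (le_trans (pairing_le_Jfun NX' NSX' (conj mh Dh) Jh X'g)).
    rewrite EFinM -JE muleAC muleC; apply: lee_wpmul2r => //.
have fin h : wassoc (wassoc X nX) (Jfun X nX) h -> (Jfun Wsp nW h < +oo)%E.
  move=> X''h; have [_ h1] := back h X''h; apply: (le_lt_trans h1).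
  have [_ Jh] := X''h; have J0 := Jfun_ge0 h NX' NSX'.
  by rewrite -(fineK (x := Jfun _ _ h)) ?ge0_fin_numE// -EFinM ltry.
split; [|split].
- move=> f Xf; exists f; split; last by apply: aeW.
  split; first exact: DX.
  by apply: (le_lt_trans (JX f Xf)); case: Xf => _ [].
- move=> h X''h; have [Dh _] := back h X''h.
  have [ft [Xft hft _]] := Dspace_representative Dh (fin h X''h).
  by exists ft; split=> //; apply: ae_impl hft => x E Ix; rewrite E.
- move=> f h Xf X''h fh; have [Dh Jh] := back h X''h; have [[mh _] _] := X''h.
  have hf : aeI h f by apply: ae_impl fh => x E Ix; rewrite E.
  have JE : Jfun (wassoc X nX) (Jfun X nX) h = Jfun (wassoc X nX) (Jfun X nX) f.
    exact: aeI_Jfun NX' mh (mX f Xf) hf.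
  split.
    have [ft [Xft hft n2]] := Dspace_representative Dh (fin h X''h).
    have -> : f = ft.
      by apply: W00_aeI => //; apply: ae_impl2 hf hft => x h1 h2 Ix; rewrite -h1// h2.
    apply: (le_trans n2); apply: (@le_trans _ _ (CB%:E * (CA%:E * Jfun (wassoc X nX) (Jfun X nX) h))%E).
      by apply: lee_wpmul2l => //; rewrite lee_fin; exact: recovery_const_ge0.
    rewrite muleA -EFinM mulrC; apply: lee_wpmul2r; first exact: Jfun_ge0 NX' NSX'.
    by rewrite lee_fin.
  rewrite JE; apply: (le_trans (JX f Xf)); rewrite -[leLHS]mul1e; apply: lee_wpmul2r.
    exact: W1pnorm_ge0.
  by rewrite lee_fin.
Qed.

End associate_spaces.

Unset Implicit Arguments.

Theorem theorem3p4 (R : realType) (p : R) (hp : 1 < p) :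
  exists C : R, 0 < C /\
  forall (v0 v1 a b ainv : R -> R) (c : R),
    weightV p v0 -> weightV p v1 -> inv_locL (dualexp p) v1 ->
    c_condition p v0 v1 c ->
    ab_conditions p v0 v1 a b ->
    ainv_condition a ainv ->
    let W := Wspace p v1 a b ainv in
    let nW := Wnorm p v1 a b ainv in
    let X := W00 p v0 v1 in
    let nX := W1pnorm p v0 v1 in
    (* J_W(f) < oo  iff  f = f~ a.e. for some f~ in W°°^1_p *)
    (forall f : R -> R, Dspace W f ->
       ((Jfun W nW f < +oo)%E <-> exists ft, X ft /\ aeI f ft)) /\
    (* in that case ||f||_{W^1_p} ≈ J_W(f) *)
    (forall f ft : R -> R, Dspace W f -> X ft -> aeI f ft ->
       (nX ft <= C%:E * Jfun W nW f)%E /\ (Jfun W nW f <= C%:E * nX ft)%E) /\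
    (* W°°^1_p = [W]'_w  (as sets, with equivalent norms) *)
    same_space C X nX (wassoc W nW) (Jfun W nW) /\
    (* W°°^1_p = [[W°°^1_p]'_w]'_w  (as sets, with equivalent norms) *)
    same_space C X nX (wassoc (wassoc X nX) (Jfun X nX))
                      (Jfun (wassoc X nX) (Jfun X nX)).
Proof.
have A0 : 0 < pairing_const p by exact: pairing_const_gt0.
have B0 : 0 <= recovery_const p by exact: recovery_const_ge0.
(* Expanded, this is [1 + A + B + A B] with [A] and [B] the two constants, so it dominates all four
   bounds required. *)
pose C := (1 + pairing_const p) * (1 + recovery_const p).
have [CA CB C1 CAB] : [/\ pairing_const p <= C, recovery_const p <= C, 1 <= C &
    pairing_const p * recovery_const p <= C] by rewrite /C; split; nra.
exists C; split; first exact: lt_le_trans C1.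
move=> v0 v1 a b ainv c V0 V1' V1V _ AB AI W nW X nX.
have F := frame_of_weights hp V0 V1' V1V AB AI.
have wae := dual_weight_gt0 V1V.
have wr := dual_weight_root hp V1'.
have ur := low_weight_root hp V0.
have Wm g : W g -> measurable_fun Ipos g by move=> [[]].
have Wp := Wspace_patch hp V0 V1' V1V AB AI.
have Wi := Wspace_locint hp V0 V1' V1V AB AI.
have Wt := frame_norm_perturb hp V0 V1' V1V AB AI.
have [h1 h2 h3] := same_spaceW F wae wr ur Wm Wp Wi Wt CA CB.
split; [exact: h1|split; [exact: h2|split; [exact: h3|]]].
exact: (same_space_bidual F wae wr ur Wm Wp Wi Wt C1 CAB).
Qed.
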